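(* (i) Let $\Omega_f$ be a disc (bounded by the circle $\mathbb{S}^1$) and let $\Omega_g$ be the domain bounded by an ellipse of non-zero eccentricity. Then near the boundary their billiard maps are $C^0$-conjugate. (ii) If $\Omega_f$ and $\Omega_g$ are domains bounded by ellipses of different eccentricities, then their billiard maps are $C^0$-conjugate near the boundary. (iii) Let $\Omega_f$ and $\Omega_g$ be strictly convex planar domains whose billiard maps are integrable near the boundary. Then near the boundary their billiard maps are $C^0$-conjugate.
   Context: Strictly convex domains are bounded, with boundary of everywhere positive curvature and sufficiently smooth. Let $\Omega\subset\mathbb{R}^2$ be such a domain with boundary of length $l$, parametrized by arc length $s\in\mathbb{R}/l\mathbb{Z}$ via $\gamma$. The billiard map acts on $(s,\varphi)$, where $\varphi\in(0,\pi)$ is the angle between the inward unit velocity at $\gamma(s)$ and the positive tangent to $\partial\Omega$ there: $(s,\varphi)\mapsto(s',\varphi')$, where $\gamma(s')$ is the next point at which the straight trajectory hits $\partial\Omega$ and $\varphi'$ is the angle of the reflected velocity (angle of reflection equals angle of incidence). The map is extended to the closed annulus $(\mathbb{R}/l\mathbb{Z})\times[0,\pi]$ by the identity on $\{\varphi=0\}$ and $\{\varphi=\pi\}$. A caustic is a smooth convex curve in $\Omega$ such that a trajectory tangent to it remains tangent to it after each reflection. The billiard map of $\Omega$ is integrable near the boundary if there is a smooth family of caustics foliating a neighborhood of the boundary. Billiard maps $f$ and $g$ of $\Omega_f$ and $\Omega_g$ are $C^0$-conjugate near the boundary if there is a homeomorphism $h$ from a neighborhood of $\{\varphi=0\}$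 in the closed annulus of $\Omega_f$, containing $\{0\le\varphi\le\delta\}$ and its image under $f$ for some $\delta>0$, onto a neighborhood of $\{\varphi=0\}$ in the closed annulus of $\Omega_g$, mapping $\{\varphi=0\}$ to $\{\varphi=0\}$ and satisfying $h\circ f=g\circ h$ on $\{0\le\varphi\le\delta\}$. *)

(* Defs.v *)
From HB Require Import structures.
From mathcomp Require Import all_boot all_order all_algebra generic_quotient.
From mathcomp Require Import all_classical all_reals all_analysis.

Set Implicit Arguments.
Unset Strict Implicit.
Unset Printing Implicit Defensive.

Import Order.TTheory GRing.Theory Num.Theory.
Import numFieldNormedType.Exports.

Local Open Scope quotient_scope.
Local Open Scope ring_scope.
Local Open Scope classical_set_scope.

(* MathComp-Analysis, over an arbitrary R : realType. The plane is R * R, whose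
   library norm is the sup norm: it is used only for topology, boundedness and
   derivatives, Euclidean geometry goes through dot2. *)

Section Plane.
Context {R : realType}.

Definition dot2 (u v : R * R) : R := u.1 * v.1 + u.2 * v.2.
Definition det2 (u v : R * R) : R := u.1 * v.2 - u.2 * v.1.
Definition rot90 (u : R * R) : R * R := (- u.2, u.1).

Definition boundary {T : topologicalType} (A : set T) : set T :=
  closure A `\` interior A.

(* For an open set A: all iterated directional derivatives of order at most n
   exist and are continuous on A, i.e. f is of class C^n on A (V is always
   finite-dimensional here). *)
Fixpoint classC {V W : normedModType R} (n : nat) (A : set V) (f : V -> W)
    : Prop :=
  (forall x, A x -> {for x, continuous f}) /\
  (if n is m.+1 then
     forall v : V, (forall x, A x -> derivable f x v) /\
               classC m A (fun x => 'D_v f x)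
   else True).

End Plane.

Section Circle.
Context {R : realType} (l : R).

Definition eqmod (x y : R) : bool := `[< exists k : int, x - y = k%:~R * l >].

Lemma eqmod_refl : reflexive eqmod.
Proof. by move=> x; apply/asboolP; exists 0; rewrite subrr mul0r. Qed.

Lemma eqmod_sym : symmetric eqmod.
Proof.
have H x y : eqmod x y -> eqmod y x.
  move=> /asboolP[k e]; apply/asboolP; exists (- k).
  by rewrite mulrNz mulNr -e opprB.
by move=> x y; apply/idP/idP => /H.
Qed.

Lemma eqmod_trans : transitive eqmod.
Proof.
move=> y x z /asboolP[j ej] /asboolP[k ek]; apply/asboolP; exists (j + k).
by rewrite intrD mulrDl -ej -ek addrA subrK.
Qed.

Canonical eqmod_equiv := EquivRel eqmod eqmod_refl eqmod_sym eqmod_trans.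

(* R / lZ with the quotient topology. *)
Definition circle := quotient_topology {eq_quot eqmod_equiv}.

End Circle.

(* A planar domain with its boundary length and an arc-length parametrization
   of its boundary, lifted to R. *)
Record table (R : realType) := Table {
  dom : set (R * R);
  len : R;
  gam : R -> R * R }.

Section Billiards.
Context {R : realType}.

(* strictly_convex r Om: dom Om is a strictly convex domain with boundary of
   class C^r, and gam Om is an arc-length parametrization of its boundary.
   The last clause says that the signed curvature of gam is positive. As dom is
   convex this also forces gam to run counterclockwise, so that rot90 of the
   tangent is the inward normal. *)
Definition strictly_convex (r : nat) (Om : table R) : Prop :=
  [/\ open (dom Om), dom Om !=set0, bounded_set (dom Om) &
      convex_set (dom Om : set (convex_lmodType (R * R)%type))] /\
  [/\ 0 < len Om,
      boundary (dom Om) = range (gam Om),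
      forall s s', gam Om s = gam Om s' <-> eqmod (len Om) s s',
      classC r setT (gam Om) &
      forall s, dot2 ((gam Om)^`() s) ((gam Om)^`() s) = 1 /\
                0 < det2 ((gam Om)^`() s) ((gam Om)^`(2) s)].

Section Map.
Variable Om : table R.

Definition phase : Type := (circle (len Om) * R)%type.

Definition annulus : set phase := [set p | 0 <= p.2 <= pi].
Definition annulus_int : set phase := [set p | 0 < p.2 < pi].
Definition bottom_edge : set phase := [set p | p.2 = 0].
Definition strip (d : R) : set phase := annulus `&` [set p | p.2 <= d].

Definition pt (p : phase) : R * R := gam Om (repr p.1).
Definition tangent (p : phase) : R * R := (gam Om)^`() (repr p.1).
Definition inner_normal (p : phase) : R * R := rot90 (tangent p).
Definition velocity (p : phase) : R * R :=
  cos p.2 *: tangent p + sin p.2 *: inner_normal p.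

(* From p, the trajectory next meets the boundary at the base point of q, and
   the velocity at q is the mirror image of the incoming one. *)
Definition billiard_step (p q : phase) : Prop :=
  annulus_int q /\
  (exists t : R,
    [/\ 0 < t, pt q = pt p + t *: velocity p &
        forall u : R, 0 < u < t ->
          ~ boundary (dom Om) (pt p + u *: velocity p)]) /\
  velocity q =
    velocity p - (2 * dot2 (velocity p) (inner_normal q)) *: inner_normal q.

(* The choice made by xget is harmless: in a strictly convex domain each p in
   annulus_int has exactly one q with billiard_step p q. *)
Definition billiard_map (p : phase) : phase :=
  if `[< annulus_int p >] then xget p [set q | billiard_step p q] else p.

Definition tangent_to (c : R -> R * R) (p : phase) : Prop :=
  exists (th a : R), [/\ 0 < a, c th = pt p + a *: velocity p &
                         det2 (velocity p) (c^`() th) = 0].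

(* c lies on one side of each of its tangent lines. *)
Definition convex_curve (c : R -> R * R) : Prop :=
  forall th : R,
    (forall x : R, 0 <= det2 (c^`() th) (c x - c th)) \/
    (forall x : R, det2 (c^`() th) (c x - c th) <= 0).

(* Closed curves are parametrized with period 1. *)
Definition caustic (r : nat) (c : R -> R * R) : Prop :=
  [/\ classC r setT c,
      forall x y, c x = c y <-> eqmod 1 x y,
      (forall x, c^`() x != 0) /\ convex_curve c,
      range c `<=` dom Om &
      forall p, annulus_int p -> tangent_to c p ->
                tangent_to c (billiard_map p)].

(* The caustics G(., t), 0 < t < 1, are the leaves of a foliation of the part
   of a neighbourhood U of the boundary that lies in the domain. *)
Definition integrable_near_boundary (r : nat) : Prop :=
  exists G : R * R -> R * R,
    let A := [set x : R * R | 0 < x.2 < 1] in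
    [/\ classC r A G,
        forall x, A x -> det2 ('D_(1, 0) G x) ('D_(0, 1) G x) != 0,
        forall t : R, 0 < t < 1 -> caustic r (fun th => G (th, t)),
        forall x y, A x -> A y -> G x = G y -> x.2 = y.2 &
        exists U : set (R * R),
          [/\ open U, boundary (dom Om) `<=` U & U `&` dom Om = G @` A]].

End Map.

Arguments annulus : clear implicits.
Arguments bottom_edge : clear implicits.
Arguments strip : clear implicits.

Definition C0_conjugate_near_boundary (Of Og : table R) : Prop :=
  exists (U : set (phase Of)) (V : set (phase Og))
         (h : phase Of -> phase Og) (k : phase Og -> phase Of) (d : R),
  [/\ 0 < d,
      U `<=` annulus Of /\ strip Of d `<=` U,
      @billiard_map Of @` strip Of d `<=` U &
      V `<=` annulus Og /\
      exists W : set (phase Og),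
        [/\ open W, bottom_edge Og `<=` W & W `&` annulus Og `<=` V]] /\
  [/\ {within U, continuous h} /\ {within V, continuous k},
      h @` U = V,
      forall p, U p -> k (h p) = p,
      h @` bottom_edge Of = bottom_edge Og &
      forall p, strip Of d p -> h (billiard_map p) = billiard_map (h p)].

Definition disc_domain (Om : table R) : Prop :=
  exists (c : R * R) (rho : R), 0 < rho /\
    dom Om = [set p | dot2 (p - c) (p - c) < rho ^+ 2].

(* c is the centre, u the direction of the major axis, a and b are the
   semi-axes, and e is the eccentricity (circles have e = 0). *)
Definition elliptic_domain (e : R) (Om : table R) : Prop :=
  exists (c u : R * R) (a b : R),
    [/\ dot2 u u = 1, 0 < b <= a, e = Num.sqrt (1 - (b / a) ^+ 2) &
        dom Om = [set p | (dot2 (p - c) u / a) ^+ 2 +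
                          (dot2 (p - c) (rot90 u) / b) ^+ 2 < 1]].

End Billiards.

(* Main.v *)
(* A family of caustics near the boundary yields a family of directions: the ray from
   [gam s] tangent to the caustic [J] makes with the boundary an angle of cosine [c s J].
   For an ellipse, Joachimsthal's conserved quantity gives such a family at once; for
   general caustics it is the slope of the tangent from [gam s] to the leaf, whose
   derivative in [J] exists except at the countably many [s] where the tangent touches the
   leaf twice.

   The generating function (the chord length) makes the derivative of [int c] in [J] a
   coordinate along each invariant curve in which the billiard map is a translation:
   [A J t - A J s - |gam t - gam s|], with [A J] a primitive of [c^~ J] and [t] the next
   impact, does not depend on [s], and comparing two values of [J] and letting them
   merge gives the claim.  After normalization this is [x |-> x + r] with the rotation
   number [r] strictly monotone in [J].  By Lazutkin's estimate on the boundary curvature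
   [kappa], the coordinate converges, as [J] tends to [0], to the normalized primitive of
   [kappa^(2/3)], so that the chart [(x, r)] extends continuously to the boundary.  Two
   tables with such charts are conjugate through [(x, r)]. *)
Require Import Defs.
From mathcomp Require Import all_boot all_order all_algebra generic_quotient ring lra.
From mathcomp Require Import all_classical all_reals all_analysis.
Import Order.TTheory GRing.Theory Num.Theory.
Import numFieldNormedType.Exports.
Local Open Scope ring_scope.
Local Open Scope classical_set_scope.
Set Implicit Arguments.
Unset Strict Implicit.
Unset Printing Implicit Defensive.

(** * Real analysis *)

Section Analysis.
Context {R : realType}.
Implicit Types (a b c s t x y e : R).

(** A caustic family is differentiable in [J] only off a countable set of boundary points, and along
    an invariant curve the next impact is merely continuous and monotone in [s]. So no derivative of
    an invariant curve in [s] is formed: the identities come from monotonicity, from comparing two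
    minimizers, and from dominated convergence, which ignores countable sets. The derivative of
    [int c] is taken in the strong sense, with both labels free near [J]; joint continuity in [s]
    and [J] follows from that. Its dynamical origin is the invariant area [ds d(cos phi)]: it
    measures the thin strip between neighbouring invariant curves. At the boundary the map
    degenerates to the identity, and a priori the rotation coordinates could fail to converge as the
    rotation number tends to 0. What controls them is a comparison of the reciprocals of the step
    lengths, whose errors add up to a bounded total over one turn. Four derivatives of the boundary
    are spent there: two for the curvature and two more for the expansion of [kappa^(2/3)]. *)

Lemma is_derive1E (V W : normedModType R) (f : V -> W) (x v : V) (d : W) :
  is_derive x v f d <-> h^-1 *: (f (h *: v + x) - f x) @[h --> (0:R)^'] --> d.
Proof.
split=> [[df <-]|df]; first exact: df.
by split; [apply/cvg_ex; exists d|exact: cvg_lim].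
Qed.

Lemma is_derive_fst (V : normedModType R) (f : V -> R * R) (x v : V) (d : R * R) :
  is_derive x v f d -> is_derive x v (fun z => (f z).1) d.1.
Proof.
move/is_derive1E => df; apply/is_derive1E.
have h : fst @ d --> d.1 by exact: cvg_fst.
by have := cvg_comp _ _ df h.
Qed.

Lemma is_derive_snd (V : normedModType R) (f : V -> R * R) (x v : V) (d : R * R) :
  is_derive x v f d -> is_derive x v (fun z => (f z).2) d.2.
Proof.
move/is_derive1E => df; apply/is_derive1E.
have h : snd @ d --> d.2 by exact: cvg_snd.
by have := cvg_comp _ _ df h.
Qed.

Lemma is_derive_dot2 (V : normedModType R) (f g : V -> R * R) (x v : V) (df dg : R * R) :
  is_derive x v f df -> is_derive x v g dg ->
  is_derive x v (fun z => dot2 (f z) (g z)) (dot2 df (g x) + dot2 (f x) dg).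
Proof.
move=> hf hg; have f1 := is_derive_fst hf; have f2 := is_derive_snd hf.
have g1 := is_derive_fst hg; have g2 := is_derive_snd hg.
apply: is_derive_eq; rewrite /dot2 /GRing.scale/=; ring.
Qed.

Lemma is_derive_det2 (V : normedModType R) (f g : V -> R * R) (x v : V) (df dg : R * R) :
  is_derive x v f df -> is_derive x v g dg ->
  is_derive x v (fun z => det2 (f z) (g z)) (det2 df (g x) + det2 (f x) dg).
Proof.
move=> hf hg; have f1 := is_derive_fst hf; have f2 := is_derive_snd hf.
have g1 := is_derive_fst hg; have g2 := is_derive_snd hg.
apply: is_derive_eq; rewrite /det2 /GRing.scale/=; ring.
Qed.

Lemma is_derive_continuous (W : normedModType R) (f : R -> W) (x : R) (d : W) :
  is_derive x 1 f d -> {for x, continuous f}.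
Proof. by move=> [h _]; apply: differentiable_continuous; exact/derivable1_diffP. Qed.

Lemma MVTd (f df : R -> R) a b : a < b ->
  (forall x, a <= x <= b -> is_derive x 1 f (df x)) ->
  exists c, a < c < b /\ f b - f a = df c * (b - a).
Proof.
move=> ab h; have [||c] := @MVT R f df a b ab.
- by move=> x; rewrite in_itv/= => /andP[ax xb]; apply: h; rewrite !ltW.
- apply: continuous_in_subspaceT => x; rewrite inE/= in_itv/= => xab.
  exact: is_derive_continuous (h x xab).
- by rewrite in_itv/= => cab e; exists c.
Qed.

Lemma is_derive_ltr (f df : R -> R) a b : a < b ->
  (forall x, a <= x <= b -> is_derive x 1 f (df x)) ->
  (forall x, a < x < b -> 0 < df x) -> f a < f b.
Proof.
move=> ab h p; have [c [cab e]] := MVTd ab h.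
by rewrite -subr_gt0 e mulr_gt0 ?p// subr_gt0.
Qed.

Lemma is_derive_ler (f df : R -> R) a b : a <= b ->
  (forall x, a <= x <= b -> is_derive x 1 f (df x)) ->
  (forall x, a <= x <= b -> 0 <= df x) -> f a <= f b.
Proof.
rewrite le_eqVlt => /predU1P[->//|ab] h p; have [c [/andP[ac cb] e]] := MVTd ab h.
by rewrite -subr_ge0 e mulr_ge0 ?p ?subr_ge0 ?ltW// !ltW.
Qed.

Lemma IVTc (f : R -> R) a b v : a <= b ->
  (forall x, a <= x <= b -> {for x, continuous f}) ->
  f a <= v <= f b -> exists c, a <= c <= b /\ f c = v.
Proof.
move=> ab cf /andP[av vb]; have [||c] := @IVT R f a b v ab.
- by apply: continuous_in_subspaceT => x; rewrite inE/= in_itv/=; exact: cf.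
- by rewrite ge_min av/= le_max vb orbT.
- by rewrite in_itv/= => cab e; exists c.
Qed.

Lemma EVT_minc (f : R -> R) a b : a <= b ->
  (forall x, a <= x <= b -> {for x, continuous f}) ->
  exists c, a <= c <= b /\ forall t, a <= t <= b -> f c <= f t.
Proof.
move=> ab cf; have [|c] := @EVT_min R f a b ab.
- by apply: continuous_in_subspaceT => x; rewrite inE/= in_itv/=; exact: cf.
- by rewrite in_itv/= => cab h; exists c.
Qed.

Lemma EVT_maxc (f : R -> R) a b : a <= b ->
  (forall x, a <= x <= b -> {for x, continuous f}) ->
  exists c, a <= c <= b /\ forall t, a <= t <= b -> f t <= f c.
Proof.
move=> ab cf; have [|c] := @EVT_max R f a b ab.
- by apply: continuous_in_subspaceT => x; rewrite inE/= in_itv/=; exact: cf.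
- by rewrite in_itv/= => cab h; exists c.
Qed.

Lemma cont_eps (T : pseudoMetricType R) (f : T -> R) (p : T) :
  {for p, continuous f} <->
  forall e, 0 < e -> exists2 d : R, 0 < d & forall q, ball p d q -> `|f q - f p| < e.
Proof.
split => [cf e e0|h].
  have /cvgrPdist_lt/(_ e e0) /nbhs_ballP[d/= d0 hd] := cf.
  by exists d => // q /hd /=; rewrite distrC.
apply/cvgrPdist_lt => e /h[d d0 hd]; apply/nbhs_ballP; exists d => // q /hd /=.
by rewrite distrC.
Qed.

Lemma near_lt (T : topologicalType) (f g : T -> R) (p : T) :
  {for p, continuous f} -> {for p, continuous g} -> f p < g p ->
  \forall q \near p, f q < g q.
Proof.
move=> cf cg fg; have h : (g \- f) q @[q --> p] --> g p - f p by exact: cvgB.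
have gf : 0 < g p - f p by rewrite subr_gt0.
by apply: (filterS _ (cvgr_gt _ h _ gf)) => q; rewrite /= subr_gt0.
Qed.

(** Made for functions given implicitly: comparing [y] with a fixed level [z] amounts to one strict
    inequality between continuous functions, and only levels within [d] of the limit need to be
    tested. *)
Lemma cvg_sandwich (T : Type) (F : set_system T) {FF : Filter F} (y : T -> R) (y0 d : R) :
  0 < d ->
  (forall z, y0 - d < z < y0 -> \forall p \near F, z < y p) ->
  (forall z, y0 < z < y0 + d -> \forall p \near F, y p < z) ->
  y @ F --> y0.
Proof.
move=> d0 lo hi; apply/cvgrPdist_lt => e e0.
have [m [m0 me md]] : exists m, [/\ 0 < m, m < e & m < d].
  exists (Num.min e d / 2); have m0 : 0 < Num.min e d by rewrite lt_min e0.
  have : Num.min e d <= e by rewrite ge_min lexx.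
  have : Num.min e d <= d by rewrite ge_min lexx orbT.
  by split; lra.
have {}lo : \forall p \near F, y0 - m < y p by apply: lo; lra.
have {}hi : \forall p \near F, y p < y0 + m by apply: hi; lra.
apply: (filterS _ (filterI lo hi)) => p [p1 p2]; rewrite ltr_norml; lra.
Qed.

End Analysis.

(** * Continuous induction and Taylor remainders *)

Section Analysis2.
Context {R : realType}.
Implicit Types (a b c s t x y e : R).

(** The supremum of the initial segments on which [Q] holds satisfies [Q] by the left step, and the
    right step pushes it up to [b]. *)
Lemma real_induction (Q : R -> Prop) a b :
  Q a ->
  (forall x, a <= x < b -> Q x -> exists2 d, 0 < d & forall y, x < y < x + d -> y <= b -> Q y) ->
  (forall x, a < x <= b -> (forall y, a <= y < x -> Q y) -> Q x) ->
  forall x, a <= x <= b -> Q x.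
Proof.
move=> Qa Qr Ql x0 /andP[ax0 x0b].
have ab : a <= b by lra.
pose S := [set x | a <= x <= b /\ forall y, a <= y <= x -> Q y].
have Sa : S a.
  by split; [lra|move=> y /andP[ay ya]; have -> : y = a by lra].
have hS : has_sup S by split; [exists a|exists b => x [/andP[_ ?] _]].
have aS : a <= sup S by apply: sup_upper_bound.
have Sb : sup S <= b by apply: ge_sup; [exists a|move=> x [/andP[_ ?] _]].
have below y : a <= y < sup S -> Q y.
  move=> /andP[ay yS].
  have [x [xab Qx] xy] := @sup_adherent _ S (sup S - y) ltac:(lra) hS.
  by apply: Qx; lra.
have Qs : Q (sup S).
  move: aS; rewrite le_eqVlt => /predU1P[<-//|aS].
  by apply: Ql => //; lra.
have [sb|/eqP sb] := eqVneq (sup S) b.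
  move: x0b; rewrite le_eqVlt => /predU1P[->|x0b]; first by rewrite -sb.
  by apply: below; lra.
have [|d d0 hd] := Qr (sup S) _ Qs.
  by rewrite aS/= lt_neqAle Sb andbT; exact/eqP.
have bs : sup S < b by rewrite lt_neqAle Sb andbT; exact/eqP.
pose z := Num.min b (sup S + d / 2).
have [zb zs] : z <= b /\ z <= sup S + d / 2.
  by split; rewrite /z ge_min lexx// orbT.
have sz : sup S < z by rewrite /z lt_min; lra.
have Sz : S z.
  split=> [|y /andP[ay yz]]; first by lra.
  have [yS|Sy|->//] := ltgtP y (sup S); first by apply: below; lra.
  by apply: hd; lra.
have := sup_upper_bound hS Sz; lra.
Qed.

(** Replaces the vanishing of a derivative when the natural parameter [tau] is only monotone:
    increments of [E] that are locally at most [e] times those of [tau] add up to at most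
    [e * (tau b - tau a)], for every [e]. *)
Lemma monotone_control_const (E tau : R -> R) :
  {homo tau : x y / x <= y} ->
  (forall s e, 0 < e -> exists2 d, 0 < d &
     forall s', `|s' - s| < d -> `|E s' - E s| <= e * `|tau s' - tau s|) ->
  forall x y, E x = E y.
Proof.
move=> mono loc.
suff H a b : a <= b -> E b = E a.
  by move=> x y; have [/H|/ltW/H] := leP x y.
move=> ab; apply/eqP; rewrite -subr_eq0 -normr_eq0; apply/eqP/le_anti; rewrite normr_ge0 andbT.
suff K e : 0 < e -> `|E b - E a| <= e * (tau b - tau a).
  apply/ler_addgt0Pl => e e0; rewrite addr0.
  have t0 : 0 <= tau b - tau a by rewrite subr_ge0; exact: mono.
  have := K (e / (tau b - tau a + 1)); rewrite divr_gt0//; last by lra.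
  move=> /(_ isT) /le_trans; apply.
  rewrite -mulrA ler_piMr//; first by lra.
  by rewrite mulrC ler_pdivrMr; lra.
move=> e0.
apply: (@real_induction (fun x => `|E x - E a| <= e * (tau x - tau a)) a b); rewrite ?lexx ?ab//.
- by rewrite !subrr normr0 mulr0.
- move=> x xab Qx; have [d d0 hd] := loc x e e0; exists d => // y yx yb.
  have := hd y; rewrite (ger0_norm (_ : 0 <= tau y - tau x)); last by rewrite subr_ge0; apply: mono; lra.
  rewrite gtr0_norm; last by lra.
  move=> /(_ ltac:(lra)) h.
  have -> : E y - E a = (E y - E x) + (E x - E a) by ring.
  by apply: le_trans (ler_normD _ _) _; lra.
- move=> x xab Qy; have [d d0 hd] := loc x e e0.
  pose y := Num.max a (x - d / 2).
  have [ya yx] : a <= y /\ x - d / 2 <= y by split; rewrite /y le_max lexx ?orbT.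
  have yx' : y < x by rewrite /y gt_max; lra.
  have := hd y; rewrite distrC gtr0_norm; last by lra.
  rewrite distrC (distrC (tau y)) (ger0_norm (_ : 0 <= tau x - tau y)); last by rewrite subr_ge0; apply: mono; lra.
  move=> /(_ ltac:(lra)) h; have := Qy y ltac:(lra) => h2.
  have -> : E x - E a = (E x - E y) + (E y - E a) by ring.
  by apply: le_trans (ler_normD _ _) _; lra.
Qed.

(** Integrates a bound once by the mean value theorem. The factor [1 / (n + 1)] is given away, as
    only orders of magnitude matter later. *)
Lemma taylor_bound_step (f df : R -> R) (C h : R) n : 0 <= C ->
  (forall x, is_derive x 1 f (df x)) -> f 0 = 0 ->
  (forall x, `|x| <= h -> `|df x| <= C * `|x| ^+ n) ->
  forall x, `|x| <= h -> `|f x| <= C * `|x| ^+ n.+1.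
Proof.
move=> C0 fd f0 hb x xh.
have [->|x0] := eqVneq x 0; first by rewrite f0 normr0 expr0n mulr0.
have [c [cx e]] : exists c, `|c| <= `|x| /\ f x = df c * x.
  have [xp|xn|] := ltgtP 0 x; last by move=> /esym/eqP; rewrite (negbTE x0).
    have [c [cb e]] := MVTd xp (fun y _ => fd y); exists c; split.
      by rewrite !gtr0_norm; lra.
    by move: e; rewrite f0 !subr0.
  have [c [cb e]] := MVTd xn (fun y _ => fd y); exists c; split.
    by rewrite !ltr0_norm; lra.
  by move: e; rewrite f0 !sub0r mulrN => /oppr_inj.
rewrite e normrM exprSr mulrA ler_wpM2r//.
apply: (le_trans (hb c (le_trans cx xh))).
by rewrite ler_wpM2l// lerXn2r// nnegrE.
Qed.

End Analysis2.

(** * Primitives, dominated convergence and strict maxima *)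

Section Analysis3.
Context {R : realType}.
Implicit Types (a b c s t x y e : R).

Lemma FTC_half (f : R -> R) (c : R) : continuous f ->
  forall x, c < x -> is_derive x 1 (fun y => \int[lebesgue_measure]_(t in `[c, y]) f t) (f x).
Proof.
move=> cf x cx.
have [||dF FE] := @continuous_FTC1_closed R f c x (x + 1) _ _ cx (cf x).
- by rewrite ltrDl.
- apply: continuous_compact_integrable; first exact: segment_compact.
  exact: continuous_subspaceT.
- by apply: DeriveDef; [exact: dF|rewrite -derive1E; exact: FE].
Qed.

(** The integral from [-1] is a primitive to the right of [-1]; integrating the reflected function
    gives one to the left of 1. They differ by a constant on the overlap [-1 < x < 1] and are glued
    at 0. *)
Lemma antiderivative (f : R -> R) : continuous f ->
  exists F : R -> R, forall x, is_derive x 1 F (f x).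
Proof.
move=> cf.
pose H y := \int[lebesgue_measure]_(t in `[-1, y]) f t.
pose H2 y := \int[lebesgue_measure]_(t in `[-1, y]) f (- t).
have cf2 : continuous (f \o -%R).
  by move=> x; apply: continuous_comp; [exact: opp_continuous|exact: cf].
have dH : forall x, -1 < x -> is_derive x 1 H (f x) by exact: FTC_half.
have dH2 : forall x, x < 1 -> is_derive x 1 (fun y => - H2 (- y)) (f x).
  move=> x x1; have h : is_derive (- x) 1 H2 (f (- - x)) by apply: (FTC_half cf2); rewrite ltrN2.
  rewrite opprK in h.
  have h1 : is_derive x 1 (fun y : R => - y) (-1) by exact: is_deriveNid.
  have h2 := @is_derive1_comp R H2 (fun y => - y) x _ _ h h1.
  apply: (is_derive_eq (is_deriveN h2)); rewrite /GRing.scale/=; ring.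
pose F y := if y < 0 then - H2 (- y) - - H2 0 else H y - H 0.
have E z : -1 < z < 1 -> - H2 (- z) - - H2 0 = H z - H 0.
  move=> z1.
  pose G y := - H2 (- y) - H y.
  have dG y : -1 < y < 1 -> is_derive y 1 G 0.
    move=> y1; have := is_deriveB (dH2 y _) (dH y _); rewrite subrr; apply; lra.
  have : G z = G 0.
    have [z0|z0|->//] := ltgtP z 0.
      have [//||c [_]] := @MVTd R G (cst 0) z 0; last by rewrite mul0r => /eqP; rewrite subr_eq0 => /eqP.
      by move=> y yz; apply: dG; lra.
    have [//||c [_]] := @MVTd R G (cst 0) 0 z; last by rewrite mul0r => /eqP; rewrite subr_eq0 => /eqP.
    by move=> y yz; apply: dG; lra.
  rewrite /G oppr0; lra.
exists F => x.
have [x0|x0] := ltP x 0.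
  apply: (@near_eq_is_derive R R R (fun y => - H2 (- y) - - H2 0) F).
    near=> y; rewrite /F ifT//; near: y; exact: lt_nbhsl.
  have h := dH2 x ltac:(lra).
  have := is_deriveB h (is_derive_cst (- H2 0) x 1); rewrite subr0; exact.
apply: (@near_eq_is_derive R R R (fun y => H y - H 0) F).
  near=> y; rewrite /F; case: ifPn => // y0; rewrite E//.
  rewrite (lt_trans y0)// andbT; near: y; apply: lt_nbhsr; lra.
have h := dH x ltac:(lra).
have := is_deriveB h (is_derive_cst (H 0) x 1); rewrite subr0; exact.
Unshelve. all: by end_near.
Qed.

(** Dominated convergence, read on the increments of the primitives [F n]; the countable set [Z],
    where nothing is known about the limit, is cut out of the domain and has measure 0. *)
Lemma bounded_convergence (f F : nat -> R -> R) (w : R -> R) (Z : set R) (C b : R) :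
  0 < b ->
  (forall n, continuous (f n)) ->
  (forall n x, is_derive x 1 (F n) (f n x)) ->
  (forall n x, `|f n x| <= C) ->
  countable Z ->
  (forall x, ~ Z x -> f n x @[n --> \oo] --> w x) ->
  (F n b - F n 0) @[n --> \oo] -->
    \int[lebesgue_measure]_(x in `[0, b] `\` Z) w x.
Proof.
move=> b0 cf dF fC cZ fw.
have mZ : measurable (Z : set (measurableTypeR R)) by exact: countable_measurable.
pose D := `[0, b] `\` Z : set (measurableTypeR R).
have mD : measurable D by apply: measurableD.
have mf n : measurable_fun D (f n).
  apply: measurable_funTS; exact: measurable_realfun.continuous_measurable_fun.
have intf n : (\int[lebesgue_measure]_(x in D) (f n x)%:E)%E = (F n b - F n 0)%:E.
  rewrite EFinB -(@continuous_FTC2 _ (f n) (F n) 0 b b0).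
  - apply/esym; apply: negligible_integral => //.
    + apply: continuous_compact_integrable; first exact: segment_compact.
      exact: continuous_subspaceT.
    + exact: countable_lebesgue_measure0.
  - exact: continuous_subspaceT.
  - split=> [x _|/=|].
    + by have [] := dF n x.
    + apply: cvg_at_right_filter; exact: is_derive_continuous (dF n 0).
    + apply: cvg_at_left_filter; exact: is_derive_continuous (dF n b).
  - by move=> x _; rewrite derive1E; have [_ ->] := dF n x.
have Cint : (@lebesgue_measure R).-integrable D (EFin \o cst C).
  have h : (@lebesgue_measure R).-integrable `[0, b] (EFin \o cst C).
    apply: continuous_compact_integrable; first exact: segment_compact.
    by apply: continuous_subspaceT => ?; exact: cvg_cst.
  apply: integrableS h; [exact: measurable_itv|exact: mD|exact: subDsetl].
have := @dominated_convergence _ _ _ lebesgue_measure D mD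
  (fun n x => (f n x)%:E) (fun x => (w x)%:E) (EFin \o cst C).
case.
- by move=> n; apply/measurable_realfun.measurable_EFinP.
- apply/measurable_realfun.measurable_EFinP; apply: (measurable_realfun.measurable_fun_cvg mf).
  by move=> x [_ /fw].
- by apply: aeW => x [_ /fw h]; apply: cvg_EFin; [exact: nearW|exact: h].
- exact: Cint.
- by apply: aeW => x n _; rewrite /= lee_fin fC.
move=> iw _ cvgw.
have h : (F n b - F n 0)%:E @[n --> \oo] -->
    (\int[lebesgue_measure]_(x in D) w x)%:E.
  rewrite /Rintegral fineK; last exact: integrable_fin_num.
  by move: cvgw; rewrite (_ : (fun n => _) = (fun n => (F n b - F n 0)%:E)) //; apply/funext => n; exact: intf.
have h2 := fine_cvg h. rewrite /= in h2. apply: h2.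
Qed.

(** Such an [s] is the strict maximum point of [f x - r * x] over some interval with rational end
    points, so three rational numbers determine it. *)
Lemma countable_strict_max (f : R -> R) :
  countable [set s | exists (r : rat) d, 0 < d /\
     forall x, `|x - s| < d -> x != s -> f x - ratr r * x < f s - ratr r * s].
Proof.
pose S (k : rat * rat * rat) := [set s | ratr k.1.2 < s < ratr k.2 /\
  forall x, ratr k.1.2 < x < ratr k.2 -> x != s ->
    f x - ratr k.1.1 * x < f s - ratr k.1.1 * s].
apply: (@sub_countable _ _ _ (\bigcup_k S k)).
  apply: subset_card_le => s [r [d [d0 h]]].
  have [p] := @rat_in_itvoo R (s - d) s ltac:(lra); rewrite in_itv/= => hp.
  have [q] := @rat_in_itvoo R s (s + d) ltac:(lra); rewrite in_itv/= => hq.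
  exists (r, p, q) => //; split=> /= [|x xpq xs]; first by lra.
  by apply: h => //; rewrite ltr_norml; lra.
apply: bigcup_countable; first exact: countableP.
move=> k _; have [[s Ss]|/forallNP nS] := pselect (exists s, S k s).
  apply: (@sub_countable _ _ _ [set s]); last exact: countable1.
  apply: subset_card_le => s' Ss' /=; apply: contrapT => /eqP ne.
  have [k1 h1] := Ss; have [k2 h2] := Ss'.
  have := h1 s' k2 ne; have := h2 s k1; rewrite eq_sym => /(_ ne); lra.
suff -> : S k = set0 by exact: countable0.
by apply/seteqP; split => // s /nS.
Qed.

End Analysis3.

(** * Plane geometry and convex arcs *)

Section Geometry.
Context {R : realType}.
Implicit Types (u v w x y : R * R).

Lemma det2Dr u v w : det2 u (v + w) = det2 u v + det2 u w.
Proof. by rewrite /det2 /=; ring. Qed.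
Lemma det2Br u v w : det2 u (v - w) = det2 u v - det2 u w.
Proof. by rewrite /det2 /=; ring. Qed.
Lemma det2Zr (a : R) u v : det2 u (a *: v) = a * det2 u v.
Proof. by rewrite /det2/= /GRing.scale/=; ring. Qed.
Lemma det2Zl (a : R) u v : det2 (a *: u) v = a * det2 u v.
Proof. by rewrite /det2/= /GRing.scale/=; ring. Qed.
Lemma det2C u v : det2 u v = - det2 v u.
Proof. by rewrite /det2 /=; ring. Qed.
Lemma det2xx u : det2 u u = 0.
Proof. by rewrite /det2 /=; ring. Qed.
Lemma dot2C u v : dot2 u v = dot2 v u.
Proof. by rewrite /dot2 /=; ring. Qed.
Lemma dot2Zr (a : R) u v : dot2 u (a *: v) = a * dot2 u v.
Proof. by rewrite /dot2/= /GRing.scale/=; ring. Qed.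
Lemma dot2Dr u v w : dot2 u (v + w) = dot2 u v + dot2 u w.
Proof. by rewrite /dot2 /=; ring. Qed.
Lemma dot2Br u v w : dot2 u (v - w) = dot2 u v - dot2 u w.
Proof. by rewrite /dot2 /=; ring. Qed.

Lemma dot2_det2 u v w :
  dot2 u v * dot2 w w = dot2 u w * dot2 v w + det2 w u * det2 w v.
Proof. by rewrite /dot2 /det2 /=; ring. Qed.

Lemma cont_det2 (T : topologicalType) (f g : T -> R * R) (p : T) :
  {for p, continuous f} -> {for p, continuous g} ->
  {for p, continuous (fun q => det2 (f q) (g q))}.
Proof.
move=> cf cg.
have c1 (h : T -> R * R) : {for p, continuous h} -> (fun q => (h q).1) @ p --> (h p).1.
  by move=> ch; have k : fst @ (h p) --> (h p).1 by [exact: cvg_fst]; have := cvg_comp _ _ ch k.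
have c2 (h : T -> R * R) : {for p, continuous h} -> (fun q => (h q).2) @ p --> (h p).2.
  by move=> ch; have k : snd @ (h p) --> (h p).2 by [exact: cvg_snd]; have := cvg_comp _ _ ch k.
by apply: cvgB; apply: cvgM; [exact: c1|exact: c2|exact: c2|exact: c1].
Qed.

Lemma cont_dot2 (T : topologicalType) (f g : T -> R * R) (p : T) :
  {for p, continuous f} -> {for p, continuous g} ->
  {for p, continuous (fun q => dot2 (f q) (g q))}.
Proof.
move=> cf cg.
have c1 (h : T -> R * R) : {for p, continuous h} -> (fun q => (h q).1) @ p --> (h p).1.
  by move=> ch; have k : fst @ (h p) --> (h p).1 by [exact: cvg_fst]; have := cvg_comp _ _ ch k.
have c2 (h : T -> R * R) : {for p, continuous h} -> (fun q => (h q).2) @ p --> (h p).2.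
  by move=> ch; have k : snd @ (h p) --> (h p).2 by [exact: cvg_snd]; have := cvg_comp _ _ ch k.
by apply: cvgD; apply: cvgM; [exact: c1|exact: c1|exact: c2|exact: c2].
Qed.

(** With [x'] in [A] close to [x], the point is a convex combination of [x'] and a point close to
    [y], which still lies in the open set [A]. *)
Lemma convex_open_closure (A : set (R * R)) x y (a : R) :
  open A -> convex_set (A : set (convex_lmodType (R * R)%type)) ->
  closure A x -> A y -> 0 < a <= 1 -> A ((1 - a) *: x + a *: y).
Proof.
move=> oA cA Ax Ay /andP[a0 a1].
have conv p q (b : R) : 0 <= b <= 1 -> A p -> A q -> A (b *: p + (1 - b) *: q).
  move=> /andP[b0 b1] Ap Aq.
  have := cA p q (Itv01 b0 b1); rewrite !inE => /(_ Ap Aq); exact.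
have near_x : \forall x' \near x, A (y + ((1 - a) / a) *: (x - x')).
  have h : (y + ((1 - a) / a) *: (x - x')) @[x' --> x] --> y.
    rewrite -[X in _ --> X]addr0 -(scaler0 _ ((1 - a) / a)) -(subrr x).
    apply: cvgD; first exact: cvg_cst.
    by apply: cvgZr; apply: cvgB; [exact: cvg_cst|exact: cvg_id].
  by apply: h; exact: open_nbhs_nbhs.
have [x' [Ax' Ay']] := Ax _ near_x.
have -> : (1 - a) *: x + a *: y = a *: (y + ((1 - a) / a) *: (x - x')) + (1 - a) *: x'.
  rewrite scalerDr scalerA mulrCA divff ?gt_eqF// mulr1 addrC -addrA; congr (_ + _).
  by rewrite -scalerDr subrK.
by apply: conv => //; lra.
Qed.

Lemma classC_derive1 (W : normedModType R) (f : R -> W) n :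
  classC n.+1 setT f ->
  (forall t : R, is_derive t 1 f (f^`() t)) /\ classC n setT f^`().
Proof.
case=> _ /(_ 1)[df cf]; split=> [x|].
  by split; [exact: df|rewrite derive1E].
by have -> : f^`() = (fun t : R => 'D_1 f t) by apply/funext => t; rewrite derive1E.
Qed.

Lemma classC_continuous (V W : normedModType R) (A : set V) (f : V -> W) n (x : V) :
  classC n A f -> A x -> {for x, continuous f}.
Proof. by case: n => [|n] [+ _]; apply. Qed.

Lemma pair_ext u v : u.1 = v.1 -> u.2 = v.2 -> u = v.
Proof. by case: u v => [a b] [c d] /= -> ->. Qed.

Lemma det2_inj u v w : det2 v u != 0 -> det2 u w = 0 -> det2 v w = 0 -> w = 0.
Proof.
rewrite /det2 => h hu hv; apply: pair_ext => /=; apply: (mulfI h); rewrite mulr0.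
  transitivity ((v.1 * w.2 - v.2 * w.1) * u.1 - (u.1 * w.2 - u.2 * w.1) * v.1); first by ring.
  by rewrite hu hv !mul0r subr0.
transitivity ((v.1 * w.2 - v.2 * w.1) * u.2 - (u.1 * w.2 - u.2 * w.1) * v.2); first by ring.
by rewrite hu hv !mul0r subr0.
Qed.

Lemma is_derive_det2r u (f : R -> R * R) (t : R) df :
  is_derive t 1 f df -> is_derive t 1 (fun s => det2 u (f s)) (det2 u df).
Proof.
move=> h; apply: (is_derive_eq (is_derive_det2 (is_derive_cst u t (1:R)) h)).
by rewrite /det2/=; ring.
Qed.

Lemma is_derive_dot2r u (f : R -> R * R) (t : R) df :
  is_derive t 1 f df -> is_derive t 1 (fun s => dot2 u (f s)) (dot2 u df).
Proof.
move=> h; apply: (is_derive_eq (is_derive_dot2 (is_derive_cst u t (1:R)) h)).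
by rewrite /dot2/=; ring.
Qed.

Lemma is_derive_subr u (f : R -> R * R) (t : R) df :
  is_derive t 1 f df -> is_derive t 1 (fun s => f s - u) df.
Proof.
move=> h; apply: (is_derive_eq (is_deriveB h (is_derive_cst u t (1:R)))).
exact: subr0.
Qed.

Lemma det2r0 u : det2 u 0 = 0.
Proof. by rewrite /det2/=; ring. Qed.

Lemma dot2_rot90 u v : dot2 u (rot90 v) = - det2 u v.
Proof. by rewrite /dot2 /det2 /rot90/=; ring. Qed.

Lemma det2_rot90 u v : det2 u (rot90 v) = dot2 u v.
Proof. by rewrite /dot2 /det2 /rot90/=; ring. Qed.

Lemma det2_rot90l u v : det2 (rot90 u) v = - dot2 u v.
Proof. by rewrite /dot2 /det2 /rot90/=; ring. Qed.

End Geometry.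

(** The derivatives of [g] up to order four are named and their periodicity is recorded, so that the
    geometric lemmas deal neither with the quotient circle nor with iterated derivatives. *)
Record convex_arc {R : realType} (D : set (R * R)) (l : R) (g T g2 g3 g4 : R -> R * R) : Prop :=
  ConvexArc {
  arc_open : open D;
  arc_ne : D !=set0;
  arc_convex : convex_set (D : set (convex_lmodType (R * R)%type));
  arc_len : 0 < l;
  arc_boundary : boundary D = range g;
  arc_inj : forall s t, g s = g t -> exists k : int, s = t + k%:~R * l;
  arc_per : forall s, g (s + l) = g s;
  arc_T_per : forall s, T (s + l) = T s;
  arc_g2_per : forall s, g2 (s + l) = g2 s;
  arc_g3_per : forall s, g3 (s + l) = g3 s;
  arc_g4_per : forall s, g4 (s + l) = g4 s;
  arc_d0 : forall s : R, is_derive s 1 g (T s);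
  arc_d1 : forall s : R, is_derive s 1 T (g2 s);
  arc_d2 : forall s : R, is_derive s 1 g2 (g3 s);
  arc_d3 : forall s : R, is_derive s 1 g3 (g4 s);
  arc_c4 : continuous g4;
  arc_unit : forall s, dot2 (T s) (T s) = 1;
  arc_curv : forall s, 0 < det2 (T s) (g2 s) }.

Lemma table_arc (R : realType) (Om : table R) : strictly_convex 4 Om ->
  convex_arc (dom Om) (len Om) (gam Om) (gam Om)^`() (gam Om)^`(2) (gam Om)^`(3) (gam Om)^`(4).
Proof.
move=> [[oD nD _ cD] [l0 E inj cC uc]].
have [d0 c3] := classC_derive1 cC; have [d1 c2] := classC_derive1 c3.
have [d2 c1] := classC_derive1 c2; have [d3 c0] := classC_derive1 c1.
have per0 s : gam Om (s + len Om) = gam Om s.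
  apply/(inj (s + len Om) s); apply/asboolP; exists 1.
  by rewrite addrC addKr mul1r.
have perS (f : R -> R * R) : (forall s, f (s + len Om) = f s) ->
    forall s, f^`() (s + len Om) = f^`() s.
  move=> pf s; rewrite !derive1E /derive; congr (lim _); apply: (congr1 (fun F => F @ _)).
  by apply/funext => h /=; rewrite addrA !pf.
have per1 := perS _ per0; have per2 := perS _ per1.
have per3 := perS _ per2; have per4 := perS _ per3.
split.
- exact: oD.
- exact: nD.
- exact: cD.
- exact: l0.
- exact: E.
- by move=> s t /inj/asboolP[k e]; exists k; rewrite -e addrC subrK.
- exact: per0.
- exact: per1.
- exact: per2.
- exact: per3.
- exact: per4.
- exact: d0.
- exact: d1.
- exact: d2.
- exact: d3.
- by move=> x; exact: (classC_continuous c0 I).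
- by move=> s; have [] := uc s.
- by move=> s; have [] := uc s.
Qed.

(** * Position of the domain relative to its tangents and chords *)

Section ArcGeometry.
Context {R : realType} (D : set (R * R)) (l : R) (g T g2 g3 g4 : R -> R * R).
Context (SC : convex_arc D l g T g2 g3 g4).
Implicit Types (s t : R).

Lemma len_gt0 : 0 < l. Proof. by case: SC. Qed.
Lemma dT s : is_derive s 1 g (T s). Proof. by case: SC. Qed.
Lemma ddT s : is_derive s 1 T (g2 s). Proof. by case: SC. Qed.
Lemma T_unit s : dot2 (T s) (T s) = 1. Proof. by case: SC. Qed.
Lemma kappa_gt0 s : 0 < det2 (T s) (g2 s). Proof. by case: SC. Qed.
Lemma cT s : {for s, continuous T}. Proof. exact: is_derive_continuous (ddT s). Qed.
Lemma cg s : {for s, continuous g}. Proof. exact: is_derive_continuous (dT s). Qed.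
Lemma cg2 s : {for s, continuous g2}.
Proof. by apply: is_derive_continuous (arc_d2 SC s). Qed.

Lemma is_derive_detg u p s : is_derive s 1 (fun t => det2 u (g t - p)) (det2 u (T s)).
Proof. by apply: is_derive_det2r; apply: is_derive_subr; exact: dT. Qed.

(** Positive curvature makes [det2 (T s) (T x)] change sign from negative to positive at [x = s];
    hence [det2 (T s) (g t - g s)] has a strict local minimum at [t = s]. *)
Lemma local_left s : exists2 d, 0 < d & forall t, 0 < `|t - s| < d ->
  0 < det2 (T s) (g t - g s).
Proof.
have cdet : {for s, continuous (fun t => det2 (T s) (g2 t))}.
  by apply: cont_det2; [exact: cvg_cst|exact: cg2].
have := near_lt (@cst_continuous _ _ 0 s) cdet (kappa_gt0 s).
move=> /nbhs_ballP[d /= d0 hd]; exists d => // t /andP[ts td].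
have A'' (x : R) : is_derive x 1 (fun x => det2 (T s) (T x)) (det2 (T s) (g2 x)).
  by apply: is_derive_det2r; exact: ddT.
have A0 : det2 (T s) (T s) = 0 by exact: det2xx.
have B0 : det2 (T s) (g s - g s) = 0 by rewrite subrr det2r0.
have pos (x : R) : `|x - s| < d -> 0 < det2 (T s) (g2 x).
  by move=> xd; apply: hd; rewrite /ball/= distrC.
have [tl|tr|e] := ltgtP t s; last by move: ts; rewrite e subrr normr0 ltxx.
  rewrite ltr0_norm in td; last by lra.
  have [c [tc e]] := MVTd tl (fun x _ => is_derive_detg (T s) (g s) x).
  have cs : c < s by lra.
  have An : det2 (T s) (T c) < 0.
    rewrite -A0; apply: (is_derive_ltr cs (fun x _ => A'' x)) => x xcs.
    by apply: pos; rewrite ltr_norml; lra.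
  have : det2 (T s) (T c) * (s - t) < 0 by rewrite pmulr_llt0; lra.
  by rewrite -e B0; lra.
rewrite gtr0_norm in td; last by lra.
have [c [tc e]] := MVTd tr (fun x _ => is_derive_detg (T s) (g s) x).
have cs : s < c by lra.
have An : 0 < det2 (T s) (T c).
  rewrite -A0; apply: (is_derive_ltr cs (fun x _ => A'' x)) => x xcs.
  by apply: pos; rewrite ltr_norml; lra.
have : 0 < det2 (T s) (T c) * (t - s) by rewrite pmulr_lgt0; lra.
by rewrite -e B0; lra.
Qed.

Lemma dom_open : open (D). Proof. by case: SC. Qed.

Lemma dom_convex_closure x y (a : R) : closure (D) x -> D y ->
  0 < a <= 1 -> D ((1 - a) *: x + a *: y).
Proof. by apply: convex_open_closure; case: SC. Qed.

Lemma arc_closure s : closure (D) (g s).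
Proof.
by have : boundary (D) (g s) by [rewrite (arc_boundary SC); exists s]; case.
Qed.

Lemma arc_notin s : ~ D (g s).
Proof.
have : boundary (D) (g s) by [rewrite (arc_boundary SC); exists s]; case=> _ ni d.
by apply: ni; move/interior_id: dom_open => ->.
Qed.

Lemma closure_boundary x : closure (D) x -> ~ D x -> exists s, g s = x.
Proof.
move=> cx nx.
have : boundary (D) x by split => // /interior_subset.
by rewrite (arc_boundary SC) => -[s _ <-]; exists s.
Qed.

(** Both points are moved into [D] towards an interior point [z], by a proportion [e] that then
    tends to 0. *)
Lemma closure_conv x y (a : R) : closure (D) x -> closure (D) y ->
  0 <= a <= 1 -> closure (D) ((1 - a) *: x + a *: y).
Proof.
have [z Dz] := arc_ne SC; move=> cx cy /andP[a0 a1] B Bn.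
pose p (e : R) := (1 - a) *: ((1 - e) *: x + e *: z) + a *: ((1 - e) *: y + e *: z).
have pD e : 0 < e <= 1 -> D (p e).
  move=> e01; have h1 := dom_convex_closure cx Dz e01; have h2 := dom_convex_closure cy Dz e01.
  move: a0; rewrite le_eqVlt => /predU1P[a0|a0]; first by rewrite /p -a0 subr0 scale1r scale0r addr0.
  by apply: dom_convex_closure => //; [exact: subset_closure|lra].
have cp : p e @[e --> (0:R)] --> (1 - a) *: x + a *: y.
  have h u : ((1 - e) *: u + e *: z) @[e --> (0:R)] --> u.
    have -> : nbhs u = nbhs ((1 - 0) *: u + (0 : R) *: z) by rewrite subr0 scale1r scale0r addr0.
    by apply: cvgD; apply: cvgZl; [apply: cvgB; [exact: cvg_cst|exact: cvg_id]|exact: cvg_id].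
  by apply: cvgD; apply: cvgZr; exact: h.
have := cp _ Bn => /nbhs_ballP[d /= d0 hd].
pose m := Num.min d 1 / 2.
have [m0 md m1] : [/\ 0 < m, m < d & m <= 1].
  have : 0 < Num.min d 1 by rewrite lt_min d0 ltr01.
  have : Num.min d 1 <= d by rewrite ge_min lexx.
  have : Num.min d 1 <= 1 by rewrite ge_min lexx orbT.
  by rewrite /m; split; lra.
exists (p m); split; first by apply: pD; rewrite m0.
by apply: hd; rewrite /ball/= sub0r normrN gtr0_norm.
Qed.

(* If [y] lay on or to the right of the tangent at [s], then [g s] would be a convex
   combination of [y] and the two boundary points [g (s + h)], [g (s - h)]. *)
Lemma dom_left s y : D y -> 0 < det2 (T s) (y - g s).
Proof.
have weak z : D z -> 0 <= det2 (T s) (z - g s).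
  move=> Dz; rewrite leNgt; apply/negP => neg.
  pose w := z - g s.
  have [d d0 loc] := local_left s.
  have wT : 0 < det2 w (T s) by rewrite det2C oppr_gt0.
  have cW : {for s, continuous (fun t => det2 w (T t))}.
    by apply: cont_det2; [exact: cvg_cst|exact: cT].
  have := near_lt (@cst_continuous _ _ 0 s) cW wT.
  move=> /nbhs_ballP[d' /= d'0 hd'].
  pose h := Num.min d d' / 2.
  have [h0 hd hd'2] : [/\ 0 < h, h < d & h < d'].
    have : 0 < Num.min d d' by rewrite lt_min d0.
    have : Num.min d d' <= d by rewrite ge_min lexx.
    have : Num.min d d' <= d' by rewrite ge_min lexx orbT.
    by rewrite /h; split; lra.
  pose a := g (s + h) - g s; pose b := g (s - h) - g s.
  have Ta : 0 < det2 (T s) a by apply: loc; rewrite addrAC subrr add0r gtr0_norm; lra.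
  have Tb : 0 < det2 (T s) b by apply: loc; rewrite addrAC subrr add0r ltr0_norm; lra.
  have wa : 0 < det2 w a.
    have sh : s < s + h by lra.
    have [c [cb e]] := MVTd sh (fun x _ => is_derive_detg w (g s) x).
    have w0 : det2 w (g s - g s) = 0 by rewrite subrr det2r0.
    move: e; rewrite w0 subr0 => ->; apply: mulr_gt0; last by lra.
    by apply: hd'; rewrite /ball/= ltr_norml; lra.
  have wb : det2 w b < 0.
    have sh : s - h < s by lra.
    have [c [cb e]] := MVTd sh (fun x _ => is_derive_detg w (g s) x).
    have w0 : det2 w (g s - g s) = 0 by rewrite subrr det2r0.
    move: e; rewrite w0 sub0r => e; rewrite -oppr_gt0 e; apply: mulr_gt0; last by lra.
    by apply: hd'; rewrite /ball/= ltr_norml; lra.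
  (* [la] is chosen so that [p], a convex combination of [a] and [b], lies on the line of [w]. As
     [p] and [w] are on opposite sides of the tangent, [p] is a negative multiple of [w]. *)
  pose la := - det2 w b / (det2 w a - det2 w b).
  have den : 0 < det2 w a - det2 w b by lra.
  have la0 : 0 < la by rewrite /la divr_gt0//; lra.
  have la1 : la < 1 by rewrite /la ltr_pdivrMr//; lra.
  pose p := la *: a + (1 - la) *: b.
  have wp : det2 w p = 0.
    by rewrite /p det2Dr !det2Zr /la; field; lra.
  have Tp : 0 < det2 (T s) p.
    by rewrite /p det2Dr !det2Zr addr_gt0// mulr_gt0//; lra.
  pose mu := det2 (T s) p / - det2 (T s) w.
  have mu0 : 0 < mu by rewrite /mu divr_gt0// oppr_gt0.
  have pw : p = - mu *: w.
    have T2 : det2 (T s) w != 0 by rewrite lt_eqF.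
    apply/eqP; rewrite -subr_eq0; apply/eqP.
    apply: (@det2_inj _ w (T s)) => //.
      by rewrite det2Br det2Zr wp det2xx mulr0 subr0.
    by rewrite det2Br det2Zr /mu; field.
  pose q := (la *: g (s + h) + (1 - la) *: g (s - h)).
  have Dg : g s = (1 - mu / (1 + mu)) *: q + (mu / (1 + mu)) *: z.
    have -> : q = g s - mu *: w.
      rewrite -scaleNr -pw /p /a /b /q.
      by apply: pair_ext; rewrite /= /GRing.scale/=; ring.
    apply: pair_ext; rewrite /w/= /GRing.scale/=; field; lra.
  apply: (@arc_notin s); rewrite Dg; apply: dom_convex_closure => //.
    rewrite /q addrC.
    by apply: closure_conv; [exact: arc_closure|exact: arc_closure|lra].
  have mu1 : 0 < 1 + mu by lra.
  by apply/andP; split; [exact: divr_gt0|rewrite ler_pdivrMr//; lra].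
(* The weak inequality becomes strict because [D] is open: [y] can be pushed a little to the right
   without leaving [D]. *)
move=> Dy; have o : \forall z \near y, D z by apply: open_nbhs_nbhs; split => //; exact: dom_open.
have cv : (y - e *: rot90 (T s)) @[e --> (0:R)] --> y.
  rewrite -[X in _ --> X]subr0 -(scale0r (rot90 (T s))).
  apply: cvgB; first exact: cvg_cst.
  by apply: cvgZl; exact: cvg_id.
have := cv _ o => /nbhs_ballP[d /= d0 hd].
have /weak : D (y - (d / 2) *: rot90 (T s)).
  by apply: hd; rewrite /ball/= sub0r normrN gtr0_norm; lra.
have -> : y - d / 2 *: rot90 (T s) - g s = (y - g s) - (d / 2) *: rot90 (T s).
  by rewrite addrAC.
rewrite (det2Br _ (y - g s)) det2Zr.
have -> : det2 (T s) (rot90 (T s)) = 1 by rewrite det2_rot90 T_unit.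
lra.
Qed.

Lemma closure_left s x : closure D x -> 0 <= det2 (T s) (x - g s).
Proof.
move=> cx; rewrite leNgt; apply/negP => neg.
have cc : {for x, continuous (fun y : R * R => det2 (T s) (y - g s))}.
  by apply: cont_det2; [exact: cvg_cst|apply: cvgB; [exact: cvg_id|exact: cvg_cst]].
have [y [Dy]] := cx _ (near_lt cc (@cst_continuous _ _ 0 x) neg).
by move=> /(lt_trans (dom_left s Dy)); rewrite ltxx.
Qed.

(* Strictness: otherwise the boundary contains a segment of the tangent line, and
   points of the arc near its midpoint lie inside a triangle spanned by that segment
   and an interior point. *)
Lemma chord_left s t : g t <> g s -> 0 < det2 (T s) (g t - g s).
Proof.
move=> gts; rewrite lt_neqAle closure_left ?andbT; last exact: arc_closure.
apply/eqP => e0; pose v := g t - g s.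
have v0 : v != 0 by rewrite subr_eq0; exact/eqP.
pose seg (c : R) := (1 - c) *: g s + c *: g t.
have cseg c : 0 <= c <= 1 -> closure D (seg c).
  by move=> c01; apply: closure_conv => //; exact: arc_closure.
have [r xr] : exists r, g r = seg 2^-1.
  apply: closure_boundary; first by apply: cseg; lra.
  move=> /(dom_left s).
  have -> : seg 2^-1 - g s = 2^-1 *: v.
    by apply: pair_ext; rewrite /seg /v/= /GRing.scale/=; lra.
  by rewrite det2Zr -e0 mulr0 ltxx.
(* The two ends lie opposite each other as seen from the midpoint [g r], and neither lies to the
   right of the tangent at [r]. *)
have Tv : det2 (T r) v = 0.
  have h1 := closure_left r (@arc_closure s); have h2 := closure_left r (@arc_closure t).
  have e1 : g s - g r = - 2^-1 *: v.
    by rewrite xr; apply: pair_ext; rewrite /seg /v/= /GRing.scale/=; lra.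
  have e2 : g t - g r = 2^-1 *: v.
    by rewrite xr; apply: pair_ext; rewrite /seg /v/= /GRing.scale/=; lra.
  by move: h1 h2; rewrite e1 e2 !det2Zr; lra.
have [y Dy] := arc_ne SC.
have yr := dom_left r Dy.
have vv : 0 < dot2 v v.
  rewrite lt_neqAle addr_ge0 ?andbT -?expr2 ?sqr_ge0//.
  apply: contra v0 => /eqP/esym/eqP; rewrite /dot2 -!expr2 paddr_eq0 ?sqr_ge0// !sqrf_eq0.
  by move=> /andP[/eqP a /eqP b]; apply/eqP; exact: pair_ext.
pose p (x : R) := g x - g r.
(* [be x] and [al x] are the coordinates of [g x - g r] in the basis formed by [y - g r] and [v].
   Both vanish at [r], and [be] is positive at the other nearby points of the arc. *)
pose be (x : R) := det2 (T r) (p x) / det2 (T r) (y - g r).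
pose al (x : R) := dot2 (p x - be x *: (y - g r)) v / dot2 v v.
have cp : {for r, continuous p} by apply: cvgB; [exact: cg|exact: cvg_cst].
have cbe : {for r, continuous be}.
  by apply: cvgM; [apply: cont_det2; [exact: cvg_cst|exact: cp]|exact: cvg_cst].
have cal : {for r, continuous al}.
  have ch : {for r, continuous (fun x => p x - be x *: (y - g r))}.
    by apply: cvgB; [exact: cp|apply: cvgZl; exact: cbe].
  by apply: cvgM; [exact: (cont_dot2 ch (@cst_continuous _ _ v r))|exact: cvg_cst].
have p0 : p r = 0 by rewrite /p subrr.
have be0 : be r = 0 by rewrite /be p0 det2r0 mul0r.
have al0 : al r = 0 by rewrite /al p0 be0 scale0r subrr dot2C /dot2/= !mulr0 addr0 mul0r.
have n1 : \forall x \near r, be x < 2^-1.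
  by apply: near_lt => //; [exact: cvg_cst|rewrite be0; lra].
have n2 : \forall x \near r, al x < 4^-1.
  by apply: near_lt => //; [exact: cvg_cst|rewrite al0; lra].
have n3 : \forall x \near r, - 4^-1 < al x.
  by apply: near_lt => //; [exact: cvg_cst|rewrite al0; lra].
have [d1 d10 hd1] := local_left r.
have : \forall x \near r, be x < 2^-1 /\ al x < 4^-1 /\ - 4^-1 < al x.
  by apply: filterI => //; exact: filterI.
move=> /nbhs_ballP[d /= d0 hd].
have [h [h0 hh1 hh]] : exists h, [/\ 0 < h, h < d1 & h < d].
  exists (Num.min d d1 / 2).
  have : 0 < Num.min d d1 by rewrite lt_min d0.
  have : Num.min d d1 <= d by rewrite ge_min lexx.
  have : Num.min d d1 <= d1 by rewrite ge_min lexx orbT.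
  by split; lra.
have [b1 [a1 a2]] : be (r + h) < 2^-1 /\ al (r + h) < 4^-1 /\ - 4^-1 < al (r + h).
  by apply: hd; rewrite /ball/= opprD addrA subrr sub0r normrN gtr0_norm.
have pp : 0 < det2 (T r) (p (r + h)).
  by apply: hd1; rewrite addrAC subrr add0r gtr0_norm; lra.
have bpos : 0 < be (r + h) by rewrite /be divr_gt0.
set B := be (r + h) in b1 bpos; set A := al (r + h) in a1 a2.
have pe : p (r + h) - B *: (y - g r) = A *: v.
  apply/eqP; rewrite -subr_eq0; apply/eqP.
  apply: (@det2_inj _ (rot90 v) (T r)).
  - rewrite det2_rot90; apply/eqP => Tv'.
    have := dot2_det2 v v (T r); rewrite Tv T_unit (dot2C v (T r)) Tv' !mulr0 mulr1 addr0.
    by move=> vv'; rewrite vv' ltxx in vv.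
  - rewrite det2_rot90l dot2Br dot2Zr (dot2C v (_ - _)) /A /al mulfVK ?subrr ?oppr0// gt_eqF//.
  - rewrite det2Br det2Zr Tv mulr0 subr0 det2Br det2Zr /B /be mulfVK ?subrr// gt_eqF//.
apply: (@arc_notin (r + h)).
have B10 : 1 - B != 0 by rewrite gt_eqF//; lra.
have -> : g (r + h) = (1 - B) *: seg (2^-1 + A / (1 - B)) + B *: y.
  have -> : g (r + h) = g r + A *: v + B *: (y - g r).
    by rewrite -pe -addrA subrK /p addrC subrK.
  rewrite xr; apply: pair_ext; rewrite /seg /v/= /GRing.scale/=; field; exact: B10.
apply: dom_convex_closure => //; last by lra.
apply: cseg.
have B1 : 0 < 1 - B by lra.
have q1 : A / (1 - B) <= 2^-1 by rewrite ler_pdivrMr//; lra.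
have q2 : - 2^-1 <= A / (1 - B) by rewrite ler_pdivlMr//; lra.
lra.
Qed.

Lemma arc_neq s t : s < t -> t < s + l -> g t <> g s.
Proof.
move=> st tl /(arc_inj SC)[k tk]; have l0 := len_gt0.
have k0 : (0 : R) < k%:~R by rewrite -(pmulr_lgt0 _ l0); lra.
have k1 : (k%:~R : R) < 1 by rewrite -(ltr_pM2r l0) mul1r; lra.
by move: k0 k1; rewrite ltr0z ltrz1 /= ; case: k tk => [[|n]|n].
Qed.

End ArcGeometry.

(** * Chord lengths and the angles of chords *)

Section Chords.
Context {R : realType} (D : set (R * R)) (l : R) (g T g2 g3 g4 : R -> R * R).
Context (SC : convex_arc D l g T g2 g3 g4).
Implicit Types (s t c : R) (p u v w : R * R).

Lemma det2_swap u v w : det2 (u - v) w = det2 w (v - u).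
Proof. by rewrite /det2 /=; ring. Qed.

Definition norm2 u := Num.sqrt (dot2 u u).

Lemma dot2_ge0 u : 0 <= dot2 u u.
Proof. by rewrite /dot2 -!expr2 addr_ge0// sqr_ge0. Qed.

Lemma dot2_gt0 u : u != 0 -> 0 < dot2 u u.
Proof.
move=> u0; rewrite lt_neqAle dot2_ge0 andbT; apply: contra u0 => /eqP/esym/eqP.
rewrite /dot2 -!expr2 paddr_eq0 ?sqr_ge0// !sqrf_eq0.
by move=> /andP[/eqP a /eqP b]; apply/eqP; exact: pair_ext.
Qed.

Lemma norm2_gt0 u : u != 0 -> 0 < norm2 u.
Proof. by move=> u0; rewrite sqrtr_gt0 dot2_gt0. Qed.

Lemma norm2_sqr u : norm2 u ^+ 2 = dot2 u u.
Proof. by rewrite sqr_sqrtr// dot2_ge0. Qed.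

Lemma norm2N u : norm2 (- u) = norm2 u.
Proof. by rewrite /norm2 /dot2 /= !mulrNN. Qed.

Lemma is_derive_norm2 (f : R -> R * R) t df : is_derive t 1 f df -> f t != 0 ->
  is_derive t 1 (fun x => norm2 (f x)) (dot2 df (f t) / norm2 (f t)).
Proof.
move=> df0 f0.
have d1 := is_derive_dot2 df0 df0.
have d2 := is_derive1_sqrt (dot2_gt0 f0).
apply: (is_derive_eq (@is_derive1_comp R Num.sqrt (fun x => dot2 (f x) (f x)) t _ _ d2 d1)).
rewrite /GRing.scale/= (dot2C (f t)) -mulr2n -/(norm2 _).
have := norm2_gt0 f0; move: (norm2 _) => n n0; rewrite -mulr_natl; field; exact: lt0r_neq0.
Qed.

(** By [dot2_det2] the derivative of the cosine of the angle with [u] factors into two determinants;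
    for chords their signs are known, which gives [cos_out_decr] and [cos_in_incr]. *)
Lemma is_derive_cosine (f : R -> R * R) u t df : is_derive t 1 f df -> f t != 0 ->
  is_derive t 1 (fun x => dot2 u (f x) / norm2 (f x))
    (det2 (f t) u * det2 (f t) df / norm2 (f t) ^+ 3).
Proof.
move=> d0 f0; have n0 := norm2_gt0 f0.
have d1 := is_derive_dot2r u d0; have d2 := is_derive_norm2 d0 f0.
have d3 := @is_deriveV R (fun x => norm2 (f x)) t _ 1 (lt0r_neq0 n0) d2.
apply: (is_derive_eq (is_deriveM d1 d3)).
have h := dot2_det2 u df (f t); rewrite -norm2_sqr in h.
rewrite /GRing.scale/=; move: n0 h; move: (norm2 _) => n n0 h.
have -> : det2 (f t) u * det2 (f t) df = dot2 u df * n ^+ 2 - dot2 u (f t) * dot2 df (f t).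
  by rewrite h; ring.
by field; exact: lt0r_neq0.
Qed.

(** Chord length, and the cosines of the angles of the chord with the tangents where it leaves and
    where it arrives. [- cos_out] and [cos_in] are the partial derivatives of [clen] in [s] and
    [t]. *)
Definition clen s t := norm2 (g t - g s).
Definition cos_out s t := dot2 (T s) (g t - g s) / clen s t.
Definition cos_in s t := dot2 (T t) (g t - g s) / clen s t.

Lemma chord_neq0 s t : s < t < s + l -> g t - g s != 0.
Proof. by move=> /andP[st ts]; rewrite subr_eq0; apply/eqP; exact: (arc_neq SC). Qed.

Lemma clen_gt0 s t : s < t < s + l -> 0 < clen s t.
Proof. by move=> h; apply: norm2_gt0; exact: chord_neq0. Qed.

Lemma chord_detA s t : s < t < s + l -> 0 < det2 (T s) (g t - g s).
Proof. by move=> /chord_neq0 h; apply: (chord_left SC); apply/eqP; rewrite -subr_eq0. Qed.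

Lemma chord_detB s t : s < t < s + l -> 0 < det2 (T t) (g s - g t).
Proof.
move=> /chord_neq0 h; apply: (chord_left SC); apply/eqP; rewrite eq_sym.
by rewrite -subr_eq0.
Qed.

Lemma clen_d2 s t : s < t < s + l -> is_derive t 1 (fun x => clen s x) (cos_in s t).
Proof.
move=> h; apply: (@is_derive_norm2 (fun x => g x - g s)); last exact: chord_neq0.
by apply: is_derive_subr; exact: dT SC _.
Qed.

Lemma clen_sym s t : clen s t = norm2 (g s - g t).
Proof. by rewrite /clen -norm2N opprB. Qed.

Lemma clen_d1 s t : s < t < s + l -> is_derive s 1 (fun x => clen x t) (- cos_out s t).
Proof.
move=> h; under eq_fun do rewrite clen_sym.
have n0 : g s - g t != 0 by rewrite -opprB oppr_eq0; exact: chord_neq0.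
apply: (is_derive_eq (@is_derive_norm2 (fun x => g x - g t) s (T s) _ n0)).
  by apply: is_derive_subr; exact: dT SC _.
by rewrite /cos_out clen_sym -mulNr; congr (_ / _); rewrite !dot2Br; ring.
Qed.

Lemma cos_out_decr s t1 t2 : s < t1 -> t1 < t2 -> t2 < s + l -> cos_out s t2 < cos_out s t1.
Proof.
move=> h1 h12 h2; rewrite -ltrN2.
pose df x := - (det2 (g x - g s) (T s) * det2 (g x - g s) (T x) / norm2 (g x - g s) ^+ 3).
apply: (@is_derive_ltr _ (fun x => - cos_out s x) df) => // x xb.
  have xs : s < x < s + l by lra.
  apply: is_deriveN; apply: (@is_derive_cosine (fun y => g y - g s)).
    by apply: is_derive_subr; exact: dT SC _.
  exact: chord_neq0.
have xs : s < x < s + l by lra.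
have a := chord_detA xs; have b := chord_detB xs.
have n0 := clen_gt0 xs.
rewrite /df -mulNr divr_gt0 ?exprn_gt0// -mulNr mulr_gt0//.
  by rewrite -det2C.
by rewrite det2_swap.
Qed.

Lemma cos_in_incr s1 s2 t : t - l < s1 -> s1 < s2 -> s2 < t -> cos_in s1 t < cos_in s2 t.
Proof.
move=> h1 h12 h2.
pose df x := - (det2 (g x - g t) (T t) * det2 (g x - g t) (T x) / norm2 (g x - g t) ^+ 3).
have cE x : cos_in x t = - (dot2 (T t) (g x - g t) / norm2 (g x - g t)).
  by rewrite /cos_in clen_sym -mulNr; congr (_ / _); rewrite !dot2Br; ring.
rewrite !cE.
apply: (@is_derive_ltr _ (fun x => - (dot2 (T t) (g x - g t) / norm2 (g x - g t))) df) => // x xb.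
  have xs : x < t < x + l by lra.
  apply: is_deriveN; apply: (@is_derive_cosine (fun y => g y - g t)).
    by apply: is_derive_subr; exact: dT SC _.
  by rewrite -opprB oppr_eq0; exact: chord_neq0.
have xs : x < t < x + l by lra.
have a := chord_detA xs; have b := chord_detB xs.
have n0 : 0 < norm2 (g x - g t) by rewrite -clen_sym; exact: clen_gt0.
rewrite /df -mulNr divr_gt0 ?exprn_gt0// -mulNr mulr_gt0//.
  by rewrite -det2C.
by rewrite det2_swap.
Qed.

Lemma unit_decomp u w : dot2 u u = 1 -> dot2 w w = dot2 u w ^+ 2 + det2 u w ^+ 2.
Proof. by move=> h; have := dot2_det2 w w u; rewrite h mulr1 (dot2C w u) !expr2. Qed.

Lemma cos_out_bound s t : s < t < s + l -> -1 < cos_out s t < 1.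
Proof.
move=> h; have n0 := clen_gt0 h; have d0 := chord_detA h.
have e := unit_decomp (g t - g s) (T_unit SC s).
rewrite -norm2_sqr -/(clen s t) in e.
have : cos_out s t ^+ 2 < 1.
  rewrite expr_div_n ltr_pdivrMr ?exprn_gt0// mul1r e ltrDl exprn_gt0//.
rewrite -[X in _ < X](expr1n _ 2) -[cos_out s t ^+ 2]real_normK ?num_real//.
rewrite ltr_pXn2r ?nnegrE// ltr_norml; exact.
Qed.

(** [f x = 0] says that the chord has the direction of cosine [c] pointing inward, or the opposite
    one, which [chord_detA] rules out. [f] vanishes at both ends of the period and decreases near
    them, so it is negative after [s] and positive before [s + l]. *)
Lemma cos_out_surj s c : -1 < c < 1 -> exists t, s < t < s + l /\ cos_out s t = c.
Proof.
move=> c1; have l0 := len_gt0 SC.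
pose q := Num.sqrt (1 - c ^+ 2).
have q20 : 0 < 1 - c ^+ 2 by nra.
have q0 : 0 < q by rewrite sqrtr_gt0.
have qq : q ^+ 2 = 1 - c ^+ 2 by rewrite sqr_sqrtr// ltW.
pose f x := c * det2 (T s) (g x - g s) - q * dot2 (T s) (g x - g s).
pose df x := c * det2 (T s) (T x) - q * dot2 (T s) (T x).
have fd (x : R) : is_derive x 1 f (df x).
  have h1 := is_derive_det2r (T s) (is_derive_subr (g s) (dT SC x)).
  have h2 := is_derive_dot2r (T s) (is_derive_subr (g s) (dT SC x)).
  exact: is_deriveB (is_deriveZ c h1) (is_deriveZ q h2).
have cdf : {for s, continuous df}.
  apply: cvgB; apply: cvgM; try exact: cvg_cst.
    by apply: (@cont_det2 _ _ (fun=> T s) T); [exact: cvg_cst|exact: cT SC _].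
  by apply: (@cont_dot2 _ _ (fun=> T s) T); [exact: cvg_cst|exact: cT SC _].
have df0 : df s < 0 by rewrite /df det2xx (T_unit SC) mulr0 mulr1; lra.
have dfp x : df (x + l) = df x by rewrite /df (arc_T_per SC).
have := near_lt cdf (@cst_continuous _ _ 0 s) df0.
move=> /nbhs_ballP[d /= d0 hd].
have [h [h0 hd' hl]] : exists h, [/\ 0 < h, h < d & h < l / 2].
  exists (Num.min d (l / 2) / 2).
  have : 0 < Num.min d (l / 2) by rewrite lt_min d0; lra.
  have : Num.min d (l / 2) <= d by rewrite ge_min lexx.
  have : Num.min d (l / 2) <= l / 2 by rewrite ge_min lexx orbT.
  by split; lra.
have fs : f s = 0 by rewrite /f subrr det2r0 dot2C /dot2 /= !mul0r !addr0 !mulr0 subrr.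
have fsl : f (s + l) = 0 by rewrite -fs /f (arc_per SC).
have f1 : f (s + h) < 0.
  have sh : s < s + h by lra.
  have [x [xb e]] := MVTd sh (fun x _ => fd x).
  have dx : df x < 0 by apply: hd; rewrite /ball/= ltr_norml; lra.
  by have : df x * (s + h - s) < 0 by [rewrite pmulr_llt0; lra]; rewrite -e fs; lra.
have f2 : 0 < f (s + l - h).
  have sh : s + l - h < s + l by lra.
  have [x [xb e]] := MVTd sh (fun x _ => fd x).
  have dx : df x < 0.
    by rewrite -(subrK l x) dfp; apply: hd; rewrite /ball/= ltr_norml; lra.
  by have : df x * (s + l - (s + l - h)) < 0 by [rewrite pmulr_llt0; lra]; rewrite -e fsl; lra.
have [|x _||t [tb ft]] := @IVTc _ f (s + h) (s + l - h) 0.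
- by lra.
- exact: is_derive_continuous (fd x).
- by rewrite !ltW.
have ts : s < t < s + l by lra.
exists t; split => //.
have dp := chord_detA ts; have np := clen_gt0 ts.
have e := unit_decomp (g t - g s) (T_unit SC s).
rewrite -norm2_sqr -/(clen s t) in e.
move: ft; rewrite /f => ft.
have de : dot2 (T s) (g t - g s) = c * (det2 (T s) (g t - g s) / q).
  have qd : q * dot2 (T s) (g t - g s) = c * det2 (T s) (g t - g s) by lra.
  have qn : q != 0 by rewrite gt_eqF.
  by rewrite mulrA -qd mulrAC divff// mul1r.
have ne : clen s t = det2 (T s) (g t - g s) / q.
  apply/eqP; rewrite -(@eqrXn2 _ 2) ?ltW// ?divr_gt0// e de.
  rewrite !expr_div_n exprMn expr_div_n qq; apply/eqP.
  by field; rewrite gt_eqF.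
by rewrite /cos_out de ne mulfK// gt_eqF// divr_gt0.
Qed.

Lemma cos_out_per s t : cos_out (s + l) (t + l) = cos_out s t.
Proof. by rewrite /cos_out /clen !(arc_per SC) (arc_T_per SC). Qed.

Lemma cont_norm2 (X : topologicalType) (f : X -> R * R) (p : X) :
  {for p, continuous f} -> {for p, continuous (fun q => norm2 (f q))}.
Proof.
move=> cf; apply: (@continuous_comp _ _ _ (fun q => dot2 (f q) (f q)) Num.sqrt).
  exact: cont_dot2.
exact: sqrt_continuous.
Qed.

Lemma cont_cos_out (X : topologicalType) (f h : X -> R) (p : X) :
  {for p, continuous f} -> {for p, continuous h} -> f p < h p < f p + l ->
  {for p, continuous (fun q => cos_out (f q) (h q))}.
Proof.
move=> cf ch b.
have cgf : {for p, continuous (g \o f)} by apply: continuous_comp => //; exact: cg SC _.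
have cgh : {for p, continuous (g \o h)} by apply: continuous_comp => //; exact: cg SC _.
have cTf : {for p, continuous (T \o f)} by apply: continuous_comp => //; exact: cT SC _.
have cch : {for p, continuous (fun q => g (h q) - g (f q))} by apply: cvgB.
apply: cvgM; first exact: (cont_dot2 cTf cch).
by apply: cvgV; [rewrite gt_eqF// clen_gt0|exact: (cont_norm2 cch)].
Qed.

Lemma cont_cos_in (X : topologicalType) (f h : X -> R) (p : X) :
  {for p, continuous f} -> {for p, continuous h} -> f p < h p < f p + l ->
  {for p, continuous (fun q => cos_in (f q) (h q))}.
Proof.
move=> cf ch b.
have cgf : {for p, continuous (g \o f)} by apply: continuous_comp => //; exact: cg SC _.
have cgh : {for p, continuous (g \o h)} by apply: continuous_comp => //; exact: cg SC _.
have cTh : {for p, continuous (T \o h)} by apply: continuous_comp => //; exact: cT SC _.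
have cch : {for p, continuous (fun q => g (h q) - g (f q))} by apply: cvgB.
apply: cvgM; first exact: (cont_dot2 cTh cch).
by apply: cvgV; [rewrite gt_eqF// clen_gt0|exact: (cont_norm2 cch)].
Qed.

End Chords.

Section Aux.
Context {R : realType}.
Implicit Types (a b x y : R).

(** The maximum over [[a, b]] can only be attained at [a], since at every other point larger values
    are found just to the left. *)
Lemma locally_decr (f : R -> R) a b : a < b ->
  (forall x, a <= x <= b -> {for x, continuous f}) ->
  (forall x, a < x <= b -> exists2 e, 0 < e & forall y, x - e < y < x -> f x < f y) ->
  f b < f a.
Proof.
move=> ab cf loc.
have [c [cab cmax]] := EVT_maxc (ltW ab) cf.
have ca : c = a.
  apply/eqP; rewrite eq_le; apply/andP; split; last by lra.
  rewrite leNgt; apply/negP => ac.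
  have [|e e0 he] := loc c; first by lra.
  pose y := Num.max a (c - e / 2).
  have [ya ye] : a <= y /\ c - e / 2 <= y by split; rewrite /y le_max lexx ?orbT.
  have yc : y < c by rewrite /y gt_max; lra.
  have h1 := he y ltac:(lra); have h2 := cmax y ltac:(lra); lra.
have [e e0 he] := loc b ltac:(lra).
pose y := Num.max a (b - e / 2).
have [ya ye] : a <= y /\ b - e / 2 <= y by split; rewrite /y le_max lexx ?orbT.
have yc : y < b by rewrite /y gt_max; lra.
have h1 := he y ltac:(lra); have h2 := cmax y ltac:(lra); rewrite ca in h2; lra.
Qed.

Lemma is_derive0_const (f : R -> R) : (forall x, is_derive x 1 f 0) -> forall x y, f x = f y.
Proof.
move=> d x y; wlog xy : x y / x < y.
  move=> H; have [/H//|/H//|->//] := ltgtP x y.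
have [c [_]] := MVTd xy (fun z _ => d z).
by rewrite mul0r => /eqP; rewrite subr_eq0 => /eqP.
Qed.

Lemma exists_shift (l s : R) : 0 < l -> exists n : nat, 0 < s + n%:R * l.
Proof.
move=> l0; exists (Num.bound `|s / l|).
have h := archi_boundP (normr_ge0 (s / l)).
have : - s <= `|s / l| * l by rewrite -{2}(gtr0_norm l0) -normrM mulfVK ?gt_eqF// ler_normr lexx orbT.
have : `|s / l| * l < (Num.bound `|s / l|)%:R * l by rewrite ltr_pM2r.
lra.
Qed.

Lemma cont_pair (X Y Z : topologicalType) (f : X -> Y) (h : X -> Z) (p : X) :
  {for p, continuous f} -> {for p, continuous h} -> {for p, continuous (fun q => (f q, h q))}.
Proof. by move=> cf ch; exact: (cvg_pair cf ch). Qed.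

Lemma cont_cst (X Y : topologicalType) (k : Y) (p : X) : {for p, continuous (fun=> k)}.
Proof. exact: cvg_cst. Qed.

Lemma cont_id (X : topologicalType) (p : X) : {for p, continuous (fun q => q)}.
Proof. exact: cvg_id. Qed.

Lemma cont2_comp (X : topologicalType) (f : R -> R -> R) (u v : X -> R) (p : X) :
  {for p, continuous u} -> {for p, continuous v} ->
  {for (u p, v p), continuous (fun q : R * R => f q.1 q.2)} ->
  {for p, continuous (fun q => f (u q) (v q))}.
Proof.
move=> cu cv cf.
exact: (@continuous_comp _ _ _ (fun q => (u q, v q)) (fun q : R * R => f q.1 q.2) p (cont_pair cu cv) cf).
Qed.

Lemma cont_fst (p : R * R) : {for p, continuous (fun q : R * R => q.1)}.
Proof. exact: cvg_fst. Qed.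

Lemma cont_snd (p : R * R) : {for p, continuous (fun q : R * R => q.2)}.
Proof. exact: cvg_snd. Qed.

End Aux.

(** * Families of invariant directions *)

(* [c s J] is the cosine of the angle at [s] on the invariant curve with label [J]. *)
Record invariant_family {R : realType} (l : R) (g T : R -> R * R) (J0 : R)
    (c : R -> R -> R) : Prop := InvariantFamily {
  fam_J0 : 0 < J0;
  fam_bound : forall s J, 0 < J < J0 -> -1 < c s J < 1;
  fam_per : forall s J, 0 < J < J0 -> c (s + l) J = c s J;
  fam_cont : forall J, 0 < J < J0 -> continuous (c^~ J);
  fam_unif : forall e, 0 < e -> exists2 J1, 0 < J1 < J0 &
    forall s J, 0 < J <= J1 -> 1 - e < c s J;
  fam_inv : forall s t J, 0 < J < J0 -> s < t < s + l ->
    cos_out g T s t = c s J -> cos_in g T s t = c t J;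
  fam_lip : forall J, 0 < J < J0 -> exists k0 k1 eta, [/\ 0 < k0, 0 < eta &
    forall J1 J2 s, `|J1 - J| < eta -> `|J2 - J| < eta -> J1 < J2 ->
      k0 * (J2 - J1) <= c s J1 - c s J2 <= k1 * (J2 - J1)];
  fam_diff : forall J, 0 < J < J0 -> exists (Z : set R) (w : R -> R), countable Z /\
    forall s, ~ Z s -> forall e, 0 < e -> exists2 eta, 0 < eta &
      forall J1 J2, `|J1 - J| < eta -> `|J2 - J| < eta -> J1 < J2 ->
        `|(c s J1 - c s J2) / (J2 - J1) - w s| < e }.

(** * The next impact along an invariant curve *)

Section Family.
Context {R : realType} (D : set (R * R)) (l : R) (g T g2 g3 g4 : R -> R * R).
Context (SC : convex_arc D l g T g2 g3 g4).
Context (J0 : R) (c : R -> R -> R) (F : invariant_family l g T J0 c).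
Implicit Types (s t J e : R).
Local Notation cos_out := (cos_out g T).
Local Notation cos_in := (cos_in g T).
Local Notation clen := (clen g).

Let l0 : 0 < l := len_gt0 SC.

Lemma fam_lip' J : 0 < J < J0 -> exists k0 k1 eta, [/\ 0 < k0, 0 < k1, 0 < eta, 
    (forall J1, `|J1 - J| < eta -> 0 < J1 < J0) &
    forall J1 J2 s, `|J1 - J| < eta -> `|J2 - J| < eta -> J1 < J2 ->
      k0 * (J2 - J1) <= c s J1 - c s J2 <= k1 * (J2 - J1)].
Proof.
move=> Jb; have [k0 [k1 [eta [k00 eta0 H]]]] := fam_lip F Jb.
have [eta' [e0 e1 e2 e3]] : exists eta', [/\ 0 < eta', eta' <= eta, eta' <= J & eta' <= J0 - J].
  exists (Num.min eta (Num.min J (J0 - J))); split.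
  - by rewrite !lt_min eta0; lra.
  - by rewrite ge_min lexx.
  - by rewrite !ge_min lexx orbT.
  - by rewrite !ge_min lexx !orbT.
exists k0, k1, eta'; split => //.
- have := H J (J + eta' / 2) 0; rewrite subrr normr0 addrAC subrr add0r gtr0_norm; last by lra.
  move=> /(_ ltac:(lra) ltac:(lra) ltac:(lra)) /andP[h1 h2].
  have : 0 < k0 * (eta' / 2) by rewrite mulr_gt0//; lra.
  move=> h3; have : 0 < k1 * (eta' / 2) by lra.
  by rewrite pmulr_lgt0//; lra.
- by move=> J1; rewrite ltr_norml; lra.
- by move=> J1 J2 s h1 h2; apply: H; [apply: lt_le_trans h1 _|apply: lt_le_trans h2 _].
Qed.

(** The Lipschitz bound in the label is uniform in [s], so continuity in [s] is used for the single
    label [J] only. *)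
Lemma fam_cont2 s J : 0 < J < J0 -> {for (s, J), continuous (fun p : R * R => c p.1 p.2)}.
Proof.
move=> Jb; have [k0 [k1 [eta [k00 k10 eta0 Hb H]]]] := fam_lip' Jb.
have lip s' J' : `|J' - J| < eta -> `|c s' J' - c s' J| <= k1 * `|J' - J|.
  move=> h; have [JJ|JJ|->] := ltgtP J' J; last by rewrite !subrr normr0 mulr0.
    have := H J' J s' h; rewrite subrr normr0 => /(_ eta0 JJ) /andP[h1 h2].
    have p : 0 < k0 * (J - J') by rewrite mulr_gt0//; lra.
    by rewrite ger0_norm; [rewrite ltr0_norm; lra|lra].
  have := H J J' s'; rewrite subrr normr0 => /(_ eta0 h JJ) /andP[h1 h2].
  have p : 0 < k0 * (J' - J) by rewrite mulr_gt0//; lra.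
  by rewrite ler0_norm; [rewrite gtr0_norm; lra|lra].
apply/cont_eps => e e0.
have cc : {for s, continuous (c^~ J)} by exact: (fam_cont F Jb).
have [d d0 hd] := (cont_eps _ _).1 cc (e / 2) ltac:(lra).
have [m [m0 m1 m2 m3]] : exists m, [/\ 0 < m, m <= d, m <= eta & k1 * m <= e / 2].
  exists (Num.min d (Num.min eta (e / 2 / k1))); split.
  - by rewrite !lt_min d0 eta0 divr_gt0//; lra.
  - by rewrite ge_min lexx.
  - by rewrite !ge_min lexx orbT.
  - by rewrite mulrC -ler_pdivlMr// !ge_min lexx !orbT.
exists m => // -[s' J'] [/= b1 b2]; rewrite /ball/= in b1 b2.
have h1 := lip s' J' ltac:(by rewrite distrC; lra).
have h2 := hd s' ltac:(by rewrite /ball/=; lra).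
have h3 : k1 * `|J' - J| <= k1 * m by rewrite ler_pM2l// distrC ltW.
have -> : c s' J' - c s J = (c s' J' - c s' J) + (c s' J - c s J) by ring.
by apply: le_lt_trans (ler_normD _ _) _; lra.
Qed.

Lemma fam_decr s J1 J2 : 0 < J1 -> J1 < J2 -> J2 < J0 -> c s J2 < c s J1.
Proof.
move=> h1 h12 h2; apply: locally_decr => // x xb.
  have xJ : 0 < x < J0 by lra.
  have cc := @fam_cont2 s _ xJ.
  apply: (@continuous_comp _ _ _ (fun J => (s, J)) (fun p : R * R => c p.1 p.2)) => //.
  exact: (cont_pair (@cont_cst _ _ _ _) (@cont_id _ _)).
have xJ : 0 < x < J0 by lra.
have [k0 [k1 [eta [k00 k10 eta0 Hb H]]]] := fam_lip' xJ.
exists eta => // y yx; have := H y x s.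
rewrite subrr normr0 => /(_ ltac:(rewrite ltr_norml; lra) eta0 ltac:(lra)) /andP[h _].
have p : 0 < k0 * (x - y) by rewrite mulr_gt0//; lra.
lra.
Qed.

(** A lift to [R] of the circle map induced on the invariant curve [J]. For labels of the family
    [nextptP] shows that the default of [xget] does not occur. *)
Definition nextpt s J := xget s [set t | s < t < s + l /\ cos_out s t = c s J].

Lemma nextptP s J : 0 < J < J0 -> s < nextpt s J < s + l /\ cos_out s (nextpt s J) = c s J.
Proof.
move=> Jb; rewrite /nextpt; case: xgetP => [t _ //|].
have [t ht] := cos_out_surj SC s (fam_bound F s Jb).
by move=> /(_ t); case.
Qed.

Lemma cos_out_inj s t1 t2 : s < t1 < s + l -> s < t2 < s + l -> cos_out s t1 = cos_out s t2 -> t1 = t2.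
Proof.
move=> /andP[a1 b1] /andP[a2 b2] e.
have [h|h|//] := ltgtP t1 t2.
  by have := cos_out_decr SC a1 h b2; rewrite e ltxx.
by have := cos_out_decr SC a2 h b1; rewrite e ltxx.
Qed.

Lemma cos_in_inj s1 s2 t : t - l < s1 < t -> t - l < s2 < t -> cos_in s1 t = cos_in s2 t -> s1 = s2.
Proof.
move=> /andP[a1 b1] /andP[a2 b2] e.
have [h|h|//] := ltgtP s1 s2.
  by have := cos_in_incr SC a1 h b2; rewrite e ltxx.
by have := cos_in_incr SC a2 h b1; rewrite e ltxx.
Qed.

Lemma nextpt_uniq s t J : 0 < J < J0 -> s < t < s + l -> cos_out s t = c s J -> nextpt s J = t.
Proof.
move=> Jb tb e; have [h1 h2] := nextptP s Jb.
by apply: (cos_out_inj h1 tb); rewrite h2 e.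
Qed.

Lemma nextpt_cos_in s J : 0 < J < J0 -> cos_in s (nextpt s J) = c (nextpt s J) J.
Proof. by move=> Jb; have [h1 h2] := nextptP s Jb; exact: (fam_inv F Jb h1 h2). Qed.

Lemma nextpt_per s J : 0 < J < J0 -> nextpt (s + l) J = nextpt s J + l.
Proof.
move=> Jb; have [h1 h2] := nextptP s Jb; apply: nextpt_uniq => //; first by lra.
by rewrite (cos_out_per SC) h2 (fam_per F).
Qed.

Lemma nextpt_lt s t J : 0 < J < J0 -> s < t < s + l -> c s J < cos_out s t -> t < nextpt s J.
Proof.
move=> Jb tb h; have [h1 h2] := nextptP s Jb.
rewrite ltNge le_eqVlt; apply/negP => /predU1P[e|lt].
  by move: h; rewrite -h2 e ltxx.
have := @cos_out_decr _ _ _ _ _ _ _ _ SC s (nextpt s J) t ltac:(lra) lt ltac:(lra); lra.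
Qed.

Lemma nextpt_gt s t J : 0 < J < J0 -> s < t < s + l -> cos_out s t < c s J -> nextpt s J < t.
Proof.
move=> Jb tb h; have [h1 h2] := nextptP s Jb.
rewrite ltNge le_eqVlt; apply/negP => /predU1P[e|lt].
  by move: h; rewrite -h2 e ltxx.
have := @cos_out_decr _ _ _ _ _ _ _ _ SC s t (nextpt s J) ltac:(lra) lt ltac:(lra); lra.
Qed.

Lemma nextpt_incrJ s J1 J2 : 0 < J1 -> J1 < J2 -> J2 < J0 -> nextpt s J1 < nextpt s J2.
Proof.
move=> h1 h12 h2; have J1b : 0 < J1 < J0 by lra.
have J2b : 0 < J2 < J0 by lra.
have [a b] := nextptP s J1b.
by apply: nextpt_lt => //; rewrite b; exact: fam_decr.
Qed.

Lemma nextpt_cont s J : 0 < J < J0 -> {for (s, J), continuous (fun p : R * R => nextpt p.1 p.2)}.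
Proof.
move=> Jb; have [a b] := nextptP s Jb.
have nJ : \forall p \near (s, J), 0 < p.2 < J0.
  have c2 : {for (s, J), continuous (snd : R * R -> R)} by exact: cvg_snd.
  have n1 := near_lt (@cst_continuous _ _ 0 (s, J)) c2 ltac:(by case/andP: Jb).
  have n2 := near_lt c2 (@cst_continuous _ _ J0 (s, J)) ltac:(by case/andP: Jb).
  by apply: (filterS _ (filterI n1 n2)) => p [/= -> ->].
have c1 : {for (s, J), continuous (fst : R * R -> R)} by exact: cvg_fst.
have cl1 : {for (s, J), continuous (fun p : R * R => p.1 + l)} by apply: cvgD; [exact: c1|exact: cvg_cst].
have nb z : s < z < s + l -> \forall p \near (s, J), p.1 < z < p.1 + l.
  move=> zb.
  have n1 := near_lt c1 (@cst_continuous _ _ z (s, J)) ltac:(by case/andP: zb).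
  have n2 := near_lt (@cst_continuous _ _ z (s, J)) cl1 ltac:(by case/andP: zb).
  by apply: (filterS _ (filterI n1 n2)) => p [/= -> ->].
have [d [d0 d1 d2]] : exists d, [/\ 0 < d, d <= nextpt s J - s & d <= s + l - nextpt s J].
  exists (Num.min (nextpt s J - s) (s + l - nextpt s J)); split.
  - by rewrite lt_min; lra.
  - by rewrite ge_min lexx.
  - by rewrite ge_min lexx orbT.
apply: (cvg_sandwich d0) => z zb.
  have zs : s < z < s + l by lra.
  have cA : {for (s, J), continuous (fun p : R * R => cos_out p.1 z)}.
    by apply: (cont_cos_out SC (f := fst) (h := fun=> z)) => //; exact: cvg_cst.
  have h : c s J < cos_out s z by rewrite -b; apply: (cos_out_decr SC); lra.
  have n := near_lt (@fam_cont2 s _ Jb) cA h.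
  apply: (filterS _ (filterI n (filterI nJ (nb z zs)))) => p [p1 [p2 p3]].
  exact: nextpt_lt.
have zs : s < z < s + l by lra.
have cA : {for (s, J), continuous (fun p : R * R => cos_out p.1 z)}.
  by apply: (cont_cos_out SC (f := fst) (h := fun=> z)) => //; exact: cvg_cst.
have h : cos_out s z < c s J by rewrite -b; apply: (cos_out_decr SC); lra.
have n := near_lt cA (@fam_cont2 s _ Jb) h.
apply: (filterS _ (filterI n (filterI nJ (nb z zs)))) => p [p1 [p2 p3]].
exact: nextpt_gt.
Qed.

Lemma nextpt_conts s J : 0 < J < J0 -> {for s, continuous (nextpt^~ J)}.
Proof.
move=> Jb.
apply: (@continuous_comp _ _ _ (fun s => (s, J)) (fun p : R * R => nextpt p.1 p.2)).
  exact: (cont_pair (@cont_id _ _) (@cont_cst _ _ _ _)).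
exact: nextpt_cont.
Qed.

(** Reversibility: the family prescribes the arrival angle at the common image, and this angle
    determines where the chord came from. *)
Lemma nextpt_inj s1 s2 J : 0 < J < J0 -> nextpt s1 J = nextpt s2 J -> s1 = s2.
Proof.
move=> Jb e; have [a1 b1] := nextptP s1 Jb; have [a2 b2] := nextptP s2 Jb.
have e1 := nextpt_cos_in s1 Jb; have e2 := nextpt_cos_in s2 Jb.
apply: (@cos_in_inj s1 s2 (nextpt s1 J)); [lra|rewrite e; lra|].
by rewrite e1 e e2.
Qed.

Lemma nextpt_pern s J (n : nat) : 0 < J < J0 -> nextpt (s + n%:R * l) J = nextpt s J + n%:R * l.
Proof.
move=> Jb; elim: n => [|n IH]; first by rewrite mul0r !addr0.
by rewrite -natr1 mulrDl mul1r addrA nextpt_per// IH addrA.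
Qed.

(** A continuous injective lift that commutes with the shift by [l] must increase: otherwise its
    value at [s] would be taken again between [t] and a translate of [s] beyond [t]. *)
Lemma nextpt_incr s t J : 0 < J < J0 -> s < t -> nextpt s J < nextpt t J.
Proof.
move=> Jb st; rewrite ltNge; apply/negP => le.
have [n] := exists_shift (s - t) l0; rewrite -addrA addrC => h.
have sn : t <= s + n%:R * l by lra.
have en := nextpt_pern s n Jb.
have nl : 0 <= n%:R * l by rewrite mulr_ge0// ltW.
have [x _||x [xb e]] := @IVTc _ (nextpt^~ J) _ _ (nextpt s J) sn.
- exact: nextpt_conts.
- by apply/andP; split; [exact: le|rewrite en; lra].
have := nextpt_inj Jb e; lra.
Qed.

Lemma nextpt_surj t J : 0 < J < J0 -> exists s, nextpt s J = t.
Proof.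
move=> Jb.
have [a1 _] := nextptP (t - l) Jb; have [a2 _] := nextptP t Jb.
have [|||x [xb e]] := @IVTc _ (nextpt^~ J) (t - l) t t.
- by lra.
- by move=> x _; exact: nextpt_conts.
- by lra.
by exists x.
Qed.

End Family.

(** * The generating function along an invariant curve *)

Section Flux.
Context {R : realType} (D : set (R * R)) (l : R) (g T g2 g3 g4 : R -> R * R).
Context (SC : convex_arc D l g T g2 g3 g4).
Context (J0 : R) (c : R -> R -> R) (F : invariant_family l g T J0 c).
Implicit Types (s t x y J e : R).
Local Notation cos_out := (cos_out g T).
Local Notation cos_in := (cos_in g T).
Local Notation clen := (clen g).
Local Notation nextpt := (nextpt l g T c).

Let l0 : 0 < l := len_gt0 SC.

Definition area J : R -> R := xget (fun=> 0) [set A | forall x, is_derive x 1 A (c x J)].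

Lemma area_d J x : 0 < J < J0 -> is_derive x 1 (area J) (c x J).
Proof.
move=> Jb; rewrite /area; case: xgetP => [A _ /(_ x) //|].
have [A hA] := antiderivative (fam_cont F Jb).
by move=> /(_ A).
Qed.

Lemma area_per J s : 0 < J < J0 -> area J (s + l) - area J s = area J l - area J 0.
Proof.
move=> Jb; rewrite -[in RHS](add0r l).
apply: (@is_derive0_const _ (fun x => area J (x + l) - area J x)) => x.
have d1 := area_d (x + l) Jb; rewrite (fam_per F) // in d1.
have d2 : is_derive x 1 (fun y : R => y + l) 1 by apply: is_derive_eq; rewrite addr0.
have d3 := @is_derive1_comp R (area J) (fun y => y + l) x _ _ d1 d2.
by apply: (is_derive_eq (is_deriveB d3 (area_d x Jb))); rewrite mulr1 subrr.
Qed.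

Lemma area_pern J s (n : nat) : 0 < J < J0 ->
  area J (s + n%:R * l) - area J s = n%:R * (area J l - area J 0).
Proof.
move=> Jb; elim: n => [|n IH]; first by rewrite !mul0r addr0 subrr.
have := area_per (s + n%:R * l) Jb.
by rewrite -natr1 mulrDl mul1r addrA (mulrDl n%:R) mul1r -IH => <-; ring.
Qed.

Definition defect J s := area J (nextpt s J) - area J s - clen s (nextpt s J).

(* [area J t - area J s - clen s t] has zero gradient along the graph of [nextpt^~ J],
   and that graph is monotone, hence rectifiable. *)
Lemma defect_const J s t : 0 < J < J0 -> defect J s = defect J t.
Proof.
(* [x + nextpt x J] grows with both coordinates of the graph and therefore controls the variation of
   each. *)
move=> Jb; pose tau x := x + nextpt x J.
have ninc x y : x <= y -> nextpt x J <= nextpt y J.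
  rewrite le_eqVlt => /predU1P[->//|xy]; apply: ltW; exact: (nextpt_incr SC F).
have tinc : {homo tau : x y / x <= y} by move=> x y xy; rewrite lerD// ninc.
apply: (monotone_control_const tinc) => {}s e e0.
have [nb ne] := nextptP SC F s Jb.
have cfst : {for (s, nextpt s J), continuous (fst : R * R -> R)} by exact: cvg_fst.
have csnd : {for (s, nextpt s J), continuous (snd : R * R -> R)} by exact: cvg_snd.
have cc1 : {for (s, nextpt s J), continuous (fun p : R * R => c p.1 J)}.
  apply: (@continuous_comp _ _ _ (fst : R * R -> R) (c^~ J)) => //; exact: (fam_cont F Jb).
have cc2 : {for (s, nextpt s J), continuous (fun p : R * R => c p.2 J)}.
  apply: (@continuous_comp _ _ _ (snd : R * R -> R) (c^~ J)) => //; exact: (fam_cont F Jb).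
have ca := cont_cos_out SC cfst csnd nb.
have cb := cont_cos_in SC cfst csnd nb.
have c1 : {for (s, nextpt s J), continuous (fun p : R * R => cos_out p.1 p.2 - c p.1 J)} by exact: cvgB.
have c2 : {for (s, nextpt s J), continuous (fun p : R * R => c p.2 J - cos_in p.1 p.2)} by exact: cvgB.
have [d1 d10 hd1] := (cont_eps _ _).1 c1 e e0.
have [d2 d20 hd2] := (cont_eps _ _).1 c2 e e0.
rewrite /= ne subrr in hd1; rewrite /= (nextpt_cos_in SC F) // subrr in hd2.
have [d [d0 dd1 dd2 dd3 dd4]] : exists d, [/\ 0 < d, d <= d1, d <= d2,
    d <= (nextpt s J - s) / 2 & d <= (s + l - nextpt s J) / 2].
  exists (Num.min (Num.min d1 d2) (Num.min ((nextpt s J - s) / 2) ((s + l - nextpt s J) / 2))).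
  split.
  - by rewrite !lt_min d10 d20; lra.
  - by rewrite !ge_min lexx.
  - by rewrite !ge_min lexx !orbT.
  - by rewrite !ge_min lexx !orbT.
  - by rewrite !ge_min lexx !orbT.
have nc := @nextpt_conts _ _ _ _ _ _ _ _ SC _ _ F s J Jb.
have [d' d'0 hd'] := (cont_eps _ _).1 nc d d0.
have [d3 [d30 d3d d3d']] : exists d3, [/\ 0 < d3, d3 <= d & d3 <= d'].
  exists (Num.min d d'); split.
  - by rewrite lt_min d0.
  - by rewrite ge_min lexx.
  - by rewrite ge_min lexx orbT.
exists d3 => // s' ss'.
have tt' : `|nextpt s' J - nextpt s J| < d by apply: hd'; rewrite /ball/= distrC; lra.
set t0 := nextpt s J in nb ne hd1 hd2 dd3 dd4 tt' *.
set t1 := nextpt s' J in tt' *.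
have bx x y : `|x - s| < d -> `|y - t0| < d -> x < y < x + l.
  by rewrite !ltr_norml; lra.
have B1 x y : `|x - s| < d -> `|y - t0| < d -> `|cos_out x y - c x J| < e.
  move=> h1 h2; have := hd1 (x, y); rewrite subr0; apply.
  by split; rewrite /ball/= distrC; lra.
have B2 x y : `|x - s| < d -> `|y - t0| < d -> `|c y J - cos_in x y| < e.
  move=> h1 h2; have := hd2 (x, y); rewrite subr0; apply.
  by split; rewrite /ball/= distrC; lra.
(* Both partial derivatives of [P] vanish at [(s, t0)], hence are below [e] in absolute value
   nearby; the two points of the graph are joined by one horizontal and one vertical segment. *)
pose P x y := area J y - area J x - clen x y.
have P1 x y : `|x - s| < d -> `|y - t0| < d ->
    is_derive x 1 (P^~ y) (cos_out x y - c x J).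
  move=> h1 h2; have h := bx _ _ h1 h2.
  have k1 := is_deriveB (is_derive_cst (area J y) x (1:R)) (area_d x Jb).
  by apply: (is_derive_eq (is_deriveB k1 (clen_d1 SC h))); ring.
have P2 x y : `|x - s| < d -> `|y - t0| < d ->
    is_derive y 1 (P x) (c y J - cos_in x y).
  move=> h1 h2; have h := bx _ _ h1 h2.
  have k1 := is_deriveB (area_d y Jb) (is_derive_cst (area J x) y (1:R)).
  by apply: (is_derive_eq (is_deriveB k1 (clen_d2 SC h))); rewrite subr0.
have E1 : `|P s' t1 - P s t1| <= e * `|s' - s|.
  have [h|h|->] := ltgtP s' s; last by rewrite !subrr normr0 mulr0.
    have dP x : s' <= x <= s -> is_derive x 1 (P^~ t1) (cos_out x t1 - c x J).
      by move=> xb; apply: P1 => //; move: ss'; rewrite !ltr_norml; lra.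
    have [x [xb ex]] := MVTd h dP.
    rewrite distrC ex normrM (distrC s') ler_wpM2r// ltW// B1//.
    by move: ss'; rewrite !ltr_norml; lra.
  have dP x : s <= x <= s' -> is_derive x 1 (P^~ t1) (cos_out x t1 - c x J).
    by move=> xb; apply: P1 => //; move: ss'; rewrite !ltr_norml; lra.
  have [x [xb ex]] := MVTd h dP.
  rewrite ex normrM ler_wpM2r// ltW// B1//.
  by move: ss'; rewrite !ltr_norml; lra.
have s0 : `|s - s| < d by rewrite subrr normr0.
have E2 : `|P s t1 - P s t0| <= e * `|t1 - t0|.
  have [h|h|->] := ltgtP t1 t0; last by rewrite !subrr normr0 mulr0.
    have dP x : t1 <= x <= t0 -> is_derive x 1 (P s) (c x J - cos_in s x).
      by move=> xb; apply: P2 => //; move: tt'; rewrite !ltr_norml; lra.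
    have [x [xb ex]] := MVTd h dP.
    rewrite distrC ex normrM (distrC t1) ler_wpM2r// ltW// B2//.
    by move: tt'; rewrite !ltr_norml; lra.
  have dP x : t0 <= x <= t1 -> is_derive x 1 (P s) (c x J - cos_in s x).
    by move=> xb; apply: P2 => //; move: tt'; rewrite !ltr_norml; lra.
  have [x [xb ex]] := MVTd h dP.
  rewrite ex normrM ler_wpM2r// ltW// B2//.
  by move: tt'; rewrite !ltr_norml; lra.
have -> : defect J s' - defect J s = (P s' t1 - P s t1) + (P s t1 - P s t0).
  by rewrite /defect /P -/t0 -/t1; ring.
apply: le_trans (ler_normD _ _) _; apply: le_trans (lerD E1 E2) _.
rewrite -mulrDr ler_wpM2l ?(ltW e0)//.
rewrite /tau -/t0 -/t1; have [h|h] := leP s s'.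
  have h2 : t0 <= t1 by exact: ninc.
  by rewrite !ger0_norm; lra.
have h2 : t1 <= t0 by apply: ninc; exact: ltW.
by rewrite !ler0_norm; lra.
Qed.

(** For fixed [s] the function [area J t - clen s t] of [t] is minimal at [nextpt s J], because
    [cos_in] increases in its first argument. Evaluating the functions of [J1] and [J2] at each
    other's minimizer gives the two bounds. *)
Lemma defect_sandwich J1 J2 s : 0 < J1 -> J1 < J2 -> J2 < J0 ->
  (area J2 (nextpt s J2) - area J1 (nextpt s J2)) - (area J2 s - area J1 s)
    <= defect J2 s - defect J1 s
    <= (area J2 (nextpt s J1) - area J1 (nextpt s J1)) - (area J2 s - area J1 s).
Proof.
move=> h1 h12 h2.
have J1b : 0 < J1 < J0 by lra.
have J2b : 0 < J2 < J0 by lra.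
have [nb1 ne1] := nextptP SC F s J1b; have [nb2 ne2] := nextptP SC F s J2b.
have ab : nextpt s J1 <= nextpt s J2 by apply: ltW; apply: (nextpt_incrJ SC F).
have up : area J2 (nextpt s J2) - clen s (nextpt s J2) <= area J2 (nextpt s J1) - clen s (nextpt s J1).
  rewrite -lerN2.
  apply: (@is_derive_ler _ (fun x => - (area J2 x - clen s x))
    (fun x => - (c x J2 - cos_in s x))) => // x xb.
    have sx : s < x < s + l by lra.
    by apply: is_deriveN; apply: is_deriveB; [exact: area_d|exact: (clen_d2 SC)].
  have [s2 es] := nextpt_surj SC F x J2b; have [nb _] := nextptP SC F s2 J2b.
  rewrite oppr_ge0 subr_le0 -es -(nextpt_cos_in SC F)// es in nb *.
  have [ss|ss|->//] := ltgtP s2 s.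
    by apply: ltW; apply: (cos_in_incr SC); lra.
  by have := nextpt_incr SC F J2b ss; rewrite es; lra.
have dn : area J1 (nextpt s J1) - clen s (nextpt s J1) <= area J1 (nextpt s J2) - clen s (nextpt s J2).
  apply: (@is_derive_ler _ (fun x => area J1 x - clen s x)
    (fun x => c x J1 - cos_in s x)) => // x xb.
    have sx : s < x < s + l by lra.
    by apply: is_deriveB; [exact: area_d|exact: (clen_d2 SC)].
  have [s2 es] := nextpt_surj SC F x J1b; have [nb _] := nextptP SC F s2 J1b.
  rewrite subr_ge0 -es -(nextpt_cos_in SC F)// es in nb *.
  have [ss|ss|->//] := ltgtP s s2.
    by apply: ltW; apply: (cos_in_incr SC); lra.
  by have := nextpt_incr SC F J1b ss; rewrite es; lra.
by rewrite /defect; lra.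
Qed.

End Flux.

(** * The derivative of the primitives in the label *)

Section FluxLimit.
Context {R : realType} (D : set (R * R)) (l : R) (g T g2 g3 g4 : R -> R * R).
Context (SC : convex_arc D l g T g2 g3 g4).
Context (J0 : R) (c : R -> R -> R) (F : invariant_family l g T J0 c).
Implicit Types (s t x y J e : R).
Local Notation nextpt := (nextpt l g T c).
Local Notation area := (area c).

Let l0 : 0 < l := len_gt0 SC.

(** Minus the difference quotient of [area] in the label; with this sign it increases in [s], as [c]
    decreases in the label. *)
Definition area_quot J1 J2 s :=
  ((area J1 s - area J1 0) - (area J2 s - area J2 0)) / (J2 - J1).

Lemma area_quot_d J1 J2 s : 0 < J1 < J0 -> 0 < J2 < J0 ->
  is_derive s 1 (area_quot J1 J2) ((c s J1 - c s J2) / (J2 - J1)).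
Proof.
move=> b1 b2.
have h1 := is_deriveB (area_d F s b1) (is_derive_cst (area J1 0) s (1:R)).
have h2 := is_deriveB (area_d F s b2) (is_derive_cst (area J2 0) s (1:R)).
have h3 := is_deriveB h1 h2.
have h4 := is_deriveZ (J2 - J1)^-1 h3.
rewrite (_ : area_quot J1 J2 = (J2 - J1)^-1 \*: (fun x => (area J1 x - area J1 0) - (area J2 x - area J2 0))); last first.
  by apply/funext => x; rewrite /area_quot mulrC.
by apply: (is_derive_eq h4); rewrite !subr0 /GRing.scale/= mulrC.
Qed.

Lemma area_quot_bound J : 0 < J < J0 -> exists k0 k1 eta, [/\ 0 < k0, 0 < eta,
    (forall J1, `|J1 - J| < eta -> 0 < J1 < J0) &
    forall J1 J2 s t, `|J1 - J| < eta -> `|J2 - J| < eta -> J1 < J2 -> s <= t ->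
      k0 * (t - s) <= area_quot J1 J2 t - area_quot J1 J2 s <= k1 * (t - s)].
Proof.
move=> Jb; have [k0 [k1 [eta [k00 k10 eta0 Hb H]]]] := fam_lip' F Jb.
exists k0, k1, eta; split => // J1 J2 s t h1 h2 h12.
rewrite le_eqVlt => /predU1P[->|st]; first by rewrite !subrr !mulr0 lexx.
have [x [xb ->]] := MVTd st (fun x _ => area_quot_d x (Hb _ h1) (Hb _ h2)).
have j : 0 < J2 - J1 by lra.
have /andP[a b] := H J1 J2 x h1 h2 h12.
rewrite !ler_pM2r ?subr_gt0//.
by rewrite ler_pdivlMr// ler_pdivrMr// a b.
Qed.

(** The limit runs over all pairs of labels near [J], including those that avoid [J]. If it failed,
    there would be a sequence of bad pairs tending to [J], to which [bounded_convergence]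
    applies. *)
Lemma area_quot_lim_pos J b : 0 < J < J0 -> 0 < b -> exists m, forall e, 0 < e ->
  exists2 eta, 0 < eta & forall J1 J2, `|J1 - J| < eta -> `|J2 - J| < eta -> J1 < J2 ->
    `|area_quot J1 J2 b - m| < e.
Proof.
move=> Jb b0; have [k0 [k1 [eta [k00 k10 eta0 Hb H]]]] := fam_lip' F Jb.
have [Z [w [cZ lw]]] := fam_diff F Jb.
exists (\int[lebesgue_measure]_(x in `[0, b] `\` Z) w x) => e e0.
apply: contrapT => /forall2NP nex.
have : forall n : nat, exists p : R * R,
    [/\ `|p.1 - J| < Num.min eta n.+1%:R^-1, `|p.2 - J| < Num.min eta n.+1%:R^-1, p.1 < p.2 &
     e <= `|area_quot p.1 p.2 b - \int[lebesgue_measure]_(x in `[0, b] `\` Z) w x| ].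
  move=> n; have [|] := nex (Num.min eta n.+1%:R^-1).
    by move=> h; exfalso; apply: h; rewrite lt_min eta0 invr_gt0 ltr0n.
  move=> h; apply: contrapT => /forallNP h2; apply: h => J1 J2 j1 j2 j12.
  by rewrite ltNge; apply/negP => h3; apply: (h2 (J1, J2)); split.
move=> /choice[p hp].
have pe n : `|(p n).1 - J| < eta /\ `|(p n).2 - J| < eta.
  by have [] := hp n; rewrite !lt_min => /andP[-> _] /andP[-> _].
have pp n : (p n).1 < (p n).2 by have [] := hp n.
have cvgc : (area_quot (p n).1 (p n).2 b - area_quot (p n).1 (p n).2 0) @[n --> \oo] -->
    \int[lebesgue_measure]_(x in `[0, b] `\` Z) w x.
  apply: (@bounded_convergence _ (fun n x => (c x (p n).1 - c x (p n).2) / ((p n).2 - (p n).1))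
     (fun n => area_quot (p n).1 (p n).2) w Z k1 b b0) => //.
  - move=> n x; have [q1 q2] := pe n.
    have c1 : {for x, continuous (c^~ (p n).1)} by exact: (fam_cont F (Hb _ q1)).
    have c2 : {for x, continuous (c^~ (p n).2)} by exact: (fam_cont F (Hb _ q2)).
    by apply: cvgM; [exact: cvgB|exact: cvg_cst].
  - by move=> n x; have [q1 q2] := pe n; apply: area_quot_d; exact: Hb.
  - move=> n x; have [q1 q2] := pe n.
    have /andP[h1 h2] := H (p n).1 (p n).2 x q1 q2 (pp n).
    have j : 0 < (p n).2 - (p n).1 by rewrite subr_gt0 pp.
    have h3 : 0 <= c x (p n).1 - c x (p n).2.
      by apply: le_trans h1; apply: ltW; exact: mulr_gt0.
    by rewrite ger0_norm; [rewrite ler_pdivrMr|apply: divr_ge0 => //; exact: ltW].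
  - move=> x nZ; apply/cvgrPdist_lt => e' e'0.
    have [d d0 hd] := lw x nZ e' e'0.
    have := near_infty_natSinv_lt (PosNum d0).
    apply: filterS => n /= hn; rewrite distrC; have [q1 q2 q3 _] := hp n.
    apply: hd => //.
      by apply: lt_trans hn; move: q1; rewrite lt_min => /andP[].
    by apply: lt_trans hn; move: q2; rewrite lt_min => /andP[].
have /cvgrPdist_lt/(_ e e0) [n _ /(_ n (leqnn n))] := cvgc.
have -> : area_quot (p n).1 (p n).2 0 = 0 by rewrite /area_quot !subrr mul0r.
by rewrite subr0 distrC ltNge => /negP h; have [_ _ _ h2] := hp n.
Qed.

Lemma area_quot_shift J1 J2 s n : 0 < J1 < J0 -> 0 < J2 < J0 ->
  area_quot J1 J2 (s + n%:R * l) = area_quot J1 J2 s + n%:R * area_quot J1 J2 l.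
Proof.
move=> b1 b2; have e1 := area_pern F s n b1; have e2 := area_pern F s n b2.
rewrite /area_quot mulrA -mulrDl; congr (_ / _); lra.
Qed.

(** The integral representation covers [s > 0]; a shift by a multiple of [l], which adds a multiple
    of the quotient at [l], reaches all other [s]. *)
Lemma area_quot_lim J s : 0 < J < J0 -> exists m, forall e, 0 < e ->
  exists2 eta, 0 < eta & forall J1 J2, `|J1 - J| < eta -> `|J2 - J| < eta -> J1 < J2 ->
    `|area_quot J1 J2 s - m| < e.
Proof.
move=> Jb; have [n sn] := exists_shift s l0.
have [k0 [k1 [eta [k00 eta0 Hb H]]]] := area_quot_bound Jb.
have [m1 h1] := area_quot_lim_pos Jb sn.
have [m2 h2] := area_quot_lim_pos Jb l0.
exists (m1 - n%:R * m2) => e e0.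
have n0 : 0 < (n%:R : R) + 1 by rewrite ltr_wpDl.
have [d1 d10 hd1] := h1 (e / 2) ltac:(lra).
have [d2 d20 hd2] := h2 (e / 2 / (n%:R + 1)) ltac:(rewrite divr_gt0//; lra).
exists (Num.min eta (Num.min d1 d2)); first by rewrite !lt_min eta0 d10.
move=> J1 J2; rewrite !lt_min => /andP[a1 /andP[b1 c1]] /andP[a2 /andP[b2 c2]] J12.
have e1 := hd1 J1 J2 b1 b2 J12; have e2 := hd2 J1 J2 c1 c2 J12.
have sh := area_quot_shift s n (Hb _ a1) (Hb _ a2).
have -> : area_quot J1 J2 s - (m1 - n%:R * m2) =
  (area_quot J1 J2 (s + n%:R * l) - m1) - n%:R * (area_quot J1 J2 l - m2).
  by rewrite sh; ring.
apply: le_lt_trans (ler_normB _ _) _.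
rewrite normrM ger0_norm//.
have : n%:R * `|area_quot J1 J2 l - m2| <= (n%:R + 1) * `|area_quot J1 J2 l - m2|.
  by rewrite ler_wpM2r// lerDl.
rewrite ltr_pdivlMr// mulrC in e2; lra.
Qed.

(** Minus the strong derivative of [area J s - area J 0] in the label: the mass that the invariant
    measure of the curve gives to the arc from 0 to [s]. *)
Definition flux s J := xget 0 [set m | forall e, 0 < e ->
  exists2 eta, 0 < eta & forall J1 J2, `|J1 - J| < eta -> `|J2 - J| < eta -> J1 < J2 ->
    `|area_quot J1 J2 s - m| < e].

Lemma fluxP s J : 0 < J < J0 -> forall e, 0 < e ->
  exists2 eta, 0 < eta & forall J1 J2, `|J1 - J| < eta -> `|J2 - J| < eta -> J1 < J2 ->
    `|area_quot J1 J2 s - flux s J| < e.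
Proof.
move=> Jb; rewrite /flux; case: xgetP => [m _ //|].
by have [m hm] := area_quot_lim s Jb => /(_ m).
Qed.

Lemma flux_approx J (r : seq R) e (d : R) : 0 < J < J0 -> 0 < e -> 0 < d ->
  exists2 h, 0 < h < d & [/\ 0 < J + h < J0 & forall s, s \in r ->
    `|area_quot J (J + h) s - flux s J| < e].
Proof.
move=> Jb e0 d0.
suff [eta eta0 H] : exists2 eta, 0 < eta & forall h, 0 < h < eta -> forall s, s \in r ->
    `|area_quot J (J + h) s - flux s J| < e.
  have [m [m0 m1 m2 m3]] : exists m, [/\ 0 < m, m <= d, m <= eta & m <= J0 - J].
    exists (Num.min d (Num.min eta (J0 - J))); split.
    - by rewrite !lt_min d0 eta0; lra.
    - by rewrite ge_min lexx.
    - by rewrite !ge_min lexx orbT.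
    - by rewrite !ge_min lexx !orbT.
  exists (m / 2); first by lra.
  by split; [lra|apply: H; lra].
elim: r => [|s r [eta eta0 H]]; first by exists 1.
have [eta' eta'0 H'] := fluxP s Jb e0.
exists (Num.min eta eta'); first by rewrite lt_min eta0.
move=> h /andP[h0]; rewrite lt_min => /andP[h1 h2] t; rewrite inE => /predU1P[->|tr].
  apply: H'; [by rewrite subrr normr0| |lra].
  by rewrite addrAC subrr add0r gtr0_norm.
by apply: H => //; rewrite h0.
Qed.

Lemma flux_bound J : 0 < J < J0 -> exists k0 k1 eta, [/\ 0 < k0, 0 < eta,
    (forall J1, `|J1 - J| < eta -> 0 < J1 < J0) &
    forall J1 s t, `|J1 - J| < eta -> s <= t ->
      k0 * (t - s) <= flux t J1 - flux s J1 <= k1 * (t - s)].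
Proof.
move=> Jb; have [k0 [k1 [eta [k00 eta0 Hb H]]]] := area_quot_bound Jb.
exists k0, k1, eta; split => // J1 s t h1 st; have J1b := Hb _ h1.
have K e : 0 < e -> k0 * (t - s) - e < flux t J1 - flux s J1 < k1 * (t - s) + e.
  move=> e0.
  have [h hb [hJ hh]] := @flux_approx J1 [:: s; t] (e / 2) (eta - `|J1 - J|) J1b ltac:(lra) ltac:(lra).
  have hs := hh s ltac:(by rewrite inE eqxx); have ht := hh t ltac:(by rewrite !inE eqxx orbT).
  have J2 : `|J1 + h - J| < eta.
    by rewrite addrAC; apply: le_lt_trans (ler_normD _ _) _; rewrite (gtr0_norm (_ : 0 < h)); lra.
  have /andP[a b] := H J1 (J1 + h) s t h1 J2 ltac:(lra) st.
  move: hs ht; rewrite !ltr_norml; lra.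
apply/andP; split.
  by apply/ler_addgt0Pl => e e0; have := K e e0; lra.
by apply/ler_addgt0Pl => e e0; have := K e e0; lra.
Qed.

Lemma flux0 J : 0 < J < J0 -> flux 0 J = 0.
Proof.
move=> Jb; apply/eqP; rewrite -normr_le0; apply/ler_addgt0Pl => e e0; rewrite addr0.
have [h hb [hJ hh]] := @flux_approx J [:: 0] e 1 Jb e0 ltr01.
have := hh 0 ltac:(by rewrite inE eqxx).
by rewrite {1}/area_quot !subrr mul0r sub0r normrN => /ltW.
Qed.

Lemma flux_per s J : 0 < J < J0 -> flux (s + l) J = flux s J + flux l J.
Proof.
move=> Jb; apply/eqP; rewrite -subr_eq0 -normr_le0; apply/ler_addgt0Pl => e e0; rewrite addr0.
have [h hb [hJ hh]] := @flux_approx J [:: s; s + l; l] (e / 3) 1 Jb ltac:(lra) ltr01.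
have h1 := hh s ltac:(by rewrite inE eqxx); have h2 := hh (s + l) ltac:(by rewrite !inE eqxx !orbT).
have h3 := hh l ltac:(by rewrite !inE eqxx !orbT).
have := area_quot_shift s 1 Jb hJ; rewrite !mul1r => e1.
by move: h1 h2 h3; rewrite e1 !ltr_norml ler_norml; lra.
Qed.

Lemma flux_cont s J : 0 < J < J0 -> {for (s, J), continuous (fun p : R * R => flux p.1 p.2)}.
Proof.
move=> Jb; have [k0 [k1 [eta [k00 eta0 Hb H]]]] := flux_bound Jb.
have k10 : 0 < k1.
  have := H J 0 1; rewrite subrr normr0 subr0 !mulr1 => /(_ eta0 ler01) /andP[a b]; lra.
apply/cont_eps => e e0.
have e40 : 0 < e / 4 by lra.
have [d d0 hd] := fluxP s Jb e40.
have [m [m0 m1 m2 m3]] : exists m, [/\ 0 < m, m <= d, m <= eta & k1 * m <= e / 2].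
  exists (Num.min d (Num.min eta (e / 2 / k1))); split.
  - by rewrite !lt_min d0 eta0 divr_gt0//; lra.
  - by rewrite ge_min lexx.
  - by rewrite !ge_min lexx orbT.
  - by rewrite mulrC -ler_pdivlMr// !ge_min lexx !orbT.
exists m => // -[s' J'] [/= b1 b2]; rewrite /ball/= in b1 b2.
have J'e : `|J' - J| < eta by rewrite distrC; lra.
have J'b := Hb _ J'e.
have e1 : `|flux s' J' - flux s J'| <= k1 * m.
  have [ss|ss] := leP s' s.
    have /andP[a b] := H J' s' s J'e ss.
    rewrite distrC ger0_norm; last by apply: le_trans a; rewrite mulr_ge0 ?subr_ge0// ltW.
    apply: le_trans b _; rewrite ler_pM2l//; move: b1; rewrite ger0_norm; lra.
  have /andP[a b] := H J' s s' J'e (ltW ss).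
  rewrite ger0_norm; last by apply: le_trans a; rewrite mulr_ge0 ?subr_ge0// ltW.
  apply: le_trans b _; rewrite ler_pM2l//; move: b1; rewrite distrC gtr0_norm; lra.
have e2 : `|flux s J' - flux s J| < e / 2.
  have [h hb [hJ hh]] := @flux_approx J' [:: s] (e / 4) (m - `|J - J'|) J'b ltac:(lra) ltac:(lra).
  have h1 := hh s ltac:(by rewrite inE eqxx).
  have h2 : `|area_quot J' (J' + h) s - flux s J| < e / 4.
    apply: hd; [by rewrite distrC; lra| |lra].
    rewrite addrAC; apply: le_lt_trans (ler_normD _ _) _.
    by rewrite distrC (gtr0_norm (_ : 0 < h)); lra.
  by move: h1 h2; rewrite !ltr_norml; lra.
have -> : flux s' J' - flux s J = (flux s' J' - flux s J') + (flux s J' - flux s J) by ring.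
by apply: le_lt_trans (ler_normD _ _) _; lra.
Qed.

(** [defect_sandwich] divided by [h]. The middle term is independent of [x], and the outer ones
    differ only by the small displacement of the next impact between the labels [J] and [J + h]. *)
Lemma area_quot_nextpt J h x k1 : 0 < J -> 0 < h -> J + h < J0 ->
  (forall y z, y <= z -> area_quot J (J + h) z - area_quot J (J + h) y <= k1 * (z - y)) ->
  area_quot J (J + h) (nextpt x J) - area_quot J (J + h) x
    <= - (defect l g T c (J + h) 0 - defect l g T c J 0) / h
    <= area_quot J (J + h) (nextpt x J) - area_quot J (J + h) x
       + k1 * (nextpt x (J + h) - nextpt x J).
Proof.
move=> J1 h0 hJ H; have Jh : J < J + h by rewrite ltrDl.
have Jb : 0 < J < J0 by rewrite J1 (lt_trans Jh).
have Jhb : 0 < J + h < J0 by rewrite hJ (lt_trans J1).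
have := defect_sandwich SC F x J1 Jh hJ.
rewrite (defect_const SC F x 0 Jb) (defect_const SC F x 0 Jhb) => /andP[sw1 sw2].
have nn : nextpt x J <= nextpt x (J + h) by apply: ltW; exact: (nextpt_incrJ SC F).
have {H}b2 := H _ _ nn.
have q y z : area_quot J (J + h) y - area_quot J (J + h) z =
  - ((area (J + h) y - area J y) - (area (J + h) z - area J z)) / h.
  have JhJ : J + h - J = h by rewrite addrAC subrr add0r.
  by rewrite /area_quot JhJ; field; rewrite gt_eqF.
have r1 : area_quot J (J + h) (nextpt x J) - area_quot J (J + h) x
    <= - (defect l g T c (J + h) 0 - defect l g T c J 0) / h.
  by rewrite q ler_pM2r ?invr_gt0// lerN2.
have r2 : - (defect l g T c (J + h) 0 - defect l g T c J 0) / h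
    <= area_quot J (J + h) (nextpt x (J + h)) - area_quot J (J + h) x.
  by rewrite q ler_pM2r ?invr_gt0// lerN2.
by rewrite r1 /=; apply: le_trans r2 _; rewrite addrAC lerD2r -lerBlDl.
Qed.

Lemma flux_nextpt s t J : 0 < J < J0 ->
  flux (nextpt s J) J - flux s J = flux (nextpt t J) J - flux t J.
Proof.
move=> Jb; apply/eqP; rewrite -subr_eq0 -normr_le0; apply/ler_addgt0Pl => e e0; rewrite addr0.
have [k0 [k1 [eta [k00 eta0 Hb H]]]] := area_quot_bound Jb.
have k10 : 0 < k1.
  have := H J (J + eta / 2) 0 1; rewrite subrr normr0 subr0 !mulr1 => /(_ eta0).
  rewrite addrAC subrr add0r gtr0_norm ?divr_gt0// => /(_ ltac:(lra) ltac:(lra) ler01) /andP[a b]; lra.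
have nc x : exists2 d, 0 < d & forall J', `|J' - J| < d -> `|nextpt x J' - nextpt x J| < e / 8 / k1.
  have c2 : {for J, continuous (nextpt x)}.
    apply: (@continuous_comp _ _ _ (fun J => (x, J)) (fun p : R * R => nextpt p.1 p.2)).
      exact: (cont_pair (@cont_cst _ _ _ _) (@cont_id _ _)).
    exact: (nextpt_cont SC F).
  have [d d0 hd] := (cont_eps _ _).1 c2 (e / 8 / k1) ltac:(rewrite divr_gt0//; lra).
  by exists d => // J' h; apply: hd; rewrite /ball/= distrC.
have [ds ds0 hds] := nc s; have [dt dt0 hdt] := nc t.
have [m [m0 m1 m2 m3]] : exists m, [/\ 0 < m, m <= ds, m <= dt & m <= eta].
  exists (Num.min ds (Num.min dt eta)); split.
  - by rewrite !lt_min ds0 dt0.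
  - by rewrite ge_min lexx.
  - by rewrite !ge_min lexx orbT.
  - by rewrite !ge_min lexx !orbT.
(* A single [h] has to serve all four points at which the flux is replaced by a quotient. *)
have [h hb [hJ hh]] := @flux_approx J [:: s; t; nextpt s J; nextpt t J] (e / 16) m Jb ltac:(lra) m0.
have q1 := hh s ltac:(by rewrite inE eqxx).
have q2 := hh t ltac:(by rewrite !inE eqxx !orbT).
have q3 := hh (nextpt s J) ltac:(by rewrite !inE eqxx !orbT).
have q4 := hh (nextpt t J) ltac:(by rewrite !inE eqxx !orbT).
have Jh : `|J + h - J| < m by rewrite addrAC subrr add0r gtr0_norm; case/andP: hb.
have JJ : `|J - J| < eta by rewrite subrr normr0.
have h0 : 0 < h by case/andP: hb.
have hm : h < m by case/andP: hb.
have JhJ : J + h - J = h by rewrite addrAC subrr add0r.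
have [Jp Jhp] : 0 < J /\ J + h < J0 by case/andP: Jb => ->; case/andP: hJ.
have Jhe : `|J + h - J| < eta by apply: lt_le_trans Jh m3.
have K y z : y <= z -> area_quot J (J + h) z - area_quot J (J + h) y <= k1 * (z - y).
  by move=> yz; have /andP[] := H J (J + h) y z JJ Jhe ltac:(by rewrite ltrDl) yz.
have key x : `|nextpt x (J + h) - nextpt x J| < e / 8 / k1 ->
    k1 * (nextpt x (J + h) - nextpt x J) <= e / 8.
  by move=> xh; rewrite mulrC -ler_pdivlMr// ltW// (le_lt_trans _ xh)// ler_norm.
have {}ks := key _ (hds _ (lt_le_trans Jh m1)).
have {}kt := key _ (hdt _ (lt_le_trans Jh m2)).
have /andP[a1 a2] := area_quot_nextpt s Jp h0 Jhp K.
have /andP[b1 b2] := area_quot_nextpt t Jp h0 Jhp K.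
move: q1 q2 q3 q4 ks kt a1 a2 b1 b2; clear hds hdt hh H K nc key Jh Jhe JJ hb hJ m0 m1 m2 m3 ds0 dt0 Hb.
rewrite !ltr_norml ler_norml; lra.
Qed.

End FluxLimit.

(** * Lazutkin's coordinate near the boundary *)

Section Periodic.
Context {R : realType}.
Implicit Types (l s x : R).

Lemma per_nat (V : Type) (f : R -> V) l (n : nat) x : (forall s, f (s + l) = f s) ->
  f (x + n%:R * l) = f x.
Proof.
move=> pf; elim: n => [|n IH]; first by rewrite mul0r addr0.
by rewrite -natr1 mulrDl mul1r addrA pf.
Qed.

Lemma per_int (V : Type) (f : R -> V) l (k : int) x : (forall s, f (s + l) = f s) ->
  f (x + k%:~R * l) = f x.
Proof.
move=> pf; case: k => n; first exact: per_nat.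
rewrite NegzE mulrNz mulNr -[in RHS](subrK (n.+1%:R * l) x).
by rewrite per_nat.
Qed.

Lemma per_reduce l x : 0 < l -> exists k : int, 0 <= x + k%:~R * l < l.
Proof.
move=> l0; exists (- Num.floor (x / l)).
have /andP[h1 h2] := floor_itv (x / l).
rewrite ler_pdivlMr// in h1; rewrite ltr_pdivrMr// intrD mulrDl mul1r in h2.
by rewrite mulrNz mulNr; lra.
Qed.

Lemma per_bounded l (f : R -> R) : 0 < l -> (forall s, f (s + l) = f s) ->
  continuous f -> exists2 B, 0 < B & forall x, `|f x| <= B.
Proof.
move=> l0 pf cf.
have cn : continuous (fun x => `|f x|).
  by move=> x; apply: continuous_comp; [exact: cf|exact: norm_continuous].
have [c [_ hc]] := EVT_maxc (ltW l0) (fun x _ => cn x).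
exists (`|f c| + 1); first by rewrite ltr_wpDl.
move=> x; have [k kb] := per_reduce x l0.
rewrite -(per_int k x pf); apply: (@le_trans _ _ `|f c|); last by rewrite lerDl.
by apply: hc; lra.
Qed.

Lemma per_pos l (f : R -> R) : 0 < l -> (forall s, f (s + l) = f s) ->
  continuous f -> (forall x, 0 < f x) -> exists2 b, 0 < b & forall x, b <= f x.
Proof.
move=> l0 pf cf f0.
have [c [_ hc]] := EVT_minc (ltW l0) (fun x _ => cf x).
exists (f c) => // x; have [k kb] := per_reduce x l0.
by rewrite -(per_int k x pf); apply: hc; lra.
Qed.

Lemma is_derive_shiftl (f df : R -> R) s (d : R) :
  is_derive (s + d) 1 f (df (s + d)) -> is_derive d 1 (fun x => f (s + x)) (df (s + d)).
Proof.
move=> h; have h2 : is_derive d 1 (fun x : R => s + x) 1.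
  by apply: (is_derive_eq (is_deriveD (is_derive_cst s d (1:R)) (is_derive_id d (1:R)))); rewrite add0r.
by apply: (is_derive_eq (@is_derive1_comp R f (fun x => s + x) d _ _ h h2)); rewrite mulr1.
Qed.

Lemma is_derive_expn n x : is_derive x 1 (fun y : R => y ^+ n.+1) (n.+1%:R * x ^+ n).
Proof.
elim: n => [|n IH].
  by rewrite expr0 mulr1; under eq_fun do rewrite expr1; exact: is_derive_id.
have -> : (fun y : R => y ^+ n.+2) = (fun y => y * y ^+ n.+1) by apply/funext => y; rewrite exprS.
apply: (is_derive_eq (is_deriveM (is_derive_id x (1:R)) IH)).
by rewrite /GRing.scale/= mulr1 -[in RHS]natr1 mulrDl mul1r mulrCA -exprS.
Qed.

(** Third-order expansion at a critical point by four applications of [taylor_bound_step], hence the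
    constant [B] instead of [B / 24]. *)
Lemma taylor4 (f0 f1 f2 f3 f4 : R -> R) (B s : R) : 0 <= B ->
  (forall x : R, is_derive x 1 f0 (f1 x)) -> (forall x : R, is_derive x 1 f1 (f2 x)) ->
  (forall x : R, is_derive x 1 f2 (f3 x)) -> (forall x : R, is_derive x 1 f3 (f4 x)) ->
  (forall x, `|f4 x| <= B) -> f1 s = 0 -> 
  forall d, `|f0 (s + d) - f0 s - f2 s / 2 * d ^+ 2 - f3 s / 6 * d ^+ 3| <= B * `|d| ^+ 4.
Proof.
move=> B0 h0 h1 h2 h3 hB f1s d.
pose r3 x := f3 (s + x) - f3 s.
pose r2 x := f2 (s + x) - f2 s - f3 s * x.
pose r1 x := f1 (s + x) - f2 s * x - f3 s / 2 * x ^+ 2.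
pose r0 x := f0 (s + x) - f0 s - f2 s / 2 * x ^+ 2 - f3 s / 6 * x ^+ 3.
have X1 (a x : R) : is_derive x 1 (fun y => a * y) a.
  by apply: (is_derive_eq (is_deriveZ a (is_derive_id x (1:R)))); rewrite /GRing.scale/= mulr1.
have Xn (a x : R) n : is_derive x 1 (fun y => a * y ^+ n.+1) (a * (n.+1%:R * x ^+ n)).
  exact: is_deriveZ (is_derive_expn n x).
have S (f df : R -> R) (x : R) : (forall y : R, is_derive y 1 f (df y)) -> is_derive x 1 (fun y => f (s + y)) (df (s + x)).
  by move=> h; exact: (is_derive_shiftl (h (s + x))).
have d3 (x : R) : is_derive x 1 r3 (f4 (s + x)).
  by apply: (is_derive_eq (is_deriveB (S _ _ x h3) (is_derive_cst (f3 s) x (1:R)))); rewrite subr0.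
have d2 (x : R) : is_derive x 1 r2 (r3 x).
  by apply: (is_derive_eq (is_deriveB (is_deriveB (S _ _ x h2) (is_derive_cst (f2 s) x (1:R))) (X1 (f3 s) x))); rewrite subr0.
have d1 (x : R) : is_derive x 1 r1 (r2 x).
  apply: (is_derive_eq (is_deriveB (is_deriveB (S _ _ x h1) (X1 (f2 s) x)) (Xn (f3 s / 2) x 1%N))).
  by rewrite /r2; field.
have d0 (x : R) : is_derive x 1 r0 (r1 x).
  apply: (is_derive_eq (is_deriveB (is_deriveB (is_deriveB (S _ _ x h0) (is_derive_cst (f0 s) x (1:R))) (Xn (f2 s / 2) x 1%N)) (Xn (f3 s / 6) x 2%N))).
  by rewrite /r1; field.
have b3 : forall x, `|x| <= `|d| -> `|r3 x| <= B * `|x| ^+ 1.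
  apply: (taylor_bound_step B0 d3); first by rewrite /r3 addr0 subrr.
  by move=> x _; rewrite expr0 mulr1.
have b2 : forall x, `|x| <= `|d| -> `|r2 x| <= B * `|x| ^+ 2.
  by apply: (taylor_bound_step B0 d2); rewrite // /r2 addr0 mulr0 !subrr.
have b1 : forall x, `|x| <= `|d| -> `|r1 x| <= B * `|x| ^+ 3.
  by apply: (taylor_bound_step B0 d1); rewrite // /r1 addr0 f1s expr0n/= !mulr0 !subr0.
apply: (taylor_bound_step B0 d0 _ b1 (lexx _)).
by rewrite /r0 addr0 subrr !expr0n/= !mulr0 !subr0.
Qed.

Lemma taylor3 (f0 f1 f2 f3 : R -> R) (B s : R) : 0 <= B ->
  (forall x : R, is_derive x 1 f0 (f1 x)) -> (forall x : R, is_derive x 1 f1 (f2 x)) ->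
  (forall x : R, is_derive x 1 f2 (f3 x)) ->
  (forall x, `|f3 x| <= B) ->
  forall d, `|f0 (s + d) - f0 s - f1 s * d - f2 s / 2 * d ^+ 2| <= B * `|d| ^+ 3.
Proof.
move=> B0 h0 h1 h2 hB d.
pose r2 x := f2 (s + x) - f2 s.
pose r1 x := f1 (s + x) - f1 s - f2 s * x.
pose r0 x := f0 (s + x) - f0 s - f1 s * x - f2 s / 2 * x ^+ 2.
have X1 (a x : R) : is_derive x 1 (fun y => a * y) a.
  by apply: (is_derive_eq (is_deriveZ a (is_derive_id x (1:R)))); rewrite /GRing.scale/= mulr1.
have Xn (a x : R) n : is_derive x 1 (fun y => a * y ^+ n.+1) (a * (n.+1%:R * x ^+ n)).
  exact: is_deriveZ (is_derive_expn n x).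
have S (f df : R -> R) (x : R) : (forall y : R, is_derive y 1 f (df y)) -> is_derive x 1 (fun y => f (s + y)) (df (s + x)).
  by move=> h; exact: (is_derive_shiftl (h (s + x))).
have d2 (x : R) : is_derive x 1 r2 (f3 (s + x)).
  by apply: (is_derive_eq (is_deriveB (S _ _ x h2) (is_derive_cst (f2 s) x (1:R)))); rewrite subr0.
have d1 (x : R) : is_derive x 1 r1 (r2 x).
  by apply: (is_derive_eq (is_deriveB (is_deriveB (S _ _ x h1) (is_derive_cst (f1 s) x (1:R))) (X1 (f2 s) x))); rewrite subr0.
have d0 (x : R) : is_derive x 1 r0 (r1 x).
  apply: (is_derive_eq (is_deriveB (is_deriveB (is_deriveB (S _ _ x h0) (is_derive_cst (f0 s) x (1:R))) (X1 (f1 s) x)) (Xn (f2 s / 2) x 1%N))).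
  by rewrite /r1; field.
have b2 : forall x, `|x| <= `|d| -> `|r2 x| <= B * `|x| ^+ 1.
  apply: (taylor_bound_step B0 d2); first by rewrite /r2 addr0 subrr.
  by move=> x _; rewrite expr0 mulr1.
have b1 : forall x, `|x| <= `|d| -> `|r1 x| <= B * `|x| ^+ 2.
  by apply: (taylor_bound_step B0 d1); rewrite // /r1 addr0 mulr0 !subrr.
apply: (taylor_bound_step B0 d0 _ b1 (lexx _)).
by rewrite /r0 addr0 subrr !expr0n/= !mulr0 !subr0.
Qed.

End Periodic.

Section Arith.
Context {R : realType}.

(** [N / D] is the tangent of the angle of a chord with the boundary, and it agrees for the two
    chords at a reflection point. As it equals [c * x] up to an error of order three on each side,
    so do [x0] and [x1] agree. *)
Lemma reflection_arith (c cm C d0 d1 D0 D1 N0 N1 x0 x1 : R) :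
  0 < cm <= c -> 0 <= C -> 0 < d0 -> 0 < d1 -> d0 / 2 <= D0 -> d1 / 2 <= D1 ->
  `|N1 - c * x1 * D1| <= C * d1 ^+ 4 -> `|N0 - c * x0 * D0| <= C * d0 ^+ 4 ->
  N1 * D0 = N0 * D1 ->
  cm * `|x1 - x0| <= 2 * C * (d0 ^+ 3 + d1 ^+ 3).
Proof.
move=> /andP[cm0 cmc] C0 d00 d10 hD0 hD1 h1 h0 e.
have D00 : 0 < D0 by lra.
have D10 : 0 < D1 by lra.
have c0 : 0 < c by lra.
have DD : 0 < D0 * D1 by exact: mulr_gt0.
rewrite -(ler_pM2r DD).
apply: (@le_trans _ _ (`|(N0 - c * x0 * D0) * D1 - (N1 - c * x1 * D1) * D0|)).
  have -> : (N0 - c * x0 * D0) * D1 - (N1 - c * x1 * D1) * D0 = c * (x1 - x0) * (D0 * D1).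
    by rewrite !mulrBl e; ring.
  rewrite !normrM (gtr0_norm c0) (gtr0_norm D00) (gtr0_norm D10).
  by rewrite ler_wpM2r ?(ltW DD)// ler_wpM2r.
apply: le_trans (ler_normB _ _) _; rewrite !(normrM (_ - _)) (gtr0_norm D00) (gtr0_norm D10).
have a1 : `|N0 - c * x0 * D0| * D1 <= C * d0 ^+ 3 * (2 * D0) * D1.
  rewrite ler_wpM2r ?(ltW D10)//; apply: le_trans h0 _; rewrite exprSr mulrA.
  by rewrite ler_wpM2l ?mulr_ge0 ?exprn_ge0 ?(ltW d00)//; lra.
have a2 : `|N1 - c * x1 * D1| * D0 <= C * d1 ^+ 3 * (2 * D1) * D0.
  rewrite ler_wpM2r ?(ltW D00)//; apply: le_trans h1 _; rewrite exprSr mulrA.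
  by rewrite ler_wpM2l ?mulr_ge0 ?exprn_ge0 ?(ltW d10)//; lra.
apply: le_trans (lerD a1 a2) _; rewrite le_eqVlt; apply/orP; left; apply/eqP; ring.
Qed.

(** Taking reciprocals divides the cubic error by [x0 * x1] and leaves one linear in the step, which
    can be summed along an orbit. Smallness of [eta] makes the steps comparable within a factor 2,
    and [6] is [2 + 4], from [x0 <= 2 * x1] and [x1 <= 2 * x0]. *)
Lemma reciprocal_step (C eta x0 x1 : R) : 0 < C -> 0 < x0 <= eta -> 0 < x1 <= eta ->
  C * eta ^+ 2 <= 4^-1 -> `|x1 - x0| <= C * (x0 ^+ 3 + x1 ^+ 3) ->
  x1 <= 2 * x0 /\ `|x1^-1 - x0^-1| <= 6 * C * x0.
Proof.
move=> C0 /andP[x00 x0e] /andP[x10 x1e] Ce h.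
have e0 : 0 < eta by lra.
have cube x : 0 < x -> x <= eta -> C * x ^+ 3 <= x / 4.
  move=> xp xe; rewrite exprSr mulrA [x / 4]mulrC ler_wpM2r ?(ltW xp)//.
  apply: le_trans Ce; rewrite ler_wpM2l ?(ltW C0)//.
  by apply: lerXn2r; rewrite ?nnegrE ?(ltW xp)// ltW.
have h0 := cube _ x00 x0e; have h1 := cube _ x10 x1e.
have h2 : `|x1 - x0| <= (x0 + x1) / 4 by apply: le_trans h _; rewrite mulrDr; lra.
have /andP[u1 u2] : x1 <= 2 * x0 <= 4 * x1 by move: h2; rewrite ler_norml; lra.
split => //.
have xx : 0 < x1 * x0 by exact: mulr_gt0.
have -> : x1^-1 - x0^-1 = (x0 - x1) / (x1 * x0) by field; rewrite !gt_eqF.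
rewrite normrM normfV (gtr0_norm xx) ler_pdivrMr// distrC.
apply: le_trans h _.
have k0 : x0 ^+ 3 <= 2 * x0 * (x1 * x0).
  have -> : 2 * x0 * (x1 * x0) = x0 ^+ 2 * (2 * x1) by ring.
  by rewrite exprSr ler_wpM2l ?sqr_ge0//; lra.
have k1 : x1 ^+ 3 <= 4 * x0 * (x1 * x0).
  have -> : 4 * x0 * (x1 * x0) = x1 * (2 * x0) ^+ 2 by ring.
  rewrite exprS ler_wpM2l ?(ltW x10)//.
  by apply: lerXn2r; rewrite ?nnegrE ?(ltW x10)//; lra.
have -> : 6 * C * x0 * (x1 * x0) = C * (2 * x0 * (x1 * x0) + 4 * x0 * (x1 * x0)) by ring.
by rewrite ler_wpM2l ?(ltW C0)// lerD.
Qed.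

End Arith.

(** * Expansion of chords in Lazutkin's coordinate *)

Section Lazutkin.
Context {R : realType} (D : set (R * R)) (l : R) (g T g2 g3 g4 : R -> R * R).
Context (SC : convex_arc D l g T g2 g3 g4).
Implicit Types (s t x : R).
Local Notation cos_out := (cos_out g T).
Local Notation cos_in := (cos_in g T).
Local Notation clen := (clen g).

Let l0 : 0 < l := len_gt0 SC.

(** Curvature and its first two derivatives; the fourth derivative of the boundary enters through
    [ka2]. *)
Let ka s := det2 (T s) (g2 s).
Let ka1 s := det2 (T s) (g3 s).
Let ka2 s := det2 (g2 s) (g3 s) + det2 (T s) (g4 s).

Let cg3 s : {for s, continuous g3}. Proof. exact: is_derive_continuous (arc_d3 SC s). Qed.
Let cg4 s : {for s, continuous g4}. Proof. exact: (arc_c4 SC). Qed.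
Let cT' s : {for s, continuous T}. Proof. exact: (cT SC). Qed.
Let cg2' s : {for s, continuous g2}. Proof. exact: (cg2 SC). Qed.

Let dka s : is_derive s 1 ka (ka1 s).
Proof.
apply: (is_derive_eq (is_derive_det2 (ddT SC s) (arc_d2 SC s))).
by rewrite det2xx add0r.
Qed.

Let dka1 s : is_derive s 1 ka1 (ka2 s).
Proof. exact: (is_derive_det2 (ddT SC s) (arc_d3 SC s)). Qed.

(** The power [kappa^(2/3)], written with [expR] and [ln], followed by its first two derivatives. *)
Let lq s := expR (2 / 3 * ln (ka s)).
Let lq1 s := lq s * (2 / 3 * (ka1 s / ka s)).
Let lq2 s := lq1 s * (2 / 3 * (ka1 s / ka s)) +
  lq s * (2 / 3 * (ka2 s / ka s - ka1 s * ka1 s / ka s ^+ 2)).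

Let ka0 s : 0 < ka s. Proof. exact: (kappa_gt0 SC). Qed.
Let lq0 s : 0 < lq s. Proof. exact: expR_gt0. Qed.

Let dlq s : is_derive s 1 lq (lq1 s).
Proof.
have h1 := @is_derive1_comp R (@ln R) ka s _ _ (is_derive1_ln (ka0 s)) (dka s).
have h2 := is_deriveZ (2 / 3) h1.
apply: (is_derive_eq (@is_derive1_comp R expR (fun x => 2 / 3 * ln (ka x)) s _ _ (is_derive_expR _) h2)).
by rewrite /lq1 /GRing.scale/= [_^-1 * _]mulrC.
Qed.

Let dlq1 s : is_derive s 1 lq1 (lq2 s).
Proof.
have h1 := @is_deriveV R ka s _ 1 (lt0r_neq0 (ka0 s)) (dka s).
have h2 : is_derive s 1 (fun y => ka1 y / ka y)
    (ka1 s * (- (ka s ^+ 2)^-1 * ka1 s) + (ka s)^-1 * ka2 s) by exact: is_deriveM (dka1 s) h1.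
have h3 : is_derive s 1 (fun y => 2 / 3 * (ka1 y / ka y))
    (2 / 3 * (ka1 s * (- (ka s ^+ 2)^-1 * ka1 s) + (ka s)^-1 * ka2 s)).
  exact: (@is_deriveZ R R R (fun y => ka1 y / ka y) (2 / 3) s 1 _ h2).
have h4 : is_derive s 1 lq1
    (lq s * (2 / 3 * (ka1 s * (- (ka s ^+ 2)^-1 * ka1 s) + (ka s)^-1 * ka2 s)) +
     (2 / 3 * (ka1 s / ka s)) * lq1 s) by exact: is_deriveM (dlq s) h3.
apply: (is_derive_eq h4); rewrite /lq2.
have := lt0r_neq0 (ka0 s); move: (ka s) (ka1 s) (ka2 s) (lq s) (lq1 s) => a b c d e a0.
by field.
Qed.

Let pT s : T (s + l) = T s. Proof. exact: (arc_T_per SC). Qed.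
Let pg2 s : g2 (s + l) = g2 s. Proof. exact: (arc_g2_per SC). Qed.
Let pg3 s : g3 (s + l) = g3 s. Proof. exact: (arc_g3_per SC). Qed.
Let pg4 s : g4 (s + l) = g4 s. Proof. exact: (arc_g4_per SC). Qed.

Let cka s : {for s, continuous ka}. Proof. exact: is_derive_continuous (dka s). Qed.
Let cka1 s : {for s, continuous ka1}. Proof. exact: is_derive_continuous (dka1 s). Qed.
Let cka2 s : {for s, continuous ka2}.
Proof. by apply: cvgD; apply: cont_det2; [exact: cg2'|exact: cg3|exact: cT'|exact: cg4]. Qed.
Let clq s : {for s, continuous lq}. Proof. exact: is_derive_continuous (dlq s). Qed.
Let clq1 s : {for s, continuous lq1}. Proof. exact: is_derive_continuous (dlq1 s). Qed.
Let clq2 s : {for s, continuous lq2}.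
Proof.
have cV : {for s, continuous (fun x => (ka x)^-1)}.
  by apply: cvgV; [rewrite gt_eqF|exact: cka].
have cV2 : {for s, continuous (fun x => (ka x ^+ 2)^-1)}.
  apply: cvgV; first by rewrite gt_eqF// exprn_gt0.
  by apply: cvgM; exact: cka.
apply: cvgD; apply: cvgM.
- exact: clq1.
- by apply: cvgM; [exact: cvg_cst|apply: cvgM; [exact: cka1|exact: cV]].
- exact: clq.
- apply: cvgM; first exact: cvg_cst.
  apply: cvgB; first by apply: cvgM; [exact: cka2|exact: cV].
  by apply: cvgM; [apply: cvgM; exact: cka1|exact: cV2].
Qed.

Let pka s : ka (s + l) = ka s. Proof. by rewrite /ka pT pg2. Qed.
Let pka1 s : ka1 (s + l) = ka1 s. Proof. by rewrite /ka1 pT pg3. Qed.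
Let pka2 s : ka2 (s + l) = ka2 s. Proof. by rewrite /ka2 pT pg2 pg3 pg4. Qed.
Let plq s : lq (s + l) = lq s. Proof. by rewrite /lq pka. Qed.
Let plq1 s : lq1 (s + l) = lq1 s. Proof. by rewrite /lq1 plq pka pka1. Qed.
Let plq2 s : lq2 (s + l) = lq2 s. Proof. by rewrite /lq2 plq plq1 pka pka1 pka2. Qed.

Let det_bound (u : R -> R * R) : (forall s, u (s + l) = u s) ->
  (forall s, {for s, continuous u}) -> exists2 B, 0 < B & forall s x,
    `|det2 (T s) (u x)| <= B /\ `|dot2 (T s) (u x)| <= B.
Proof.
move=> pu cu.
have cn : continuous (fun x => norm2 (u x)) by move=> x; exact: cont_norm2.
have [B B0 hB] := per_bounded l0 (fun s => congr1 norm2 (pu s)) cn.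
exists B => // s x.
have e := unit_decomp (u x) (T_unit SC s).
have h : norm2 (u x) ^+ 2 <= B ^+ 2.
  apply: lerXn2r; rewrite ?nnegrE ?sqrtr_ge0 ?(ltW B0)//.
  by apply: le_trans (ler_norm _) (hB x).
rewrite norm2_sqr e in h.
split; rewrite -(@ler_pXn2r _ 2) ?nnegrE ?normr_ge0 ?(ltW B0)// real_normK ?num_real//.
  by apply: le_trans h; rewrite lerDr sqr_ge0.
by apply: le_trans h; rewrite lerDl sqr_ge0.
Qed.

Let dotTg2 s : dot2 (T s) (g2 s) = 0.
Proof.
have h := is_derive_dot2 (ddT SC s) (ddT SC s).
have h2 : is_derive s 1 (fun z => dot2 (T z) (T z)) 0.
  have -> : (fun z => dot2 (T z) (T z)) = cst 1 by apply/funext => z; exact: (T_unit SC).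
  exact: is_derive_cst.
have [_ e1] := h; have [_ e2] := h2.
by move: e1; rewrite e2 (dot2C (g2 s)) => e3; lra.
Qed.

(** The exponent 2/3 is made for this estimate. Up to higher order the determinant is
    [ka/2 x^2 + ka1/6 x^3], the scalar product is [x], and the increment of [K] is
    [lq x + lq1/2 x^2]; the cubic terms match because [lq1 / lq = 2/3 ka1 / ka]. Negative [x] are
    allowed, so one expansion serves the chords before and after a reflection. *)
Lemma lazutkin_taylor : exists K : R -> R, exists C h0 : R,
  [/\ forall s : R, is_derive s 1 K (lq s), 0 < C, 0 < h0 <= 1 &
  forall s x, `|x| <= h0 ->
   `|det2 (T s) (g (s + x) - g s) - ka s / (2 * lq s) * (K (s + x) - K s) * dot2 (T s) (g (s + x) - g s)|
     <= C * `|x| ^+ 4 /\ `|dot2 (T s) (g (s + x) - g s) - x| <= `|x| / 2].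
Proof.
have [K dK] := antiderivative clq.
have [B4 B40 hB4] := det_bound pg4 cg4.
have [B3 B30 hB3] := det_bound pg3 cg3.
have [BQ BQ0 hBQ] := per_bounded l0 plq2 clq2.
have [B1 B10 hB1] := per_bounded l0 plq1 clq1.
have [B0 B00 hB0] := per_bounded l0 plq clq.
have ccc : continuous (fun s => ka s / (2 * lq s)).
  move=> s; apply: cvgM; first exact: cka.
  apply: cvgV; first by rewrite gt_eqF// mulr_gt0.
  by apply: cvgM; [exact: cvg_cst|exact: clq].
have pcc s : ka (s + l) / (2 * lq (s + l)) = ka s / (2 * lq s) by rewrite pka plq.
have [BC BC0 hBC] := per_bounded l0 pcc ccc.
exists K, (B4 + BC * (B0 + B1) * B3 + BC * BQ + BC * BQ * B3), (Num.min 1 (1 / (2 * B3))).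
split => //.
- by rewrite !addr_gt0// !mulr_gt0// addr_gt0.
- by rewrite ge_min lexx lt_min ltr01 divr_gt0// mulr_gt0.
move=> s x; rewrite le_min => /andP[x1 xB].
set X := `|x|; have X0 : 0 <= X by exact: normr_ge0.
set N := det2 _ _; set E := dot2 _ _.
have hN : `|N - ka s / 2 * x ^+ 2 - ka1 s / 6 * x ^+ 3| <= B4 * X ^+ 4.
  have := @taylor4 R (fun y => det2 (T s) (g y - g s)) (fun y => det2 (T s) (T y))
    (fun y => det2 (T s) (g2 y)) (fun y => det2 (T s) (g3 y)) (fun y => det2 (T s) (g4 y))
    B4 s (ltW B40) _ _ _ _ _ (det2xx _) x.
  rewrite subrr det2r0 subr0; apply.
  - by move=> y; exact: (is_derive_detg SC).
  - by move=> y; apply: is_derive_det2r; exact: (ddT SC).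
  - by move=> y; apply: is_derive_det2r; exact: (arc_d2 SC).
  - by move=> y; apply: is_derive_det2r; exact: (arc_d3 SC).
  - by move=> y; have [] := hB4 s y.
have hE : `|E - x| <= B3 * X ^+ 3.
  have := @taylor3 R (fun y => dot2 (T s) (g y - g s)) (fun y => dot2 (T s) (T y))
    (fun y => dot2 (T s) (g2 y)) (fun y => dot2 (T s) (g3 y)) B3 s (ltW B30) _ _ _ _ x.
  have d0 : dot2 (T s) 0 = 0 by rewrite /dot2/=; ring.
  rewrite subrr d0 (T_unit SC) dotTg2 !mul0r !subr0 mul1r; apply.
  - by move=> y; apply: is_derive_dot2r; apply: is_derive_subr; exact: (dT SC).
  - by move=> y; apply: is_derive_dot2r; exact: (ddT SC).
  - by move=> y; apply: is_derive_dot2r; exact: (arc_d2 SC).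
  - by move=> y; have [] := hB3 s y.
have hK : `|K (s + x) - K s - lq s * x - lq1 s / 2 * x ^+ 2| <= BQ * X ^+ 3.
  by apply: (taylor3 s (ltW BQ0) dK dlq dlq1 hBQ).
have {}hBC := hBC s; have {}hB0 := hB0 s; have {}hB1 := hB1 s.
set cc := ka s / (2 * lq s) in hBC *.
set rN := N - _ - _ in hN; set rE := E - x in hE; set rK := K (s + x) - _ - _ - _ in hK.
split; last first.
  apply: le_trans hE _; rewrite exprS mulrCA ler_wpM2l//.
  have x2 : X ^+ 2 <= X by rewrite expr2 ler_piMr.
  have : B3 * X <= 2^-1.
    by move: xB; rewrite -/X ler_pdivlMr ?mulr_gt0//; lra.
  by apply: le_trans; rewrite ler_wpM2l// ltW.
have eq : N - cc * (K (s + x) - K s) * E =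
   rN - cc * (lq s * x + lq1 s / 2 * x ^+ 2) * rE - cc * rK * x - cc * rK * rE.
  rewrite /rN /rE /rK /cc /lq1.
  have := lt0r_neq0 (ka0 s); have := lt0r_neq0 (lq0 s).
  by move: (ka s) (ka1 s) (lq s) => a b d d0 a0; field; rewrite a0 d0.
have hin : `|lq s * x + lq1 s / 2 * x ^+ 2| <= (B0 + B1) * X.
  apply: le_trans (ler_normD _ _) _; rewrite mulrDl; apply: lerD.
    by rewrite normrM ler_wpM2r.
  rewrite -mulrA normrM; apply: ler_pM => //.
  have XX : X ^+ 2 <= X by rewrite expr2 ler_piMr.
  rewrite normrM normrX -/X (@gtr0_norm _ 2^-1) ?invr_gt0//.
  by apply: le_trans XX; rewrite ler_piMl ?sqr_ge0// invf_le1// ler1n.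
have X14 : X ^+ 3 * X ^+ 3 <= X ^+ 4.
  by rewrite -exprD (exprD X 4 2) ler_piMr ?exprn_ge0// exprn_ile1.
have tri (a b c d : R) : `|a - b - c - d| <= `|a| + `|b| + `|c| + `|d|.
  apply: le_trans (ler_normB _ _) _; rewrite lerD2r.
  by apply: le_trans (ler_normB _ _) _; rewrite lerD2r; exact: ler_normB.
rewrite eq; apply: le_trans (tri _ _ _ _) _; rewrite !(normrM (cc * _)) !(normrM cc) -/X.
have t1 : `|cc| * `|lq s * x + lq1 s / 2 * x ^+ 2| * `|rE| <= BC * (B0 + B1) * B3 * X ^+ 4.
  have -> : BC * (B0 + B1) * B3 * X ^+ 4 = BC * ((B0 + B1) * X) * (B3 * X ^+ 3) by ring.
  by rewrite ler_pM ?mulr_ge0// ler_pM.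
have t2 : `|cc| * `|rK| * X <= BC * BQ * X ^+ 4.
  have -> : BC * BQ * X ^+ 4 = BC * (BQ * X ^+ 3) * X by ring.
  by rewrite ler_wpM2r// ler_pM.
have t3 : `|cc| * `|rK| * `|rE| <= BC * BQ * B3 * X ^+ 4.
  have -> : `|cc| * `|rK| * `|rE| = `|cc| * (`|rK| * `|rE|) by rewrite mulrA.
  have -> : BC * BQ * B3 * X ^+ 4 = BC * (BQ * B3 * X ^+ 4) by ring.
  rewrite ler_pM ?mulr_ge0//.
  apply: (@le_trans _ _ ((BQ * X ^+ 3) * (B3 * X ^+ 3))); first by rewrite ler_pM.
  have -> : BQ * X ^+ 3 * (B3 * X ^+ 3) = BQ * B3 * (X ^+ 3 * X ^+ 3) by ring.
  by rewrite ler_wpM2l// mulr_ge0// ltW.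
by rewrite !mulrDl; lra.
Qed.

(* In the coordinate [K], with [K' = kappa^(2/3)], the lengths of consecutive steps of a
   billiard orbit agree up to third order. *)
Lemma lazutkin_step : exists K : R -> R, exists C h0 : R,
  [/\ K 0 = 0, forall s, K (s + l) = K s + K l, {homo K : x y / x < y}, continuous K &
   [/\ 0 < C, 0 < h0 < l & forall s0 s1 s2, s0 < s1 -> s1 < s2 -> s1 - s0 <= h0 -> s2 - s1 <= h0 ->
     cos_in s0 s1 = cos_out s1 s2 ->
     K s2 - K s1 <= 2 * (K s1 - K s0) /\
     `|(K s2 - K s1)^-1 - (K s1 - K s0)^-1| <= C * (K s1 - K s0)]].
Proof.
have [K [C [h [dK C0 /andP[hp h1] H]]]] := lazutkin_taylor.
have [Bq Bq0 hBq] := per_bounded l0 plq clq.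
have [bq bq0 hbq] := per_pos l0 plq clq lq0.
have [bk bk0 hbk] := per_pos l0 pka cka ka0.
pose cm := bk / (2 * Bq).
have cm0 : 0 < cm by rewrite divr_gt0// mulr_gt0.
have hcm s : 0 < cm <= ka s / (2 * lq s).
  rewrite cm0 /= ler_pM//; [exact: ltW|by rewrite invr_ge0 mulr_ge0// ltW|].
  rewrite lef_pV2 ?posrE ?mulr_gt0// ler_wpM2l//.
  by apply: le_trans (hBq s); exact: ler_norm.
pose C' := 2 * C / (cm * bq ^+ 3).
have C'0 : 0 < C' by apply: divr_gt0; [exact: mulr_gt0|rewrite mulr_gt0// exprn_gt0].
have Kb x y : x < y -> bq * (y - x) <= K y - K x <= Bq * (y - x).
  move=> xy; have [z [_ ->]] := MVTd xy (fun z _ => dK z).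
  rewrite !ler_wpM2r ?subr_ge0 ?(ltW xy)//= ?hbq//.
  by apply: le_trans (hBq z); exact: ler_norm.
have Kper s : K (s + l) - K s = K l - K 0.
  rewrite -[in RHS](add0r l).
  apply: (@is_derive0_const _ (fun x => K (x + l) - K x)) => x.
  have d1 := dK (x + l); rewrite plq in d1.
  have d2 : is_derive x 1 (fun y : R => y + l) 1.
    by apply: (is_derive_eq (is_deriveD (is_derive_id x (1:R)) (is_derive_cst l x (1:R)))); rewrite addr0.
  have d3 := @is_derive1_comp R K (fun y => y + l) x _ _ d1 d2.
  by apply: (is_derive_eq (is_deriveB d3 (dK x))); rewrite mulr1 subrr.
(* Small enough for [reciprocal_step]: [eta <= 1] and [C' * eta <= 1 / 4]. *)
pose eta := Num.min 1 (1 / (4 * C')).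
have eta0 : 0 < eta by rewrite lt_min ltr01 /= divr_gt0//; exact: mulr_gt0.
have etaC : C' * eta ^+ 2 <= 4^-1.
  have e1 : eta <= 1 by rewrite ge_min lexx.
  have e2 : eta <= 1 / (4 * C') by rewrite ge_min lexx orbT.
  apply: (@le_trans _ _ (C' * eta)); first by rewrite ler_wpM2l ?(ltW C'0)// expr2 ler_piMr ?(ltW eta0).
  have C4 : 0 < 4 * C' by exact: mulr_gt0.
  rewrite (ler_pdivlMr _ _ C4) in e2.
  by rewrite -[4^-1]mul1r ler_pdivlMr//; lra.
have [h' [h'0 h'h h'l h'e]] : exists h', [/\ 0 < h', h' <= h, h' < l & Bq * h' <= eta].
  exists (Num.min h (Num.min (l / 2) (eta / Bq))); split.
  - by rewrite !lt_min hp !divr_gt0.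
  - by rewrite ge_min lexx.
  - by rewrite !gt_min ltr_pdivrMr// ltr_pMr// ltr1n orbT.
  - by rewrite mulrC -ler_pdivlMr// !ge_min lexx !orbT.
exists (fun s => K s - K 0), (6 * C'), h'; split.
- by rewrite subrr.
- by move=> s; have := Kper s; lra.
- move=> x y xy; have /andP[k _] := Kb x y xy.
  have : 0 < bq * (y - x) by rewrite mulr_gt0// subr_gt0.
  lra.
- by move=> s; apply: cvgB; [exact: is_derive_continuous (dK s)|exact: cvg_cst].
split; [by rewrite mulr_gt0|by rewrite h'0|].
move=> s0 s1 s2 s01 s12 d0h d1h ref.
have -> : K s2 - K 0 - (K s1 - K 0) = K s2 - K s1 by ring.
have -> : K s1 - K 0 - (K s0 - K 0) = K s1 - K s0 by ring.
have /andP[k0 k0'] := Kb _ _ s01; have /andP[k1 k1'] := Kb _ _ s12.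
have [p0 p1] : 0 < s1 - s0 /\ 0 < s2 - s1 by split; rewrite subr_gt0.
have x0b : 0 < K s1 - K s0 <= eta.
  apply/andP; split; first by apply: lt_le_trans k0; rewrite mulr_gt0.
  by apply: le_trans k0' _; apply: le_trans h'e; rewrite ler_wpM2l// ltW.
have x1b : 0 < K s2 - K s1 <= eta.
  apply/andP; split; first by apply: lt_le_trans k1; rewrite mulr_gt0.
  by apply: le_trans k1' _; apply: le_trans h'e; rewrite ler_wpM2l// ltW.
apply: (reciprocal_step C'0 x0b x1b etaC).
have ch0 : s0 < s1 < s0 + l by rewrite s01 /= -ltrBlDl (le_lt_trans d0h).
have ch1 : s1 < s2 < s1 + l by rewrite s12 /= -ltrBlDl (le_lt_trans d1h).
have [H1 D1] := H s1 (s2 - s1) ltac:(by rewrite gtr0_norm// (le_trans d1h)).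
have [H0 D0] := H s1 (- (s1 - s0)) ltac:(by rewrite normrN gtr0_norm// (le_trans d0h)).
rewrite (_ : s1 + (s2 - s1) = s2) ?(gtr0_norm p1) in H1 D1; last by ring.
rewrite (_ : s1 + - (s1 - s0) = s0) ?normrN ?(gtr0_norm p0) in H0 D0; last by ring.
(* The cosines agree and both determinants are positive, so the two chords make angles of the same
   tangent at [s1]. *)
have sgn : det2 (T s1) (g s2 - g s1) * dot2 (T s1) (g s1 - g s0) =
           det2 (T s1) (g s0 - g s1) * dot2 (T s1) (g s2 - g s1).
  have L0 := clen_gt0 SC ch0; have L1 := clen_gt0 SC ch1.
  have N0 := chord_detB SC ch0; have N1 := chord_detA SC ch1.
  have e0 := unit_decomp (g s0 - g s1) (T_unit SC s1).
  have e1 := unit_decomp (g s2 - g s1) (T_unit SC s1).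
  rewrite -norm2_sqr -clen_sym in e0; rewrite -norm2_sqr -/(clen s1 s2) in e1.
  have sw : dot2 (T s1) (g s0 - g s1) = - dot2 (T s1) (g s1 - g s0) by rewrite !dot2Br; ring.
  move: ref; rewrite /cos_in /cos_out.
  rewrite sw in e0; move: L0 L1 N0 N1 e0 e1.
  move: (clen s0 s1) (clen s1 s2) (det2 (T s1) (g s0 - g s1)) (det2 (T s1) (g s2 - g s1))
    (dot2 (T s1) (g s1 - g s0)) (dot2 (T s1) (g s2 - g s1)) => L0 L1 N0 N1 E0 E1.
  move=> L00 L10 N00 N10 e0 e1 ref.
  have r : E1 = E0 / L0 * L1 by rewrite ref mulfVK// gt_eqF.
  have n : N1 = N0 / L0 * L1.
    apply/eqP; rewrite -(@eqrXn2 _ 2) ?(ltW N10)// ?mulr_ge0 ?invr_ge0 ?(ltW N00) ?(ltW L00) ?(ltW L10)//.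
    have -> : N1 ^+ 2 = L1 ^+ 2 - E1 ^+ 2 by rewrite e1; ring.
    have N0e : N0 ^+ 2 = L0 ^+ 2 - E0 ^+ 2 by rewrite e0; ring.
    rewrite r !exprMn exprVn N0e; apply/eqP; field; exact: lt0r_neq0.
  by rewrite n r; ring.
have N0' : `|det2 (T s1) (g s0 - g s1) - ka s1 / (2 * lq s1) * (K s1 - K s0) * dot2 (T s1) (g s1 - g s0)|
    <= C * (s1 - s0) ^+ 4.
  apply: le_trans H0; rewrite le_eqVlt; apply/orP; left; apply/eqP; congr `|_|.
  by rewrite !(dot2Br (T s1)); ring.
have E0' : (s1 - s0) / 2 <= dot2 (T s1) (g s1 - g s0).
  by move: D0; rewrite ler_norml !dot2Br; lra.
have E1' : (s2 - s1) / 2 <= dot2 (T s1) (g s2 - g s1) by move: D1; rewrite ler_norml; lra.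
have := reflection_arith (hcm s1) (ltW C0) p0 p1 E0' E1' H1 N0' sgn.
rewrite mulrC -ler_pdivlMr// => /le_trans; apply.
have cb d x : 0 < d -> bq * d <= x -> d ^+ 3 <= x ^+ 3 / bq ^+ 3.
  move=> d0 dx; rewrite ler_pdivlMr ?exprn_gt0// -exprMn mulrC.
  have db : 0 <= bq * d by rewrite mulr_ge0// ltW.
  by apply: lerXn2r => //; rewrite nnegrE// (le_trans db).
have c0 := cb _ _ p0 k0; have c1 := cb _ _ p1 k1.
have -> : C' * ((K s1 - K s0) ^+ 3 + (K s2 - K s1) ^+ 3) =
    2 * C * ((K s1 - K s0) ^+ 3 / bq ^+ 3 + (K s2 - K s1) ^+ 3 / bq ^+ 3) / cm.
  by rewrite /C'; field; rewrite !gt_eqF.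
rewrite ler_wpM2r ?invr_ge0 ?(ltW cm0)// ler_wpM2l ?mulr_ge0 ?(ltW C0)//.
exact: lerD.
Qed.

End Lazutkin.

(** * Rotation numbers and action-angle coordinates *)

Section Rotation.
Context {R : realType} (D : set (R * R)) (l : R) (g T g2 g3 g4 : R -> R * R).
Context (SC : convex_arc D l g T g2 g3 g4).
Context (J0 : R) (c : R -> R -> R) (F : invariant_family l g T J0 c).
Implicit Types (s t x y J e : R).
Local Notation nextpt := (nextpt l g T c).
Local Notation flux := (flux c).
Local Notation cos_out := (cos_out g T).

Let l0 : 0 < l := len_gt0 SC.

Definition xcoord s J := flux s J / flux l J.
Definition rotnum J := xcoord (nextpt 0 J) J.

Lemma flux_incr s t J : 0 < J < J0 -> s < t -> flux s J < flux t J.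
Proof.
move=> Jb st; have [k0 [k1 [eta [k00 eta0 Hb H]]]] := flux_bound SC F Jb.
have := H J s t; rewrite subrr normr0 => /(_ eta0 (ltW st)) /andP[a _].
have : 0 < k0 * (t - s) by rewrite mulr_gt0// subr_gt0.
lra.
Qed.

Lemma flux_l_gt0 J : 0 < J < J0 -> 0 < flux l J.
Proof. by move=> Jb; rewrite -(flux0 SC F Jb); exact: flux_incr. Qed.

Lemma xcoord_incr s t J : 0 < J < J0 -> s < t -> xcoord s J < xcoord t J.
Proof.
by move=> Jb st; rewrite /xcoord ltr_pM2r ?invr_gt0 ?flux_l_gt0//; exact: flux_incr.
Qed.

Lemma xcoord_le s t J : 0 < J < J0 -> s <= t -> xcoord s J <= xcoord t J.
Proof.
by move=> Jb; rewrite le_eqVlt => /predU1P[->//|st]; apply: ltW; exact: xcoord_incr.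
Qed.

Lemma xcoord0 J : 0 < J < J0 -> xcoord 0 J = 0.
Proof. by move=> Jb; rewrite /xcoord (flux0 SC F)// mul0r. Qed.

Lemma xcoord_per s J : 0 < J < J0 -> xcoord (s + l) J = xcoord s J + 1.
Proof.
move=> Jb; rewrite /xcoord (flux_per SC F)// mulrDl divff// gt_eqF//.
exact: flux_l_gt0.
Qed.

Lemma xcoord_perz s (k : int) J : 0 < J < J0 -> xcoord (s + k%:~R * l) J = xcoord s J + k%:~R.
Proof.
move=> Jb; have H (n : nat) t : xcoord (t + n%:R * l) J = xcoord t J + n%:R.
  elim: n => [|n IH]; first by rewrite mul0r !addr0.
  by rewrite -natr1 mulrDl mul1r !addrA xcoord_per// IH.
case: k => n; first exact: H.
rewrite NegzE !mulrNz mulNr -{2}(subrK (n.+1%:R * l) s) H.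
by rewrite addrK.
Qed.

Lemma xcoord_nextpt s J : 0 < J < J0 -> xcoord (nextpt s J) J = xcoord s J + rotnum J.
Proof.
move=> Jb; have := flux_nextpt SC F s 0 Jb; rewrite (flux0 SC F)// subr0 => e.
by rewrite /rotnum /xcoord -e -mulrDl addrC subrK.
Qed.

Lemma rot_gt0 J : 0 < J < J0 -> 0 < rotnum J.
Proof.
move=> Jb; have [/andP[h _] _] := nextptP SC F 0 Jb.
by have := xcoord_incr Jb h; rewrite xcoord0.
Qed.

Lemma xcoord_cont s J : 0 < J < J0 -> {for (s, J), continuous (fun p : R * R => xcoord p.1 p.2)}.
Proof.
move=> Jb; apply: cvgM; first exact: (flux_cont SC F).
apply: cvgV; first by rewrite gt_eqF//; exact: flux_l_gt0.
by apply: (cont2_comp (@cont_cst _ _ l _) (@cont_snd _ _)); exact: (flux_cont SC F).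
Qed.

Lemma rot_cont J : 0 < J < J0 -> {for J, continuous rotnum}.
Proof.
move=> Jb.
have c1 : {for J, continuous (fun J => nextpt 0 J)}.
  apply: (cont2_comp (@cont_cst _ _ (0 : R) _) (@cont_id _ _)).
  exact: (nextpt_cont SC F).
by apply: (cont2_comp c1 (@cont_id _ _)); exact: xcoord_cont.
Qed.

Lemma xcoord_conts s J : 0 < J < J0 -> {for s, continuous (xcoord^~ J)}.
Proof.
by move=> Jb; apply: (cont2_comp (@cont_id _ _) (@cont_cst _ _ J _)); exact: xcoord_cont.
Qed.

Lemma xcoordl J : 0 < J < J0 -> xcoord l J = 1.
Proof. by move=> Jb; rewrite -[l]add0r xcoord_per// xcoord0// add0r. Qed.

Lemma xcoord_close s J1 J2 : 0 < J1 < J0 -> 0 < J2 < J0 -> xcoord s J1 <= xcoord s J2 + 1.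
Proof.
move=> b1 b2; have [k /andP[k0 kl]] := per_reduce s l0.
have a1 := xcoord_perz s k b1; have a2 := xcoord_perz s k b2.
have h1 := xcoord_le b1 (ltW kl); rewrite xcoordl// in h1.
have h2 := xcoord_le b2 k0; rewrite xcoord0// in h2.
lra.
Qed.

(* In the coordinate of the slower map, a rotation, compactness gives a
   uniform gain of the faster map at each step. *)
Lemma rot_incr J1 J2 : 0 < J1 -> J1 < J2 -> J2 < J0 -> rotnum J1 < rotnum J2.
Proof.
move=> h1 h12 h2; have b1 : 0 < J1 < J0 by rewrite h1 (lt_trans h12).
have b2 : 0 < J2 < J0 by rewrite h2 (lt_trans h1).
pose f s := xcoord (nextpt s J2) J1 - xcoord (nextpt s J1) J1.
have fp s : f (s + l) = f s.
  by rewrite /f !(nextpt_per SC F)// !xcoord_per//; ring.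
have cf : continuous f.
  move=> s; apply: cvgB.
    apply: (@continuous_comp _ _ _ (nextpt^~ J2) (xcoord^~ J1)); last exact: xcoord_conts.
    exact: (nextpt_conts SC F).
  apply: (@continuous_comp _ _ _ (nextpt^~ J1) (xcoord^~ J1)); last exact: xcoord_conts.
  exact: (nextpt_conts SC F).
have f0 s : 0 < f s.
  by rewrite subr_gt0; apply: xcoord_incr => //; exact: (nextpt_incrJ SC F).
have [eta eta0 hf] := per_pos l0 fp cf f0.
(* Along this orbit the coordinate of [J2] is exactly [n * rotnum J2], that of [J1] is at least
   [n * (rotnum J1 + eta)], and by [xcoord_close] the latter exceeds the former by at most 1. *)
pose o n := iter n (nextpt^~ J2) 0.
have o2 n : xcoord (o n) J2 = n%:R * rotnum J2.
  elim: n => [|n IH]; first by rewrite mul0r /o /= xcoord0.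
  by rewrite /o /= xcoord_nextpt// -/(o n) IH -natr1 mulrDl mul1r.
have o1 n : n%:R * (rotnum J1 + eta) <= xcoord (o n) J1.
  elim: n => [|n IH]; first by rewrite mul0r /o /= xcoord0.
  have := hf (o n); rewrite /f xcoord_nextpt// => h.
  by rewrite /o /= -/(o n) -natr1 mulrDl mul1r; lra.
suff : rotnum J1 + eta <= rotnum J2 by lra.
rewrite leNgt; apply/negP => lt; pose d := rotnum J1 + eta - rotnum J2.
have d0 : 0 < d by rewrite subr_gt0.
have [n hn] := exists_shift (- 2) d0.
have a := o1 n; have b := xcoord_close (o n) b1 b2; rewrite o2 in b.
have : n%:R * d <= 1 by rewrite /d mulrBr; lra.
lra.
Qed.

(** By compactness the chords from [s] to [s + d] make angles bounded away from 0, whereas the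
    directions of the curve [J] tend to the tangent uniformly in [s]. *)
Lemma nextpt_small e : 0 < e -> exists2 J1, 0 < J1 < J0 &
  forall s J, 0 < J <= J1 -> nextpt s J < s + e.
Proof.
move=> e0.
have [d [d0 de dl]] : exists d, [/\ 0 < d, d <= e & d < l].
  exists (Num.min e (l / 2)); split.
  - by rewrite lt_min e0 divr_gt0.
  - by rewrite ge_min lexx.
  - by rewrite gt_min ltr_pdivrMr// ltr_pMr// ltr1n orbT.
have sb s : s < s + d < s + l by rewrite ltrDl d0 ltrD2l.
have f0 s : 0 < 1 - cos_out s (s + d) by have /andP[_ h] := cos_out_bound SC (sb s); rewrite subr_gt0.
have fp s : 1 - cos_out (s + l) (s + l + d) = 1 - cos_out s (s + d).
  by rewrite addrAC (cos_out_per SC).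
have cf : continuous (fun s => 1 - cos_out s (s + d)).
  move=> s; apply: cvgB; first exact: cvg_cst.
  have ch : {for s, continuous (fun s => s + d)} by apply: cvgD; [exact: cvg_id|exact: cvg_cst].
  exact: (cont_cos_out SC (@cont_id _ s) ch (sb s)).
have [b b0 hb] := per_pos l0 fp cf f0.
have [J1 J1b hJ] := fam_unif F b0.
exists J1 => // s J Jb.
have Jb0 : 0 < J < J0.
  by case/andP: Jb J1b => j1 j2 /andP[j3 j4]; rewrite j1 (le_lt_trans j2).
apply: (@lt_le_trans _ _ (s + d)); last by rewrite lerD2l.
apply: (nextpt_gt SC F) => //.
by have := hJ s J Jb; have := hb s; lra.
Qed.

(** On the orbit of 0 [xcoord] grows by exactly [rotnum J] per step. The steps [xi n] in the
    coordinate [K] have reciprocals within [C * K (o n)] of that of [xi 0], so they equal [xi 0] up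
    to a relative error of order [xi 0]. Hence both coordinates are proportional to [n] up to an
    error of order [xi 0], and their known values at [l] fix the ratio. *)
Lemma xcoord_limit : exists k : R -> R,
  [/\ k 0 = 0, forall s, k (s + l) = k s + 1, {homo k : x y / x < y}, continuous k &
   forall e, 0 < e -> exists2 J1, 0 < J1 < J0 & forall s J, 0 < J <= J1 -> `|xcoord s J - k s| < e].
Proof.
have [K [C [h0 [K0 Kper Kinc Kc [C0 /andP[h00 h0l] step]]]]] := lazutkin_step SC.
have Kl : 0 < K l by rewrite -K0; exact: Kinc.
exists (fun s => K s / K l); split.
- by rewrite K0 mul0r.
- by move=> s; rewrite Kper mulrDl divff// gt_eqF.
- by move=> x y xy; rewrite ltr_pM2r ?invr_gt0//; exact: Kinc.
- by move=> s; apply: cvgM; [exact: Kc|exact: cvg_cst].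
move=> e e0.
have Kle x y : x <= y -> K x <= K y.
  by rewrite le_eqVlt => /predU1P[->//|/Kinc/ltW].
(* [Q * xi 0] will bound the relative drift of the steps while the orbit stays below [2 * l]; [Q1]
   adds one whole step, since a given point lies between two impacts. *)
pose Q := C * (2 * K l). 
have Q0 : 0 < Q by rewrite mulr_gt0// mulr_gt0.
pose Q1 := Q * (2 * K l) + 1.
have Q10 : 0 < Q1 by rewrite ltr_wpDl// mulr_ge0// ltW// mulr_gt0.
(* choose the step so small that 2 Q1 (K d - K 0) < e K l *)
have [d [d0 dh Kd]] : exists d, [/\ 0 < d, d <= h0 & K d <= e * K l / (4 * Q1)].
  have eb : 0 < e * K l / (4 * Q1) by apply: divr_gt0; exact: mulr_gt0.
  have [d' d'0 hd'] := (cont_eps _ _).1 (Kc 0) _ eb.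
  exists (Num.min h0 (d' / 2)); split.
  - by rewrite lt_min h00 divr_gt0.
  - by rewrite ge_min lexx.
  - have m0 : 0 < Num.min h0 (d' / 2) by rewrite lt_min h00 divr_gt0.
    have m1 : Num.min h0 (d' / 2) < d'.
      by rewrite gt_min ltr_pdivrMr// ltr_pMr// ltr1n orbT.
    have := hd' (Num.min h0 (d' / 2)); rewrite K0 subr0 => hh.
    apply: ltW; apply: le_lt_trans (ler_norm _) _; apply: hh.
    by rewrite /ball/= sub0r normrN gtr0_norm.
have [J1 J1b hJ] := nextpt_small d0.
exists J1 => // s J Jb.
have Jb0 : 0 < J < J0.
  by case/andP: Jb J1b => j1 j2 /andP[j3 j4]; rewrite j1 (le_lt_trans j2).
suff H t : 0 <= t < l -> `|xcoord t J - K t / K l| < e.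
  have [k kb] := per_reduce s l0; have := H _ kb.
  rewrite xcoord_perz//.
  have -> : K (s + k%:~R * l) / K l = K s / K l + k%:~R.
    have Kn (n : nat) u : K (u + n%:R * l) = K u + n%:R * K l.
      elim: n => [|n IH]; first by rewrite !mul0r !addr0.
      by rewrite -natr1 !mulrDl !mul1r !addrA Kper IH.
    have -> : K (s + k%:~R * l) = K s + k%:~R * K l.
      case: k {kb} => n; first exact: Kn.
      rewrite NegzE !mulrNz !mulNr -{2}(subrK (n.+1%:R * l) s) Kn.
      by rewrite addrK.
    by rewrite mulrDl mulfK// gt_eqF.
  by rewrite opprD addrACA subrr addr0.
pose o n := iter n (nextpt^~ J) 0.
have on n : o n.+1 = nextpt (o n) J by [].
have oinc n : o n < o n.+1 by rewrite on; have [/andP[]] := nextptP SC F (o n) Jb0.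
have ostep n : o n.+1 - o n <= h0.
  by have := hJ (o n) J Jb; rewrite -on; lra.
pose xi n := K (o n.+1) - K (o n).
have xi0 n : 0 < xi n by rewrite subr_gt0; apply: Kinc.
have rec n : `|(xi n.+1)^-1 - (xi n)^-1| <= C * xi n.
  have h : K (o n.+2) - K (o n.+1) <= 2 * (K (o n.+1) - K (o n)) /\
      `|(K (o n.+2) - K (o n.+1))^-1 - (K (o n.+1) - K (o n))^-1| <= C * (K (o n.+1) - K (o n)).
    apply: step => //.
    rewrite [in LHS]on (nextpt_cos_in SC F) // -on [in RHS]on.
    by have [_ ->] := nextptP SC F (o n.+1) Jb0.
  by case: h.
have o0 : o 0%N = 0 by [].
(* The errors telescope because the steps [xi] sum up to [K (o n)]. *)
have rec0 n : `|(xi n)^-1 - (xi 0)^-1| <= C * K (o n).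
  elim: n => [|n IH]; first by rewrite subrr normr0 o0 K0 mulr0.
  have -> : (xi n.+1)^-1 - (xi 0)^-1 = ((xi n.+1)^-1 - (xi n)^-1) + ((xi n)^-1 - (xi 0)^-1) by ring.
  apply: le_trans (ler_normD _ _) _; apply: le_trans (lerD (rec n) IH) _.
  by rewrite -mulrDr /xi subrK.
have Ko n : 0 <= K (o n).
  elim: n => [|n IH]; first by rewrite o0 K0.
  by apply: le_trans IH _; apply: ltW; apply: Kinc.
have omono m n : (m <= n)%N -> o m <= o n.
  elim: n => [|n IH]; first by rewrite leqn0 => /eqP ->.
  rewrite leq_eqVlt => /predU1P[->//|]; rewrite ltnS => /IH h.
  by apply: le_trans h _; apply: ltW; exact: oinc.
have K2l : 2 * K l = K (2 * l).
  by rewrite (_ : 2 * l = l + l) ?Kper; ring.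
have drift n : o n <= 2 * l -> `|K (o n) - n%:R * xi 0%N| <= Q * xi 0%N * K (o n).
  elim: n => [|n IH] hn; first by rewrite o0 K0 mul0r subr0 normr0 mulr0.
  have hn' : o n <= 2 * l by apply: le_trans hn; apply: ltW; exact: oinc.
  have Kn2 : K (o n) <= 2 * K l.
    by rewrite K2l; exact: Kle.
  have x1 : `|xi n - xi 0%N| <= Q * xi 0%N * xi n.
    have -> : xi n - xi 0%N = - ((xi n)^-1 - (xi 0)^-1) * (xi 0%N * xi n).
      by field; rewrite !gt_eqF.
    rewrite normrM normrN (gtr0_norm (mulr_gt0 (xi0 0%N) (xi0 n))) -mulrA.
    rewrite ler_wpM2r ?(ltW (mulr_gt0 (xi0 0%N) (xi0 n)))//.
    by apply: le_trans (rec0 n) _; rewrite ler_wpM2l// ltW.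
  have -> : K (o n.+1) - n.+1%:R * xi 0%N = (K (o n) - n%:R * xi 0%N) + (xi n - xi 0%N).
    by rewrite /xi -natr1; ring.
  apply: le_trans (ler_normD _ _) _; apply: le_trans (lerD (IH hn') x1) _.
  by rewrite -mulrDr /xi [K (o n) + _]addrC subrK.
have r0 := rot_gt0 Jb0.
have ox n : xcoord (o n) J = n%:R * rotnum J.
  elim: n => [|n IH]; first by rewrite mul0r o0 xcoord0.
  by rewrite on xcoord_nextpt// IH -natr1 mulrDl mul1r.
have comp u : 0 <= u <= l -> `|K u - xi 0%N / rotnum J * xcoord u J| <= Q1 * xi 0%N.
  move: u => {}t /andP[t0 tl].
  have xt0 := xcoord_le Jb0 t0; rewrite xcoord0// in xt0.
  pose n := Num.truncn (xcoord t J / rotnum J).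
  have /andP[n1 n2] := truncn_itv (divr_ge0 xt0 (ltW r0)).
  rewrite -/n in n1 n2; rewrite ler_pdivlMr// -ox in n1; rewrite ltr_pdivrMr// -ox in n2.
  have nt : o n <= t.
    by rewrite leNgt; apply/negP => /(xcoord_incr Jb0); lra.
  have tn : t < o n.+1.
    by rewrite ltNge; apply/negP => /(xcoord_le Jb0); lra.
  have on1 : o n.+1 <= 2 * l by have := ostep n; lra.
  have on0 : o n <= 2 * l by lra.
  have K2 m : o m <= 2 * l -> `|K (o m) - m%:R * xi 0%N| <= (Q1 - 1) * xi 0%N.
    move=> hm; apply: le_trans (drift m hm) _.
    have -> : (Q1 - 1) * xi 0%N = Q * xi 0%N * (2 * K l) by rewrite /Q1; ring.
    apply: ler_wpM2l; last by rewrite K2l; exact: Kle.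
    by apply: mulr_ge0; apply: ltW.
  have a := K2 _ on0; have b := K2 _ on1.
  have k1 := Kle _ _ nt; have k2 := Kle _ _ (ltW tn).
  have lam0 : 0 <= xi 0%N / rotnum J by apply: divr_ge0; exact: ltW.
  have l1 : n%:R * xi 0%N <= xi 0%N / rotnum J * xcoord t J.
    have -> : n%:R * xi 0%N = xi 0%N / rotnum J * (n%:R * rotnum J) by field; rewrite gt_eqF.
    by rewrite -ox; exact: ler_wpM2l.
  have l2 : xi 0%N / rotnum J * xcoord t J <= n.+1%:R * xi 0%N.
    have -> : n.+1%:R * xi 0%N = xi 0%N / rotnum J * (n.+1%:R * rotnum J) by field; rewrite gt_eqF.
    by rewrite -ox; apply: ler_wpM2l => //; exact: ltW.
  move: a b l1 l2; rewrite -natr1 !mulrDl !mul1r !mulNr mul1r !ler_norml.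
  move: (n%:R * xi 0%N) (Q1 * xi 0%N) (xi 0%N / rotnum J * xcoord t J) => u v w.
  lra.
move=> /andP[t0 tl].
have c1 := comp t; rewrite t0 (ltW tl) in c1; have {}c1 := c1 isT.
have c2 := comp l; rewrite (ltW l0) lexx in c2; have {}c2 := c2 isT.
have xl := xcoordl Jb0.
rewrite xl mulr1 in c2.
have xt : 0 <= xcoord t J <= 1.
  have a := xcoord_le Jb0 t0; have b := xcoord_le Jb0 (ltW tl).
  by rewrite xcoord0// in a; rewrite xl in b; rewrite a b.
have xi0d : xi 0%N <= e * K l / (4 * Q1).
  apply: le_trans Kd; rewrite /xi o0 K0 subr0; apply: Kle.
  by have := hJ 0 J Jb; rewrite add0r => /ltW.
have key : Q1 * xi 0%N <= e * K l / 4.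
  have -> : e * K l / 4 = Q1 * (e * K l / (4 * Q1)) by field; rewrite gt_eqF.
  by rewrite ler_wpM2l// ltW.
(* The comparison is used at [t] and at [l], each time with an error of at most [e * K l / 4]. *)
rewrite -(ltr_pM2r Kl) -{2}(gtr0_norm Kl) -normrM.
have -> : (xcoord t J - K t / K l) * K l =
   (K l - xi 0%N / rotnum J) * xcoord t J - (K t - xi 0%N / rotnum J * xcoord t J).
  by field; rewrite !gt_eqF.
apply: le_lt_trans (ler_normB _ _) _; rewrite normrM.
case/andP: xt => xt0 xt1; rewrite (ger0_norm xt0).
have : `|K l - xi 0%N / rotnum J| * xcoord t J <= Q1 * xi 0%N.
  by apply: le_trans c2; rewrite ler_piMr.
have eK : 0 < e * K l by exact: mulr_gt0.
move: c1 key eK; move: (e * K l) (Q1 * xi 0%N) (`|K l - _| * _) `|K t - _| => u v w z.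
lra.
Qed.

Lemma rot_small e : 0 < e -> exists2 J1, 0 < J1 < J0 & forall J, 0 < J <= J1 -> rotnum J < e.
Proof.
move=> e0; have [k [k0 kper kinc kc lim]] := xcoord_limit.
have e2 : 0 < e / 2 by rewrite divr_gt0.
have [d d0 hd] := (cont_eps _ _).1 (kc 0) _ e2.
have [J1 J1b h1] := lim _ e2.
have [J2 J2b h2] := nextpt_small d0.
exists (Num.min J1 J2).
  by case/andP: J1b => a b; case/andP: J2b => a' b'; rewrite lt_min a a' gt_min b.
move=> J; rewrite le_min => /andP[Jp /andP[JJ1 JJ2]].
have Jb : 0 < J < J0.
  by rewrite Jp (le_lt_trans JJ1)//; case/andP: J1b.
have hx := h1 (nextpt 0 J) J ltac:(by rewrite Jp).
have hn := h2 0 J ltac:(by rewrite Jp); rewrite add0r in hn.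
have [/andP[n0 _] _] := nextptP SC F 0 Jb.
have hk : `|k (nextpt 0 J) - k 0| < e / 2.
  by apply: hd; rewrite /ball/= sub0r normrN gtr0_norm.
rewrite k0 subr0 in hk; move: hx hk; rewrite -/(rotnum J).
move: (rotnum J) (k (nextpt 0 J)) => u v; rewrite !ltr_norml; lra.
Qed.

End Rotation.

(* Coordinates [(xh s r, r)] in which the billiard map is [(x, r) |-> (x + r, r)]; the
   angle at [s] on the curve of rotation number [r] has cosine [ch s r]. *)
Record action_angle {R : realType} (l : R) (g T : R -> R * R) (r0 : R)
    (ch xh : R -> R -> R) : Prop := ActionAngle {
  aa_r0 : 0 < r0;
  aa_chc : continuous (fun p : R * R => ch p.1 p.2);
  aa_xhc : continuous (fun p : R * R => xh p.1 p.2);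
  aa_chp : forall s r, ch (s + l) r = ch s r;
  aa_xhp : forall s r, xh (s + l) r = xh s r + 1;
  aa_xhi : forall s t r, s < t -> xh s r < xh t r;
  aa_ch0 : forall s, ch s 0 = 1;
  aa_chd : forall s r1 r2, 0 <= r1 -> r1 < r2 -> r2 <= r0 -> ch s r2 < ch s r1;
  aa_chb : forall s r, -1 < ch s r <= 1;
  aa_step : forall s t r, 0 < r <= r0 -> s < t < s + l -> cos_out g T s t = ch s r ->
    cos_in g T s t = ch t r /\ xh t r = xh s r + r }.

(** * From an invariant family to action-angle coordinates *)

Section ActionAngle.
Context {R : realType} (D : set (R * R)) (l : R) (g T g2 g3 g4 : R -> R * R).
Context (SC : convex_arc D l g T g2 g3 g4).
Context (J0 : R) (c : R -> R -> R) (F : invariant_family l g T J0 c).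
Implicit Types (s t x y J e r : R).
Local Notation rotnum := (rotnum l g T c).
Local Notation xcoord := (xcoord l c).

(** Rotation numbers are kept up to [r0], that of [J1], while [Jof] inverts [rotnum] up to the
    larger [r2]; the margin makes [Jof] continuous at [r0]. *)
Let J1 := J0 / 2.
Let J2 := J0 * (3 / 4).
Let J1b : 0 < J1 < J0. Proof. by have := fam_J0 F; rewrite /J1; lra. Qed.
Let J2b : 0 < J2 < J0. Proof. by have := fam_J0 F; rewrite /J2; lra. Qed.
Let J12 : J1 < J2. Proof. by have := fam_J0 F; rewrite /J1 /J2; lra. Qed.
Let r0 := rotnum J1.
Let r00 : 0 < r0. Proof. exact: (rot_gt0 SC F J1b). Qed.
Let r2 := rotnum J2.
Let r02 : r0 < r2.
Proof. by apply: (rot_incr SC F) => //; [case/andP: J1b|case/andP: J2b]. Qed.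

Definition Jof r := xget 0 [set J | 0 < J < J0 /\ rotnum J = r].

Lemma JofP r : 0 < r <= r2 -> 0 < Jof r < J0 /\ rotnum (Jof r) = r.
Proof.
move=> /andP[rp rr]; rewrite /Jof; case: xgetP => [J _ //|].
have [J3 /andP[J3p J3J] h3] := rot_small SC F rp.
have h := h3 J3; rewrite J3p lexx in h; have {}h := h isT.
have J32 : J3 <= J2.
  rewrite leNgt; apply/negP => JJ.
  have := @rot_incr _ _ _ _ _ _ _ _ SC _ _ F J2 J3 ltac:(by case/andP: J2b) JJ J3J.
  rewrite -/r2; lra.
have [||J [/andP[Ja Jb] Jr]] := @IVTc _ rotnum J3 J2 r J32.
- move=> x /andP[xa xb]; apply: (rot_cont SC F).
  by rewrite (lt_le_trans J3p xa) (le_lt_trans xb)//; case/andP: J2b.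
- by rewrite (ltW h).
move=> /(_ J) []; split => //.
by rewrite (lt_le_trans J3p Ja) (le_lt_trans Jb)//; case/andP: J2b.
Qed.

Lemma Jof_lt r J : 0 < r <= r2 -> 0 < J < J0 -> r < rotnum J -> Jof r < J.
Proof.
move=> rb Jb h; have [/andP[a1 a2] b] := JofP rb; rewrite ltNge le_eqVlt.
apply/negP => /predU1P[e|lt]; first by move: h; rewrite e b ltxx.
have := rot_incr SC F _ lt a2; rewrite b; case/andP: Jb => Jp _ /(_ Jp); lra.
Qed.

Lemma Jof_gt r J : 0 < r <= r2 -> 0 < J < J0 -> rotnum J < r -> J < Jof r.
Proof.
move=> rb Jb h; have [/andP[a1 a2] b] := JofP rb; rewrite ltNge le_eqVlt.
apply/negP => /predU1P[e|lt]; first by move: h; rewrite -e b ltxx.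
have := rot_incr SC F a1 lt; rewrite b; case/andP: Jb => _ Jp /(_ Jp); lra.
Qed.

Lemma Jof_incr ra rb : 0 < ra -> ra < rb -> rb <= r2 -> Jof ra < Jof rb.
Proof.
move=> a ab b; have [h1 h2] := @JofP rb ltac:(by rewrite (lt_trans a)).
by apply: Jof_lt; rewrite ?h2// a (le_trans (ltW ab)).
Qed.

Lemma Jof_cont r : 0 < r < r2 -> {for r, continuous Jof}.
Proof.
move=> /andP[rp rr]; have rb : 0 < r <= r2 by rewrite rp ltW.
have [/andP[a1 a2] b] := JofP rb.
have n1 : \forall q \near r, 0 < q by exact: lt_nbhsr.
have n2 : \forall q \near r, q < r2 by exact: lt_nbhsl.
have d0 : 0 < Num.min (Jof r) (J0 - Jof r) by rewrite lt_min a1 subr_gt0.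
have d1 : Num.min (Jof r) (J0 - Jof r) <= Jof r by rewrite ge_min lexx.
have d2 : Num.min (Jof r) (J0 - Jof r) <= J0 - Jof r by rewrite ge_min lexx orbT.
apply: (cvg_sandwich d0) => z /andP[z1 z2].
  have zb : 0 < z < J0 by lra.
  have zr : rotnum z < r by rewrite -b; apply: (rot_incr SC F) => //; case/andP: zb.
  have n3 : \forall q \near r, rotnum z < q by exact: lt_nbhsr.
  apply: (filterS _ (filterI n3 (filterI n1 n2))) => q [q3 [q1 q2]].
  by apply: Jof_gt => //; rewrite q1 ltW.
have zb : 0 < z < J0 by lra.
have zr : r < rotnum z by rewrite -b; apply: (rot_incr SC F) => //; case/andP: zb.
have n3 : \forall q \near r, q < rotnum z by exact: lt_nbhsl.
apply: (filterS _ (filterI n3 (filterI n1 n2))) => q [q3 [q1 q2]].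
by apply: Jof_lt => //; rewrite q1 ltW.
Qed.

Lemma family_action_angle : exists r0 ch xh, action_angle l g T r0 ch xh.
Proof.
have [k [k0 kper kinc kc klim]] := xcoord_limit SC F.
(* Rotation numbers are capped at [r0], and for [r <= 0] the boundary values are used: in this way
   the charts are continuous on the whole plane. *)
pose cl r := Num.min r r0.
have clr r : r <= r0 -> cl r = r by move=> h; rewrite /cl; apply/min_idPl.
have clb r : 0 < r -> 0 < cl r <= r2.
  by move=> rp; rewrite /cl lt_min rp r00 ge_min (ltW r02) orbT.
have clb' r : 0 < r -> 0 < cl r < r2.
  by move=> rp; rewrite /cl lt_min rp r00 gt_min r02 orbT.
have ccl r : {for r, continuous cl}.
  by apply: continuous_min; [exact: cvg_id|exact: cvg_cst].
pose ch s r := if r <= 0 then 1 else c s (Jof (cl r)).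
pose xh s r := if r <= 0 then k s else xcoord s (Jof (cl r)).
have Jb r : 0 < r -> 0 < Jof (cl r) < J0 by move=> /clb/JofP[].
have small J : 0 < J < J0 -> exists2 d, 0 < d & forall r, 0 < r < d -> Jof (cl r) < J.
  move=> Jbb; have rJ := rot_gt0 SC F Jbb.
  exists (Num.min (rotnum J) r0); first by rewrite lt_min rJ r00.
  move=> r /andP[rp]; rewrite lt_min => /andP[rr rr0].
  by apply: Jof_lt => //; [exact: clb|rewrite clr// ltW].
have Jcont r : 0 < r -> {for r, continuous (fun r => Jof (cl r))}.
  move=> rp; apply: (@continuous_comp _ _ _ cl Jof); first exact: ccl.
  by apply: Jof_cont; exact: clb'.
(* Gluing along [r = 0] by uniform convergence; it is applied to the constant 1 with [c], and to [k]
   with [xcoord]. *)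
have mix (u : R -> R) (v : R -> R -> R) : continuous u ->
    (forall s J, 0 < J < J0 -> {for (s, J), continuous (fun p : R * R => v p.1 p.2)}) ->
    (forall e, 0 < e -> exists2 J, 0 < J < J0 & forall s J', 0 < J' <= J -> `|v s J' - u s| < e) ->
    continuous (fun p : R * R => if p.2 <= 0 then u p.1 else v p.1 (Jof (cl p.2))).
  move=> cu cv lim [s r]; have [rn|rp|rz] := ltgtP r 0.
  - have n : \forall p \near ((s, r) : R * R), p.2 < 0.
      by apply: near_lt rn; [exact: cont_snd|exact: cvg_cst].
    have cc : {for (s, r), continuous (fun p : R * R => u p.1)}.
      by apply: (@continuous_comp _ _ _ (fun p : R * R => p.1) u); [exact: cont_fst|exact: cu].
    rewrite /continuous_at /= (ltW rn).
    apply: cvg_trans cc; apply: near_eq_cvg.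
    by apply: (filterS _ n) => p /= pn; rewrite (ltW pn).
  - have n : \forall p \near ((s, r) : R * R), 0 < p.2.
      by apply: near_lt rp; [exact: cvg_cst|exact: cont_snd].
    have cc : {for (s, r), continuous (fun p : R * R => v p.1 (Jof (cl p.2)))}.
      apply: (cont2_comp (@cont_fst _ _)); last exact: cv (Jb _ rp).
      by apply: (@continuous_comp _ _ _ (fun p : R * R => p.2) (fun r => Jof (cl r)));
        [exact: cont_snd|exact: Jcont].
    rewrite /continuous_at /= leNgt rp /=.
    apply: cvg_trans cc; apply: near_eq_cvg.
    by apply: (filterS _ n) => p /= pn; rewrite leNgt pn.
  - rewrite {}rz; apply/cont_eps => e e0 /=; rewrite lexx.
    have e2 : 0 < e / 2 by rewrite divr_gt0.
    have [d1 d10 hd1] := (cont_eps _ _).1 (cu s) _ e2.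
    have [J JJ hJ] := lim _ e2; have [d2 d20 hd2] := small _ JJ.
    exists (Num.min d1 d2); first by rewrite lt_min d10 d20.
    move=> [s' r'] [/= b1 b2]; rewrite /ball/= in b1 b2.
    move: b1 b2; rewrite !lt_min sub0r normrN => /andP[b1 _] /andP[_ b2].
    have h1 : `|u s' - u s| < e / 2 by exact: hd1.
    case: ifPn => [_|]; first by apply: lt_trans h1 _; lra.
    rewrite -ltNge => rp; have JB := Jb _ rp; case/andP: (JB) => JB1 JB2.
    have h2 := hJ s' (Jof (cl r')); rewrite JB1 ltW in h2; last first.
      by apply: hd2; rewrite rp; rewrite gtr0_norm in b2.
    have {}h2 := h2 isT.
    have -> : v s' (Jof (cl r')) - u s = (v s' (Jof (cl r')) - u s') + (u s' - u s) by ring.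
    by apply: le_lt_trans (ler_normD _ _) _; lra.
exists r0, ch, xh; split => //.
- apply: (mix (fun=> 1) c) => //; first by move=> ?; exact: cvg_cst.
    by move=> s J; exact: (fam_cont2 F).
  move=> e e0; have [J JJ hJ] := fam_unif F e0; exists J => // s J' JJ'.
  have J'b : 0 < J' < J0.
    by case/andP: JJ' => -> /le_lt_trans; apply; case/andP: JJ.
  have := hJ s J' JJ'; have /andP[_ b] := fam_bound F s J'b.
  by rewrite ltr_norml; lra.
- apply: (mix k xcoord) => //.
    by move=> s J; exact: (xcoord_cont SC F).
- by move=> s r; rewrite /ch; case: ifPn => //; rewrite -ltNge => /Jb; exact: (fam_per F).
- by move=> s r; rewrite /xh; case: ifPn => [_|]; [exact: kper|rewrite -ltNge => /Jb; exact: (xcoord_per SC F)].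
- by move=> s t r st; rewrite /xh; case: ifPn => [_|]; [exact: kinc|rewrite -ltNge => /Jb JJ; exact: (xcoord_incr SC F)].
- by move=> s; rewrite /ch lexx.
- move=> s ra rb a ab b; have bp : 0 < rb by rewrite (le_lt_trans a).
  rewrite /ch [rb <= 0]leNgt bp /=; case: ifPn => [_|].
    by have /andP[] := fam_bound F s (Jb _ bp).
  rewrite -ltNge => ap; have [j1 _] := andP (Jb _ ap); have [_ j2] := andP (Jb _ bp).
  apply: (fam_decr F) => //; rewrite !clr ?(le_trans (ltW ab))//.
  by apply: Jof_incr => //; apply: le_trans b (ltW r02).
- move=> s r; rewrite /ch; case: ifPn => [_|]; first by rewrite lexx andbT; lra.
  by rewrite -ltNge => /Jb JJ; have /andP[-> /ltW ->] := fam_bound F s JJ.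
move=> s t r /andP[rp rr] st; rewrite /ch /xh leNgt rp /= => e.
have JJ := Jb _ rp.
have et := nextpt_uniq SC F JJ st e.
split; first exact: (fam_inv F JJ st e).
rewrite -et (xcoord_nextpt SC F)//; congr (_ + _).
by have [_ ->] := JofP (clb _ rp); exact: clr.
Qed.

End ActionAngle.

(** * The billiard map *)

Local Open Scope quotient_scope.

Section ArcStep.
Context {R : realType} (D : set (R * R)) (l : R) (g T g2 g3 g4 : R -> R * R).
Context (SC : convex_arc D l g T g2 g3 g4).
Implicit Types (s t x y r : R) (u v w : R * R).
Local Notation cos_out := (cos_out g T).
Local Notation cos_in := (cos_in g T).
Local Notation clen := (clen g).

Definition vel s (phi : R) := cos phi *: T s + sin phi *: rot90 (T s).

Lemma cos_in_bound s t : s < t < s + l -> -1 < cos_in s t < 1.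
Proof.
move=> h; have n0 := clen_gt0 SC h; have d0 := chord_detB SC h.
have e := unit_decomp (g s - g t) (T_unit SC t).
rewrite -norm2_sqr -clen_sym in e.
have sw : dot2 (T t) (g t - g s) = - dot2 (T t) (g s - g t) by rewrite !dot2Br; ring.
have : cos_in s t ^+ 2 < 1.
  rewrite /cos_in sw expr_div_n sqrrN ltr_pdivrMr ?exprn_gt0// mul1r e ltrDl exprn_gt0//.
rewrite -[X in _ < X](expr1n _ 2) -[cos_in s t ^+ 2]real_normK ?num_real//.
rewrite ltr_pXn2r ?nnegrE// ltr_norml; exact.
Qed.

Lemma unit_frame u w : dot2 u u = 1 -> w = dot2 u w *: u + det2 u w *: rot90 u.
Proof.
move=> h; apply: pair_ext; rewrite /dot2 /det2 /rot90/= /GRing.scale/=.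
  by rewrite -[LHS]mul1r -h /dot2; ring.
by rewrite -[LHS]mul1r -h /dot2; ring.
Qed.

Lemma dot_vel s phi : dot2 (T s) (vel s phi) = cos phi.
Proof.
rewrite /vel dot2Dr !dot2Zr (T_unit SC) dot2_rot90 det2xx; ring.
Qed.

Lemma det_vel s phi : det2 (T s) (vel s phi) = sin phi.
Proof.
rewrite /vel det2Dr !det2Zr det2xx det2_rot90 (T_unit SC); ring.
Qed.

Lemma vel_inj s phi psi : 0 < phi < pi -> 0 < psi < pi -> vel s phi = vel s psi -> phi = psi.
Proof.
move=> /andP[a b] /andP[a' b'] e; apply: cos_inj.
- by rewrite in_itv/= !ltW.
- by rewrite in_itv/= !ltW.
by rewrite -(dot_vel s) e dot_vel.
Qed.

Lemma sqr_eq_pos (a b : R) : 0 < a -> 0 < b -> a ^+ 2 = b ^+ 2 -> a = b.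
Proof. by move=> a0 b0 e; apply/eqP; rewrite -(@eqrXn2 _ 2) ?(ltW a0) ?(ltW b0)// e. Qed.

Lemma chord_vel s t phi : 0 < phi < pi -> s < t < s + l -> cos_out s t = cos phi ->
  g t = g s + clen s t *: vel s phi.
Proof.
move=> /andP[p0 ppi] st e; have L0 := clen_gt0 SC st.
have sp : 0 < sin phi by apply: sin_gt0_pi; rewrite p0.
have d0 := chord_detA SC st.
have ue := unit_decomp (g t - g s) (T_unit SC s).
rewrite -norm2_sqr -/(clen s t) in ue.
have c1 : dot2 (T s) (g t - g s) = clen s t * cos phi.
  by rewrite -e /cos_out mulrCA divff ?mulr1// gt_eqF.
have s1 : det2 (T s) (g t - g s) = clen s t * sin phi.
  apply: sqr_eq_pos => //; first exact: mulr_gt0.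
  have -> : det2 (T s) (g t - g s) ^+ 2 = clen s t ^+ 2 - dot2 (T s) (g t - g s) ^+ 2.
    by rewrite ue; ring.
  by rewrite exprMn sin2cos2 c1; ring.
have := unit_frame (g t - g s) (T_unit SC s); rewrite c1 s1 => h.
rewrite -[LHS](subrK (g s)) h addrC; congr (_ + _).
by rewrite /vel scalerDr !scalerA.
Qed.

(** A boundary point inside the chord would have both ends weakly to the left of its tangent, in
    opposite directions. The tangent would then contain the chord, against [chord_left]. *)
Lemma chord_free s t phi r (x : R) : 0 < phi < pi -> s < t < s + l -> cos_out s t = cos phi ->
  0 < x < clen s t -> g r <> g s + x *: vel s phi.
Proof.
move=> pp st e /andP[x0 xL] er; have et := chord_vel pp st e.
have h1 := closure_left SC r (@arc_closure _ _ _ _ _ _ _ _ SC s).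
have h2 := closure_left SC r (@arc_closure _ _ _ _ _ _ _ _ SC t).
have e1 : g s - g r = (- x) *: vel s phi by rewrite er opprD addrA subrr sub0r scaleNr.
have e2 : g t - g r = (clen s t - x) *: vel s phi.
  by rewrite er et opprD addrACA subrr add0r scalerBl.
rewrite e1 det2Zr in h1; rewrite e2 det2Zr in h2.
have x1 : 0 < clen s t - x by rewrite subr_gt0.
have h3 : det2 (T r) (vel s phi) = 0.
  apply/eqP; rewrite eq_le; apply/andP; split.
    by move: h1; rewrite mulNr oppr_ge0 pmulr_rle0.
  by move: h2; rewrite pmulr_rge0.
have ne : g s <> g r.
  move=> eq; have : (- x) *: vel s phi = 0 by rewrite -e1 eq subrr.
  move/(congr1 (fun w => det2 (T s) w)); rewrite det2Zr det_vel det2r0.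
  move/eqP; rewrite mulf_eq0 oppr_eq0 gt_eqF//= => /eqP sp.
  by have := @sin_gt0_pi R phi pp; rewrite sp ltxx.
by have := chord_left SC ne; rewrite e1 det2Zr h3 mulr0 ltxx.
Qed.

(** In the frame at [t], reflection keeps the tangential component [cos_in s t] and reverses the
    normal one, which is negative on arrival. *)
Lemma chord_reflect s t phi : 0 < phi < pi -> s < t < s + l -> cos_out s t = cos phi ->
  vel t (acos (cos_in s t)) =
  vel s phi - (2 * dot2 (vel s phi) (rot90 (T t))) *: rot90 (T t).
Proof.
move=> pp st e; have et := chord_vel pp st e; have L0 := clen_gt0 SC st.
have cb := cos_in_bound st.
have vE : vel s phi = (clen s t)^-1 *: (g t - g s).
  by rewrite et addrAC subrr add0r scalerA mulVf ?scale1r// gt_eqF.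
have c1 : dot2 (T t) (vel s phi) = cos_in s t by rewrite vE dot2Zr /cos_in mulrC.
have d1 : det2 (T t) (vel s phi) < 0.
  have := chord_detB SC st; rewrite vE det2Zr => h.
  rewrite pmulr_rlt0 ?invr_gt0// -oppr_gt0 -mulN1r -det2Zr scaleN1r opprB; exact: h.
have vv : dot2 (vel s phi) (vel s phi) = 1.
  by rewrite (unit_decomp _ (T_unit SC s)) dot_vel det_vel cos2Dsin2.
have ue := unit_decomp (vel s phi) (T_unit SC t); rewrite vv c1 in ue.
have ab : -1 <= cos_in s t <= 1 by case/andP: cb => /ltW -> /ltW ->.
have s1 : sin (acos (cos_in s t)) = - det2 (T t) (vel s phi).
  rewrite sin_acos//; apply: sqr_eq_pos; [|by rewrite oppr_gt0|].
    rewrite sqrtr_gt0 ue addrAC subrr add0r lt_neqAle sqr_ge0 andbT eq_sym sqrf_eq0.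
    by rewrite lt_eqF.
  by rewrite sqrrN sqr_sqrtr ue addrAC subrr add0r// sqr_ge0.
rewrite [in RHS](unit_frame (vel s phi) (T_unit SC t)) c1 /vel s1 acosK ?in_itv//=.
rewrite dot2C -/(vel s phi).
set d := det2 _ _; set cc := cos_in s t.
have -> : dot2 (rot90 (T t)) (cc *: T t + d *: rot90 (T t)) = d.
  rewrite dot2Dr !dot2Zr (dot2C _ (T t)) dot2_rot90 det2xx.
  have -> : dot2 (rot90 (T t)) (rot90 (T t)) = dot2 (T t) (T t) by rewrite /dot2 /rot90/=; ring.
  by rewrite (T_unit SC); ring.
by rewrite -addrA -scalerBl; congr (_ + _); congr (_ *: _); ring.
Qed.

End ArcStep.

Section Billiard.
Context {R : realType} (Om : table R) (SC0 : strictly_convex 4 Om).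
Implicit Types (s t : R).
Local Notation l := (len Om).
Local Notation circ := (\pi_(circle (len Om))).
Let SC := table_arc SC0.

Lemma circP s t : circ s = circ t <-> exists k : int, s = t + k%:~R * l.
Proof.
split=> [/eqmodP/asboolP[k e]|[k e]].
  by exists k; rewrite -e addrC subrK.
by apply/eqmodP/asboolP; exists k; rewrite e addrAC subrr add0r.
Qed.

Lemma circ_repr (V : Type) (f : R -> V) s : (forall x, f (x + l) = f x) ->
  f (repr (circ s)) = f s.
Proof.
move=> pf; have /circP[k ->] : circ (repr (circ s)) = circ s by rewrite reprK.
exact: per_int.
Qed.

Lemma pt_circ s phi : pt (circ s, phi) = gam Om s.
Proof. by rewrite /pt /= (circ_repr _ (arc_per SC)). Qed.

Lemma tangent_circ s phi : tangent (circ s, phi) = (gam Om)^`() s.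
Proof. by rewrite /tangent /= (circ_repr _ (arc_T_per SC)). Qed.

Lemma velocity_circ s phi : velocity (circ s, phi) = vel (gam Om)^`() s phi.
Proof. by rewrite /velocity /inner_normal tangent_circ. Qed.

(** The chord lemmas verify [billiard_step] for this value. Conversely, [chord_free] fixes the
    hitting time, hence the base point, and then [vel_inj] fixes the angle. *)
Lemma billiard_lift s t (phi : R) : 0 < phi < pi -> s < t < s + l ->
  cos_out (gam Om) (gam Om)^`() s t = cos phi ->
  billiard_map (circ s, phi) = (circ t, acos (cos_in (gam Om) (gam Om)^`() s t)) :> phase Om.
Proof.
move=> pp st e; rewrite /billiard_map asboolT//.
have cb := cos_in_bound SC st.
have ab : 0 < acos (cos_in (gam Om) (gam Om)^`() s t) < pi.
  case/andP: cb => c1 c2; rewrite acos_gt0 ?acos_ltpi// ?c1 ?c2 ?(ltW c1) ?(ltW c2)//.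
set q0 := (circ t, _) : phase Om.
have bE : boundary (dom Om) = range (gam Om) by exact: arc_boundary SC.
have st0 : billiard_step (circ s, phi) q0.
  split; first exact: ab.
  split.
    exists (clen (gam Om) s t); split.
    - by have h := clen_gt0 SC st.
    - by rewrite /q0 !pt_circ velocity_circ; exact: (chord_vel SC).
    - move=> u ub; rewrite bE pt_circ velocity_circ => -[r _ er].
      exact: (chord_free SC pp st e ub er).
  by rewrite /q0 /inner_normal tangent_circ !velocity_circ; exact: (chord_reflect SC).
apply: xget_unique => // -[c2 psi] [/= psib [[x [x0 ex free]] refl]].
rewrite -[c2]reprK; set t2 := repr c2.
rewrite -(reprK c2) -/t2 !pt_circ velocity_circ in ex.
rewrite pt_circ velocity_circ bE in free.
rewrite -(reprK c2) -/t2 /inner_normal tangent_circ !velocity_circ in refl.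
have et := chord_vel SC pp st e.
have xL : x = clen (gam Om) s t.
  have [h|h|//] := ltgtP x (clen (gam Om) s t).
    by have := chord_free SC pp st e (r := t2) (x := x) ltac:(by rewrite x0); rewrite ex.
  exfalso; apply: (free (clen (gam Om) s t)); first by rewrite h (clen_gt0 SC st).
  by rewrite -et; exists t.
have tt : circ t2 = circ t.
  apply/circP; apply: (arc_inj SC); rewrite ex xL; exact: esym et.
congr (_, _); first exact: tt.
have t2e : (gam Om)^`() t2 = (gam Om)^`() t.
  by rewrite -[LHS](tangent_circ t2 0) -[RHS](tangent_circ t 0) tt.
have v2 phi' : vel (gam Om)^`() t2 phi' = vel (gam Om)^`() t phi' by rewrite /vel t2e.
apply: (vel_inj SC (s := t)) => //.
by rewrite -v2 refl t2e; exact: esym (chord_reflect SC pp st e).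
Qed.

End Billiard.

(** * Conjugacies *)

Section Chart.
Context {R : realType} (l : R) (g T : R -> R * R) (r0 : R) (ch xh : R -> R -> R).
Context (AA : action_angle l g T r0 ch xh) (l0 : 0 < l).
Implicit Types (s t r x phi : R).

(** The rotation number of the invariant curve through a phase point, and the inverse of the chart
    in the variable [s]. *)
Definition rotval s phi := xget 0 [set r | 0 <= r <= r0 /\ ch s r = cos phi].
Definition invx x r := xget 0 [set s | xh s r = x].

Let ch_conts s r : {for r, continuous (ch s)}.
Proof. by apply: (cont2_comp (@cont_cst _ _ s _) (@cont_id _ _)); exact: (aa_chc AA). Qed.

Let xh_conts s r : {for s, continuous (xh^~ r)}.
Proof. by apply: (cont2_comp (@cont_id _ _) (@cont_cst _ _ r _)); exact: (aa_xhc AA). Qed.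

Lemma rotvalP s phi : ch s r0 <= cos phi ->
  0 <= rotval s phi <= r0 /\ ch s (rotval s phi) = cos phi.
Proof.
move=> h; rewrite /rotval; case: xgetP => [r _ //|].
have [||r [rb e]] := @IVTc _ (fun r => - ch s r) 0 r0 (- cos phi) (ltW (aa_r0 AA)).
- by move=> x _; apply: cvgN; exact: ch_conts.
- by rewrite !lerN2 (aa_ch0 AA) cos_le1.
by move=> /(_ r)[]; split => //; apply: oppr_inj.
Qed.

Lemma ch_lt s r1 r2 : 0 <= r1 <= r0 -> 0 <= r2 <= r0 -> (ch s r1 < ch s r2) = (r2 < r1).
Proof.
move=> /andP[a b] /andP[a' b']; apply/idP/idP => h; last exact: (aa_chd AA).
rewrite ltNge le_eqVlt; apply/negP => /predU1P[e|lt]; first by move: h; rewrite e ltxx.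
by have := aa_chd AA s a lt b'; lra.
Qed.

Lemma rotval_uniq s phi r : 0 <= r <= r0 -> ch s r = cos phi -> rotval s phi = r.
Proof.
move=> rb e.
have h : ch s r0 <= cos phi.
  rewrite -e; case/andP: rb => rp; rewrite le_eqVlt => /predU1P[->//|lt].
  by apply: ltW; exact: (aa_chd AA).
have [b e2] := rotvalP h.
have [lt|lt|//] := ltgtP (rotval s phi) r.
  by move: lt; rewrite -(ch_lt s rb b) e e2 ltxx.
by move: lt; rewrite -(ch_lt s b rb) e e2 ltxx.
Qed.

Lemma rotval_per s phi : rotval (s + l) phi = rotval s phi.
Proof.
rewrite /rotval; congr (xget _ _); apply/funext => r /=.
by rewrite (aa_chp AA).
Qed.

Lemma invxP x r : xh (invx x r) r = x.
Proof.
rewrite /invx; case: xgetP => [s _ //|].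
have xn (n : nat) s : xh (s + n%:R * l) r = xh s r + n%:R.
  elim: n => [|n IH]; first by rewrite mul0r !addr0.
  by rewrite -natr1 mulrDl mul1r !addrA (aa_xhp AA) IH.
have [n hn] := exists_shift (x - xh 0 r) ltr01.
have [m hm] := exists_shift (xh 0 r - x) ltr01.
rewrite mulr1 in hn; rewrite mulr1 in hm.
have a1 := xn n (- (n%:R * l)); rewrite addNr in a1.
have a2 := xn m 0; rewrite add0r in a2.
have le : - (n%:R * l) <= m%:R * l.
  by apply: (@le_trans _ _ 0); rewrite ?oppr_le0 mulr_ge0// ltW.
have [||s [_ e]] := @IVTc _ (xh^~ r) (- (n%:R * l)) (m%:R * l) x le.
- by move=> s _; exact: xh_conts.
- by lra.
by move=> /(_ s).
Qed.

Lemma xh_lt s t r : (xh s r < xh t r) = (s < t).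
Proof.
apply/idP/idP => h; last exact: (aa_xhi AA).
rewrite ltNge le_eqVlt; apply/negP => /predU1P[e|lt]; first by move: h; rewrite e ltxx.
by have := aa_xhi AA r lt; lra.
Qed.

Lemma invx_uniq s r : invx (xh s r) r = s.
Proof.
have e := invxP (xh s r) r; have [h|h|//] := ltgtP (invx (xh s r) r) s.
  by move: h; rewrite -(xh_lt _ _ r) e ltxx.
by move: h; rewrite -(xh_lt _ _ r) e ltxx.
Qed.

Lemma invx_per x r : invx (x + 1) r = invx x r + l.
Proof. by rewrite -{1}(invxP x r) -(aa_xhp AA) invx_uniq. Qed.

Let chart_dom : set (R * R) := [set p | 0 <= p.2 <= pi /\ ch p.1 r0 <= cos p.2].

(** On [chart_dom] comparing [rotval] with a level [z] in [[0, r0]] means comparing [ch s z] with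
    [cos phi], both continuous; levels outside [[0, r0]] are never crossed. *)
Lemma rotval_cont (p : R * R) : chart_dom p ->
  (fun q : R * R => rotval q.1 q.2) @ within chart_dom (nbhs p) --> rotval p.1 p.2.
Proof.
move=> [pb ph]; have [rb re] := rotvalP ph.
have dn : \forall q \near within chart_dom (nbhs p), chart_dom q by exact: withinT.
have chq z : {for p, continuous (fun q : R * R => ch q.1 z)}.
  by apply: (cont2_comp (@cont_fst _ _) (@cont_cst _ _ z _)); exact: (aa_chc AA).
have cq : {for p, continuous (fun q : R * R => cos q.2)}.
  by apply: (@continuous_comp _ _ _ (fun q : R * R => q.2) cos); [exact: cont_snd|exact: continuous_cos].
apply: (cvg_sandwich ltr01) => z /andP[z1 z2].
  have [zn|zp] := ltP z 0.
    by apply: (filterS _ dn) => q [_ /rotvalP[/andP[h _] _]]; exact: lt_le_trans h.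
  have zb : 0 <= z <= r0 by rewrite zp (le_trans (ltW z2)) //; case/andP: rb.
  have n : \forall q \near p, cos q.2 < ch q.1 z.
    by apply: near_lt => //; rewrite -re ch_lt.
  have n' : \forall q \near within chart_dom (nbhs p), cos q.2 < ch q.1 z by exact: cvg_within n.
  apply: (filterS _ (filterI dn n')) => q [[_ qh] h].
  by have [qb qe] := rotvalP qh; rewrite -(ch_lt q.1 qb zb) qe.
have [zn|zp] := ltP r0 z.
  by apply: (filterS _ dn) => q [_ /rotvalP[/andP[_ h] _]]; exact: le_lt_trans h zn.
have zb : 0 <= z <= r0 by rewrite zp (le_trans _ (ltW z1)) //; case/andP: rb.
have n : \forall q \near p, ch q.1 z < cos q.2.
  by apply: near_lt => //; rewrite -re ch_lt.
have n' : \forall q \near within chart_dom (nbhs p), ch q.1 z < cos q.2 by exact: cvg_within n.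
apply: (filterS _ (filterI dn n')) => q [[_ qh] h].
by have [qb qe] := rotvalP qh; rewrite -(ch_lt q.1 zb qb) qe.
Qed.

Lemma invx_cont (p : R * R) : {for p, continuous (fun q : R * R => invx q.1 q.2)}.
Proof.
have xq z : {for p, continuous (fun q : R * R => xh z q.2)}.
  by apply: (cont2_comp (@cont_cst _ _ z _) (@cont_snd _ _)); exact: (aa_xhc AA).
apply: (cvg_sandwich ltr01) => z /andP[z1 z2].
  have n : \forall q \near p, xh z q.2 < q.1.
    have h : xh z p.2 < p.1 by rewrite -[X in _ < X](invxP p.1 p.2) xh_lt.
    exact: (near_lt (xq z) (@cont_fst _ p) h).
  by apply: (filterS _ n) => q h; rewrite -(xh_lt _ _ q.2) invxP.
have n : \forall q \near p, q.1 < xh z q.2.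
  have h : p.1 < xh z p.2 by rewrite -[X in X < _](invxP p.1 p.2) xh_lt.
  exact: (near_lt (@cont_fst _ p) (xq z) h).
by apply: (filterS _ n) => q h; rewrite -(xh_lt _ _ q.2) invxP.
Qed.

(** Argued by order in order to include the value 1, where [acos] has no derivative; this is the
    edge of the annulus. *)
Lemma acos_cont_le (X : topologicalType) (E : set X) (p : X) (y : X -> R) (y0 : R) :
  -1 < y0 <= 1 -> (forall q, -1 < y q <= 1) -> y @ within E (nbhs p) --> y0 ->
  (fun q => acos (y q)) @ within E (nbhs p) --> acos y0.
Proof.
set F := within E (nbhs p); have FF : Filter F by rewrite /F; apply: within_filter.
move=> /andP[ya yb] yq cy.
have y01 : -1 <= y0 <= 1 by rewrite (ltW ya).
have q01 q : -1 <= y q <= 1 by have /andP[/ltW -> ->] := yq q.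
have a0 := acos_ge0 y01; have api := acos_ltpi (_ : -1 < y0 <= 1).
have {}api : acos y0 < pi by apply: api; rewrite ya.
have d0 : 0 < pi - acos y0 by rewrite subr_gt0.
have cosa (u : R) : -1 <= u <= 1 -> cos (acos u) = u by move=> h; rewrite acosK// in_itv.
have inpi (u : R) : -1 <= u <= 1 -> acos u \in `[0, pi]%R.
  by move=> h; rewrite in_itv/= acos_ge0// acos_lepi.
apply: (@cvg_sandwich _ _ F FF _ _ _ d0) => z /andP[z1 z2].
  have [zn|zp] := ltP z 0.
    have n0 : \forall q \near within E (nbhs p), setT q by exact: filterT.
    by apply: (filterS _ n0) => q _; apply: lt_le_trans zn _; exact: acos_ge0.
  have zi : z \in `[0, pi]%R by rewrite in_itv/= zp (le_trans (ltW z2)) // ltW.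
  have h : y0 < cos z by rewrite -(cosa _ y01) ltr_cos ?inpi.
  have n : \forall q \near within E (nbhs p), y q < cos z by exact: (cvgr_lt _ cy _ h).
  apply: (filterS _ n) => q /= hq.
  by rewrite -ltr_cos ?inpi ?q01// cosa.
have zi : z \in `[0, pi]%R by rewrite in_itv/= (le_trans a0 (ltW z1)); lra.
have h : cos z < y0 by rewrite -(cosa _ y01) ltr_cos ?inpi.
have n : \forall q \near within E (nbhs p), cos z < y q by exact: (cvgr_gt _ cy _ h).
  apply: (filterS _ n) => q /= hq.
by rewrite -ltr_cos ?inpi ?q01// cosa.
Qed.

Lemma action_angle_le r1 : 0 < r1 <= r0 -> action_angle l g T r1 ch xh.
Proof.
move=> /andP[r10 r1r]; split => //.
- exact: (aa_chc AA).
- exact: (aa_xhc AA).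
- exact: (aa_chp AA).
- exact: (aa_xhp AA).
- exact: (aa_xhi AA).
- exact: (aa_ch0 AA).
- by move=> s ra rb a ab b; apply: (aa_chd AA) => //; exact: le_trans b r1r.
- exact: (aa_chb AA).
by move=> s t r /andP[rp rr]; apply: (aa_step AA); rewrite rp (le_trans rr).
Qed.

End Chart.

(** * Periodic functions on the circle *)

Section CircleTopology.
Context {R : realType} (l : R).
Local Notation circ := (\pi_(circle l)).

Lemma circ_open (s e : R) : 0 < e -> nbhs (circ s) (circ @` ball s e).
Proof.
move=> e0; apply: (@open_nbhs_nbhs _ (circ s : circle l)); split; last first.
  by exists s => //; exact: ballxx.
rewrite /open/= /quotient_open.
have -> : circ @^-1` (circ @` ball s e) = \bigcup_(k in [set: int]) ((fun x : R => x + k%:~R * l) @^-1` ball s e).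
  apply/seteqP; split => x /=.
    move=> [y yb /eqmodP/asboolP[k ek]]; exists k => //=.
    by rewrite -ek addrC subrK.
  move=> [k _ /= xb]; exists (x + k%:~R * l) => //; apply/eqmodP/asboolP.
  by exists k; rewrite addrAC subrr add0r.
apply: bigcup_open => k _; apply: open_comp; last exact: ball_open.
by move=> x _; apply: cvgD; [exact: cvg_id|exact: cvg_cst].
Qed.

(** [repr] is not continuous, but periodicity absorbs its jumps: continuity on the circle is checked
    on the universal cover. *)
Lemma circ_cont (Z : topologicalType) (E : set (circle l * R)%type) (f : R * R -> Z)
    (p : circle l * R) :
  (forall s phi, f (s + l, phi) = f (s, phi)) ->
  f @ within [set q : R * R | E (circ q.1, q.2)] (nbhs (repr p.1, p.2)) --> f (repr p.1, p.2) ->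
  (fun q : circle l * R => f (repr q.1, q.2)) @ within E (nbhs p) --> f (repr p.1, p.2).
Proof.
move=> fper cf W /cf /= fW.
have {}fW : \forall q \near ((repr p.1, p.2) : R * R), E (circ q.1, q.2) -> W (f q) by exact: fW.
have /nbhs_ballP[e e0 be] := fW.
have n : \forall q \near p, (circ @` ball (repr p.1) e) q.1 /\ ball p.2 e q.2.
  exists (circ @` ball (repr p.1) e, ball p.2 e) => //=; split; last exact: nbhsx_ballx.
  by have := circ_open (repr p.1) e0; rewrite reprK.
rewrite /within/=; apply: (filterS _ n) => -[c phi] /= [[s sb <-] pb] Eq.
have -> : f (repr (circ s), phi) = f (s, phi).
  have : circ (repr (circ s)) = circ s by rewrite reprK.
  move=> /eqmodP/asboolP[k ek].
  have -> : repr (circ s) = s + k%:~R * l by rewrite -ek addrC subrK.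
  exact: (@per_int _ _ (fun s => f (s, phi))).
by apply: (be (s, phi)).
Qed.

End CircleTopology.

(** * The conjugacy on the universal cover and on the annulus *)

Section Lift.
Context {R : realType} (lA lB : R) (gA TA gB TB : R -> R * R) (r0 : R)
  (chA xhA chB xhB : R -> R -> R).
Context (AA : action_angle lA gA TA r0 chA xhA) (AB : action_angle lB gB TB r0 chB xhB).
Context (lA0 : 0 < lA) (lB0 : 0 < lB).
Implicit Types (s t r phi : R).

Definition conj_lift (q : R * R) : R * R :=
  let r := rotval r0 chA q.1 q.2 in
  let s' := invx xhB (xhA q.1 r) r in (s', acos (chB s' r)).

Lemma conj_lift_per s phi : conj_lift (s + lA, phi) = conj_lift (s, phi) + (lB, 0).
Proof.
rewrite /conj_lift /= (rotval_per AA) (aa_xhp AA) (invx_per AB lB0) (aa_chp AB).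
by congr (_, _); rewrite addr0.
Qed.

Lemma conj_lift_rotval s phi r : 0 <= r <= r0 -> chA s r = cos phi ->
  conj_lift (s, phi) = (invx xhB (xhA s r) r, acos (chB (invx xhB (xhA s r) r) r)).
Proof. by move=> rb e; rewrite /conj_lift /= (rotval_uniq AA rb e). Qed.

Lemma acos_ch s r : cos (acos (chB s r)) = chB s r.
Proof. by rewrite acosK// in_itv/=; have /andP[/ltW -> ->] := aa_chb AB s r. Qed.

Lemma acos_ch_range s r : 0 <= acos (chB s r) <= pi.
Proof.
have /andP[h1 h2] := aa_chb AB s r.
by rewrite acos_ge0 ?acos_lepi// (ltW h1).
Qed.

Lemma acos_ch_int s r : 0 < r <= r0 -> 0 < acos (chB s r) < pi.
Proof.
move=> /andP[h1 h2]; have /andP[c1 c2] := aa_chb AB s r.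
have lt1 : chB s r < 1 by rewrite -(aa_ch0 AB s); exact: (aa_chd AB).
by rewrite acos_gt0 ?acos_ltpi// ?c1 ?lt1 ?(ltW c1).
Qed.

Lemma conj_lift_cont (p : R * R) :
  0 <= p.2 <= pi -> chA p.1 r0 <= cos p.2 ->
  conj_lift @ within [set q : R * R | 0 <= q.2 <= pi /\ chA q.1 r0 <= cos q.2] (nbhs p)
    --> conj_lift p.
Proof.
move=> pb ph; set E := [set q : R * R | _].
have cr : (fun q : R * R => rotval r0 chA q.1 q.2) @ within E (nbhs p) --> rotval r0 chA p.1 p.2.
  exact: (@rotval_cont _ _ _ _ _ _ _ AA p).
have c1 : (fun q : R * R => q.1) @ within E (nbhs p) --> p.1.
  by apply: cvg_within_filter; exact: cont_fst.
have comp2 (f : R -> R -> R) (u v : R * R -> R) :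
    {for (u p, v p), continuous (fun q : R * R => f q.1 q.2)} ->
    u @ within E (nbhs p) --> u p -> v @ within E (nbhs p) --> v p ->
    (fun q => f (u q) (v q)) @ within E (nbhs p) --> f (u p) (v p).
  move=> cf cu cv.
  exact: (@cvg_comp _ _ _ (fun q => (u q, v q)) (fun q : R * R => f q.1 q.2) _ _ _ (cvg_pair cu cv) cf).
have cx : (fun q : R * R => xhA q.1 (rotval r0 chA q.1 q.2)) @ within E (nbhs p) -->
    xhA p.1 (rotval r0 chA p.1 p.2).
  by apply: (comp2 _ (fun q => q.1)) => //; exact: (aa_xhc AA).
have ci := comp2 (invx xhB) _ _ (@invx_cont _ _ _ _ _ _ _ AB lB0 _) cx cr.
have ca : (fun q => (conj_lift q).2) @ within E (nbhs p) --> (conj_lift p).2.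
  apply: acos_cont_le => [|q|]; try exact: (aa_chb AB).
  by apply: (comp2 chB _ _ _ ci cr); exact: (aa_chc AB).
exact: (cvg_pair ci ca).
Qed.

End Lift.

Section Conj.
Context {R : realType} (TA TB : table R).
Context (SCA0 : strictly_convex 4 TA) (SCB0 : strictly_convex 4 TB).
Context (r0 : R) (chA xhA chB xhB : R -> R -> R).
Context (AA : action_angle (len TA) (gam TA) (gam TA)^`() r0 chA xhA).
Context (AB : action_angle (len TB) (gam TB) (gam TB)^`() r0 chB xhB).
Local Notation circA := (\pi_(circle (len TA))).
Local Notation circB := (\pi_(circle (len TB))).
Let SCA := table_arc SCA0.
Let SCB := table_arc SCB0.
Let lA0 : 0 < len TA. Proof. exact: len_gt0 SCA. Qed.
Let lB0 : 0 < len TB. Proof. exact: len_gt0 SCB. Qed.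
Implicit Types (s t r phi : R).

(** The closed region between the edge and the invariant curve of rotation number [r0]; the billiard
    map sends it into itself. *)
Definition conj_dom : set (phase TA) :=
  [set p | 0 <= p.2 <= pi /\ chA (repr p.1) r0 <= cos p.2].

Definition conj_map (p : phase TA) : phase TB :=
  let q := conj_lift r0 chA xhA chB xhB (repr p.1, p.2) in (circB q.1, q.2).

Let lift s phi := conj_lift r0 chA xhA chB xhB (s, phi).

Lemma conj_map_circ s phi :
  conj_map (circA s, phi) = (circB (lift s phi).1, (lift s phi).2).
Proof.
rewrite /conj_map /=.
apply: (@circ_repr _ TA _ (fun s => (circB (lift s phi).1, (lift s phi).2) : phase TB)) => x.
rewrite /lift (conj_lift_per AA AB lB0) /= addr0; congr (_, _).
by apply/circP; exists 1; rewrite mul1r.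
Qed.

Lemma conj_dom_circ s phi : conj_dom (circA s, phi) <-> 0 <= phi <= pi /\ chA s r0 <= cos phi.
Proof.
rewrite /conj_dom /=.
by rewrite (@circ_repr _ TA _ (fun s => chA s r0)) // => x; exact: (aa_chp AA).
Qed.

Lemma conj_map_cont : {within conj_dom, continuous conj_map}.
Proof.
apply/subspace_continuousP => p [pb ph].
have cl := @conj_lift_cont _ _ _ _ _ _ _ _ _ _ _ _ AA AB lB0 (repr p.1, p.2) pb ph.
have eE : [set q : R * R | conj_dom (circA q.1, q.2)] =
  [set q : R * R | 0 <= q.2 <= pi /\ chA q.1 r0 <= cos q.2].
  by apply/seteqP; split => -[s phi] /conj_dom_circ.
rewrite -eE in cl.
have c1 := cvg_comp _ _ cl (@cont_fst _ _); have c2 := cvg_comp _ _ cl (@cont_snd _ _).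
have cpi : continuous (fun s => circB s : circle (len TB)) by exact: pi_continuous.
have {}c1 := cvg_comp _ _ c1 (cpi _).
have h1 := circ_cont (f := fun q : R * R => circB (lift q.1 q.2).1) _ c1.
have h2 := circ_cont (f := fun q : R * R => (lift q.1 q.2).2) _ c2.
apply: (cvg_pair (h1 _) (h2 _)) => s phi; rewrite /lift (conj_lift_per AA AB lB0) /= ?addr0 //.
by apply/circP; exists 1; rewrite mul1r.
Qed.

Lemma conj_map_edge (p : phase TA) : @bottom_edge R TA p -> conj_dom p /\ @bottom_edge R TB (conj_map p).
Proof.
case: p => c phi e; have {e}-> : phi = 0 by exact: e.
rewrite -[c]reprK; move: (repr c) => s.
have h : chA s 0 = cos (0 : R) by rewrite cos0; exact: (aa_ch0 AA).
have b : 0 <= (0 : R) <= r0 by rewrite lexx ltW// (aa_r0 AA).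
split.
  apply/conj_dom_circ; rewrite lexx pi_ge0 cos0; split => //.
  by have /andP[] := aa_chb AA s r0.
by rewrite conj_map_circ /lift (conj_lift_rotval _ _ AA b h) /bottom_edge/= (aa_ch0 AB) acos1.
Qed.

Lemma conj_map_step (p : phase TA) : conj_dom p ->
  conj_dom (billiard_map p) /\ conj_map (billiard_map p) = billiard_map (conj_map p).
Proof.
case: p => c phi; rewrite -[c]reprK; move: (repr c) => s /conj_dom_circ[pb ph].
have [rb re] := rotvalP AA ph; move: (rotval _ _ _ _) rb re => r rb re.
(* Rotation number 0 is the edge, where both billiard maps are the identity. *)
have [r0'|rn] := eqVneq r 0.
  have p0 : phi = 0.
    apply: cos_inj; rewrite ?in_itv//= ?lexx ?pi_ge0//.
    by rewrite -re r0' (aa_ch0 AA) cos0.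
  have ed : @bottom_edge R TA (circA s, phi) by [].
  have id1 : billiard_map (circA s, phi) = (circA s, phi) :> phase TA.
    by rewrite /billiard_map asboolF// /annulus_int/= p0 ltxx.
  have [_ e2] := conj_map_edge ed.
  rewrite id1; split; first by apply/conj_dom_circ.
  rewrite /billiard_map asboolF// => /andP[h _].
  have e3 : (conj_map (circA s, phi)).2 = 0 := e2.
  by move: (h : 0 < (conj_map (circA s, phi)).2); rewrite e3 ltxx.
have rb' : 0 < r <= r0 by move: rb; rewrite le_eqVlt eq_sym (negPf rn).
have [c1 c2] : chA s r < 1 /\ -1 < chA s r.
  split; last by have /andP[] := aa_chb AA s r.
  by rewrite -(aa_ch0 AA s); case/andP: rb' => a b; exact: (aa_chd AA).
have pp : 0 < phi < pi.
  case/andP: pb => p1 p2; rewrite !lt_neqAle p1 p2 !andbT; apply/andP; split.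
    by apply/eqP => e; move: c1; rewrite re -e cos0 ltxx.
  by apply/eqP => e; move: c2; rewrite re e cospi ltxx.
have cb : -1 < cos phi < 1 by rewrite -re c1 c2.
have [t [tb te]] := cos_out_surj SCA s cb.
rewrite (billiard_lift SCA0 pp tb te).
have te' := te; rewrite -re in te'.
have [i1 i2] := aa_step AA rb' tb te'.
rewrite i1.
have ct : cos (acos (chA t r)) = chA t r by exact: acos_ch AA _ _.
split.
  apply/conj_dom_circ; split; first exact: acos_ch_range AA _ _.
  rewrite ct; case/andP: rb' => rp; rewrite le_eqVlt => /predU1P[->//|lt].
  by apply: ltW; apply: (aa_chd AA) => //; exact: ltW.
rewrite !conj_map_circ /lift (conj_lift_rotval _ _ AA rb re) (conj_lift_rotval _ _ AA rb (esym ct)) /=.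
set s' := invx xhB (xhA s r) r.
have pp' := acos_ch_int AB s' rb'.
have c' := acos_ch AB s' r.
have cb' : -1 < cos (acos (chB s' r)) < 1.
  rewrite c'; have /andP[-> _] := aa_chb AB s' r; rewrite -(aa_ch0 AB s').
  by case/andP: rb' => a b; exact: (aa_chd AB).
have [t' [tb' te2]] := cos_out_surj SCB s' cb'.
rewrite (billiard_lift SCB0 pp' tb' te2).
rewrite c' in te2.
have [j1 j2] := aa_step AB rb' tb' te2.
(* Both next impacts have the coordinate of the starting point increased by [r]. *)
have e : invx xhB (xhA t r) r = t'.
  by rewrite -(invx_uniq AB lB0 t' r) j2 i2 (invxP AB lB0).
by rewrite e -j1.
Qed.

Lemma conj_map_dom_rot (p : phase TA) : conj_dom p ->
  exists s r s', [/\ 0 <= r <= r0, p = (circA s, p.2), chA s r = cos p.2, xhB s' r = xhA s r &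
    conj_map p = (circB s', acos (chB s' r))].
Proof.
case: p => c phi; rewrite -[c]reprK; move: (repr c) => s /conj_dom_circ[pb ph].
have [rb re] := rotvalP AA ph.
exists s, (rotval r0 chA s phi), (invx xhB (xhA s (rotval r0 chA s phi)) (rotval r0 chA s phi)).
split => //; first by rewrite (invxP AB lB0).
by rewrite conj_map_circ /lift (conj_lift_rotval _ _ AA rb re).
Qed.

End Conj.
Arguments conj_dom {R TA}.
Arguments conj_map {R TA TB}.

Section Conjugacy.
Context {R : realType}.
Implicit Types (TA TB : table R).

(** The construction is symmetric: exchanging the tables produces the inverse map. *)
Lemma conj_map_cancel TA TB r0 chA xhA chB xhB
    (SCA : strictly_convex 4 TA) (SCB : strictly_convex 4 TB)
    (AA : action_angle (len TA) (gam TA) (gam TA)^`() r0 chA xhA)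
    (AB : action_angle (len TB) (gam TB) (gam TB)^`() r0 chB xhB) (p : phase TA) :
  conj_dom r0 chA p ->
  conj_dom r0 chB (conj_map r0 chA xhA chB xhB p : phase TB) /\
  conj_map r0 chB xhB chA xhA (conj_map r0 chA xhA chB xhB p : phase TB) = p.
Proof.
move=> pd; have [s [r [s' [rb pe e1 e2 ->]]]] := conj_map_dom_rot SCB AA AB pd.
have c' := acos_ch AB s' r.
split.
  apply/(conj_dom_circ AB); split; first exact: acos_ch_range AB _ _.
  rewrite c'; case/andP: rb => rp; rewrite le_eqVlt => /predU1P[->//|lt].
  by apply: ltW; apply: (aa_chd AB).
rewrite (conj_map_circ SCA AB AA) (conj_lift_rotval _ _ AB rb (esym c')) /= e2.
rewrite (invx_uniq AA (len_gt0 (table_arc SCA))) e1 [RHS]pe; congr (_, _).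
rewrite cosK// in_itv/=; exact: pd.1.
Qed.

Lemma action_angle_conjugate TA TB rA rB chA xhA chB xhB
    (SCA : strictly_convex 4 TA) (SCB : strictly_convex 4 TB) :
  action_angle (len TA) (gam TA) (gam TA)^`() rA chA xhA ->
  action_angle (len TB) (gam TB) (gam TB)^`() rB chB xhB ->
  C0_conjugate_near_boundary TA TB.
Proof.
move=> AA0 AB0; pose r0 := Num.min rA rB.
have r0p : 0 < r0 by rewrite lt_min (aa_r0 AA0) (aa_r0 AB0).
have AA : action_angle (len TA) (gam TA) (gam TA)^`() r0 chA xhA.
  by apply: (action_angle_le AA0); rewrite r0p ge_min lexx.
have AB : action_angle (len TB) (gam TB) (gam TB)^`() r0 chB xhB.
  by apply: (action_angle_le AB0); rewrite r0p ge_min lexx orbT.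
(* By compactness [ch s r0] stays below 1 by a uniform margin, so the domain of the chart contains a
   whole strip along the edge. *)
have collar (T0 : table R) ch xh (SC : strictly_convex 4 T0) :
    action_angle (len T0) (gam T0) (gam T0)^`() r0 ch xh ->
    exists2 d, 0 < d & forall p : phase T0, 0 <= p.2 <= d -> conj_dom r0 ch p.
  move=> A0; have l0 := len_gt0 (table_arc SC).
  have chc : continuous (fun s => 1 - ch s r0).
    move=> s; apply: cvgB; first exact: cvg_cst.
    apply: (cont2_comp (@cont_id _ _) (@cont_cst _ _ r0 _)); exact: (aa_chc A0).
  have [||m m0 hm] := per_pos l0 _ chc.
  - by move=> s; rewrite (aa_chp A0).
  - by move=> s; rewrite subr_gt0 -(aa_ch0 A0 s) (aa_chd A0).
  have [d d0 hd] := (cont_eps _ _).1 (@continuous_cos R 0) _ m0.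
  pose d1 := Num.min (d / 2) (pi / 2).
  have d1d : d1 <= d / 2 by rewrite ge_min lexx.
  have d1p : d1 <= pi / 2 by rewrite ge_min lexx orbT.
  have p0 : 0 < pi :> R := pi_gt0 R.
  exists d1; first by rewrite lt_min !divr_gt0.
  move=> p /andP[h1 h2]; split; first by rewrite h1 (le_trans h2) //; lra.
  have : ball 0 d p.2.
    by rewrite /ball/= sub0r normrN ger0_norm //; lra.
  move/hd; rewrite cos0 ltr_distl => /andP[hc _].
  by have := hm (repr p.1); lra.
have [d d0 hd] := collar _ _ _ SCA AA; have [d' d'0 hd'] := collar _ _ _ SCB AB.
have SU : @strip R TA d `<=` conj_dom r0 chA.
  by move=> p [/= /andP[h1 _] h2]; apply: hd; rewrite h1.
pose h := conj_map r0 chA xhA chB xhB : phase TA -> phase TB.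
pose k := conj_map r0 chB xhB chA xhA : phase TB -> phase TA.
have hk := conj_map_cancel SCA SCB AA AB.
have kh := conj_map_cancel SCB SCA AB AA.
exists (conj_dom r0 chA), (conj_dom r0 chB), h, k, d; split; split => //.
- by split => // p [].
- by move=> _ [p /SU pd <-]; have [] := conj_map_step SCA SCB AA AB pd.
- split; first by move=> p [].
  exists [set p | p.2 < d']; split.
  + apply: (@open_comp _ _ (fun p : phase TB => p.2) [set x | x < d']); last exact: open_lt.
    by move=> p _; exact: cvg_snd.
  + by move=> p e; rewrite /= (e : p.2 = 0).
  + by move=> p [/= h1 /andP[h2 _]]; apply: hd'; rewrite h2 ltW.
- by split; [exact: (@conj_map_cont _ _ _ SCB _ _ _ _ _ AA AB)|exact: (@conj_map_cont _ _ _ SCA _ _ _ _ _ AB AA)].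
- apply/seteqP; split => [_ [p pd <-]|q qd]; first by have [] := hk p pd.
  by have [kd e] := kh q qd; exists (k q).
- by move=> p pd; have [] := hk p pd.
- apply/seteqP; split => [_ [p pd <-]|q qd].
    by have [] := conj_map_edge SCB AA AB pd.
  have [q1 q2] := conj_map_edge SCA AB AA qd.
  by exists (k q) => //; have [] := kh q q1.
- by move=> p /SU pd; have [] := conj_map_step SCA SCB AA AB pd.
Qed.

Lemma family_conjugate TA TB JA JB cA cB
    (SCA : strictly_convex 4 TA) (SCB : strictly_convex 4 TB) :
  invariant_family (len TA) (gam TA) (gam TA)^`() JA cA ->
  invariant_family (len TB) (gam TB) (gam TB)^`() JB cB ->
  C0_conjugate_near_boundary TA TB.
Proof.
move=> FA FB; have [rA [chA [xhA AA]]] := family_action_angle (table_arc SCA) FA.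
have [rB [chB [xhB AB]]] := family_action_angle (table_arc SCB) FB.
exact: (action_angle_conjugate SCA SCB AA AB).
Qed.

End Conjugacy.

(** * Ellipses *)

Section Joachimsthal.
Context {R : realType} (D : set (R * R)) (l : R) (g T g2 g3 g4 : R -> R * R).
Context (SC : convex_arc D l g T g2 g3 g4).
Implicit Types (s t x J e : R).
Local Notation cos_out := (cos_out g T).
Local Notation cos_in := (cos_in g T).
Local Notation clen := (clen g).
Let l0 : 0 < l := len_gt0 SC.

(* [cos_in s t'] is the derivative of the chord length, which increases from [0]. *)
Lemma cos_in_pos s t : s < t < s + l ->
  (forall t', s < t' <= t -> cos_in s t' != 0) -> 0 < cos_in s t.
Proof.
move=> /andP[st ts] nz; have stb : s < t < s + l by rewrite st.
have nt : cos_in s t != 0 by apply: nz; rewrite st lexx.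
rewrite lt_neqAle eq_sym nt leNgt; apply/negP => neg.
have cin x : s < x <= t -> {for x, continuous (fun x => cos_in s x)}.
  move=> /andP[sx xt]; apply: (cont_cos_in SC); [exact: cont_cst|exact: cont_id|].
  by rewrite sx (le_lt_trans xt).
have negx x : s < x < t -> cos_in s x < 0.
  move=> /andP[sx xt]; rewrite ltNge; apply/negP => pos.
  have [||y [/andP[y1 y2] ey]] := @IVTc _ (fun x => - cos_in s x) x t 0 (ltW xt).
  - by move=> y /andP[y1 y2]; apply: cvgN; apply: cin; rewrite (lt_le_trans sx).
  - by rewrite oppr_le0 pos oppr_ge0 ltW.
  have := nz y; rewrite (lt_le_trans sx y1) y2 => /(_ isT).
  by rewrite -oppr_eq0 ey eqxx.
have cl : {for s, continuous (fun x => clen s x)}.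
  apply: cont_norm2; apply: cvgB; [exact: (cg SC)|exact: cvg_cst].
have n : \forall x \near s, clen s x < clen s t.
  apply: near_lt => //; first exact: cvg_cst.
  rewrite {1}/clen subrr /norm2 /dot2 /= mulr0 addr0 sqrtr0; exact: clen_gt0 SC _ _ stb.
have /nbhs_ballP[d /= d0 hd] := n.
pose x := s + Num.min (d / 2) ((t - s) / 2).
have m1 : Num.min (d / 2) ((t - s) / 2) <= d / 2 by rewrite ge_min lexx.
have m2 : Num.min (d / 2) ((t - s) / 2) <= (t - s) / 2 by rewrite ge_min lexx orbT.
have m0 : 0 < Num.min (d / 2) ((t - s) / 2) by rewrite lt_min; lra.
have sx : s < x by rewrite /x; lra.
have xt : x < t by rewrite /x; lra.
have : clen s x < clen s t.
  by apply: hd; rewrite /ball/= /x opprD addrA subrr sub0r normrN gtr0_norm//; lra.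
suff : - clen s x < - clen s t by rewrite ltrN2 => h1 h2; have := lt_trans h1 h2; rewrite ltxx.
apply: (@is_derive_ltr _ (fun x => - clen s x) (fun x => - cos_in s x)) => // y yb.
  by apply: is_deriveN; apply: (clen_d2 SC); move: yb ts sx; lra.
by rewrite oppr_gt0; apply: negx; move: yb sx; lra.
Qed.

Context (nu : R -> R) (nuc : continuous nu) (nup : forall s, nu (s + l) = nu s)
  (nu0 : forall s, 0 < nu s).
Hypothesis inv : forall s t, s < t < s + l ->
  nu s ^+ 2 * (1 - cos_out s t ^+ 2) = nu t ^+ 2 * (1 - cos_in s t ^+ 2).

(** The curve on which the conserved quantity [nu s * sin phi] has the value [J]. *)
Definition joach s J := Num.sqrt (1 - (J / nu s) ^+ 2).

Lemma joach_family : exists J0, invariant_family l g T J0 joach.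
Proof.
have [m m0 hm] := per_pos l0 nup nuc nu0.
have [M M0 hM] := per_bounded l0 nup nuc.
have {}hM s : nu s <= M by apply: le_trans (hM s); exact: ler_norm.
(* With [J < m / 2] the sine [J / nu s] is below [1 / 2], so the cosines exceed [1 / 2] and the
   square root stays away from its singularity. *)
pose J0 := m / 2.
have J00 : 0 < J0 by rewrite /J0; lra.
have qb s J : 0 < J < J0 -> 0 < J / nu s < 1 / 2.
  move=> /andP[j1 j2]; rewrite divr_gt0//= ltr_pdivrMr//.
  by have := hm s; rewrite /J0 in j2; lra.
have sb s J : 0 < J < J0 -> 3 / 4 < 1 - (J / nu s) ^+ 2 < 1.
  move=> /(qb s)/andP[q1 q2]; have : 0 < (J / nu s) ^+ 2 by exact: exprn_gt0.
  have : (J / nu s) ^+ 2 < (1 / 2) ^+ 2 by rewrite ltr_pXn2r// nnegrE ltW.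
  have -> : (1 / 2) ^+ 2 = 1 / 4 :> R by field.
  by lra.
have sqr s J : 0 < J < J0 -> joach s J ^+ 2 = 1 - (J / nu s) ^+ 2.
  by move=> /(sb s) /andP[h _]; rewrite sqr_sqrtr//; lra.
have cb s J : 0 < J < J0 -> 1 / 2 < joach s J < 1.
  move=> Jb; have := sb s J Jb; rewrite -sqr// => /andP[h1 h2].
  have p : 0 <= joach s J by exact: sqrtr_ge0.
  by rewrite !real_ltNge ?num_real//; apply/andP; split; apply/negP => h; move: h1 h2; rewrite expr2; nra.
have diff s J1 J2 : 0 < J1 < J0 -> 0 < J2 < J0 ->
    joach s J1 - joach s J2 = (J1 + J2) / (nu s ^+ 2 * (joach s J1 + joach s J2)) * (J2 - J1).
  move=> b1 b2; have := sqr s J1 b1; have := sqr s J2 b2.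
  have := cb s J1 b1; have := cb s J2 b2.
  move: (joach s J1) (joach s J2) => x y /andP[x1 _] /andP[y1 _] ey ex.
  have xy : x + y != 0 by apply/eqP; lra.
  have n0 := nu0 s; have n1 : nu s != 0 by rewrite gt_eqF.
  apply: (mulIf xy).
  have -> : (x - y) * (x + y) = x ^+ 2 - y ^+ 2 by ring.
  by rewrite ex ey; field; rewrite n1 xy.
have near_small J : 0 < J < J0 -> exists eta, [/\ 0 < eta, eta <= J / 2 & eta <= J0 - J].
  move=> Jb; exists (Num.min (J / 2) (J0 - J)).
  rewrite lt_min !ge_min !lexx orbT; split => //.
  by lra.
have inb J eta J1 : eta <= J / 2 -> eta <= J0 - J -> `|J1 - J| < eta -> 0 < J1 < J0 /\ J / 2 < J1 < 3 / 2 * J.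
  by rewrite ltr_norml; lra.
exists J0; split => //.
- by move=> s J /(cb s); lra.
- by move=> s J _; rewrite /joach nup.
- move=> J Jb s; apply: (@continuous_comp _ _ _ (fun s => 1 - (J / nu s) ^+ 2) Num.sqrt).
    apply: cvgB; first exact: cvg_cst.
    apply: (@continuous_comp _ _ _ (fun s => J / nu s) (fun x => x ^+ 2)); last exact: exprn_continuous.
    by apply: cvgM; [exact: cvg_cst|apply: cvgV; [rewrite gt_eqF|exact: nuc]].
  exact: sqrt_continuous.
- move=> e e0; pose J1 := Num.min (m / 4) (m * e / 2).
  have a1 : J1 <= m / 4 by rewrite ge_min lexx.
  have a2 : J1 <= m * e / 2 by rewrite ge_min lexx orbT.
  have a0 : 0 < J1 by rewrite lt_min !divr_gt0// mulr_gt0.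
  exists J1; first by rewrite a0 /J0; lra.
  move=> s J /andP[j1 j2]; have Jb : 0 < J < J0 by rewrite j1 /J0; lra.
  have h1 := sqr s J Jb; have /andP[c1 c2] := cb s J Jb; have /andP[q1 q2] := qb s J Jb.
  have qe : J / nu s < e.
    rewrite ltr_pdivrMr//; have := hm s => h.
    have : e * m <= e * nu s by rewrite ler_pM2l.
    have : 0 < e * m by exact: mulr_gt0.
    by rewrite mulrC in a2; lra.
  have : joach s J ^+ 2 < joach s J by rewrite expr2 -[X in _ < X]mulr1 ltr_pM2l//; lra.
  have : (J / nu s) ^+ 2 < J / nu s by rewrite expr2 -[X in _ < X]mulr1 ltr_pM2l//; lra.
  by lra.
- move=> s t J Jb st e.
  have nuJ x : nu x ^+ 2 * (1 - joach x J ^+ 2) = J ^+ 2.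
    by rewrite sqr//; have n1 : nu x != 0 by [rewrite gt_eqF]; field.
  (* Conservation determines [cos_in s t] only up to sign. No chord from [s] to a point [t'] up to
     [t] arrives perpendicularly, since this would give [nu t' <= J < m]; so [cos_in_pos]
     applies. *)
  have pos : 0 < cos_in s t.
    apply: cos_in_pos => // t' /andP[st' tt']; apply/eqP => z.
    have st'b : s < t' < s + l by rewrite st' (le_lt_trans tt')//; case/andP: st.
    have h := inv st'b; rewrite z expr0n /= subr0 mulr1 in h.
    have cout : joach s J <= cos_out s t'.
      move: tt'; rewrite le_eqVlt => /predU1P[->|lt]; first by rewrite e.
      by rewrite -e ltW//; apply: (cos_out_decr SC) => //; case/andP: st.
    have /andP[c1 _] := cb s J Jb.
    have sq : joach s J ^+ 2 <= cos_out s t' ^+ 2 by rewrite ler_pXn2r// nnegrE; lra.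
    have : nu t' ^+ 2 <= J ^+ 2.
      by rewrite -h -(nuJ s) ler_pM2l ?exprn_gt0//; lra.
    rewrite ler_pXn2r ?nnegrE ?(ltW (nu0 _))//; last by lra.
    by have := hm t'; rewrite /J0 in Jb; lra.
  have h := inv st; rewrite e nuJ -(nuJ t) in h.
  have n2 : nu t ^+ 2 != 0 by rewrite expf_neq0// gt_eqF.
  have /(mulfI n2) h2 := h.
  have h3 : joach t J ^+ 2 = cos_in s t ^+ 2 by lra.
  apply: sqr_eq_pos => //; have := cb t J Jb; lra.
- move=> J Jb; have [eta [eta0 h1 h2]] := near_small J Jb.
  exists (J / (M ^+ 2 * 2)), (3 * J / (m ^+ 2)), eta; split => //.
    by rewrite divr_gt0 ?mulr_gt0 ?exprn_gt0//; case/andP: Jb.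
  move=> J1 J2 s k1 k2 k12; have [b1 b1'] := inb J eta J1 h1 h2 k1.
  have [b2 b2'] := inb J eta J2 h1 h2 k2.
  rewrite diff// !ler_pM2r ?subr_gt0//.
  have := cb s J1 b1; have := cb s J2 b2; move: (joach s J1) (joach s J2) => x y hx hy.
  have n0 := nu0 s.
  have M2 : nu s ^+ 2 <= M ^+ 2 by rewrite ler_pXn2r// nnegrE ltW.
  have m2 : m ^+ 2 <= nu s ^+ 2 by rewrite ler_pXn2r// nnegrE ltW.
  have d0 : 0 < nu s ^+ 2 * (x + y) by rewrite mulr_gt0 ?exprn_gt0//; lra.
  have up : nu s ^+ 2 * (x + y) <= M ^+ 2 * 2 by rewrite ler_pM ?exprn_ge0 ?(ltW n0)//; lra.
  have lo : m ^+ 2 * 1 <= nu s ^+ 2 * (x + y) by rewrite ler_pM ?exprn_ge0 ?(ltW m0)//; lra.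
  have mp : 0 < m ^+ 2 by exact: exprn_gt0.
  apply/andP; split; apply: ler_pM; rewrite ?invr_ge0 ?lef_pV2 ?posrE //.
  + by lra.
  + by rewrite mulr_ge0// exprn_ge0 // ltW.
  + by lra.
  + by apply: lt_le_trans d0 up.
  + by lra.
  + exact: ltW.
  + by lra.
  + by rewrite mulr1 in lo.
move=> J Jb; have [eta [eta0 h1 h2]] := near_small J Jb.
exists set0, (fun s => (J + J) / (nu s ^+ 2 * (joach s J + joach s J))).
split; first exact: countable0.
move=> s _ e e0; have [b _] : 0 < J < J0 /\ J / 2 < J < 3 / 2 * J.
  by apply: (inb J eta J h1 h2); rewrite subrr normr0.
have cj : continuous (joach s).
  move=> x; apply: (@continuous_comp _ _ _ (fun J => 1 - (J / nu s) ^+ 2) Num.sqrt).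
    apply: cvgB; first exact: cvg_cst.
    apply: (@continuous_comp _ _ _ (fun J => J / nu s) (fun x => x ^+ 2)); last exact: exprn_continuous.
    by apply: cvgM; [exact: cvg_id|exact: cvg_cst].
  exact: sqrt_continuous.
have d0 : nu s ^+ 2 * (joach s J + joach s J) != 0.
  by rewrite gt_eqF// mulr_gt0 ?exprn_gt0//; have := cb s J b; lra.
have cj2 (u : R * R -> R) (p : R * R) : {for p, continuous u} -> {for p, continuous (fun q => joach s (u q))}.
  by move=> cu; apply: continuous_comp => //; exact: cj.
have c2 : {for (J, J), continuous (fun q : R * R => (q.1 + q.2) / (nu s ^+ 2 * (joach s q.1 + joach s q.2)))}.
  apply: cvgM; first by apply: cvgD; [exact: cont_fst|exact: cont_snd].
  apply: cvgV => //; apply: cvgM; first exact: cvg_cst.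
  by apply: cvgD; apply: cj2; [exact: cont_fst|exact: cont_snd].
have [d d00 hd] := (cont_eps _ _).1 c2 e e0.
exists (Num.min d eta); first by rewrite lt_min d00.
move=> J1 J2; rewrite !lt_min => /andP[k1 k1'] /andP[k2 k2'] k12.
have [b1 _] := inb J eta J1 h1 h2 k1'; have [b2 _] := inb J eta J2 h1 h2 k2'.
rewrite diff// mulfK; last by rewrite subr_eq0 gt_eqF.
by apply: (hd (J1, J2)); split; rewrite /ball/= distrC.
Qed.

End Joachimsthal.

(** * Joachimsthal's integral of an ellipse *)

Section Ellipse.
Context {R : realType} (D : set (R * R)) (l : R) (g T g2 g3 g4 : R -> R * R).
Context (SC : convex_arc D l g T g2 g3 g4).
Context (c u : R * R) (a b : R) (a0 : 0 < a) (b0 : 0 < b).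
Hypothesis DE : D = [set p | (dot2 (p - c) u / a) ^+ 2 + (dot2 (p - c) (rot90 u) / b) ^+ 2 < 1].
Implicit Types (s t x J e : R) (p q : R * R).

(** The bilinear form whose open unit ball around [c] is [D]; [ell_grad] is half the gradient of its
    quadratic form. *)
Definition ell_form p q :=
  dot2 p u * dot2 q u / a ^+ 2 + dot2 p (rot90 u) * dot2 q (rot90 u) / b ^+ 2.

Definition ell_grad p : R * R := (dot2 p u / a ^+ 2) *: u + (dot2 p (rot90 u) / b ^+ 2) *: rot90 u.

Lemma ell_gradE p q : dot2 (ell_grad p) q = ell_form p q.
Proof. by rewrite /ell_form /ell_grad /dot2 /= /GRing.scale /=; ring. Qed.

Lemma ell_domE : D = [set p | ell_form (p - c) (p - c) < 1].
Proof.
have an : a != 0 by rewrite gt_eqF. have bn : b != 0 by rewrite gt_eqF.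
by rewrite DE; congr mkset; apply/funext => p; rewrite /ell_form !expr_div_n !expr2.
Qed.

Lemma ell_form_sym p q : ell_form p q = ell_form q p.
Proof. by rewrite /ell_form; ring. Qed.

Lemma ell_formD p q r : ell_form p (q + r) = ell_form p q + ell_form p r.
Proof. by rewrite -!ell_gradE dot2Dr. Qed.

Lemma ell_formN p q : ell_form p (- q) = - ell_form p q.
Proof. by rewrite -!ell_gradE -scaleN1r dot2Zr mulN1r. Qed.

Lemma cont_ell_grad (X : topologicalType) (f : X -> R * R) (y : X) :
  {for y, continuous f} -> {for y, continuous (fun z => ell_grad (f z))}.
Proof.
move=> cf; have cu : {for y, continuous (fun z => dot2 (f z) u)}.
  by apply: cont_dot2 => //; exact: cont_cst.
have cv : {for y, continuous (fun z => dot2 (f z) (rot90 u))}.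
  by apply: cont_dot2 => //; exact: cont_cst.
by apply: cvgD; apply: cvgZ; [apply: cvgM => //; exact: cvg_cst|exact: cvg_cst|apply: cvgM => //; exact: cvg_cst|exact: cvg_cst].
Qed.

Lemma cont_ell_form (X : topologicalType) (f : X -> R * R) (y : X) :
  {for y, continuous f} -> {for y, continuous (fun z => ell_form (f z) (f z))}.
Proof.
move=> cf; have -> : (fun z => ell_form (f z) (f z)) = (fun z => dot2 (ell_grad (f z)) (f z)).
  by apply/funext => z; rewrite ell_gradE.
by apply: cont_dot2 => //; exact: cont_ell_grad.
Qed.

Lemma ell_boundary s : ell_form (g s - c) (g s - c) = 1.
Proof.
apply/eqP; rewrite eq_le; apply/andP; split; last first.
  by have := arc_notin SC (s := s); rewrite ell_domE /= => /negP; rewrite -leNgt.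
rewrite leNgt; apply/negP => lt.
have cq : {for g s, continuous (fun p : R * R => ell_form (p - c) (p - c))}.
  by apply: cont_ell_form; apply: cvgB; [exact: cvg_id|exact: cvg_cst].
have n := near_lt (@cont_cst _ R 1 (g s)) cq lt.
have [p [Dp h]] := arc_closure SC n.
by move: Dp; rewrite ell_domE /= => h2; have := lt_trans h h2; rewrite ltxx.
Qed.

Lemma ell_tangent s : ell_form (g s - c) (T s) = 0.
Proof.
have d0 : is_derive s 1 (fun x => g x - c) (T s) by apply: is_derive_subr; exact: (dT SC).
have d1 := is_derive_dot2r u d0; have d2 := is_derive_dot2r (rot90 u) d0.
have m := is_deriveD (is_deriveZ (a ^- 2) (is_deriveM d1 d1)) (is_deriveZ (b ^- 2) (is_deriveM d2 d2)).
have D1 : is_derive s 1 (fun=> 1 : R) (2 * ell_form (g s - c) (T s)).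
  have -> : (fun=> 1 : R) = (fun x => a ^- 2 * (dot2 u (g x - c) * dot2 u (g x - c)) +
      b ^- 2 * (dot2 (rot90 u) (g x - c) * dot2 (rot90 u) (g x - c))).
    apply/funext => x; rewrite -(ell_boundary x) /ell_form !(dot2C _ u) !(dot2C _ (rot90 u)).
    by rewrite [X in X + _]mulrC [X in _ + X]mulrC.
  apply: (is_derive_eq m).
  rewrite /ell_form /GRing.scale /= !(dot2C _ u) !(dot2C _ (rot90 u)); ring.
have D2 : is_derive s 1 (fun=> 1 : R) 0 by exact: is_derive_cst.
have := @derive_val _ _ _ _ _ _ _ D1; rewrite (@derive_val _ _ _ _ _ _ _ D2) => /esym/eqP.
by rewrite mulf_eq0 pnatr_eq0 /= => /eqP.
Qed.

(** The length of [ell_grad], which by [ell_gradN] points along the outward normal. *)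
Definition ell_norm s := - det2 (T s) (ell_grad (g s - c)).

Lemma ell_gradN s : ell_grad (g s - c) = - ell_norm s *: rot90 (T s).
Proof.
rewrite /ell_norm opprK [LHS](unit_frame _ (T_unit SC s)).
by rewrite dot2C ell_gradE ell_tangent scale0r add0r.
Qed.

Lemma ell_norm_gt0 s : 0 < ell_norm s.
Proof.
have Dc : D c by rewrite ell_domE /= subrr /ell_form /dot2 /= !mul0r !addr0 !mul0r addr0.
have h := dom_left SC s Dc.
have e : ell_norm s * det2 (T s) (c - g s) = 1.
  rewrite -(ell_boundary s) -ell_gradE ell_gradN.
  rewrite /dot2 /det2 /rot90 /= /GRing.scale /=; ring.
by rewrite -(pmulr_lgt0 _ h) e.
Qed.

(** The conserved quantity is [ell_norm s * sin phi]. For a chord from [p] to [q], taken relative to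
    the centre, its conservation is the identity [ell_form (p + q) (q - p) = 0], valid because both
    points have form value 1. *)
Lemma ellipse_family : exists J0 f, invariant_family l g T J0 f.
Proof.
have [||||J0 F] := @joach_family _ _ _ _ _ _ _ _ SC ell_norm.
- move=> s; have cc : {for s, continuous (fun x => det2 (T x) (ell_grad (g x - c)))}.
    apply: cont_det2; first exact: (cT SC).
    by apply: cont_ell_grad; apply: cvgB; [exact: (cg SC)|exact: cvg_cst].
  exact: (cvgN cc).
- by move=> s; rewrite /ell_norm (arc_per SC) (arc_T_per SC).
- exact: ell_norm_gt0.
- move=> s t st; have L0 := clen_gt0 SC st.
  have zero : ell_norm s * det2 (T s) (g t - g s) + ell_norm t * det2 (T t) (g t - g s) = 0.
    have rd r v : ell_norm r * det2 (T r) v = - ell_form (g r - c) v.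
      rewrite -ell_gradE ell_gradN /dot2 /det2 /rot90 /= /GRing.scale /=; ring.
    have e1 := ell_boundary s; have e2 := ell_boundary t.
    rewrite !rd.
    have -> : g t - g s = (g t - c) + - (g s - c) by rewrite opprB addrA subrK.
    move: (g t - c) (g s - c) e1 e2 => p q e1 e2.
    by rewrite !ell_formD !ell_formN e1 e2 (ell_form_sym q); ring.
  have us := unit_decomp (g t - g s) (T_unit SC s); have ut := unit_decomp (g t - g s) (T_unit SC t).
  rewrite -norm2_sqr in us; rewrite -norm2_sqr in ut.
  have n0 : clen g s t != 0 by rewrite gt_eqF.
  have q (x y : R) : clen g s t ^+ 2 = x ^+ 2 + y ^+ 2 -> 1 - (x / clen g s t) ^+ 2 = (y / clen g s t) ^+ 2.
    by move=> h; rewrite !expr_div_n; apply: (mulIf (expf_neq0 2 n0)); rewrite mulrBl mul1r !divfK ?expf_neq0// h; ring.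
  rewrite /cos_out /cos_in (q _ _ us) (q _ _ ut) -!exprMn.
  apply/eqP; rewrite -subr_eq0 subr_sqr !mulrA -!mulrDl zero mul0r mulr0; exact/eqP.
by exists J0, (joach ell_norm).
Qed.

End Ellipse.

Lemma elliptic_family (R : realType) (e : R) (Om : table R) : strictly_convex 4 Om ->
  elliptic_domain e Om -> exists J0 f, invariant_family (len Om) (gam Om) (gam Om)^`() J0 f.
Proof.
move=> SC [c [u [a [b [_ /andP[b0 ba] _ DE]]]]].
exact: (ellipse_family (table_arc SC) (lt_le_trans b0 ba) b0 DE).
Qed.

Lemma disc_family (R : realType) (Om : table R) : strictly_convex 4 Om ->
  disc_domain Om -> exists J0 f, invariant_family (len Om) (gam Om) (gam Om)^`() J0 f.
Proof.
move=> SC [c [rho [r0 DE]]].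
apply: (@ellipse_family _ _ _ _ _ _ _ _ (table_arc SC) c (1, 0) rho rho r0 r0).
rewrite DE; congr mkset; apply/funext => p.
have -> : dot2 (p - c) (1, 0) = (p - c).1 by rewrite /dot2 /=; ring.
have -> : dot2 (p - c) (rot90 (1, 0)) = (p - c).2 by rewrite /dot2 /rot90 /=; ring.
by rewrite !expr_div_n -mulrDl ltr_pdivrMr ?exprn_gt0// mul1r /dot2 !expr2.
Qed.

(** * Caustics *)

Section Minimum.
Context {R : realType}.
Implicit Types (a b h z : R).

Lemma tube (X : topologicalType) a b (P : R -> X -> Prop) (x : X) :
  (forall h, a <= h <= b -> \forall q \near ((h, x) : R * X), P q.1 q.2) ->
  \forall y \near x, forall h, a <= h <= b -> P h y.
Proof.
move=> H.
have cmp : compact `[a, b]%classic by exact: segment_compact.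
have /compact_near_coveringP/(_ X (nbhs x) (fun y h => P h y) _) cov := cmp.
have n : \forall y \near x, `[a, b]%classic `<=` P^~ y.
  apply: cov => h; rewrite /= in_itv /= => /H; exact.
apply: (filterS _ n) => y yP h hb; apply: yP; rewrite /= in_itv/=; exact: hb.
Qed.

Variable X : topologicalType.
Implicit Types (f : R -> X -> R) (x : X).

(** Minimum over [0 <= h <= 1], later one period of a closed leaf. Compactness, in the form of
    [tube], makes it continuous in [x]. *)
Definition minv f x : R := xget 0 [set m | (exists h, 0 <= h <= 1 /\ f h x = m) /\
  forall h, 0 <= h <= 1 -> m <= f h x].

Lemma minvP f x : (forall h, {for h, continuous (f^~ x)}) ->
  (exists h, 0 <= h <= 1 /\ f h x = minv f x) /\ forall h, 0 <= h <= 1 -> minv f x <= f h x.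
Proof.
move=> cf; rewrite /minv; case: xgetP => [m _ //|].
have [c [cb cm]] := EVT_minc ler01 (fun h _ => cf h).
by move=> /(_ (f c x)) []; split; [exists c|].
Qed.

Lemma minv_cont f x :
  (forall h, {for (h, x), continuous (fun q : R * X => f q.1 q.2)}) ->
  (\forall y \near x, forall h, {for h, continuous (f^~ y)}) ->
  {for x, continuous (minv f)}.
Proof.
move=> cf n0; have [[h [hb e]] lo] := minvP (nbhs_singleton n0).
have cs (z : R) (q : R * X) : {for q, continuous (fun=> z)} by exact: cvg_cst.
apply: (cvg_sandwich ltr01) => z /andP[z1 z2].
  have n : \forall y \near x, forall k, 0 <= k <= 1 -> z < f k y.
    apply: tube => k kb; apply: near_lt; [exact: cs|exact: cf|].
    by apply: lt_le_trans z2 _; exact: lo.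
  apply: (filterS _ (filterI n0 n)) => y [cy hy].
  by have [[k [kb <-]] _] := minvP cy; exact: hy.
have cx : {for x, continuous (f h)}.
  apply: (@continuous_comp _ _ _ (fun y => (h, y)) (fun q : R * X => f q.1 q.2)); last exact: cf.
  by apply: cont_pair; [exact: cvg_cst|exact: cvg_id].
have n : \forall y \near x, f h y < z.
  by apply: near_lt => //; [exact: cvg_cst|rewrite e].
apply: (filterS _ (filterI n0 n)) => y [cy hy].
have [_ lo'] := minvP cy; exact: le_lt_trans (lo' _ hb) hy.
Qed.

Lemma segment_sign (V : normedModType R) (F : V -> R) (p q : V) :
  (forall a, 0 <= a <= 1 -> {for (p + a *: (q - p)), continuous F}) ->
  (forall a, 0 <= a <= 1 -> F (p + a *: (q - p)) != 0) ->
  0 < F p -> 0 < F q.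
Proof.
move=> cF nz Fp.
have e0 : p + 0 *: (q - p) = p by rewrite scale0r addr0.
have e1 : p + 1 *: (q - p) = q by rewrite scale1r addrCA subrr addr0.
rewrite lt_neqAle eq_sym -{1}e1 nz ?lexx ?ler01//= leNgt; apply/negP => Fq.
have [||a [ab e]] := @IVTc _ (fun a => - F (p + a *: (q - p))) 0 1 0 ler01.
- move=> a ab; apply: cvgN.
  apply: (@continuous_comp _ _ _ (fun a => p + a *: (q - p)) F); last exact: cF.
  by apply: cvgD; [exact: cvg_cst|apply: cvgZ; [exact: cvg_id|exact: cvg_cst]].
- by rewrite e0 e1 oppr_le0 oppr_ge0 !ltW.
by have := nz a ab; rewrite -oppr_eq0 e eqxx.
Qed.

End Minimum.

(** The data of an integrable table used below. Whether the leaves grow or shrink with [t] is still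
    open. The [t]-derivative is recorded through [det2 u], that is, for real functions. *)
Record foliation {R : realType} (D : set (R * R)) (G Gh Gt : R * R -> R * R) : Prop := Foliation {
  fol_c : forall p, 0 < p.2 < 1 -> {for p, continuous G};
  fol_ch : forall p, 0 < p.2 < 1 -> {for p, continuous Gh};
  fol_ct : forall p, 0 < p.2 < 1 -> {for p, continuous Gt};
  fol_dh : forall h t : R, 0 < t < 1 -> is_derive h 1 (fun x : R => G (x, t)) (Gh (h, t));
  fol_dt : forall u (h t : R), 0 < t < 1 ->
    is_derive t 1 (fun x : R => det2 u (G (h, x))) (det2 u (Gt (h, t)));
  fol_det : forall p, 0 < p.2 < 1 -> det2 (Gh p) (Gt p) != 0;
  fol_per : forall h t : R, 0 < t < 1 -> G (h + 1, t) = G (h, t);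
  fol_inj : forall h h' t : R, 0 < t < 1 -> G (h, t) = G (h', t) -> exists k : int, h = h' + k%:~R;
  fol_side : forall h t : R, 0 < t < 1 ->
    (forall x, 0 <= det2 (Gh (h, t)) (G (x, t) - G (h, t))) \/
    (forall x, det2 (Gh (h, t)) (G (x, t) - G (h, t)) <= 0);
  fol_dom : forall p, 0 < p.2 < 1 -> D (G p);
  fol_cover : exists U : set (R * R), [/\ open U, boundary D `<=` U &
    forall x, U x -> D x -> exists p, 0 < p.2 < 1 /\ G p = x] }.

Section Sections.
Context {R : realType}.

Lemma derive_section (V W : normedModType R) (f : V -> W) (k : R -> V) (v : V) (x : R) :
  (forall a, k (a *: 1 + x) = a *: v + k x) -> derivable f (k x) v ->
  is_derive x 1 (f \o k) ('D_v f (k x)).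
Proof.
move=> kE df.
have E : (fun a : R => a^-1 *: ((f \o k) (a *: 1 + x) - (f \o k) x)) =
         (fun a : R => a^-1 *: (f (a *: v + k x) - f (k x))).
  by apply/funext => a; rewrite /= kE.
by apply: DeriveDef; [rewrite /derivable E|rewrite /derive E].
Qed.

Lemma foliation_flip (D : set (R * R)) (G Gh Gt : R * R -> R * R) : foliation D G Gh Gt ->
  foliation D (fun p => G (p.1, 1 - p.2)) (fun p => Gh (p.1, 1 - p.2)) (fun p => - Gt (p.1, 1 - p.2)).
Proof.
move=> F; have fb (t : R) : 0 < t < 1 -> 0 < 1 - t < 1 by lra.
have cfl (p : R * R) : {for p, continuous (fun p : R * R => (p.1, 1 - p.2))}.
  apply: cont_pair; first exact: cont_fst.
  by apply: cvgB; [exact: cvg_cst|exact: cont_snd].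
have cc (f : R * R -> R * R) (p : R * R) : {for (p.1, 1 - p.2), continuous f} ->
    {for p, continuous (fun p : R * R => f (p.1, 1 - p.2))}.
  by move=> cf; apply: (@continuous_comp _ _ _ (fun p : R * R => (p.1, 1 - p.2)) f).
split.
- by move=> p /fb pb; apply: cc; exact: (fol_c F).
- by move=> p /fb pb; apply: cc; exact: (fol_ch F).
- by move=> p /fb pb; apply: cvgN; apply: cc; exact: (fol_ct F).
- by move=> h t /fb tb; exact: (fol_dh F h tb).
- move=> u h t /fb tb; have d1 : is_derive t 1 (fun x : R => 1 - x) (-1).
    by apply: (is_derive_eq (is_deriveB (is_derive_cst (1:R) t (1:R)) (is_derive_id t (1:R)))); rewrite sub0r.
  rewrite /= -[- Gt _]scaleN1r det2Zr mulrC.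
  exact: (@is_derive1_comp R (fun x => det2 u (G (h, x))) (fun x => 1 - x) t _ _ (fol_dt F u h tb) d1).
- move=> p /fb pb; rewrite /= -[- Gt _]scaleN1r det2Zr mulN1r oppr_eq0; exact: (fol_det F).
- by move=> h t /fb tb; exact: (fol_per F h tb).
- by move=> h h' t /fb tb; exact: (fol_inj F tb).
- by move=> h t /fb tb; exact: (fol_side F h tb).
- by move=> p /fb pb; exact: (fol_dom F).
have [U [oU bU cU]] := fol_cover F; exists U; split => // x Ux Dx.
have [p [pb <-]] := cU x Ux Dx; exists (p.1, 1 - p.2); split; first exact: fb.
by rewrite /= opprB addrCA subrr addr0; case: p pb.
Qed.

End Sections.

Definition preserves_tangency {R : realType} (Om : table R) (G : R * R -> R * R) :=
  forall t, 0 < t < 1 -> forall p : phase Om, annulus_int p ->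
    tangent_to (fun h => G (h, t)) p -> tangent_to (fun h => G (h, t)) (billiard_map p).

Lemma integrable_foliation (R : realType) (Om : table R) (r : nat) :
  integrable_near_boundary Om r.+1 ->
  exists G Gh Gt, foliation (dom Om) G Gh Gt /\ preserves_tangency Om G.
Proof.
move=> [G [cG dG caus _ [U [oU bU cU]]]].
have [cG0 cGv] := cG.
have d1 (v p : R * R) : 0 < p.2 < 1 -> derivable G p v by move=> pb; have [h _] := cGv v; exact: h.
have c1 (v p : R * R) : 0 < p.2 < 1 -> {for p, continuous (fun x => 'D_v G x)}.
  by move=> pb; have [_ h] := cGv v; exact: classC_continuous h pb.
have dh (h t : R) : 0 < t < 1 -> is_derive h 1 (fun x : R => G (x, t)) ('D_(1, 0) G (h, t)).
  move=> tb; apply: (@derive_section _ _ _ G (fun x : R => (x, t)) (1, 0) h) => [a|]; last exact: d1.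
  by apply: pair_ext; rewrite /= /GRing.scale /= ?mulr1 ?mulr0 ?add0r.
have dt (h t : R) : 0 < t < 1 -> is_derive t 1 (fun x : R => G (h, x)) ('D_(0, 1) G (h, t)).
  move=> tb; apply: (@derive_section _ _ _ G (fun x : R => (h, x)) (0, 1) t) => [a|]; last exact: d1.
  by apply: pair_ext; rewrite /= /GRing.scale /= ?mulr1 ?mulr0 ?add0r.
have dE (h t : R) : 0 < t < 1 -> (fun x : R => G (x, t))^`() h = 'D_(1, 0) G (h, t).
  by move=> tb; rewrite derive1E (@derive_val _ _ _ _ _ _ _ (dh h t tb)).
exists G, (fun p => 'D_(1, 0) G p), (fun p => 'D_(0, 1) G p); split; last first.
  by move=> t tb p; have [_ _ _ _ h] := caus t tb; exact: h.
split.
- by move=> p; exact: cG0.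
- by move=> p; exact: c1.
- by move=> p; exact: c1.
- exact: dh.
- by move=> u h t tb; apply: is_derive_det2r; exact: dt.
- by move=> p; exact: dG.
- move=> h t tb; have [_ inj _ _ _] := caus t tb; apply/(inj (h + 1) h); apply/asboolP.
  by exists 1; rewrite mulr1 addrC addKr.
- move=> h h' t tb; have [_ inj _ _ _] := caus t tb => /(inj h h')/asboolP[k e].
  by exists k; rewrite -[k%:~R]mulr1 -e addrC subrK.
- by move=> h t tb; have [_ _ [_ cv] _ _] := caus t tb; have := cv h; rewrite dE.
- by case=> h t tb; have [_ _ _ sub _] := caus t tb; apply: sub; exists h.
exists U; split => // x Ux Dx.
have : (U `&` dom Om) x by [].
by rewrite cU => -[p pb <-]; exists p.
Qed.

(** * Orientation of the leaves *)

Section Orientation.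
Context {R : realType} (D : set (R * R)) (G Gh Gt : R * R -> R * R).
Context (F : foliation D G Gh Gt).
Implicit Types (u v w p q : R * R) (h t x : R).

(* The tangent line of the leaf [t] at [h] has direction [u] and the leaf on its left. *)
Definition contact u h t := forall x, det2 u (G (h, t)) <= det2 u (G (x, t)).

Lemma leaf_per (k : int) h t : 0 < t < 1 -> G (h + k%:~R, t) = G (h, t).
Proof.
move=> tb; have := @per_int _ _ (fun h => G (h, t)) 1 k h; rewrite mulr1; apply => x.
exact: fol_per F _ _ tb.
Qed.

Lemma leaf_reduce h t : 0 < t < 1 -> exists2 x, 0 <= x <= 1 & G (x, t) = G (h, t).
Proof.
move=> tb; have [k /andP[k0 k1]] := per_reduce h (@ltr01 R).
by rewrite mulr1 in k0 k1; exists (h + k%:~R); [rewrite k0 ltW|exact: leaf_per].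
Qed.

Lemma contact_det u h t : 0 < t < 1 -> contact u h t -> det2 u (Gh (h, t)) = 0.
Proof.
move=> tb c; have dx x := is_derive_det2r u (fol_dh F x tb).
have d0 : is_derive h 1 (fun x => det2 u (G (x, t))) 0.
  apply: (@derive1_at_min _ _ (h - 1) (h + 1)).
  - by lra.
  - by move=> x _; case: (dx x).
  - by rewrite in_itv /=; lra.
  - by move=> x _; exact: c.
by rewrite -(@derive_val _ _ _ _ _ _ _ (dx h)) (@derive_val _ _ _ _ _ _ _ d0).
Qed.

Lemma det2_eq0 u w : u != 0 -> det2 u w = 0 -> w = (dot2 u w / dot2 u u) *: u.
Proof.
move=> u0 e; have n0 := dot2_gt0 u0; have n1 : dot2 u u != 0 by rewrite gt_eqF.
have e' : u.1 * w.2 = u.2 * w.1 by apply/eqP; rewrite -subr_eq0; exact/eqP.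
apply: pair_ext; rewrite /= /GRing.scale /= mulrAC; apply: (mulIf n1); rewrite divfK// /dot2.
  by transitivity (w.1 * (u.1 * u.1) + u.2 * w.1 * u.2); [ring|rewrite -e'; ring].
by transitivity (w.2 * (u.2 * u.2) + u.1 * w.2 * u.1); [ring|rewrite e'; ring].
Qed.

Let side (x : R) p : R := det2 (Gh p) (G (x, p.2) - G p).
(** The sum of the minimum and the maximum of [side] along the leaf. As [side] vanishes at the point
    itself and does not change sign, this is its nonzero extreme value; it tells on which side the
    leaf lies and depends continuously on the point. *)
Definition orient p := minv side p - minv (fun x p => - side x p) p.

Let cside x p : 0 < p.2 < 1 -> {for (x, p), continuous (fun q : R * (R * R) => side q.1 q.2)}.
Proof.
move=> pb; have c2 (f : R * R -> R * R) : {for p, continuous f} ->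
    {for (x, p), continuous (fun q : R * (R * R) => f q.2)}.
  by move=> cf; apply: (@continuous_comp _ _ _ (fun q : R * (R * R) => q.2) f); [exact: cvg_snd|exact: cf].
apply: cont_det2; first by apply: c2; exact: (fol_ch F).
apply: cvgB; last by apply: c2; exact: (fol_c F).
apply: (@continuous_comp _ _ _ (fun q : R * (R * R) => (q.1, q.2.2)) G); last exact: (fol_c F).
by apply: cont_pair; [exact: cvg_fst|apply: (@continuous_comp _ _ _ (fun q : R * (R * R) => q.2) (fun p : R * R => p.2)); [exact: cvg_snd|exact: cont_snd]].
Qed.

Let csidex p : 0 < p.2 < 1 -> forall x, {for x, continuous (side^~ p)}.
Proof.
move=> pb x; apply: (@continuous_comp _ _ _ (fun x => (x, p)) (fun q : R * (R * R) => side q.1 q.2)).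
  by apply: cont_pair; [exact: cvg_id|exact: cvg_cst].
exact: cside.
Qed.

Let near_strip p : 0 < p.2 < 1 -> \forall q \near p, 0 < q.2 < 1.
Proof.
move=> /andP[p0 p1].
have n0 : \forall q \near p, 0 < q.2 by apply: near_lt p0; [exact: cvg_cst|exact: cont_snd].
have n1 : \forall q \near p, q.2 < 1 by apply: near_lt p1; [exact: cont_snd|exact: cvg_cst].
by apply: (filterS _ (filterI n0 n1)) => q [-> ->].
Qed.

Let orient_cont p : 0 < p.2 < 1 -> {for p, continuous orient}.
Proof.
move=> pb; apply: cvgB; apply: minv_cont.
- by move=> x; exact: cside.
- by apply: (filterS _ (near_strip pb)) => q; exact: csidex.
- by move=> x; apply: cvgN; exact: cside.
- by apply: (filterS _ (near_strip pb)) => q qb x; apply: cvgN; exact: csidex.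
Qed.

(* A leaf contained in a line would have a point with zero velocity. *)
Let side_neq0 p : 0 < p.2 < 1 -> ~ forall x, side x p = 0.
Proof.
case: p => h t tb z; pose v := Gh (h, t).
have d0 x := is_derive_det2r v (fol_dh F x tb).
have d1 x := is_derive_dot2r v (fol_dh F x tb).
have [x [xb e]] := @MVTd _ _ _ 0 1 ltr01 (fun x _ => d1 x).
rewrite -[X in G (X, _)]add0r (fol_per F _ tb) subrr subr0 mulr1 in e.
have e2 : det2 v (Gh (x, t)) = 0.
  have E : (fun x => det2 v (G (x, t))) = fun=> det2 v (G (h, t)).
    by apply/funext => y; have := z y; rewrite /side det2Br => /eqP; rewrite subr_eq0 => /eqP.
  rewrite -(@derive_val _ _ _ _ _ _ _ (d0 x)) E; exact: (@derive_val _ _ _ _ _ _ _ (is_derive_cst _ _ _)).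
have v0 : v != 0.
  apply/eqP => v0; have := fol_det F (p := (h, t)) tb.
  by rewrite -/v v0 /det2 /= !mul0r subrr eqxx.
have h0 : Gh (x, t) = 0 by rewrite (det2_eq0 v0 e2) -e mul0r scale0r.
by have := fol_det F (p := (x, t)) tb; rewrite h0 /det2 /= !mul0r subrr eqxx.
Qed.

Let side_red x h t : 0 < t < 1 -> exists2 y, 0 <= y <= 1 & side y (h, t) = side x (h, t).
Proof. by move=> tb; have [y yb e] := leaf_reduce x tb; exists y => //; rewrite /side /= e. Qed.

Let side0 h t : side h (h, t) = 0. Proof. by rewrite /side /= subrr det2r0. Qed.

Lemma orient_gt0 h t : 0 < t < 1 -> (forall x, 0 <= det2 (Gh (h, t)) (G (x, t) - G (h, t))) ->
  0 < orient (h, t).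
Proof.
move=> tb pos.
have [[x [xb e]] lo] := minvP (csidex (p := (h, t)) tb).
have cn y : {for y, continuous (fun y => - side y (h, t))} by apply: cvgN; exact: csidex.
have [[y [yb e']] lo'] := @minvP _ _ (fun x p => - side x p) (h, t) cn.
have [z zb ez] := side_red h h tb.
have m1 : minv side (h, t) = 0.
  apply/eqP; rewrite eq_le -{2}e pos andbT.
  by rewrite -(side0 h t) -ez lo.
rewrite /orient m1 sub0r oppr_gt0 ltNge; apply/negP => h2; apply: (@side_neq0 (h, t)) => // w.
have [w' wb <-] := side_red w h tb.
by apply/eqP; rewrite eq_le pos andbT; have := lo' _ wb; lra.
Qed.

Lemma orient_lt0 h t : 0 < t < 1 -> (forall x, det2 (Gh (h, t)) (G (x, t) - G (h, t)) <= 0) ->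
  orient (h, t) < 0.
Proof.
move=> tb pos.
have [[x [xb e]] lo] := minvP (csidex (p := (h, t)) tb).
have cn y : {for y, continuous (fun y => - side y (h, t))} by apply: cvgN; exact: csidex.
have [[y [yb e']] lo'] := @minvP _ _ (fun x p => - side x p) (h, t) cn.
have [z zb ez] := side_red h h tb.
have m1 : minv (fun x p => - side x p) (h, t) = 0.
  apply/eqP; rewrite eq_le -{2}e' oppr_ge0 pos andbT.
  by rewrite -oppr0 -(side0 h t) -ez lo'.
rewrite /orient m1 subr0 ltNge; apply/negP => h2; apply: (@side_neq0 (h, t)) => // w.
have [w' wb <-] := side_red w h tb.
by apply/eqP; rewrite eq_le pos /=; have := lo _ wb; lra.
Qed.

Let orient_neq0 p : 0 < p.2 < 1 -> orient p != 0.
Proof.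
case: p => h t tb; have [/(orient_gt0 tb) h0|/(orient_lt0 tb) h0] := fol_side F h tb.
  by rewrite gt_eqF.
by rewrite lt_eqF.
Qed.

(** Positive exactly when [Gt] points to the side on which the leaf lies, that is, when the leaf
    moves inward as [t] grows. *)
Let flow p := orient p * det2 (Gh p) (Gt p).

Let flow_sign (e : R) p q : e != 0 -> 0 < p.2 < 1 -> 0 < q.2 < 1 -> 0 < e * flow p -> 0 < e * flow q.
Proof.
move=> e0 pb qb; have sb (a : R) : 0 <= a <= 1 -> 0 < (p + a *: (q - p)).2 < 1.
  move=> /andP[a0 a1]; move: pb qb => /andP[p0 p1] /andP[q0 q1].
  rewrite /= /GRing.scale /=; move: p.2 q.2 p0 p1 q0 q1 => x y x0 x1 y0 y1.
  have [xy|yx] := leP x y.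
    have h1 : 0 <= a * (y - x) by rewrite mulr_ge0 ?subr_ge0.
    have h2 : a * (y - x) <= 1 * (y - x) by rewrite ler_wpM2r ?subr_ge0.
    by lra.
  have h1 : 0 <= a * (x - y) by rewrite mulr_ge0 ?subr_ge0// ltW.
  have h2 : a * (x - y) <= 1 * (x - y) by rewrite ler_wpM2r ?subr_ge0// ltW.
  by rewrite -[y - x]opprB mulrN; lra.
apply: (@segment_sign _ _ (fun p => e * flow p)) => a /sb ab.
  apply: cvgM; first exact: cvg_cst.
  apply: cvgM; first exact: orient_cont.
  by apply: cont_det2; [exact: (fol_ch F)|exact: (fol_ct F)].
by rewrite !mulf_neq0// ?orient_neq0// (fol_det F).
Qed.

Let contact_flow u h t : u != 0 -> 0 < t < 1 -> contact u h t ->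
  exists2 m, 0 < m & flow (h, t) = m * det2 u (Gt (h, t)).
Proof.
move=> u0 tb c; have e := det2_eq0 u0 (contact_det tb c).
move: (_ / _) e => lam e.
have l0 : lam != 0.
  apply/eqP => l0; have := fol_det F (p := (h, t)) tb.
  by rewrite e l0 scale0r /det2 /= !mul0r subrr eqxx.
exists (orient (h, t) * lam); last by rewrite /flow e det2Zl mulrA.
have cc x : 0 <= det2 u (G (x, t) - G (h, t)) by rewrite det2Br subr_ge0.
have [neg|pos|e0] := ltgtP lam 0; last by rewrite e0 eqxx in l0.
  rewrite nmulr_lgt0//; apply: orient_lt0 => // x.
  by rewrite e det2Zl nmulr_rle0.
rewrite pmulr_lgt0//; apply: orient_gt0 => // x.
by rewrite e det2Zl mulr_ge0// ltW.
Qed.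

(** [flow] is continuous without zeros on the convex strip [0 < t < 1], so either all leaves move
    inward or all move outward. *)
Lemma contact_sign :
  (forall u h t, u != 0 -> 0 < t < 1 -> contact u h t -> 0 < det2 u (Gt (h, t))) \/
  (forall u h t, u != 0 -> 0 < t < 1 -> contact u h t -> det2 u (Gt (h, t)) < 0).
Proof.
pose p0 : R * R := (0, 1 / 2); have pb : 0 < p0.2 < 1 by rewrite /p0/=; lra.
have n0 : flow p0 != 0 by rewrite mulf_neq0 ?orient_neq0 ?(fol_det F).
have [neg|pos|e] := ltgtP (flow p0) 0; last by rewrite e eqxx in n0.
  right=> u h t u0 tb c; have [m m0 e] := contact_flow u0 tb c.
  have := @flow_sign (-1) p0 (h, t) _ pb tb.
  by rewrite oppr_eq0 oner_neq0 !mulN1r !oppr_gt0 => /(_ isT neg); rewrite e pmulr_rlt0.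
left=> u h t u0 tb c; have [m m0 e] := contact_flow u0 tb c.
have := @flow_sign 1 p0 (h, t) _ pb tb.
by rewrite oner_neq0 !mul1r => /(_ isT pos); rewrite e pmulr_rgt0.
Qed.

End Orientation.

(** If the leaves move outward, the labels are reversed; afterwards every leaf shrinks as [t]
    grows. *)
Lemma oriented_foliation (R : realType) (Om : table R) (G Gh Gt : R * R -> R * R) :
  foliation (dom Om) G Gh Gt -> preserves_tangency Om G ->
  exists G Gh Gt, [/\ foliation (dom Om) G Gh Gt, preserves_tangency Om G &
    forall u h t, u != 0 -> 0 < t < 1 -> contact G u h t -> 0 < det2 u (Gt (h, t))].
Proof.
move=> F tan; have [pos|neg] := contact_sign F; first by exists G, Gh, Gt.
have fb (t : R) : 0 < t < 1 -> 0 < 1 - t < 1 by lra.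
exists (fun p => G (p.1, 1 - p.2)), (fun p => Gh (p.1, 1 - p.2)), (fun p => - Gt (p.1, 1 - p.2)).
split; first exact: foliation_flip.
- by move=> t /fb tb p pi; exact: (tan _ tb p pi).
move=> u h t u0 /fb tb c.
by rewrite /= -[- Gt _]scaleN1r det2Zr mulN1r oppr_gt0; exact: (neg u h (1 - t) u0 tb c).
Qed.

(** * Support functions of the leaves *)

Section Support.
Context {R : realType} (D : set (R * R)) (l : R) (g T g2 g3 g4 : R -> R * R).
Context (SC : convex_arc D l g T g2 g3 g4).
Context (G Gh Gt : R * R -> R * R) (F : foliation D G Gh Gt).
Hypothesis sgn : forall u h t, u != 0 -> 0 < t < 1 -> contact G u h t -> 0 < det2 u (Gt (h, t)).
Implicit Types (u v w p : R * R) (h t x s z : R).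

(** The support function of the leaf: the line of direction [u] that has the leaf on its left and
    touches it consists of the points where [det2 u] takes this value. *)
Definition leaf_support u t : R := minv (fun h (q : R * R * R) => det2 q.1 (G (h, q.2))) (u, t).

Let cdet (X : topologicalType) (fu : X -> R * R) (fh ft : X -> R) (q : X) :
  {for q, continuous fu} -> {for q, continuous fh} -> {for q, continuous ft} -> 0 < ft q < 1 ->
  {for q, continuous (fun q => det2 (fu q) (G (fh q, ft q)))}.
Proof.
move=> cu ch ct tb; apply: cont_det2 => //.
apply: (@continuous_comp _ _ _ (fun q => (fh q, ft q)) G); last exact: (fol_c F).
exact: cont_pair.
Qed.

Let cdeth u t : 0 < t < 1 -> forall h, {for h, continuous (fun h => det2 u (G (h, t)))}.
Proof.
move=> tb h.
exact: (@cdet _ (fun=> u) (fun h => h) (fun=> t) h (@cont_cst _ _ u h) (@cont_id _ h) (@cont_cst _ _ t h) tb).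
Qed.

Lemma leaf_support_le u h t : 0 < t < 1 -> leaf_support u t <= det2 u (G (h, t)).
Proof.
move=> tb; have [x xb <-] := leaf_reduce F h tb.
have [_ lo] := @minvP _ _ (fun h (q : R * R * R) => det2 q.1 (G (h, q.2))) (u, t) (@cdeth u t tb).
exact: lo xb.
Qed.

Lemma leaf_supportP u t : 0 < t < 1 ->
  exists2 h, 0 <= h <= 1 & contact G u h t /\ det2 u (G (h, t)) = leaf_support u t.
Proof.
move=> tb.
have [[h [hb e]] _] := @minvP _ _ (fun h (q : R * R * R) => det2 q.1 (G (h, q.2))) (u, t) (@cdeth u t tb).
by exists h => //; split => // x; rewrite e; exact: leaf_support_le.
Qed.

Lemma leaf_support_cont (X : topologicalType) (fu : X -> R * R) (ft : X -> R) (q : X) :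
  {for q, continuous fu} -> {for q, continuous ft} -> 0 < ft q < 1 ->
  {for q, continuous (fun q => leaf_support (fu q) (ft q))}.
Proof.
move=> cu ct tb.
apply: (@continuous_comp _ _ _ (fun q => (fu q, ft q)) (minv (fun h (q : R * R * R) => det2 q.1 (G (h, q.2))))).
  exact: cont_pair.
have c3 (a : R * R * R) : {for a, continuous (fun q : R * R * R => q.2)} by exact: cvg_snd.
apply: minv_cont => [h|].
  set x : R * (R * R * R) := (h, (fu q, ft q)).
  have k0 : {for x, continuous (fun q : R * (R * R * R) => q.2)} by exact: cvg_snd.
  have k1 : {for x, continuous (fun q : R * (R * R * R) => q.1)} by exact: cvg_fst.
  have k2 : {for x, continuous (fun q : R * (R * R * R) => q.2.1)}.
    by apply: (@continuous_comp _ _ _ (fun q : R * (R * R * R) => q.2) fst); [exact: k0|exact: cvg_fst].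
  have k3 : {for x, continuous (fun q : R * (R * R * R) => q.2.2)}.
    by apply: (@continuous_comp _ _ _ (fun q : R * (R * R * R) => q.2) snd); [exact: k0|exact: cvg_snd].
  exact: (cdet k2 k1 k3 tb).
case/andP: tb => t0 t1.
have n0 : \forall y \near ((fu q, ft q) : R * R * R), 0 < y.2 by apply: near_lt t0; [exact: cvg_cst|exact: c3].
have n1 : \forall y \near ((fu q, ft q) : R * R * R), y.2 < 1 by apply: near_lt t1; [exact: c3|exact: cvg_cst].
by apply: (filterS _ (filterI n0 n1)) => y [y0 y1] h; apply: cdeth; rewrite y0.
Qed.

(** Envelope argument: a contact point of a leaf, moved to slightly smaller [t] with [h] fixed, has
    a smaller [det2 u], and this bounds the support of the earlier leaf. *)
Lemma leaf_support_incr u t t' : u != 0 -> 0 < t -> t < t' -> t' < 1 -> leaf_support u t < leaf_support u t'.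
Proof.
move=> u0 t0 tt t1; rewrite -ltrN2; apply: (@locally_decr _ (fun x => - leaf_support u x)) => // x xb.
  apply: cvgN; apply: leaf_support_cont; [exact: cvg_cst|exact: cvg_id|lra].
have x1 : 0 < x < 1 by lra.
have [h hb [ch eh]] := leaf_supportP u x1; have dp := sgn u0 x1 ch.
have cG : {for x, continuous (fun y => det2 u (Gt (h, y)))}.
  apply: cont_det2; first exact: cvg_cst.
  apply: (@continuous_comp _ _ _ (fun y => (h, y)) Gt); last exact: (fol_ct F).
  by apply: cont_pair; [exact: cvg_cst|exact: cvg_id].
have n := near_lt (@cont_cst _ R 0 x) cG dp.
have /nbhs_ballP[e /= e0 he] := n.
exists (Num.min e x); first by rewrite lt_min e0; lra.
move=> y /andP[ye yx].
have m1 : Num.min e x <= e by rewrite ge_min lexx.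
have m2 : Num.min e x <= x by rewrite ge_min lexx orbT.
rewrite ltrN2; apply: (@le_lt_trans _ _ (det2 u (G (h, y)))); first by apply: leaf_support_le; lra.
rewrite -eh; apply: (@is_derive_ltr _ (fun y => det2 u (G (h, y))) (fun y => det2 u (Gt (h, y)))) => // w wb.
  by apply: (fol_dt F); lra.
by apply: he; rewrite /ball/= gtr0_norm; lra.
Qed.

Lemma leaf_support_le_incr u t t' : u != 0 -> 0 < t -> t <= t' -> t' < 1 -> leaf_support u t <= leaf_support u t'.
Proof. by move=> u0 t0; rewrite le_eqVlt => /predU1P[->//|tt] t1; rewrite ltW ?leaf_support_incr. Qed.

(* The leaves come arbitrarily close to the boundary, so they cross every line through a
   boundary point that is not tangent there. *)
Lemma leaf_support_cross (u : R -> R * R) : (forall s, {for s, continuous u}) ->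
  (forall s, u (s + l) = u s) -> (forall s, det2 (u s) (T s) != 0) ->
  exists t1, 0 < t1 < 1 /\ forall s t, 0 < t <= t1 -> leaf_support (u s) t < det2 (u s) (g s).
Proof.
move=> cu pu ub; have l0 := len_gt0 SC.
have un0 s : u s != 0.
  by apply/eqP => e; have := ub s; rewrite e /det2 /= !mul0r subrr eqxx.
have cgd s : {for s, continuous (fun x => det2 (u x) (g x))} by apply: cont_det2 => //; exact: (cg SC).
have loc s : exists2 t, 0 < t < 1 & leaf_support (u s) t < det2 (u s) (g s).
  (* Otherwise [g s] would minimize [det2 (u s)] on the boundary, and [u s] would be parallel to the
     tangent there. *)
  have [x gx] : exists x, det2 (u s) (g x) < det2 (u s) (g s).
    apply/not_existsP => nex; have dx x := is_derive_det2r (u s) (dT SC x).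
    have d0 : is_derive s 1 (fun x => det2 (u s) (g x)) 0.
      apply: (@derive1_at_min _ _ (s - 1) (s + 1)).
      - by lra.
      - by move=> x _; case: (dx x).
      - by rewrite in_itv /=; lra.
      - by move=> x _; rewrite leNgt; apply/negP; exact: nex.
    have := ub s.
    by rewrite -(@derive_val _ _ _ _ _ _ _ (dx s)) (@derive_val _ _ _ _ _ _ _ d0) eqxx.
  have [U [oU bU cU]] := fol_cover F.
  have Ug : U (g x) by apply: bU; rewrite (arc_boundary SC); exists x.
  have c1 : {for g x, continuous (fun y : R * R => det2 (u s) y)}.
    by apply: cont_det2; [exact: cvg_cst|exact: cvg_id].
  have n1 := near_lt c1 (@cont_cst _ R (det2 (u s) (g s)) (g x)) gx.
  have n2 : \forall y \near g x, U y by exact: open_nbhs_nbhs.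
  have [y [Dy [Uy hy]]] := arc_closure SC (filterI n2 n1).
  have [[h t] [/= tb e]] := cU y Uy Dy.
  by exists t => //; apply: le_lt_trans (leaf_support_le _ h tb) _; rewrite e.
(* Compactness of a period and monotonicity in [t] make the threshold uniform in [s]. *)
have cmp : compact `[0, l]%classic by exact: segment_compact.
pose P t s := 0 < t < 1 -> leaf_support (u s) t < det2 (u s) (g s).
have /compact_near_coveringP/(_ R (0:R)^'+ P _) cov := cmp.
have n : \forall t \near (0:R)^'+, `[0, l]%classic `<=` P t.
  apply: cov => s _; have [t tb ht] := loc s.
  have n1 : \forall s' \near s, leaf_support (u s') t < det2 (u s') (g s').
    have cs := leaf_support_cont (cu s) (@cont_cst _ _ t s) tb.
    exact: (near_lt cs (cgd s) ht).
  have r0 : \forall t' \near (0:R)^'+, 0 < t' by exact: nbhs_right_gt.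
  have r1 : \forall t' \near (0:R)^'+, t' < t by apply: nbhs_right_lt; case/andP: tb.
  have n2 : \forall t' \near (0:R)^'+, 0 < t' < t.
    by apply: (filterS _ (filterI r0 r1)) => x [-> ->].
  exists ([set s' | leaf_support (u s') t < det2 (u s') (g s')], [set t' | 0 < t' < t]) => //=.
  move=> [s' t'] [/= h1 /andP[h2 h3]] _; apply: le_lt_trans h1.
  by apply: leaf_support_le_incr => //; [exact: ltW|case/andP: tb].
have n2 : \forall t' \near (0:R)^'+, 0 < t' < 1.
  have r0 : \forall t' \near (0:R)^'+, 0 < t' by exact: nbhs_right_gt.
  have r1 : \forall t' \near (0:R)^'+, t' < 1 by exact: nbhs_right_lt.
  by apply: (filterS _ (filterI r0 r1)) => x [-> ->].
have nn : \forall t' \near (0:R)^'+, `[0, l]%classic `<=` P t' /\ 0 < t' < 1 by apply: (filterS _ (filterI n n2)) => x [].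
have [t1 [h1 h2]] : exists t1, `[0, l]%classic `<=` P t1 /\ 0 < t1 < 1 by exact: (@filter_ex _ _ (at_right_proper_filter (0:R)) _ nn).
exists t1; split => // s t /andP[t0 tt].
have [k /andP[k0 k1]] := per_reduce s l0.
rewrite -(@per_int _ _ u l k s pu) -(@per_int _ _ g l k s (arc_per SC)).
apply: (@le_lt_trans _ _ (leaf_support (u (s + k%:~R * l)) t1)).
  by apply: leaf_support_le_incr => //; case/andP: h2.
by apply: h1 => //; rewrite /= in_itv/= k0 ltW.
Qed.

End Support.

(** * The slope of the tangent from a boundary point to a leaf *)

Section Slope.
Context {R : realType} (D : set (R * R)) (l : R) (g T g2 g3 g4 : R -> R * R).
Context (SC : convex_arc D l g T g2 g3 g4).
Context (G Gh Gt : R * R -> R * R) (F : foliation D G Gh Gt).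
Hypothesis sgn : forall u h t, u != 0 -> 0 < t < 1 -> contact G u h t -> 0 < det2 u (Gt (h, t)).
Implicit Types (u v w p : R * R) (h t x s z : R).
Local Notation leaf_support := (leaf_support G).

Definition dir s z := T s + z *: rot90 (T s).

Lemma dir_det s z w : det2 (dir s z) w = det2 (T s) w - z * dot2 (T s) w.
Proof. by rewrite /dir /det2 /dot2 /rot90 /= /GRing.scale /=; ring. Qed.

Lemma det_dir s z : det2 (T s) (dir s z) = z.
Proof. by rewrite /dir det2Dr det2Zr det2xx det2_rot90 (T_unit SC) mulr1 add0r. Qed.

Lemma dot_dir s z : dot2 (T s) (dir s z) = 1.
Proof. by rewrite /dir dot2Dr dot2Zr (T_unit SC) dot2_rot90 det2xx oppr0 mulr0 addr0. Qed.

Lemma dir_neq0 s z : dir s z != 0.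
Proof.
apply/eqP => e; have := dot_dir s z.
by rewrite e /dot2 /= !mulr0 addr0 => /esym/eqP; rewrite oner_eq0.
Qed.

Lemma dir_per s z : dir (s + l) z = dir s z.
Proof. by rewrite /dir (arc_T_per SC). Qed.

Lemma dir_cont (X : topologicalType) (fs fz : X -> R) (q : X) :
  {for q, continuous fs} -> {for q, continuous fz} ->
  {for q, continuous (fun q => dir (fs q) (fz q))}.
Proof.
move=> cs cz; have c1 : {for q, continuous (fun q => T (fs q))}.
  by apply: (@continuous_comp _ _ _ fs T) => //; exact: (cT SC).
have c2 : {for q, continuous (fun q => rot90 (T (fs q)))}.
  apply: (@cont_pair _ _ _ (fun q => - (T (fs q)).2) (fun q => (T (fs q)).1)).
    by apply: cvgN; apply: (@continuous_comp _ _ _ (fun q => T (fs q)) snd); [exact: c1|exact: cvg_snd].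
  by apply: (@continuous_comp _ _ _ (fun q => T (fs q)) fst); [exact: c1|exact: cvg_fst].
by apply: cvgD; [exact: c1|apply: cvgZ; [exact: cz|exact: c2]].
Qed.

(** The least position of the leaf relative to the line through [g s] of slope [z] over the tangent:
    positive when the leaf is strictly to the left of the line, zero when the line supports it. *)
Definition gap s z t : R := leaf_support (dir s z) t - det2 (dir s z) (g s).

Lemma gap_le s z t h : 0 < t < 1 -> gap s z t <= det2 (dir s z) (G (h, t) - g s).
Proof. by move=> tb; rewrite /gap det2Br lerD2r (leaf_support_le F). Qed.

Lemma gapP s z t : 0 < t < 1 -> exists2 h, 0 <= h <= 1 &
  contact G (dir s z) h t /\ det2 (dir s z) (G (h, t) - g s) = gap s z t.
Proof.
move=> tb; have [h hb [c e]] := leaf_supportP F (dir s z) tb; exists h => //; split => //.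
by rewrite det2Br e.
Qed.

Lemma gap_cont (X : topologicalType) (fs fz ft : X -> R) (q : X) :
  {for q, continuous fs} -> {for q, continuous fz} -> {for q, continuous ft} -> 0 < ft q < 1 ->
  {for q, continuous (fun q => gap (fs q) (fz q) (ft q))}.
Proof.
move=> cs cz ct tb; have cd := dir_cont cs cz.
apply: cvgB; first exact: (leaf_support_cont F cd ct tb).
have cgs : {for q, continuous (fun q => g (fs q))}.
  by apply: (@continuous_comp _ _ _ fs g) => //; exact: (cg SC).
exact: (cont_det2 cd cgs).
Qed.

Lemma gap_incr s z t t' : 0 < t -> t < t' -> t' < 1 -> gap s z t < gap s z t'.
Proof. by move=> t0 tt t1; rewrite /gap ltrD2r (leaf_support_incr F sgn) ?dir_neq0. Qed.

Lemma leaf_left s h t : 0 < t < 1 -> 0 < det2 (T s) (G (h, t) - g s).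
Proof. by move=> tb; apply: (dom_left SC); exact: (fol_dom F (p := (h, t)) tb). Qed.

Lemma gap0 s t : 0 < t < 1 -> 0 < gap s 0 t.
Proof.
move=> tb; have [h hb [_ <-]] := gapP s 0 tb.
by rewrite dir_det mul0r subr0 leaf_left.
Qed.

(* For a fixed point of the leaf, its position relative to the line of slope [z] through
   [g s] is an affine function of [z], positive at [z = 0]. *)
Lemma gap_pos s z z0 t : 0 < t < 1 -> 0 <= z -> z < z0 -> gap s z0 t = 0 -> 0 < gap s z t.
Proof.
move=> tb zp zz e; have [h hb [_ <-]] := gapP s z tb.
have := gap_le s z0 h tb; have := leaf_left s h tb; rewrite e !dir_det.
move: (det2 _ _) (dot2 _ _) => a b a0 h0.
have [b0|b0] := leP b 0.
  have : z * b <= 0 by rewrite mulr_ge0_le0.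
  by lra.
have : 0 < (z0 - z) * b by rewrite mulr_gt0 ?subr_gt0.
by rewrite mulrBl; lra.
Qed.

Lemma gap_neg s z z0 t : 0 < t < 1 -> 0 < z0 -> z0 < z -> gap s z0 t = 0 -> gap s z t < 0.
Proof.
move=> tb zp zz e; have [h hb [_ eh]] := gapP s z0 tb.
apply: le_lt_trans (gap_le s z h tb) _.
have := leaf_left s h tb; move: eh; rewrite e !dir_det.
move: (det2 _ _) (dot2 _ _) => a b h0 a0.
have b0 : 0 < b by rewrite -(pmulr_rgt0 _ zp); lra.
have : 0 < (z - z0) * b by rewrite mulr_gt0 ?subr_gt0.
by rewrite mulrBl; lra.
Qed.

Context (t0 : R) (t0b : 0 < t0 < 1).
Hypothesis gap1 : forall s t, 0 < t <= t0 -> gap s 1 t < 0.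

Let inb t : 0 < t <= t0 -> 0 < t < 1.
Proof. by move=> /andP[a b]; rewrite a (le_lt_trans b) //; case/andP: t0b. Qed.

Definition slope s t := xget 0 [set z | 0 < z < 1 /\ gap s z t = 0].

Lemma slopeP s t : 0 < t <= t0 -> 0 < slope s t < 1 /\ gap s (slope s t) t = 0.
Proof.
move=> tb; have tb1 := inb tb.
rewrite /slope; case: xgetP => [z _ //|].
have g0 := gap0 s tb1; have g1 := gap1 s tb.
have [||z [/andP[z0 z1] e]] := @IVTc _ (fun z => - gap s z t) 0 1 0 ler01.
- move=> z _; apply: cvgN.
  exact: (@gap_cont _ (fun=> s) (fun z => z) (fun=> t) z (@cont_cst _ _ s z) (@cont_id _ z) (@cont_cst _ _ t z) tb1).
- by rewrite oppr_le0 oppr_ge0 !ltW.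
move/eqP: e; rewrite oppr_eq0 => /eqP e.
move=> /(_ z) []; split => //; rewrite !lt_neqAle z0 z1 !andbT; apply/andP; split.
  by apply/eqP => ez; rewrite -ez in e; rewrite e ltxx in g0.
by apply/eqP => ez; rewrite ez in e; rewrite e ltxx in g1.
Qed.

Lemma slope_gt s t z : 0 < t <= t0 -> 0 < gap s z t -> z < slope s t.
Proof.
move=> tb h; have [/andP[z0 z1] e] := slopeP s tb; rewrite ltNge le_eqVlt.
apply/negP => /predU1P[ez|lt]; first by move: h; rewrite -ez e ltxx.
have tb1 := inb tb.
by have := gap_neg tb1 z0 lt e; lra.
Qed.

Lemma slope_lt s t z : 0 < t <= t0 -> 0 <= z -> gap s z t < 0 -> slope s t < z.
Proof.
move=> tb zp h; have [/andP[z0 z1] e] := slopeP s tb; rewrite ltNge le_eqVlt.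
apply/negP => /predU1P[ez|lt]; first by move: h; rewrite ez e ltxx.
have tb1 := inb tb.
by have := gap_pos tb1 zp lt e; lra.
Qed.

Lemma slope_uniq s t z : 0 < t <= t0 -> 0 < z -> gap s z t = 0 -> slope s t = z.
Proof.
move=> tb zp h; have [/andP[z0 z1] e] := slopeP s tb; have tb1 := inb tb.
have [lt|lt|//] := ltgtP (slope s t) z.
  by have := gap_pos tb1 (ltW z0) lt h; rewrite e ltxx.
by have := gap_pos tb1 (ltW zp) lt e; rewrite h ltxx.
Qed.

Lemma slope_per s t : slope (s + l) t = slope s t.
Proof.
rewrite /slope; congr (xget _ _); apply/funext => z.
by rewrite /= /gap dir_per (arc_per SC).
Qed.

Lemma slope_incr s t t' : 0 < t -> t < t' -> t' <= t0 -> slope s t < slope s t'.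
Proof.
move=> tp tt tb; apply: slope_gt; first by lra.
have [_ <-] : 0 < slope s t < 1 /\ gap s (slope s t) t = 0 by apply: slopeP; lra.
by apply: gap_incr => //; have := t0b; lra.
Qed.

Lemma slope_cont (X : topologicalType) (fs ft : X -> R) (q : X) :
  {for q, continuous fs} -> {for q, continuous ft} -> 0 < ft q < t0 ->
  {for q, continuous (fun q => slope (fs q) (ft q))}.
Proof.
move=> cs ct /andP[tp tt].
have n0 : \forall x \near q, 0 < ft x by apply: near_lt tp; [exact: cont_cst|].
have n1 : \forall x \near q, ft x < t0 by apply: near_lt tt; [|exact: cont_cst].
have tb : 0 < ft q <= t0 by rewrite tp ltW.
have tb1 := inb tb.
have [/andP[z0 z1] e] := slopeP (fs q) tb.
have cgap z := gap_cont cs (@cont_cst _ _ z q) ct tb1.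
apply: (cvg_sandwich z0) => z /andP[a b].
  have pz : 0 < gap (fs q) z (ft q) by apply: gap_pos tb1 _ b e; lra.
  have n2 := near_lt (@cont_cst _ R 0 q) (cgap z) pz.
  apply: (filterS _ (filterI n2 (filterI n0 n1))) => x [x2 [x0 x1]].
  by apply: slope_gt => //; rewrite x0 ltW.
have pz : gap (fs q) z (ft q) < 0 by exact: gap_neg tb1 z0 a e.
have n2 := near_lt (cgap z) (@cont_cst _ R 0 q) pz.
apply: (filterS _ (filterI n2 (filterI n0 n1))) => x [x2 [x0 x1]].
by apply: slope_lt => //; [rewrite x0 ltW|lra].
Qed.

(** Leaves close to the boundary cross the line of slope [e] through every [g s], so their tangents
    are flatter. *)
Lemma slope_unif e : 0 < e -> exists t1, 0 < t1 < t0 /\ forall s t, 0 < t <= t1 -> slope s t < e.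
Proof.
move=> e0.
have [|||t1 [t1b ht]] := @leaf_support_cross _ _ _ _ _ _ _ _ SC _ _ _ F sgn (fun s => dir s e).
- by move=> s; apply: dir_cont; [exact: cont_id|exact: cont_cst].
- by move=> s; exact: dir_per.
- by move=> s; rewrite det2C det_dir oppr_eq0 gt_eqF.
pose t2 := Num.min t1 (t0 / 2).
have m1 : t2 <= t1 by rewrite ge_min lexx.
have m2 : t2 <= t0 / 2 by rewrite ge_min lexx orbT.
have m0 : 0 < t2 by rewrite lt_min; have := t0b; lra.
exists t2; split; first by have := t0b; lra.
move=> s t tb; apply: slope_lt; [have := t0b; lra|exact: ltW|].
by rewrite /gap subr_lt0; apply: ht; lra.
Qed.

End Slope.

(** * Dependence of the slope on the leaf *)

Section SlopeDerivative.
Context {R : realType} (D : set (R * R)) (l : R) (g T g2 g3 g4 : R -> R * R).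
Context (SC : convex_arc D l g T g2 g3 g4).
Context (G Gh Gt : R * R -> R * R) (F : foliation D G Gh Gt).
Hypothesis sgn : forall u h t, u != 0 -> 0 < t < 1 -> contact G u h t -> 0 < det2 u (Gt (h, t)).
Context (t0 : R) (t0b : 0 < t0 < 1).
Hypothesis gap1 : forall s t, 0 < t <= t0 -> gap g T G s 1 t < 0.
Implicit Types (u v w p : R * R) (h t x s z : R).
Local Notation gap := (gap g T G).
Local Notation dir := (dir T).
Local Notation slope := (slope g T G).

Let inb t : 0 < t < t0 -> 0 < t < 1 /\ 0 < t <= t0.
Proof. by move=> /andP[a b]; rewrite a (ltW b) (lt_trans b) //; case/andP: t0b. Qed.

(* [G (h, t)] is the point where the tangent from [g s] touches the leaf [t]. *)
Definition touch s h t := det2 (dir s (slope s t)) (G (h, t) - g s) = 0.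

Definition ahead s h t : R := dot2 (T s) (G (h, t) - g s).

(** The derivative of the slope in [t], obtained by differentiating the equation [touch] implicitly
    with [h] fixed. The three times are kept apart because bounds of difference quotients evaluate
    the factors at different times. *)
Definition rate s h (t1 t2 t3 : R) := det2 (dir s (slope s t1)) (Gt (h, t2)) / ahead s h t3.

Lemma touch_ge s t x : 0 < t < t0 -> 0 <= det2 (dir s (slope s t)) (G (x, t) - g s).
Proof.
move=> /inb[tb tb']; have [_ <-] := slopeP SC F t0b gap1 s tb'.
exact: (gap_le g T F s _ x tb).
Qed.

Lemma touch_contact s h t : 0 < t < t0 -> touch s h t -> contact G (dir s (slope s t)) h t.
Proof.
move=> tb th x; rewrite -subr_ge0 -det2Br.
have := touch_ge s x tb; rewrite !det2Br; move: th; rewrite /touch det2Br; lra.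
Qed.

Lemma touch_ex s t : 0 < t < t0 -> exists2 h, 0 <= h <= 1 & touch s h t.
Proof.
move=> /inb[tb tb']; have [_ e] := slopeP SC F t0b gap1 s tb'.
by have [h hb [_ eh]] := gapP g T F s (slope s t) tb; exists h => //; rewrite /touch eh.
Qed.

Lemma touch_ahead s h t : 0 < t < t0 -> touch s h t -> 0 < ahead s h t.
Proof.
move=> /inb[tb tb'] e; have [/andP[z0 _] _] := slopeP SC F t0b gap1 s tb'.
have := leaf_left SC F s h tb; move: e; rewrite /touch dir_det -/(ahead s h t) => e a0.
by rewrite -(pmulr_rgt0 _ z0); lra.
Qed.

Lemma touch_rate s h t : 0 < t < t0 -> touch s h t -> 0 < rate s h t t t.
Proof.
move=> tb e; rewrite divr_gt0 ?touch_ahead//.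
apply: sgn; [exact: (dir_neq0 SC)|exact: (inb tb).1|exact: touch_contact].
Qed.

Let dGt s z h t : 0 < t < 1 ->
  is_derive t 1 (fun x : R => det2 (dir s z) (G (h, x) - g s)) (det2 (dir s z) (Gt (h, t))).
Proof.
move=> tb; have d := fol_dt F (dir s z) h tb.
have -> : (fun x : R => det2 (dir s z) (G (h, x) - g s)) = (fun x : R => det2 (dir s z) (G (h, x)) - det2 (dir s z) (g s)).
  by apply/funext => x; rewrite det2Br.
apply: (is_derive_eq (is_deriveB d (is_derive_cst (det2 (dir s z) (g s)) t (1:R)))).
exact: subr0.
Qed.

Let shift_z s z z' h t : det2 (dir s z') (G (h, t) - g s) =
  det2 (dir s z) (G (h, t) - g s) - (z' - z) * ahead s h t.
Proof. by rewrite !dir_det /ahead; ring. Qed.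

(** The touching point of the leaf [t1], moved to [t2] with [h] fixed, cannot lie to the right of
    the tangent to the leaf [t2]. [slope_lower] moves the touching point of [t2] back instead. Each
    bound involves one touching parameter only, as this parameter may jump with [t]. *)
Lemma slope_upper s h t1 t2 : 0 < t1 -> t1 < t2 -> t2 < t0 -> touch s h t1 -> 0 < ahead s h t2 ->
  exists2 x, t1 < x < t2 & slope s t2 - slope s t1 <= rate s h t1 x t2 * (t2 - t1).
Proof.
move=> a b c th E0; have b1 : 0 < t1 < t0 by lra. have b2 : 0 < t2 < t0 by lra.
have [h2 _ th2] := touch_ex s b2; have := touch_ge s h b2.
rewrite (shift_z _ (slope s t1)) => H.
have [|x [xb e]] := @MVTd _ (fun x => det2 (dir s (slope s t1)) (G (h, x) - g s))
    (fun t => det2 (dir s (slope s t1)) (Gt (h, t))) t1 t2 b.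
  by move=> y yb; apply: dGt; have := t0b; lra.
exists x => //; rewrite /rate mulrAC ler_pdivlMr// -e.
by move: th; rewrite /touch => ->; rewrite subr0; lra.
Qed.

Lemma slope_lower s h t1 t2 : 0 < t1 -> t1 < t2 -> t2 < t0 -> touch s h t2 -> 0 < ahead s h t1 ->
  exists2 x, t1 < x < t2 & rate s h t2 x t1 * (t2 - t1) <= slope s t2 - slope s t1.
Proof.
move=> a b c th E0; have b1 : 0 < t1 < t0 by lra. have b2 : 0 < t2 < t0 by lra.
have [h1 _ th1] := touch_ex s b1; have := touch_ge s h b1.
rewrite (shift_z _ (slope s t2)) => H.
have [|x [xb e]] := @MVTd _ (fun x => det2 (dir s (slope s t2)) (G (h, x) - g s))
    (fun t => det2 (dir s (slope s t2)) (Gt (h, t))) t1 t2 b.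
  by move=> y yb; apply: dGt; have := t0b; lra.
exists x => //; rewrite /rate mulrAC ler_pdivrMr// -e.
by move: th; rewrite /touch => ->; rewrite sub0r; lra.
Qed.

Let ahead_cont (X : topologicalType) (fs fh ft : X -> R) (q : X) :
  {for q, continuous fs} -> {for q, continuous fh} -> {for q, continuous ft} -> 0 < ft q < 1 ->
  {for q, continuous (fun q => ahead (fs q) (fh q) (ft q))}.
Proof.
move=> cs ch ct tb.
have cTs : {for q, continuous (fun q => T (fs q))}.
  by apply: (@continuous_comp _ _ _ fs T) => //; exact: (cT SC).
have cgs : {for q, continuous (fun q => g (fs q))}.
  by apply: (@continuous_comp _ _ _ fs g) => //; exact: (cg SC).
have cG : {for q, continuous (fun q => G (fh q, ft q))}.
  by apply: (@continuous_comp _ _ _ (fun q => (fh q, ft q)) G); [exact: cont_pair|exact: (fol_c F)].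
have cd : {for q, continuous (fun q => G (fh q, ft q) - g (fs q))} by exact: cvgB.
exact: (cont_dot2 cTs cd).
Qed.

Let touch_cont (X : topologicalType) (fs fh ft : X -> R) (q : X) :
  {for q, continuous fs} -> {for q, continuous fh} -> {for q, continuous ft} -> 0 < ft q < t0 ->
  {for q, continuous (fun q => det2 (dir (fs q) (slope (fs q) (ft q))) (G (fh q, ft q) - g (fs q)))}.
Proof.
move=> cs ch ct tb.
have cz := slope_cont SC F t0b gap1 cs ct tb.
have cdr := dir_cont SC cs cz.
have cgs : {for q, continuous (fun q => g (fs q))}.
  by apply: (@continuous_comp _ _ _ fs g) => //; exact: (cg SC).
have cG : {for q, continuous (fun q => G (fh q, ft q))}.
  by apply: (@continuous_comp _ _ _ (fun q => (fh q, ft q)) G); [exact: cont_pair|apply: (fol_c F); exact: (inb tb).1].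
have cd : {for q, continuous (fun q => G (fh q, ft q) - g (fs q))} by exact: cvgB.
exact: (cont_det2 cdr cd).
Qed.

Let rate_cont (X : topologicalType) (fs fh f1 f2 f3 : X -> R) (q : X) :
  {for q, continuous fs} -> {for q, continuous fh} -> {for q, continuous f1} ->
  {for q, continuous f2} -> {for q, continuous f3} ->
  0 < f1 q < t0 -> 0 < f2 q < t0 -> 0 < f3 q < t0 -> 0 < ahead (fs q) (fh q) (f3 q) ->
  {for q, continuous (fun q => rate (fs q) (fh q) (f1 q) (f2 q) (f3 q))}.
Proof.
move=> cs ch c1 c2 c3 b1 b2 b3 a0.
have cz := slope_cont SC F t0b gap1 cs c1 b1.
have cdr := dir_cont SC cs cz.
have cGt : {for q, continuous (fun q => Gt (fh q, f2 q))}.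
  by apply: (@continuous_comp _ _ _ (fun q => (fh q, f2 q)) Gt); [exact: cont_pair|apply: (fol_ct F); exact: (inb b2).1].
apply: cvgM; first exact: (cont_det2 cdr cGt).
by apply: cvgV; [rewrite gt_eqF|apply: ahead_cont => //; exact: (inb b3).1].
Qed.

Let contF (X Y Z : topologicalType) (f : X -> Y * Z) (q : X) :
  {for q, continuous f} -> {for q, continuous (fun q => (f q).1)}.
Proof. by move=> cf; apply: (@continuous_comp _ _ _ f fst) => //; exact: cvg_fst. Qed.

Let contS (X Y Z : topologicalType) (f : X -> Y * Z) (q : X) :
  {for q, continuous f} -> {for q, continuous (fun q => (f q).2)}.
Proof. by move=> cf; apply: (@continuous_comp _ _ _ f snd) => //; exact: cvg_snd. Qed.

Local Notation Y := (R * R * R * R)%type.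

Let cs_ (q : R * (R * Y)) : {for q, continuous (fun q : R * (R * Y) => q.2.1)}.
Proof. by apply: contF; apply: contS; exact: cont_id. Qed.

Let ch_ (q : R * (R * Y)) : {for q, continuous (fun q : R * (R * Y) => q.1)}.
Proof. by apply: contF; exact: cont_id. Qed.

Let c1_ (q : R * (R * Y)) : {for q, continuous (fun q : R * (R * Y) => q.2.2.1.1.1)}.
Proof. by do 3 apply: contF; do 2 apply: contS; exact: cont_id. Qed.

Let c2_ (q : R * (R * Y)) : {for q, continuous (fun q : R * (R * Y) => q.2.2.1.1.2)}.
Proof. by apply: contS; do 2 apply: contF; do 2 apply: contS; exact: cont_id. Qed.

Let c3_ (q : R * (R * Y)) : {for q, continuous (fun q : R * (R * Y) => q.2.2.1.2)}.
Proof. by apply: contS; apply: contF; do 2 apply: contS; exact: cont_id. Qed.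

(** Compactness in [h]: parameters that do not touch remain so for nearby data, so a property valid
    near every touching parameter holds at all touching parameters of nearby data. A point of [Y]
    carries the three times of [rate] and a spare real number. *)
Let touch_tube (P : R -> R * Y -> Prop) s0 t : 0 < t < t0 ->
  (forall h, touch s0 h t -> \forall q \near ((h, (s0, (t, t, t, 0))) : R * (R * Y)), P q.1 q.2) ->
  \forall x \near ((s0, (t, t, t, 0)) : R * Y), forall h, 0 <= h <= 1 ->
    touch x.1 h x.2.1.1.1 -> P h x.
Proof.
move=> tb H; apply: (@tube _ _ 0 1 (fun h (x : R * Y) => touch x.1 h x.2.1.1.1 -> P h x)) => h _.
have [th|nth] := pselect (touch s0 h t).
  by apply: (filterS _ (H h th)).
set q0 : R * (R * Y) := (h, (s0, (t, t, t, 0))).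
have ct : {for q0, continuous (fun q : R * (R * Y) =>
    det2 (dir q.2.1 (slope q.2.1 q.2.2.1.1.1)) (G (q.1, q.2.2.1.1.1) - g q.2.1))}.
  exact: (@touch_cont _ (fun q : R * (R * Y) => q.2.1) (fun q : R * (R * Y) => q.1)
    (fun q : R * (R * Y) => q.2.2.1.1.1) q0 (@cs_ q0) (@ch_ q0) (@c1_ q0) tb).
have c0 : {for q0, continuous (fun=> 0 : R)} by exact: cvg_cst.
have [neg|pos|e0] := ltgtP (det2 (dir s0 (slope s0 t)) (G (h, t) - g s0)) 0; last by [].
  by apply: (filterS _ (near_lt ct c0 neg)) => q /= h1; rewrite /touch => h2; rewrite h2 ltxx in h1.
by apply: (filterS _ (near_lt c0 ct pos)) => q /= h1; rewrite /touch => h2; rewrite h2 ltxx in h1.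
Qed.

Let rate_near s0 h t : 0 < t < t0 -> touch s0 h t ->
  {for ((h, (s0, (t, t, t, 0))) : R * (R * Y)), continuous (fun q : R * (R * Y) =>
     rate q.2.1 q.1 q.2.2.1.1.1 q.2.2.1.1.2 q.2.2.1.2)}.
Proof.
move=> tb th.
set q0 : R * (R * Y) := (h, (s0, (t, t, t, 0))).
exact: (@rate_cont _ (fun q : R * (R * Y) => q.2.1) (fun q : R * (R * Y) => q.1) (fun q : R * (R * Y) => q.2.2.1.1.1)
  (fun q : R * (R * Y) => q.2.2.1.1.2) (fun q : R * (R * Y) => q.2.2.1.2) q0 (@cs_ q0) (@ch_ q0) (@c1_ q0) (@c2_ q0) (@c3_ q0)
  tb tb tb (touch_ahead tb th)).
Qed.

Let ahead_near s0 h t : 0 < t < t0 -> touch s0 h t ->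
  \forall q \near ((h, (s0, (t, t, t, 0))) : R * (R * Y)), 0 < ahead q.2.1 q.1 q.2.2.1.2.
Proof.
move=> tb th.
set q0 : R * (R * Y) := (h, (s0, (t, t, t, 0))).
have ca := @ahead_cont _ (fun q : R * (R * Y) => q.2.1) (fun q : R * (R * Y) => q.1)
  (fun q : R * (R * Y) => q.2.2.1.2) q0 (@cs_ q0) (@ch_ q0) (@c3_ q0) (inb tb).1.
exact: (near_lt (@cont_cst _ R 0 _) ca (touch_ahead tb th)).
Qed.

Let room t : 0 < t < t0 -> exists eta, [/\ 0 < eta, eta <= t & eta <= t0 - t].
Proof.
move=> tb; exists (Num.min t (t0 - t)).
by rewrite lt_min !ge_min !lexx orbT; split => //; lra.
Qed.

Lemma slope_lip t : 0 < t < t0 -> exists k eta, [/\ 0 < k, 0 < eta &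
  forall t1 t2 s, `|t1 - t| < eta -> `|t2 - t| < eta -> t1 < t2 ->
    k * (t2 - t1) <= slope s t2 - slope s t1 <= k^-1 * (t2 - t1)].
Proof.
move=> tb; have l0 := len_gt0 SC.
(* The spare coordinate is the candidate for the constant [k]: it is 0 at the base point and [d / 2]
   once the radius [d] of the neighbourhood is known. *)
pose P h (x : R * Y) := [/\ 0 < ahead x.1 h x.2.1.2,
  x.2.2 < rate x.1 h x.2.1.1.1 x.2.1.1.2 x.2.1.2 & x.2.2 * rate x.1 h x.2.1.1.1 x.2.1.1.2 x.2.1.2 < 1].
pose y0 : Y := (t, t, t, 0).
have n : \forall y \near y0, forall s, 0 <= s <= l -> forall h, 0 <= h <= 1 ->
    touch s h y.1.1.1 -> P h (s, y).
  apply: (@tube _ _ 0 l (fun s y => forall h, 0 <= h <= 1 -> touch s h y.1.1.1 -> P h (s, y))) => s _.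
  have := @touch_tube P s t tb _; rewrite -/y0 => H.
  have {}H := H _; apply: (filterS _ (H _)) => [[s' y] //|h th].
  have c1 := rate_near tb th; have n2 := ahead_near tb th.
  have ck : {for ((h, (s, y0)) : R * (R * Y)), continuous (fun q : R * (R * Y) => q.2.2.2)}.
    by do 3 apply: contS; exact: cont_id.
  have n3 := near_lt ck c1 (touch_rate tb th).
  have ckr : {for ((h, (s, y0)) : R * (R * Y)), continuous (fun q : R * (R * Y) =>
      q.2.2.2 * rate q.2.1 q.1 q.2.2.1.1.1 q.2.2.1.1.2 q.2.2.1.2)} by exact: (cvgM ck c1).
  have n4 := near_lt ckr (@cont_cst _ R 1 _) _; rewrite /= mul0r in n4.
  have {}n4 := n4 ltr01.
  by apply: (filterS _ (filterI n2 (filterI n3 n4))) => q [q2 [q3 q4]]; split.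
have /nbhs_ballP[d /= d0 hd] := n.
have [e [e0 e1 e2]] := room tb.
pose eta := Num.min d e.
have m1 : eta <= d by rewrite ge_min lexx.
have m2 : eta <= e by rewrite ge_min lexx orbT.
have m0 : 0 < eta by rewrite lt_min d0.
have k0 : 0 < d / 2 by rewrite divr_gt0.
have bnd s h t1 t2 t3 : `|t1 - t| < eta -> `|t2 - t| < eta -> `|t3 - t| < eta ->
    0 <= s <= l -> 0 <= h <= 1 -> touch s h t1 -> P h (s, (t1, t2, t3, d / 2)).
  move=> k1 k2 k3 sb hb th; apply: hd => //.
  have bl (x : R) : `|x - t| < eta -> ball t d x by rewrite /ball/= distrC => /lt_le_trans; apply.
  split; last by rewrite /ball/= sub0r normrN gtr0_norm //; lra.
  by split; [split; exact: bl|exact: bl].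
exists (d / 2), eta; split => // t1 t2 s k1 k2 k12.
wlog sb : s / 0 <= s <= l.
  move=> H; have [k /andP[ka kb]] := per_reduce s l0.
  have := H (s + k%:~R * l); rewrite ka ltW// => /(_ isT).
  have pz x : slope (s + k%:~R * l) x = slope s x.
    by apply: (@per_int _ _ (fun s => slope s x)) => y; exact: slope_per SC _ _ _.
  by rewrite !pz.
have b1 : 0 < t1 /\ t1 < t0 by move: k1; rewrite ltr_norml; lra.
have b2 : 0 < t2 /\ t2 < t0 by move: k2; rewrite ltr_norml; lra.
have mid x : t1 < x < t2 -> `|x - t| < eta by move: k1 k2; rewrite !ltr_norml; lra.
have tt : 0 < t2 - t1 by rewrite subr_gt0.
have [h1 hb1 th1] := @touch_ex s t1 ltac:(by apply/andP).
have [h2 hb2 th2] := @touch_ex s t2 ltac:(by apply/andP).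
apply/andP; split.
  have [a0 _ _] := bnd s h2 t2 t2 t1 k2 k2 k1 sb hb2 th2.
  have [x xb le] := slope_lower b1.1 k12 b2.2 th2 a0; apply: le_trans le.
  have [_ lo _] := bnd s h2 t2 x t1 k2 (mid x xb) k1 sb hb2 th2.
  by rewrite ler_pM2r// ltW.
have [a0 _ _] := bnd s h1 t1 t1 t2 k1 k1 k2 sb hb1 th1.
have [x xb le] := slope_upper b1.1 k12 b2.2 th1 a0; apply: (le_trans le).
have [_ _ up] := bnd s h1 t1 x t2 k1 (mid x xb) k2 sb hb1 th1.
rewrite ler_pM2r// ltW// -(ltr_pM2l k0) mulfV ?gt_eqF//.
Qed.

(** Parameters of the same point of one leaf differ by an integer, hence give the same point on
    every leaf. *)
Let leaf_Gt h h' t : 0 < t < 1 -> G (h, t) = G (h', t) -> Gt (h, t) = Gt (h', t).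
Proof.
move=> tb /(fol_inj F tb)[k hk].
have e u : det2 u (Gt (h, t)) = det2 u (Gt (h', t)).
  have n0 : \forall x \near t, 0 < x by case/andP: tb => a _; exact: lt_nbhsr.
  have n1 : \forall x \near t, x < 1 by case/andP: tb => _ a; exact: lt_nbhsl.
  have n : \forall x \near t, det2 u (G (h', x)) = det2 u (G (h, x)).
    by apply: (filterS _ (filterI n0 n1)) => x [x0 x1]; rewrite hk (leaf_per F)// x0.
  have d := near_eq_is_derive n (fol_dt F u h' tb).
  by rewrite -(@derive_val _ _ _ _ _ _ _ d) (@derive_val _ _ _ _ _ _ _ (fol_dt F u h tb)).
apply: pair_ext.
  by have := e (0, 1); rewrite /det2 /= !mul0r !mul1r !sub0r => /oppr_inj.
by have := e (1, 0); rewrite /det2 /= !mul0r !mul1r !subr0.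
Qed.

(** If the tangent touches the leaf at a single point, all touching parameters have the same [rate],
    towards which both bounds of the difference quotient converge. *)
Lemma slope_diff s t : 0 < t < t0 ->
  (forall h h', touch s h t -> touch s h' t -> G (h, t) = G (h', t)) ->
  exists v0 : R, forall e, 0 < e -> exists2 eta, 0 < eta &
    forall t1 t2, `|t1 - t| < eta -> `|t2 - t| < eta -> t1 < t2 ->
      `|(slope s t2 - slope s t1) / (t2 - t1) - v0| < e.
Proof.
move=> tb uq; have [hs hsb ths] := touch_ex s tb.
exists (rate s hs t t t) => e e0; set v0 := rate s hs t t t.
pose P h (x : R * Y) := 0 < ahead x.1 h x.2.1.2 /\
  `|rate x.1 h x.2.1.1.1 x.2.1.1.2 x.2.1.2 - v0| < e.
have n := @touch_tube P s t tb _.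
have {}n : \forall x \near ((s, (t, t, t, 0)) : R * Y), forall h, 0 <= h <= 1 ->
    touch x.1 h x.2.1.1.1 -> P h x.
  apply: n => h th; have c1 := rate_near tb th; have n2 := ahead_near tb th.
  have ew : rate s h t t t = v0.
    have eG := uq _ _ th ths; have eGt := leaf_Gt (inb tb).1 eG.
    by rewrite /v0 /rate /ahead eG eGt.
  have /cvgrPdist_lt/(_ e e0) nn := c1; rewrite /= ew in nn.
  by apply: (filterS _ (filterI n2 nn)) => q [q2 q3]; split => //; rewrite distrC.
have /nbhs_ballP[d /= d0 hd] := n.
have [e' [e'0 e1 e2]] := room tb.
pose eta := Num.min d e'.
have m1 : eta <= d by rewrite ge_min lexx.
have m2 : eta <= e' by rewrite ge_min lexx orbT.
have m0 : 0 < eta by rewrite lt_min d0.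
have bnd h t1 t2 t3 : `|t1 - t| < eta -> `|t2 - t| < eta -> `|t3 - t| < eta ->
    0 <= h <= 1 -> touch s h t1 -> P h (s, (t1, t2, t3, 0)).
  move=> k1 k2 k3 hb th; apply: hd => //.
  have bl (x : R) : `|x - t| < eta -> ball t d x by rewrite /ball/= distrC => /lt_le_trans; apply.
  split; first exact: ballxx.
  split; last exact: ballxx.
  by split; [split; exact: bl|exact: bl].
exists eta => // t1 t2 k1 k2 k12.
have b1 : 0 < t1 /\ t1 < t0 by move: k1; rewrite ltr_norml; lra.
have b2 : 0 < t2 /\ t2 < t0 by move: k2; rewrite ltr_norml; lra.
have mid x : t1 < x < t2 -> `|x - t| < eta by move: k1 k2; rewrite !ltr_norml; lra.
have tt : 0 < t2 - t1 by rewrite subr_gt0.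
have [h1 hb1 th1] := @touch_ex s t1 ltac:(by apply/andP).
have [h2 hb2 th2] := @touch_ex s t2 ltac:(by apply/andP).
have lo : v0 - e < (slope s t2 - slope s t1) / (t2 - t1).
  have [a0 _] := bnd h2 t2 t2 t1 k2 k2 k1 hb2 th2.
  have [x xb le] := slope_lower b1.1 k12 b2.2 th2 a0.
  have [_] := bnd h2 t2 x t1 k2 (mid x xb) k1 hb2 th2.
  rewrite ltr_distl /= => /andP[h3 _]; apply: lt_le_trans h3 _.
  by rewrite ler_pdivlMr.
have up : (slope s t2 - slope s t1) / (t2 - t1) < v0 + e.
  have [a0 _] := bnd h1 t1 t1 t2 k1 k1 k2 hb1 th1.
  have [x xb le] := slope_upper b1.1 k12 b2.2 th1 a0.
  have [_] := bnd h1 t1 x t2 k1 (mid x xb) k2 hb1 th1.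
  rewrite ltr_distl /= => /andP[_ h3]; apply: le_lt_trans h3.
  by rewrite ler_pdivrMr.
by rewrite ltr_distl lo up.
Qed.

End SlopeDerivative.

Lemma derive_quot (R : realType) (f : R -> R) (s d e : R) : is_derive s 1 f d -> 0 < e ->
  exists2 eta, 0 < eta & forall x, x != s -> `|x - s| < eta -> `|(f x - f s) / (x - s) - d| < e.
Proof.
move=> /is_derive1E/cvgrPdist_lt df e0.
have /nbhs_ballP[eta /= eta0 h] := df e e0; exists eta => // x xs xe.
have := h (x - s); rewrite /ball/= sub0r normrN subr_eq0 => /(_ xe xs).
by rewrite distrC /GRing.scale /= mulr1 subrK mulrC.
Qed.

(** * Boundary points whose tangent touches the leaf twice *)

Section TwoTouch.
Context {R : realType} (D : set (R * R)) (l : R) (g T g2 g3 g4 : R -> R * R).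
Context (SC : convex_arc D l g T g2 g3 g4).
Context (G Gh Gt : R * R -> R * R) (F : foliation D G Gh Gt).
Hypothesis sgn : forall u h t, u != 0 -> 0 < t < 1 -> contact G u h t -> 0 < det2 u (Gt (h, t)).
Context (t0 : R) (t0b : 0 < t0 < 1).
Hypothesis gap1 : forall s t, 0 < t <= t0 -> gap g T G s 1 t < 0.
Context (t : R) (tb : 0 < t < t0).
Implicit Types (u v w p e : R * R) (h x s z : R).
Local Notation slope := (slope g T G).
Local Notation touch := (touch g T G).
Local Notation ahead := (ahead g T G).

Let v x := dir T x (slope x t).
(** In the frame of a fixed unit vector [e], [f e x] is the slope of the tangent direction [v x],
    and [m e p x] the slope of the line from [g x] to [p]. The frame is fixed so that values at
    different [x] can be compared. *)
Let f e x : R := det2 e (v x) / dot2 e (v x).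
Let m e p x : R := det2 e (p - g x) / dot2 e (p - g x).

Let v_cont s : {for s, continuous v}.
Proof.
apply: (@dir_cont _ _ _ _ _ _ _ _ SC _ (fun x => x) (fun x => slope x t)); first exact: cont_id.
exact: (slope_cont SC F t0b gap1 (@cont_id _ s) (@cont_cst _ _ t s) tb).
Qed.

Lemma touch_dir s h : touch s h t -> G (h, t) - g s = ahead s h t *: v s.
Proof.
move=> th; have e := det2_eq0 (dir_neq0 SC s (slope s t)) th.
have a : ahead s h t = dot2 (dir T s (slope s t)) (G (h, t) - g s) / dot2 (dir T s (slope s t)) (dir T s (slope s t)).
  by rewrite /ahead {1}e dot2Zr (dot_dir SC) mulr1.
by rewrite a.
Qed.

Let dm e p s : dot2 e e = 1 -> dot2 e (p - g s) != 0 ->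
  is_derive s 1 (m e p) (det2 (T s) (p - g s) / dot2 e (p - g s) ^+ 2).
Proof.
move=> e1 n0; have d0 : is_derive s 1 (fun x => p - g x) (- T s).
  by apply: (is_derive_eq (is_deriveB (is_derive_cst p s (1:R)) (dT SC s))); rewrite sub0r.
have d1 := is_derive_det2r e d0; have d2 := is_derive_dot2r e d0.
have d3 := @is_deriveV R (fun x => dot2 e (p - g x)) s _ 1 n0 d2.
apply: (is_derive_eq (is_deriveM d1 d3)).
rewrite -[- T s]scaleN1r det2Zr dot2Zr /GRing.scale /=.
have -> : det2 (T s) (p - g s) = det2 e (p - g s) * dot2 e (T s) - det2 e (T s) * dot2 e (p - g s).
  by rewrite -[LHS]mul1r -e1 /det2 /dot2; ring.
by field.
Qed.

(** Directions from [g x] to points of the leaf are never clockwise of [v x], and near [s] the two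
    denominators have the same sign. *)
Let f_le e s h : dot2 e e = 1 -> dot2 e (v s) != 0 -> touch s h t ->
  \forall x \near s, f e x <= m e (G (h, t)) x.
Proof.
move=> e1 n0 th; have a0 := touch_ahead SC F t0b gap1 tb th.
have c1 : {for s, continuous (fun x => dot2 e (G (h, t) - g x) * dot2 e (v x))}.
  have cw : {for s, continuous (fun x => G (h, t) - g x)}.
    by apply: cvgB; [exact: cvg_cst|exact: (cg SC)].
  exact: (cvgM (cont_dot2 (@cont_cst _ _ e s) cw) (cont_dot2 (@cont_cst _ _ e s) (@v_cont s))).
have p0 : 0 < dot2 e (G (h, t) - g s) * dot2 e (v s).
  by rewrite (touch_dir th) dot2Zr -mulrA -expr2 mulr_gt0// exprn_even_gt0.
have n := near_lt (@cont_cst _ R 0 s) c1 p0.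
apply: (filterS _ n) => x /= px.
have nn : dot2 e (G (h, t) - g x) != 0 /\ dot2 e (v x) != 0.
  by split; apply/eqP => z; move: px; rewrite z ?mulr0 ?mul0r ltxx.
have [nn1 nn2] := nn.
have ge := touch_ge SC F t0b gap1 x h tb.
rewrite -subr_ge0 /m /f.
have -> : det2 e (G (h, t) - g x) / dot2 e (G (h, t) - g x) - det2 e (v x) / dot2 e (v x) =
    det2 (v x) (G (h, t) - g x) / (dot2 e (G (h, t) - g x) * dot2 e (v x)).
  have -> : det2 (v x) (G (h, t) - g x) =
      det2 e (G (h, t) - g x) * dot2 e (v x) - det2 e (v x) * dot2 e (G (h, t) - g x).
    by rewrite -[LHS]mul1r -e1 /det2 /dot2; ring.
  by field; rewrite nn1 nn2.
by rewrite divr_ge0// ltW.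
Qed.

Let f_eq e s h : dot2 e (v s) != 0 -> touch s h t -> f e s = m e (G (h, t)) s.
Proof.
move=> n0 th; have a0 := touch_ahead SC F t0b gap1 tb th.
by rewrite /m (touch_dir th) det2Zr dot2Zr /f invfM mulrACA divff ?mul1r// gt_eqF.
Qed.

(* The slope function lies below the slopes of the lines to the two touching points and
   coincides with both at [s]; as these have different derivatives at [s], subtracting a
   linear function of rational slope leaves a strict local maximum. *)
Let two_touch e s h h' : dot2 e e = 1 -> dot2 e (v s) != 0 -> touch s h t -> touch s h' t ->
  ahead s h t < ahead s h' t ->
  exists (r : rat) d, 0 < d /\
     forall x, `|x - s| < d -> x != s -> f e x - ratr r * x < f e s - ratr r * s.
Proof.
move=> e1 n0 th th' aa; have a0 := touch_ahead SC F t0b gap1 tb th.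
have a0' := touch_ahead SC F t0b gap1 tb th'.
have tb' : 0 < t <= t0 by case/andP: tb => -> /ltW.
have [/andP[z0 _] _] := slopeP SC F t0b gap1 s tb'.
pose q := slope s t / dot2 e (v s) ^+ 2.
have q0 : 0 < q by rewrite divr_gt0// exprn_even_gt0.
have dq k : touch s k t -> is_derive s 1 (m e (G (k, t))) (q / ahead s k t).
  move=> tk; have ak := touch_ahead SC F t0b gap1 tb tk; have ank : ahead s k t != 0 by rewrite gt_eqF.
  have nk : dot2 e (G (k, t) - g s) != 0 by rewrite (touch_dir tk) dot2Zr mulf_neq0.
  apply: (is_derive_eq (dm e1 nk)).
  rewrite (touch_dir tk) det2Zr dot2Zr (det_dir SC) /q.
  by field; rewrite ank n0.
have d1 := dq h th; have d2 := dq h' th'.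
have qq : q / ahead s h' t < q / ahead s h t by rewrite ltr_pM2l// ltf_pV2 ?posrE.
have [r] := rat_in_itvoo qq; rewrite in_itv /= => /andP[r1 r2].
have [eta1 eta10 h1] := derive_quot d1 (e := q / ahead s h t - ratr r) ltac:(by rewrite subr_gt0).
have [eta2 eta20 h2] := derive_quot d2 (e := ratr r - q / ahead s h' t) ltac:(by rewrite subr_gt0).
have /nbhs_ballP[d3 /= d30 h3] := f_le e1 n0 th.
have /nbhs_ballP[d4 /= d40 h4] := f_le e1 n0 th'.
exists r, (Num.min (Num.min eta1 eta2) (Num.min d3 d4)); rewrite !lt_min eta10 eta20 d30 d40; split => //.
move=> x; rewrite !lt_min => /andP[/andP[x1 x2] /andP[x3 x4]] xs.
have i1 := h1 x xs x1; have i2 := h2 x xs x2.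
have i3 : f e x <= m e (G (h, t)) x by apply: h3; rewrite /ball /= distrC.
have i4 : f e x <= m e (G (h', t)) x by apply: h4; rewrite /ball /= distrC.
have e3 := f_eq n0 th; have e4 := f_eq n0 th'.
rewrite -e3 in i1; rewrite -e4 in i2.
rewrite ltr_distl in i1; rewrite ltr_distl in i2.
have [lt|lt|xe] := ltgtP x s; last by rewrite xe eqxx in xs.
  have n : x - s < 0 by rewrite subr_lt0.
  move: i1 => /andP[]; rewrite opprB addrCA subrr addr0 ltr_ndivlMr// => i5 _.
  by move: i5 i3; rewrite mulrBr; lra.
have n : 0 < x - s by rewrite subr_gt0.
move: i2 => /andP[_]; rewrite addrCA subrr addr0 ltr_pdivrMr// => i5.
by move: i5 i4; rewrite mulrBr; lra.
Qed.

(** At least one coordinate axis is not orthogonal to [v s] and can serve as [e], so two countable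
    sets cover everything. *)
Lemma two_touch_countable : countable [set s | exists h h',
  [/\ touch s h t, touch s h' t & G (h, t) <> G (h', t)]].
Proof.
pose S e := [set s | exists (r : rat) d, 0 < d /\
     forall x, `|x - s| < d -> x != s -> f e x - ratr r * x < f e s - ratr r * s].
apply: (@sub_countable _ _ _ (\bigcup_(b in [set: bool]) S (if b then (1, 0) else (0, 1)))); last first.
  apply: bigcup_countable => [|b _]; [exact: countableP|exact: countable_strict_max].
apply: subset_card_le => s [h [h' [th th' nG]]].
have key e : dot2 e e = 1 -> dot2 e (v s) != 0 -> S e s.
  move=> e1 n0; have [lt|lt|ea] := ltgtP (ahead s h t) (ahead s h' t).
  - exact: two_touch e1 n0 th th' lt.
  - exact: two_touch e1 n0 th' th lt.
  exfalso; apply: nG; apply: (@addIr _ (- g s)).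
  by rewrite (touch_dir th) (touch_dir th') ea.
have [z|nz] := eqVneq (dot2 (1, 0) (v s)) 0; last first.
  by exists true => //; apply: key => //; rewrite /dot2 /= !mulr1 !mulr0 addr0.
exists false => //; apply: key; first by rewrite /dot2 /= !mulr1 !mulr0 add0r.
apply/eqP => z'; have := dir_neq0 SC s (slope s t); rewrite -/(v s).
have -> : v s = 0.
  apply: pair_ext; first by move: z; rewrite /dot2 /= mul1r mul0r addr0.
  by move: z'; rewrite /dot2 /= mul1r mul0r add0r.
by rewrite eqxx.
Qed.

End TwoTouch.

(** * From slopes to cosines *)

Section CosSlope.
Context {R : realType}.
Implicit Types (z e : R).

Definition hyp z : R := Num.sqrt (1 + z ^+ 2).
Definition cos_slope z : R := (hyp z)^-1.

Lemma hyp_sqr z : hyp z ^+ 2 = 1 + z ^+ 2.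
Proof. by rewrite sqr_sqrtr// addr_ge0// sqr_ge0. Qed.

Lemma hyp_ge1 z : 1 <= hyp z.
Proof. by rewrite -[X in X <= _]sqrtr1 ler_sqrt ?addr_ge0 ?sqr_ge0// lerDl sqr_ge0. Qed.

Lemma hyp_gt0 z : 0 < hyp z. Proof. exact: lt_le_trans ltr01 (hyp_ge1 z). Qed.

Lemma hyp_lt z : 0 < z -> hyp z < 1 + z.
Proof.
move=> z0; rewrite -(ltr_pXn2r (ltn0Sn 1)) ?nnegrE; [|exact: ltW (hyp_gt0 z)|lra].
by rewrite hyp_sqr; lra.
Qed.

Lemma hyp_cont z : {for z, continuous hyp}.
Proof.
apply: (@continuous_comp _ _ _ (fun z => 1 + z ^+ 2) Num.sqrt); last exact: sqrt_continuous.
by apply: cvgD; [exact: cvg_cst|exact: exprn_continuous].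
Qed.

Lemma cos_slope_gt0 z : 0 < cos_slope z. Proof. by rewrite invr_gt0 hyp_gt0. Qed.

Lemma cos_slope_lt1 z : 0 < z -> cos_slope z < 1.
Proof.
move=> z0; rewrite invf_lt1 ?hyp_gt0// -(ltr_pXn2r (ltn0Sn 1)) ?nnegrE ?ler01 ?(ltW (hyp_gt0 z))//.
by rewrite hyp_sqr expr1n ltrDl exprn_gt0.
Qed.

Lemma cos_slope_near e z : 0 < z < e -> 1 - e < cos_slope z.
Proof.
move=> /andP[z0 ze]; have h := hyp_lt z0; have p := hyp_gt0 z.
apply: (@lt_trans _ _ (1 - z)); first by lra.
rewrite -(ltr_pM2r p) mulVf ?gt_eqF//.
have [z1|z1] := leP 1 z.
  by apply: (@le_lt_trans _ _ 0) => //; rewrite mulr_le0_ge0 ?(ltW p)//; lra.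
apply: (@lt_trans _ _ ((1 - z) * (1 + z))); first by rewrite ltr_pM2l//; lra.
have : 0 < z * z by exact: mulr_gt0.
by lra.
Qed.

Lemma cos_slope_cont z : {for z, continuous cos_slope}.
Proof. by apply: cvgV; [rewrite gt_eqF ?hyp_gt0|exact: hyp_cont]. Qed.

(** The divided difference of [cos_slope], up to sign, in a form that also makes sense for
    [z1 = z2]. *)
Definition cquot z1 z2 : R := (z1 + z2) / (hyp z1 * hyp z2 * (hyp z1 + hyp z2)).

Lemma cos_slopeB z1 z2 : cos_slope z1 - cos_slope z2 = cquot z1 z2 * (z2 - z1).
Proof.
have p1 := hyp_gt0 z1; have p2 := hyp_gt0 z2.
have e1 := hyp_sqr z1; have e2 := hyp_sqr z2; rewrite /cos_slope /cquot.
move: (hyp z1) (hyp z2) p1 p2 e1 e2 => a b a0 b0 e1 e2.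
have n1 : a != 0 by rewrite gt_eqF. have n2 : b != 0 by rewrite gt_eqF.
have n3 : a + b != 0 by rewrite gt_eqF// addr_gt0.
have -> : (z1 + z2) / (a * b * (a + b)) * (z2 - z1) = (z2 ^+ 2 - z1 ^+ 2) / (a * b * (a + b)).
  by field; rewrite n1 n2 n3.
have -> : z2 ^+ 2 - z1 ^+ 2 = b ^+ 2 - a ^+ 2 by rewrite e1 e2; ring.
by field; rewrite n1 n2 n3.
Qed.

Lemma cquot_bound z1 z2 : 0 < z1 < 1 -> 0 < z2 < 1 -> (z1 + z2) / 16 <= cquot z1 z2 <= 1.
Proof.
move=> /andP[a b] /andP[c d].
have h1 := hyp_ge1 z1; have h2 := hyp_ge1 z2.
have k1 := hyp_lt a; have k2 := hyp_lt c.
have q1 : 0 < hyp z1 * hyp z2 by rewrite mulr_gt0 ?hyp_gt0.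
have q2 : 1 <= hyp z1 * hyp z2 by rewrite mulr_ege1.
have q3 : hyp z1 * hyp z2 <= 2 * 2 by apply: ler_pM; lra.
have r1 : 1 * 2 <= hyp z1 * hyp z2 * (hyp z1 + hyp z2) by apply: ler_pM; lra.
have r2 : hyp z1 * hyp z2 * (hyp z1 + hyp z2) <= (2 * 2) * 4 by apply: ler_pM; lra.
rewrite /cquot; move: (_ * _ * (_ + _)) r1 r2 => X r1 r2.
have X0 : 0 < X by lra.
apply/andP; split; last by rewrite ler_pdivrMr//; lra.
by rewrite ler_pM2l ?addr_gt0// lef_pV2 ?posrE//; lra.
Qed.

Lemma cquot_cont (X : topologicalType) (f1 f2 : X -> R) (q : X) :
  {for q, continuous f1} -> {for q, continuous f2} ->
  {for q, continuous (fun q => cquot (f1 q) (f2 q))}.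
Proof.
move=> c1 c2.
have ch f : {for q, continuous f} -> {for q, continuous (fun q => hyp (f q))}.
  by move=> cf; apply: (@continuous_comp _ _ _ f hyp) => //; exact: hyp_cont.
apply: cvgM; first exact: cvgD.
apply: cvgV; first by rewrite gt_eqF// !mulr_gt0 ?addr_gt0 ?hyp_gt0.
by apply: cvgM; [apply: cvgM|apply: cvgD]; exact: ch.
Qed.

End CosSlope.

(** * Reflection of a ray tangent to a leaf *)

Section Reflection.
Context {R : realType} (D : set (R * R)) (l : R) (g T g2 g3 g4 : R -> R * R).
Context (SC : convex_arc D l g T g2 g3 g4).
Context (G Gh Gt : R * R -> R * R) (F : foliation D G Gh Gt).
Hypothesis sgn : forall u h t, u != 0 -> 0 < t < 1 -> contact G u h t -> 0 < det2 u (Gt (h, t)).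
Context (t0 : R) (t0b : 0 < t0 < 1).
Hypothesis gap1 : forall s t, 0 < t <= t0 -> gap g T G s 1 t < 0.
Hypothesis back : forall s t, 0 < t <= t0 -> exists h, ahead g T G s h t < 0.
Implicit Types (u v w p e : R * R) (h x s t z : R).
Local Notation slope := (slope g T G).
Local Notation touch := (touch g T G).
Local Notation ahead := (ahead g T G).
Local Notation dir := (dir T).
Local Notation cos_out := (cos_out g T).
Local Notation cos_in := (cos_in g T).

Let inb t : 0 < t < t0 -> 0 < t < 1 /\ 0 < t <= t0.
Proof. by move=> /andP[a b]; rewrite a (ltW b) (lt_trans b) //; case/andP: t0b. Qed.

Let cs_bound z : -1 <= cos_slope z <= 1.
Proof.
have := cos_slope_gt0 z; have : cos_slope z <= 1 by rewrite invf_le1 ?hyp_gt0// hyp_ge1.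
by lra.
Qed.

Lemma acos_slope z : 0 < z -> 0 < acos (cos_slope z) < pi.
Proof.
move=> z0; have c0 := cos_slope_gt0 z; have c1 := cos_slope_lt1 z0.
by rewrite acos_gt0 ?acos_ltpi//; lra.
Qed.

Lemma vel_slope s z : 0 < z -> vel T s (acos (cos_slope z)) = cos_slope z *: dir s z.
Proof.
move=> z0; have c0 := cos_slope_gt0 z.
rewrite /vel acosK ?in_itv//= ?cs_bound// sin_acos ?cs_bound//.
have -> : Num.sqrt (1 - cos_slope z ^+ 2) = cos_slope z * z.
  have -> : 1 - cos_slope z ^+ 2 = (cos_slope z * z) ^+ 2.
    have n0 : hyp z != 0 by rewrite gt_eqF// hyp_gt0.
    rewrite exprMn /cos_slope exprVn; apply: (mulfI (expf_neq0 2 n0)).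
    by rewrite mulrBr mulrA divff ?expf_neq0// mulr1 mul1r hyp_sqr; ring.
  by rewrite sqrtr_sqr ger0_norm// mulr_ge0// ltW.
by rewrite /dir scalerDr scalerA.
Qed.

Let vel_det s psi w : det2 (vel T s psi) w = cos psi * det2 (T s) w - sin psi * dot2 (T s) w.
Proof. by rewrite /vel /det2 /dot2 /rot90 /= /GRing.scale /=; ring. Qed.

(* The reflected line is tangent to the leaf; if it had the leaf on its right, it would
   coincide with the line travelled backwards, i.e. be normal to the boundary, which is
   impossible as the leaf has points behind the normal. *)
Lemma tangent_continues s s1 t h' (a : R) : 0 < t < t0 -> s < s1 < s + l ->
  cos_out s s1 = cos_slope (slope s t) -> 0 < a ->
  G (h', t) = g s1 + a *: vel T s1 (acos (cos_in s s1)) ->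
  det2 (vel T s1 (acos (cos_in s s1))) (Gh (h', t)) = 0 ->
  cos_in s s1 = cos_slope (slope s1 t).
Proof.
move=> tb st e a0 eG dG; have [tb1 tb2] := inb tb.
have [/andP[z0 _] _] := slopeP SC F t0b gap1 s tb2.
set z := slope s t in e z0.
have pp := acos_slope z0; set phi := acos (cos_slope z) in pp.
have cphi : cos phi = cos_slope z by rewrite acosK// in_itv/= cs_bound.
have e' : cos_out s s1 = cos phi by rewrite cphi.
have refl := chord_reflect SC pp st e'; have ch := chord_vel SC pp st e'.
have L0 := clen_gt0 SC st.
set psi := acos (cos_in s s1) in eG dG refl.
have /andP[x1 x2] := cos_in_bound SC st.
have xb : -1 <= cos_in s s1 <= 1 by rewrite !ltW.
have cpsi : cos psi = cos_in s s1 by rewrite acosK.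
have y0 : 0 < sin psi.
  by apply: sin_gt0_pi; rewrite acos_gt0 ?acos_ltpi// ?x1 ?x2 ?(ltW x1) ?(ltW x2).
rewrite -cpsi in x1 x2 |- *; set x := cos psi in x1 x2 refl |- *.
set u := vel T s phi in refl ch.
have uE : u = cos_slope z *: dir s z by rewrite /u vel_slope.
set v := vel T s1 psi in eG dG refl.
have Tv : dot2 (T s1) v = x by rewrite /v (dot_vel SC).
have Dv : det2 (T s1) v = sin psi by rewrite /v (det_vel SC).
have vN : v != 0 by apply/eqP => v0; move: Dv y0; rewrite v0 det2r0 => <-; rewrite ltxx.
have Tu : dot2 (T s1) u = x.
  by rewrite -Tv refl dot2Br dot2Zr (dot2_rot90 (T s1) (T s1)) det2xx oppr0 mulr0 subr0.
have Du : det2 (T s1) u = - sin psi.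
  rewrite -Dv refl det2Br det2Zr det2_rot90 (T_unit SC) mulr1.
  have -> : dot2 u (rot90 (T s1)) = det2 (T s1) u by rewrite dot2_rot90 -det2C.
  by ring.
have uv : det2 u v = 2 * (x * sin psi).
  have := unit_frame u (T_unit SC s1); rewrite Tu Du => ->.
  transitivity (2 * (x * sin psi) * dot2 (T s1) (T s1)); last by rewrite (T_unit SC) mulr1.
  by rewrite /v /vel -/x /det2 /dot2 /rot90 /= /GRing.scale /=; ring.
have [h hb th] := touch_ex SC F t0b gap1 s tb.
have ah := touch_ahead SC F t0b gap1 tb th.
have Gs : exists k, k < 0 /\ G (h, t) - g s1 = k *: u.
  have td := touch_dir SC th; rewrite -/z in td.
  have c0 := cos_slope_gt0 z.
  have e1 : G (h, t) - g s1 = (ahead s h t / cos_slope z - clen g s s1) *: u.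
    rewrite ch opprD addrA td scalerBl; congr (_ - _).
    by rewrite uE scalerA divfK// gt_eqF.
  exists (ahead s h t / cos_slope z - clen g s s1); split => //.
  have := leaf_left SC F s1 h tb1; rewrite e1 det2Zr Du mulrN -mulNr pmulr_lgt0//.
  by rewrite oppr_gt0.
have [k [k0 ek]] := Gs.
have eG1 : G (h', t) - g s1 = a *: v by rewrite eG addrC addKr.
have left_u y : 0 <= det2 u (G (y, t) - g s1).
  have := touch_ge SC F t0b gap1 s y tb; rewrite -/z => H.
  have -> : det2 u (G (y, t) - g s1) = det2 u (G (y, t) - g s).
    by rewrite ch !det2Br det2Dr det2Zr det2xx mulr0 addr0.
  by rewrite uE det2Zl mulr_ge0// ltW// cos_slope_gt0.
(* The touching point of the reflected line is ahead in the direction [v] and to the left of the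
   incoming line. *)
have xle : 0 <= x.
  have := left_u h'; rewrite eG1 det2Zr uv pmulr_rge0// pmulr_rge0// pmulr_lge0//.
have mu := det2_eq0 vN dG; move: (_ / _) mu => mu eGh.
have mu0 : mu != 0.
  apply/eqP => m0; have := fol_det F (p := (h', t)) tb1.
  by rewrite eGh m0 scale0r /det2 /= !mul0r subrr eqxx.
have shift y : det2 v (G (y, t) - G (h', t)) = det2 v (G (y, t) - g s1).
  by rewrite eG !det2Br det2Dr det2Zr det2xx mulr0 addr0.
have side : (forall y, 0 <= det2 v (G (y, t) - g s1)) \/ (forall y, det2 v (G (y, t) - g s1) <= 0).
  have [neg|pos|m0] := ltgtP mu 0; last by rewrite m0 eqxx in mu0.
    have [H|H] := fol_side F h' tb1; [right|left] => y; have := H y; rewrite eGh det2Zl shift.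
      by rewrite nmulr_rge0.
    by rewrite nmulr_rle0.
  have [H|H] := fol_side F h' tb1; [left|right] => y; have := H y; rewrite eGh det2Zl shift.
    by rewrite pmulr_rge0.
  by rewrite pmulr_rle0.
(* With the leaf on its left, [v] cannot be the normal, since [gap1] gives leaf points with positive
   tangential coordinate; so [sin psi / x] is the slope of a supporting line. *)
case: side => H.
  have x0 : 0 < x.
    rewrite lt_neqAle xle andbT eq_sym; apply/eqP => x00.
    have [y _ [_ ey]] := gapP g T F s1 1 tb1; have := gap1 s1 tb2; rewrite -ey dir_det mul1r => neg.
    have := H y; rewrite vel_det -/x x00 mul0r sub0r oppr_ge0 pmulr_rle0//.
    by have := leaf_left SC F s1 y tb1; lra.
  have dz : dir s1 (sin psi / x) = x^-1 *: v.
    by rewrite /v /vel -/x scalerDr !scalerA mulVf ?gt_eqF// scale1r /dir mulrC.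
  have gz : gap g T G s1 (sin psi / x) t = 0.
    apply/eqP; rewrite eq_le; apply/andP; split.
      apply: le_trans (gap_le g T F s1 _ h' tb1) _.
      by rewrite eG1 dz det2Zl det2Zr det2xx !mulr0.
    have [y _ [_ <-]] := gapP g T F s1 (sin psi / x) tb1.
    by rewrite dz det2Zl mulr_ge0// invr_ge0 ltW.
  have -> := slope_uniq SC F t0b gap1 tb2 (divr_gt0 y0 x0) gz.
  rewrite /cos_slope /hyp.
  have -> : 1 + (sin psi / x) ^+ 2 = (x^-1) ^+ 2.
    have xn : x != 0 by rewrite gt_eqF.
    apply: (mulfI (expf_neq0 2 xn)); rewrite mulrDr mulr1 expr_div_n mulrCA divff ?expf_neq0// mulr1.
    by rewrite exprVn divff ?expf_neq0// cos2Dsin2.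
  by rewrite sqrtr_sqr ger0_norm ?invr_ge0 ?(ltW x0)// invrK.
(* With the leaf on the right of [v], the point where the incoming line touches it, a negative
   multiple of [u] from [g s1], yields the opposite inequality for [x]. *)
have x00 : x = 0.
  apply/eqP; rewrite eq_le xle andbT.
  have := H h; rewrite ek det2Zr det2C uv nmulr_rle0// oppr_ge0.
  by rewrite pmulr_rle0// pmulr_lle0.
have [y hy] := back s1 tb2.
have := H y; rewrite vel_det -/x x00 mul0r sub0r oppr_le0 pmulr_rge0// => h2.
by move: hy; rewrite /ahead ltNge h2.
Qed.

End Reflection.

(** * The invariant family of a foliation by caustics *)

Section CausticFamily.
Context {R : realType} (D : set (R * R)) (l : R) (g T g2 g3 g4 : R -> R * R).
Context (SC : convex_arc D l g T g2 g3 g4).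
Context (G Gh Gt : R * R -> R * R) (F : foliation D G Gh Gt).
Hypothesis sgn : forall u h t, u != 0 -> 0 < t < 1 -> contact G u h t -> 0 < det2 u (Gt (h, t)).
Implicit Types (h x s t z e : R).
Local Notation slope := (slope g T G).

(** Leaves close to the boundary cross two lines through each [g s]: that of slope 1, which bounds
    the tangent slopes, and the normal, which produces leaf points behind it. *)
Lemma steep_collar : exists t0, [/\ 0 < t0 < 1,
  forall s t, 0 < t <= t0 -> gap g T G s 1 t < 0 &
  forall s t, 0 < t <= t0 -> exists h, ahead g T G s h t < 0].
Proof.
have [|||t1 [t1b h1]] := @leaf_support_cross _ _ _ _ _ _ _ _ SC _ _ _ F sgn (fun s => dir T s 1).
- by move=> s; apply: (dir_cont SC); [exact: cont_id|exact: cont_cst].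
- by move=> s; exact: (dir_per SC).
- by move=> s; rewrite det2C (det_dir SC) oppr_eq0 oner_neq0.
have [|||t2 [t2b h2]] := @leaf_support_cross _ _ _ _ _ _ _ _ SC _ _ _ F sgn (fun s => (-1) *: rot90 (T s)).
- move=> s; have c0 : {for s, continuous (fun s => rot90 (T s))}.
    apply: (@cont_pair _ _ _ (fun s => - (T s).2) (fun s => (T s).1)).
      by apply: cvgN; apply: (@continuous_comp _ _ _ T snd); [exact: (cT SC)|exact: cvg_snd].
    by apply: (@continuous_comp _ _ _ T fst); [exact: (cT SC)|exact: cvg_fst].
  by apply: cvgZ; [exact: cvg_cst|exact: c0].
- by move=> s; rewrite (arc_T_per SC).
- by move=> s; rewrite det2Zl det2C det2_rot90 (T_unit SC) mulrN1 opprK oner_neq0.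
pose t0 := Num.min t1 t2.
have m1 : t0 <= t1 by rewrite ge_min lexx.
have m2 : t0 <= t2 by rewrite ge_min lexx orbT.
have m0 : 0 < t0 by rewrite lt_min; lra.
exists t0; split; first by lra.
  by move=> s t tb; rewrite /gap subr_lt0; apply: h1; lra.
move=> s t tb; have tb1 : 0 < t < 1 by lra.
have := h2 s t ltac:(lra).
have [h _ [_ <-]] := leaf_supportP F ((-1) *: rot90 (T s)) tb1.
rewrite -subr_lt0 -det2Br det2Zl => H; exists h; move: H.
have -> // : -1 * det2 (rot90 (T s)) (G (h, t) - g s) = ahead g T G s h t.
by rewrite /ahead /det2 /dot2 /rot90 /=; ring.
Qed.

Context (t0 : R) (t0b : 0 < t0 < 1).
Hypothesis gap1 : forall s t, 0 < t <= t0 -> gap g T G s 1 t < 0.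
Hypothesis inv : forall s s1 t, 0 < t < t0 -> s < s1 < s + l ->
  cos_out g T s s1 = cos_slope (slope s t) -> cos_in g T s s1 = cos_slope (slope s1 t).

Lemma caustic_family : invariant_family l g T t0 (fun s t => cos_slope (slope s t)).
Proof.
have l0 := len_gt0 SC.
have inb t : 0 < t < t0 -> 0 < t < 1 /\ 0 < t <= t0.
  by move=> /andP[a b]; rewrite a (ltW b) (lt_trans b) //; case/andP: t0b.
have sb s t : 0 < t < t0 -> 0 < slope s t < 1.
  by move=> /inb[_ tb]; have [] := slopeP SC F t0b gap1 s tb.
have room t : 0 < t < t0 -> exists eta, [/\ 0 < eta, eta <= t / 2 & eta <= t0 - t].
  move=> tb; exists (Num.min (t / 2) (t0 - t)).
  by rewrite lt_min !ge_min !lexx orbT; split => //; lra.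
split.
- by case/andP: t0b.
- move=> s t tb; have /andP[z0 _] := sb s t tb.
  by rewrite cos_slope_lt1// andbT (lt_trans _ (cos_slope_gt0 _))// oppr_lt0 ltr01.
- by move=> s t tb; rewrite (slope_per SC).
- move=> t tb s.
  apply: (@continuous_comp _ _ _ (fun s => slope s t) cos_slope); last exact: cos_slope_cont.
  exact: (slope_cont SC F t0b gap1 (@cont_id _ s) (@cont_cst _ _ t s) tb).
- move=> e e0; have [t1 [t1b ht]] := slope_unif SC F sgn t0b gap1 e0.
  exists t1 => // s t tb; apply: cos_slope_near.
  have tb' : 0 < t < t0 by lra.
  by rewrite (ht s t tb) andbT; case/andP: (sb s t tb').
- by move=> s s1 t tb st; exact: inv.
- move=> t tb; have [k [eta [k0 eta0 H]]] := slope_lip SC F sgn t0b gap1 tb.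
  have [e [e0 e1 e2]] := room t tb.
  have tb2 : 0 < t / 2 < t0 by lra.
  have [||m m0 hm] := @per_pos _ l (fun s => slope s (t / 2)) l0 (fun s => slope_per SC G s (t / 2)).
  - move=> s; exact: (slope_cont SC F t0b gap1 (@cont_id _ s) (@cont_cst _ _ (t / 2) s) tb2).
  - by move=> s; case/andP: (sb s (t / 2) tb2).
  pose eta' := Num.min eta e.
  have m1 : eta' <= eta by rewrite ge_min lexx.
  have m2 : eta' <= e by rewrite ge_min lexx orbT.
  have eta'0 : 0 < eta' by rewrite lt_min eta0.
  (* [cquot] is at least a sixteenth of the sum of the two slopes, each of which is at least [m],
     its minimum on the leaf [t / 2]. *)
  exists (m / 8 * k), k^-1, eta'; split => //; first by rewrite mulr_gt0// divr_gt0.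
  move=> t1 t2 s h1 h2 h12.
  have b1 : t / 2 < t1 /\ t1 < t0 by move: h1; rewrite ltr_norml; lra.
  have b2 : t / 2 < t2 /\ t2 < t0 by move: h2; rewrite ltr_norml; lra.
  have /andP[lo up] := H t1 t2 s (lt_le_trans h1 m1) (lt_le_trans h2 m1) h12.
  have lowb x : t / 2 < x /\ x < t0 -> m <= slope s x.
    move=> [xa xb]; apply: le_trans (hm s) _; apply: ltW.
    by apply: (slope_incr SC F sgn t0b gap1); [case/andP: tb2|exact: xa|exact: ltW].
  have l1 := lowb _ b1; have l2 := lowb _ b2.
  have /andP[q1 q2] := cquot_bound (sb s t1 ltac:(lra)) (sb s t2 ltac:(lra)).
  rewrite cos_slopeB.
  have tt : 0 < t2 - t1 by rewrite subr_gt0.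
  have kt : 0 <= k * (t2 - t1) by rewrite mulr_ge0// ltW.
  have z12 : 0 <= slope s t2 - slope s t1 by apply: le_trans lo.
  have qm : m / 8 <= cquot (slope s t1) (slope s t2) by lra.
  apply/andP; split.
    by rewrite -mulrA ler_pM// ltW// divr_gt0.
  by apply: le_trans up; rewrite ler_piMl.
move=> t tb; exists [set s | exists h h', [/\ touch g T G s h t, touch g T G s h' t & G (h, t) <> G (h', t)]].
have cz := two_touch_countable SC F t0b gap1 tb.
have W s : exists w, ~ (exists h h', [/\ touch g T G s h t, touch g T G s h' t & G (h, t) <> G (h', t)]) ->
    forall e, 0 < e -> exists2 eta, 0 < eta &
    forall t1 t2, `|t1 - t| < eta -> `|t2 - t| < eta -> t1 < t2 ->
      `|(slope s t2 - slope s t1) / (t2 - t1) - w| < e.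
  have [ex|nex] := pselect (exists h h', [/\ touch g T G s h t, touch g T G s h' t & G (h, t) <> G (h', t)]).
    (* A default value: at the exceptional boundary points nothing is claimed. *)
    by exists 0.
  have [|w hw] := @slope_diff _ _ _ _ _ _ _ _ SC _ _ _ F t0 t0b gap1 s t tb; last by exists w.
  by move=> h h' th th'; apply: contrapT => nG; apply: nex; exists h, h'.
have [w hw] := choice W.
exists (fun s => cquot (slope s t) (slope s t) * w s); split; first exact: cz.
move=> s ns e e0; have {}hw := hw s ns.
set z := slope s t; set W0 := w s in hw *.
have ct (X : topologicalType) (f : X -> R) (q : X) : {for q, continuous f} -> f q = t ->
    {for q, continuous (fun q => slope s (f q))}.
  by move=> cf ef; apply: (slope_cont SC F t0b gap1 (@cont_cst _ _ s q) cf); rewrite ef.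
have cq : {for ((t, t) : R * R), continuous (fun q : R * R => cquot (slope s q.1) (slope s q.2))}.
  exact: (cquot_cont (ct _ _ _ (@cont_fst _ (t, t)) erefl) (ct _ _ _ (@cont_snd _ (t, t)) erefl)).
have W1 : 0 < `|W0| + 1 by rewrite ltr_wpDl.
have e2 : 0 < e / 2 / (`|W0| + 1) by rewrite !divr_gt0.
have [d d0 hd] := (cont_eps _ _).1 cq _ e2.
have [eta eta0 he] := hw (e / 2) ltac:(by rewrite divr_gt0).
have [r [r0 r1 r2]] := room t tb.
exists (Num.min d (Num.min eta r)); first by rewrite !lt_min d0 eta0.
move=> t1 t2; rewrite !lt_min => /and3P[a1 a2 a3] /and3P[b1 b2 b3] h12.
have tb1 : 0 < t1 < t0 by move: a3; rewrite ltr_norml; lra.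
have tb2 : 0 < t2 < t0 by move: b3; rewrite ltr_norml; lra.
have hq : `|cquot (slope s t1) (slope s t2) - cquot z z| < e / 2 / (`|W0| + 1).
  by apply: (hd (t1, t2)); split; rewrite /ball/= distrC.
have hs := he t1 t2 a2 b2 h12.
have /andP[q1 q2] := cquot_bound (sb s t1 tb1) (sb s t2 tb2).
have q0 : 0 <= cquot (slope s t1) (slope s t2).
  by apply: le_trans q1; have := sb s t1 tb1; have := sb s t2 tb2; lra.
rewrite cos_slopeB -mulrA; move: ((_ - _) / _) (cquot (slope s t1) _) (cquot z z) hs hq q0 q2 => q Q Q0 hs hq Q1 Q2.
have -> : Q * q - Q0 * W0 = Q * (q - W0) + W0 * (Q - Q0) by ring.
apply: le_lt_trans (ler_normD _ _) _; rewrite !normrM (ger0_norm Q1).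
have k1 : Q * `|q - W0| <= `|q - W0| by rewrite ler_piMl.
have k2 : `|W0| * `|Q - Q0| <= e / 2.
  rewrite ltr_pdivlMr// in hq; apply: le_trans (ltW hq).
  by rewrite mulrC; apply: ler_wpM2l => //; rewrite lerDl ler01.
by lra.
Qed.

End CausticFamily.

(** The phase point over [s] with the tangent slope is tangent to the leaf [t]. By the caustic
    property so is its image, and [tangent_continues] recognizes the image as the ray with the leaf
    on its left. *)
Lemma integrable_family (R : realType) (Om : table R) : strictly_convex 4 Om ->
  integrable_near_boundary Om 4 ->
  exists J0 c, invariant_family (len Om) (gam Om) (gam Om)^`() J0 c.
Proof.
move=> SC0 /integrable_foliation[G0 [Gh0 [Gt0 [F0 tan0]]]].
have [G [Gh [Gt [F tan sgn]]]] := oriented_foliation F0 tan0.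
have SC := table_arc SC0.
have [t0 [t0b gap1 back]] := steep_collar SC F sgn.
exists t0, (fun s t => cos_slope (slope (gam Om) (gam Om)^`() G s t)).
apply: (caustic_family SC F sgn t0b gap1) => s s1 t tb st e.
have tb1 : 0 < t < 1 by lra.
have tb2 : 0 < t <= t0 by lra.
have [/andP[z0 _] _] := slopeP SC F t0b gap1 s tb2.
set z := slope _ _ _ s t in e z0.
have pp := acos_slope z0.
have c0 := cos_slope_gt0 z; have c1 := cos_slope_lt1 z0.
have e' : cos_out (gam Om) (gam Om)^`() s s1 = cos (acos (cos_slope z)).
  by rewrite acosK// in_itv/= (ltW c1) andbT; lra.
have dE h : (fun x => G (x, t))^`() h = Gh (h, t).
  by rewrite derive1E (@derive_val _ _ _ _ _ _ _ (fol_dh F h tb1)).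
have [h _ th] := touch_ex SC F t0b gap1 s tb.
pose p : phase Om := (\pi_(circle (len Om)) s, acos (cos_slope z)).
have vE : velocity p = cos_slope z *: dir (gam Om)^`() s z.
  by rewrite (velocity_circ SC0) vel_slope.
have tp : tangent_to (fun x => G (x, t)) p.
  exists h, (ahead (gam Om) (gam Om)^`() G s h t / cos_slope z); split.
  - by rewrite divr_gt0// (touch_ahead SC F t0b gap1 tb th).
  - rewrite (pt_circ SC0) vE scalerA divfK ?gt_eqF//.
    by rewrite -(touch_dir SC th) addrC subrK.
  rewrite dE vE det2Zl (contact_det F tb1); first by rewrite mulr0.
  exact: (touch_contact SC F t0b gap1 tb th).
have := tan t tb1 p pp tp; rewrite (billiard_lift SC0 pp st e').
move=> [h' [a [a0 eG dG]]]; rewrite dE (velocity_circ SC0) in dG.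
rewrite (pt_circ SC0) (velocity_circ SC0) in eG.
exact: (tangent_continues SC F t0b gap1 back tb st e a0 eG dG).
Qed.

Theorem proposition2 (R : realType) :
  exists r : nat, (2 <= r)%N /\
  [/\ (forall (Of Og : table R) (e : R),
         strictly_convex r Of -> strictly_convex r Og ->
         disc_domain Of -> elliptic_domain e Og -> e <> 0 ->
         C0_conjugate_near_boundary Of Og),
      (forall (Of Og : table R) (ef eg : R),
         strictly_convex r Of -> strictly_convex r Og ->
         elliptic_domain ef Of -> elliptic_domain eg Og -> ef <> eg ->
         C0_conjugate_near_boundary Of Og)
    & (forall Of Og : table R,
         strictly_convex r Of -> strictly_convex r Og ->
         integrable_near_boundary Of r -> integrable_near_boundary Og r ->
         C0_conjugate_near_boundary Of Og)].
Proof.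
(* Four derivatives of the boundary are what the expansion in [lazutkin_taylor] uses. *)
exists 4%N; split => //; split.
- move=> Of Og e SCf SCg /(disc_family SCf)[Jf [cf Ff]] /(elliptic_family SCg)[Jg [cg Fg]] _.
  exact: family_conjugate SCf SCg Ff Fg.
- move=> Of Og ef eg SCf SCg /(elliptic_family SCf)[Jf [cf Ff]] /(elliptic_family SCg)[Jg [cg Fg]] _.
  exact: family_conjugate SCf SCg Ff Fg.
move=> Of Og SCf SCg /(integrable_family SCf)[Jf [cf Ff]] /(integrable_family SCg)[Jg [cg Fg]].
exact: family_conjugate SCf SCg Ff Fg.
Qed.
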